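(* Let $q>1$, $\nu>0$ and $0<h<1$. Consider on $\mathbb{T}^2$ the advective porous medium equation $$\partial_t\theta+v\cdot\nabla\theta-\nu\Delta(\theta^{q})=0,\qquad \theta(x,0)=\theta_0(x),$$ with initial data satisfying $0<h\leq\theta_0\leq h^{-1}$ and $\|\theta_0-\bar\theta_0\|_{L^2}=1$. Then for any $\tau>0$ there exist a cell size $m$ and an amplitude $A$ (depending on $\tau$, $h$ and $\nu$) such that, with the cellular flow $v(x)=A\,u(mx)$, $u(x)=\nabla^{\perp}\big(\sin(2\pi x_1)\sin(2\pi x_2)\big)$, the solution $\theta$ satisfies $$\|\theta(\cdot,\tau)-\bar\theta\|_{L^2}\leq\tfrac12 .$$
   Context: $\nabla^\perp=(-\partial_{x_2},\partial_{x_1})$; $\mathbb{T}^2=[0,1]^2$. $\bar f$ denotes the mean of $f$ over $\mathbb{T}^2$; the mean is preserved by the equation, so $\bar\theta=\bar\theta_0$. For smooth divergence-free $v$ and such data there is a unique solution, which satisfies $h\le\theta\le h^{-1}$. *)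

(* Defs.v *)
From HB Require Import structures.
From mathcomp Require Import all_boot all_order all_algebra.
From mathcomp Require Import all_classical all_reals all_analysis.
Set Implicit Arguments. Unset Strict Implicit. Unset Printing Implicit Defensive.
Import Order.TTheory GRing.Theory Num.Theory.
Import numFieldNormedType.Exports.
Local Open Scope classical_set_scope.
Local Open Scope ring_scope.

Section Defs.
Variable R : realType.

Definition torus_int (f : R -> R -> R) : \bar R :=
  (\int[lebesgue_measure]_(x in `[0%R, 1%R]%classic)
     \int[lebesgue_measure]_(y in `[0%R, 1%R]%classic) (f x y)%:E)%E.

Definition torus_mean (f : R -> R -> R) : R := fine (torus_int f).

Definition L2sq_dev (f : R -> R -> R) : \bar R :=
  torus_int (fun x y => (f x y - torus_mean f) ^+ 2).

Definition L2sq_dist (f g : R -> R -> R) : \bar R :=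
  torus_int (fun x y => (f x y - g x y) ^+ 2).

(* Cellular flow u = grad^perp (sin(2 pi x1) sin(2 pi x2)),
   grad^perp = (-d_{x2}, d_{x1}). *)
Definition u1 (x1 x2 : R) : R :=
  - (2 * pi * (sin (2 * pi * x1) * cos (2 * pi * x2))).
Definition u2 (x1 x2 : R) : R :=
  2 * pi * (cos (2 * pi * x1) * sin (2 * pi * x2)).

Definition v1 (A : R) (m : nat) (x1 x2 : R) : R := A * u1 (m%:R * x1) (m%:R * x2).
Definition v2 (A : R) (m : nat) (x1 x2 : R) : R := A * u2 (m%:R * x1) (m%:R * x2).

(* theta : x1 -> x2 -> t -> R, a solution on T^2 x (0, oo):
   1-periodic in x1, x2; classical (pointwise derivatives) for t > 0;
   attains the initial datum theta0 in L^2(T^2) as t -> 0+;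
   and h <= theta <= h^-1 (a property of the unique solution, see context). *)
Definition is_APME_solution (q nu h A : R) (m : nat)
    (theta0 : R -> R -> R) (theta : R -> R -> R -> R) : Prop :=
  [/\ (forall x1 x2 t, theta (x1 + 1) x2 t = theta x1 x2 t
                       /\ theta x1 (x2 + 1) t = theta x1 x2 t),
      (forall x1 x2 t, 0 < t -> h <= theta x1 x2 t <= h^-1),
      (forall t, 0 < t -> continuous (fun p : R * R => theta p.1 p.2 t)),
      (forall x1 x2 t, 0 < t ->
        let P := fun a b => theta a b t `^ q in
        derivable (fun s => theta x1 x2 s) t 1 /\
            derivable (fun a => theta a x2 t) x1 1 /\
            derivable (fun b => theta x1 b t) x2 1 /\
            (forall a, derivable (fun c => P c x2) a 1) /\
            (forall b, derivable (fun c => P x1 c) b 1) /\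
            derivable (derive1 (fun c => P c x2)) x1 1 /\
            derivable (derive1 (fun c => P x1 c)) x2 1 /\
            derive1 (fun s => theta x1 x2 s) t
            + (v1 A m x1 x2 * derive1 (fun a => theta a x2 t) x1
               + v2 A m x1 x2 * derive1 (fun b => theta x1 b t) x2)
            - nu * (derive1 (derive1 (fun c => P c x2)) x1
                    + derive1 (derive1 (fun c => P x1 c)) x2) = 0) &
      ((fun t => L2sq_dist (fun x1 x2 => theta x1 x2 t) theta0) @ 0^'+ --> 0%E)].

End Defs.

(* Main.v *)
(** P = theta ^ q solves P_t = a(P) Lap P - v . grad P with a bounded above and below, but only
    pointwise, with no continuity of the derivatives.  So P(t) is replaced by its spatial
    sup-convolution, which is a one-sidedly regular subsolution; an entropy inequality for nonlinear
    powers of it, in which finite differences stand for gradients, absorbs the quadratic gradient errors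
    and passes to the limit.  This needs P to be semicontinuous forward in time, which follows from a
    Baire category argument: on a portion of the bad set P is Lipschitz in time, and a barrier together
    with the entropy inequality then shows that P is forward continuous there.

    The consequences are: a space-time bound on the gradient energy (independent of A), the weak formulation
    up to the drop of a bounded nonincreasing entropy, and the decay of the moments of (P - c)^+ and
    (c - P)^+.  On a time window where the energy and the entropy drop are small, testing with functions
    of the stream function and of one coordinate shows, as A grows, that the weak averages of P over
    each cell satisfy closed linear relations; together with a thin boundary layer argument across
    the cell edges, they force the averages over all the cells to be nearly equal.  The oscillation
    inside a cell is bounded by Poincare's inequality with a constant of order 1 / m^2.  Hence at some
    time before tau the variance of P is small, and by the moment decay it stays small. *)

Require Import Defs.
From HB Require Import structures.
From mathcomp Require Import all_boot all_order all_algebra.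
From mathcomp Require Import all_classical all_reals all_analysis.
From mathcomp Require Import measurable_realfun ring lra.
Set Implicit Arguments. Unset Strict Implicit. Unset Printing Implicit Defensive.
Import Order.TTheory GRing.Theory Num.Theory.
Import numFieldNormedType.Exports.
Local Open Scope classical_set_scope.
Local Open Scope ring_scope.

(** * Integration and continuity *)

(** Derivatives of [P] exist at every point but need not be integrable, so every differential step
    is a bound on backward difference quotients, integrated by a Dini argument. The sup-convolution
    costs an error [Cgrad] times a squared gradient. For a profile [(x - c)_+ ^ (n + 2)] the
    derivative beats the value by a factor of order [n], so a large [n] absorbs this error; that is
    the origin of [n] and of [HN].

    The order of choice is: [m] from the energy density alone, then the number of time windows, then
    the layer parameter [e], and [A] last. It is consistent because the energy bound does not see
    [A], and it lets [e] and [A] beat errors multiplied by the number of cells.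

    Functions of the stream function are invariant under the flow. Hence a test function
    [gam e (psi)] times cosines has a transport term equal to [A] times a fixed weight, and the
    average of that weight is [O(1/A)]. As [e] tends to 0, [gam e (psi)] concentrates on the cell
    boundary, and these relations say that the four edges of a cell carry equal weighted averages.
    Neighbouring cells share an edge, so the equality propagates. *)

HB.lock Definition J (R : realType) (a b : R) (f : R -> R) : R :=
  \int[lebesgue_measure]_(x in `[a, b]) f x.

Section Integral1D.
Variable R : realType.
Implicit Types (f g F : R -> R) (a b c x A k : R).

Lemma J_integrable a b f : continuous f ->
  (@lebesgue_measure R).-integrable `[a, b] (EFin \o f).
Proof.
move=> cf; apply: continuous_compact_integrable; first exact: segment_compact.
exact: continuous_subspaceT.
Qed.

Lemma JE a b f : continuous f ->
  (\int[lebesgue_measure]_(x in `[a, b]) (f x)%:E)%E = (J a b f)%:E.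
Proof.
move=> cf; rewrite J.unlock /Rintegral fineK//.
exact: integrable_fin_num (J_integrable _ _ cf).
Qed.

Lemma eq_J a b f g : (forall x, a <= x <= b -> f x = g x) -> J a b f = J a b g.
Proof.
by move=> fg; rewrite J.unlock; apply: eq_Rintegral => x; rewrite inE/= in_itv/= => /fg.
Qed.

Lemma JD a b f g : continuous f -> continuous g ->
  J a b (fun x => f x + g x) = J a b f + J a b g.
Proof. by move=> cf cg; rewrite J.unlock RintegralD//; exact: J_integrable. Qed.

Lemma JB a b f g : continuous f -> continuous g ->
  J a b (fun x => f x - g x) = J a b f - J a b g.
Proof. by move=> cf cg; rewrite J.unlock RintegralB//; exact: J_integrable. Qed.

Lemma JZ a b k f : continuous f -> J a b (fun x => k * f x) = k * J a b f.
Proof. by move=> cf; rewrite J.unlock RintegralZl//; exact: J_integrable. Qed.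

Lemma J_cst a b k : a <= b -> J a b (fun=> k) = k * (b - a).
Proof.
move=> ab; rewrite J.unlock Rintegral_cst//= lebesgue_measure_itv/= lte_fin.
case: ltP => [//|ba]; have -> : b = a by apply/eqP; rewrite eq_le ba ab.
by rewrite /= subrr mulr0.
Qed.

Lemma J_le a b f g : continuous f -> continuous g ->
  (forall x, a <= x <= b -> f x <= g x) -> J a b f <= J a b g.
Proof.
move=> cf cg fg; rewrite J.unlock; apply: le_Rintegral; [by []|exact: J_integrable..|].
by move=> x/=; rewrite in_itv/= => /fg.
Qed.

Lemma J_ge0 a b f : (forall x, a <= x <= b -> 0 <= f x) -> 0 <= J a b f.
Proof. by move=> f0; rewrite J.unlock; apply: Rintegral_ge0 => x/=; rewrite in_itv/= => /f0. Qed.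

Lemma J_abs a b f : continuous f -> `|J a b f| <= J a b (fun x => `|f x|).
Proof. by move=> cf; rewrite J.unlock; apply: le_normr_Rintegral => //; exact: J_integrable. Qed.

Lemma Jaa a f : J a a f = 0.
Proof. by rewrite J.unlock set_itv1 Rintegral_set1. Qed.

Lemma J_split a b c f : continuous f -> a <= b -> b <= c ->
  J a c f = J a b f + J b c f.
Proof.
move=> cf ab bc; apply/eqP; rewrite addrC -subr_eq; apply/eqP.
rewrite !J.unlock (Rintegral_itvB (b := BRight c))//; last exact: J_integrable.
rewrite Rintegral_itv_obnd_cbnd//.
apply: integrableS (J_integrable b c cf) => //; exact: subset_itv_oc_cc.
Qed.

Lemma J_dct a b (C : R) (f_ : nat -> R -> R) f :
  (forall n, continuous (f_ n)) -> continuous f ->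
  (forall n x, a <= x <= b -> `|f_ n x| <= C) ->
  (forall x, a <= x <= b -> f_ ^~ x @ \oo --> f x) ->
  (fun n => J a b (f_ n)) @ \oo --> J a b f.
Proof.
move=> cf_ cf fC ff.
have mR h (ch : continuous h) := measurable_int _ (J_integrable a b ch).
suff H : ((fun n => (J a b (f_ n))%:E) @ \oo --> (J a b f)%:E)%E.
  by move/fine_cvgP : H => [].
rewrite -JE//.
have ig := J_integrable a b (@cst_continuous R R C).
have ff' : {ae (@lebesgue_measure R), forall x, `[a, b]%classic x ->
    (fun n => (f_ n x)%:E) @ \oo --> (f x)%:E}.
  apply: aeW => x/=; rewrite in_itv/= => xab; apply: cvg_EFin; [exact: nearW|].
  exact: ff.
have fg' : {ae (@lebesgue_measure R), forall x n, `[a, b]%classic x ->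
    (`|(f_ n x)%:E| <= (EFin \o cst C) x)%E}.
  by apply: aeW => x n/=; rewrite in_itv/= lee_fin; exact: fC.
have [|||||_ _] := @dominated_convergence _ _ R (@lebesgue_measure R) _
   (measurable_itv `[a, b]) (fun n x => (f_ n x)%:E) (fun x => (f x)%:E)
   (EFin \o cst C).
- by move=> n; exact: mR.
- exact: mR.
- exact: ff'.
- exact: ig.
- exact: fg'.
by apply: cvg_trans; apply: near_eq_cvg; apply: nearW => n /=; rewrite JE.
Qed.

Lemma J_prim A x f : continuous f -> A < x ->
  is_derive x (1 : R) (fun x => J A x f) (f x).
Proof.
move=> cf Ax.
rewrite J.unlock.
have [] := @continuous_FTC1_closed R f A x (x + 1) _ (J_integrable _ _ cf) Ax (cf x).
  by rewrite ltrDl.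
move=> df fE; refine (DeriveDef df _); rewrite -[RHS]fE; exact/esym/derive1E.
Qed.

Lemma J_ftc a b f F : a <= b -> continuous f ->
  (forall x, a <= x <= b -> is_derive x (1 : R) F (f x)) ->
  J a b f = F b - F a.
Proof.
move=> + cf dF; rewrite le_eqVlt => /predU1P[<-|ab]; first by rewrite Jaa subrr.
apply/EFin_inj; rewrite -JE// EFinB (@continuous_FTC2 _ f F)//.
- exact: continuous_subspaceT.
- have cF x : a <= x <= b -> {for x, continuous F}.
    by move=> /dF [dx _]; apply: differentiable_continuous; exact/derivable1_diffP.
  split.
  + by move=> x; rewrite in_itv/= => /andP[ax xb]; case: (dF x); rewrite ?(ltW ax)?(ltW xb).
  + by apply: cvg_at_right_filter; apply: cF; rewrite lexx ltW.
  + by apply: cvg_at_left_filter; apply: cF; rewrite lexx ltW.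
- move=> x; rewrite in_itv/= => /andP[ax xb]; rewrite derive1E.
  by have /dF[_ ->] : a <= x <= b by rewrite !ltW.
Qed.

Lemma J_shift a b c f : a <= b -> continuous f ->
  J a b (fun x => f (x + c)) = J (a + c) (b + c) f.
Proof.
move=> ab cf; pose A := a + c - 1.
have cf' : continuous (fun x => f (x + c)).
  move=> x; apply: continuous_comp; last exact: cf.
  by apply: cvgD; [exact: cvg_id|exact: cvg_cst].
have d1 x : a <= x <= b -> is_derive x 1 (fun x => J A (x + c) f) (f (x + c)).
  move=> /andP[ax xb]; have Ax : A < x + c by rewrite /A; lra.
  have Hs : is_derive x (1 : R) (fun x : R => x + c) 1.
    by apply: is_derive_eq; exact: addr0.
  by have := is_derive1_comp (f := fun x => J A x f) (g := fun x : R => x + c) (J_prim cf Ax) Hs; rewrite mulr1.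
have d2 x : a + c <= x <= b + c -> is_derive x 1 (fun x => J A x f) (f x).
  by move=> /andP[ax xb]; apply: J_prim => //; rewrite /A; lra.
rewrite (J_ftc ab cf' d1) (J_ftc _ cf d2)//.
by rewrite lerD2r.
Qed.

End Integral1D.

(** * Monotonicity from one-sided Dini bounds *)

Section Dini.
Variable R : realType.
Implicit Types (F N : R -> R) (a b t s r e k : R).

(** Only an upward jump just after [t] has to be excluded: what happens just before [t] is governed
    by the backward quotients. Downward jumps are allowed. *)
Definition right_usc_on a b F := forall t, a <= t -> t < b -> forall e, 0 < e ->
  exists2 r, 0 < r & forall s, t < s -> s < t + r -> s <= b -> F s <= F t + e.

(** Let [c] be the infimum of the times from which on [N] stays above [N b]. Right semicontinuity
    puts [c] itself into this set, and the hypothesis to the left of [c] would enlarge the set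
    unless [c = a]. *)
Lemma left_nonincr N a b : a <= b -> right_usc_on a b N ->
  (forall t, a < t -> t <= b -> exists2 r, 0 < r &
    forall s, t - r < s -> s < t -> a <= s -> N t <= N s) ->
  N b <= N a.
Proof.
move=> ab usc lft.
pose S := [set t | a <= t /\ forall s, t <= s -> s <= b -> N b <= N s].
have Sb : S b by split=> // s bs sb; have -> : s = b by apply/eqP; rewrite eq_le sb.
have lbS : lbound S a by move=> x [].
have hS : has_inf S by split; [exists b|exists a].
pose c := inf S.
have ac : a <= c by apply: lb_le_inf => //; exists b.
have cb : c <= b by apply: ge_inf => //; exists a.
have gtc s : c < s -> s <= b -> N b <= N s.
  move=> cs sb; have e0 : 0 < s - c by rewrite subr_gt0.
  have [x [ax Sx] xs] := inf_adherent e0 hS.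
  by apply: Sx => //; move: xs; rewrite -/c addrC subrK => /ltW.
have Nc : N b <= N c.
  move: cb; rewrite le_eqVlt => /predU1P[->//|cb].
  apply/ler_addgt0Pr => e e0; have [r r0 H] := usc c ac cb e e0.
  pose s := Num.min b (c + r / 2).
  have cs : c < s by rewrite /s lt_min cb ltrDl divr_gt0.
  have sb : s <= b by rewrite /s ge_min lexx.
  apply: le_trans (gtc s cs sb) (H s cs _ sb).
  by rewrite /s gt_min; apply/orP; right; rewrite ltrD2l ltr_pdivrMr// mulrDr mulr1 ltrDl.
have Sc : S c.
  split=> // s; rewrite le_eqVlt => /predU1P[<-//|cs] sb; exact: gtc.
move: ac; rewrite le_eqVlt => /predU1P[->//|ac].
have [r r0 H] := lft c ac cb.
pose s := Num.max a (c - r / 2).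
have sc : s < c by rewrite /s gt_max ac ltrBlDr ltrDl divr_gt0.
have as_ : a <= s by rewrite /s le_max lexx.
have rs : c - r < s.
  by rewrite /s lt_max; apply/orP; right; rewrite ltrD2l ltrN2 ltr_pdivrMr// mulrDr mulr1 ltrDl.
have : S s.
  split=> // x sx xb; have [cx|xc] := leP c x; first by case: Sc => _; apply.
  apply: le_trans Nc (H x _ xc _); [exact: lt_le_trans rs sx|exact: le_trans as_ sx].
move=> /(ge_inf (ex_intro _ a lbS)); rewrite -/c => cs.
by move: sc; rewrite ltNge cs.
Qed.

(** Subtracting [k * (t - a)] reduces this to [left_nonincr]. The loss is at most [e] for
    [k = e / (b - a + 1)], where the [+ 1] covers [a = b]. *)
Lemma dini_le F a b : a <= b -> right_usc_on a b F ->
  (forall t, a < t -> t <= b -> forall k, 0 < k -> exists2 r, 0 < r &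
    forall s, t - r < s -> s < t -> a <= s -> F t - F s <= k * (t - s)) ->
  F b <= F a.
Proof.
move=> ab usc dF; apply/ler_addgt0Pr => e e0.
pose k := e / (b - a + 1).
have d0 : 0 < b - a + 1 by lra.
have k0 : 0 < k by rewrite divr_gt0.
have /= := @left_nonincr (fun t => F t - k * (t - a)) a b ab _ _.
have kE : k * (b - a) <= e.
  by rewrite /k mulrAC ler_pdivrMr// ler_pM2l//; lra.
have H : forall x y : R, x - k * (b - a) <= y - k * (a - a) -> x <= y + e.
  by move=> x y; rewrite subrr mulr0 subr0; lra.
move=> G; apply: H; apply: G.
- move=> t at_ tb e' e'0; have [r r0 Hr] := usc t at_ tb e' e'0.
  exists r => // s ts sr sb; have := Hr s ts sr sb.
  have : k * t <= k * s by rewrite ler_pM2l// ltW.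
  by rewrite !mulrBr; lra.
- move=> t at_ tb; have [r r0 Hr] := dF t at_ tb k k0.
  by exists r => // s sr st as_; have := Hr s sr st as_; rewrite !mulrBr; lra.
Qed.

End Dini.

Section Continuity.
Variables (R : realType) (T : topologicalType).
Implicit Types f g : T -> R.

Lemma cont_cst (k : R) : continuous (fun _ : T => k).
Proof. exact: cst_continuous. Qed.

Lemma cont_add f g : continuous f -> continuous g -> continuous (fun u => f u + g u).
Proof. by move=> cf cg u; exact: (continuousD (cf u) (cg u)). Qed.

Lemma cont_sub f g : continuous f -> continuous g -> continuous (fun u => f u - g u).
Proof. by move=> cf cg u; exact: (continuousB (cf u) (cg u)). Qed.

Lemma cont_opp f : continuous f -> continuous (fun u => - f u).
Proof. by move=> cf u; exact: (continuousN (cf u)). Qed.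

Lemma cont_mul f g : continuous f -> continuous g -> continuous (fun u => f u * g u).
Proof. by move=> cf cg u; exact: (continuousM (cf u) (cg u)). Qed.

Lemma cont_norm f : continuous f -> continuous (fun u => `|f u|).
Proof. by move=> cf u; exact: (cvg_norm (cf u)). Qed.

Lemma cont_exp f n : continuous f -> continuous (fun u => f u ^+ n).
Proof.
move=> cf; elim: n => [|n IH]; first by under eq_fun do rewrite expr0; exact: cont_cst.
by under eq_fun do rewrite exprS; exact: cont_mul.
Qed.

Lemma cont_max f g : continuous f -> continuous g ->
  continuous (fun u => Num.max (f u) (g u)).
Proof. by move=> cf cg u; exact: (continuous_max (cf u) (cg u)). Qed.

Lemma cont_min f g : continuous f -> continuous g ->
  continuous (fun u => Num.min (f u) (g u)).
Proof. by move=> cf cg u; exact: (continuous_min (cf u) (cg u)). Qed.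

Lemma cont_mk (g h : T -> R) :
  continuous g -> continuous h -> continuous (fun u => (g u, h u)).
Proof. by move=> cg ch u; exact: (cvg_pair (cg u) (ch u)). Qed.

End Continuity.

Lemma cont_comp (T U V : topologicalType) (g : T -> U) (h : U -> V) :
  continuous g -> continuous h -> continuous (fun u => h (g u)).
Proof. by move=> cg ch u; apply: (continuous_comp (cg u) (ch _)). Qed.

Lemma cont_fst (R : realType) : continuous (fun z : R * R => z.1).
Proof. by move=> z; exact: cvg_fst. Qed.

Lemma cont_snd (R : realType) : continuous (fun z : R * R => z.2).
Proof. by move=> z; exact: cvg_snd. Qed.

Lemma cont_idR (R : realType) : continuous (fun x : R => x).
Proof. by move=> x; exact: cvg_id. Qed.

(** * Iterated integrals over rectangles *)

Section Plane.
Variable R : realType.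
Implicit Types (f g : R * R -> R) (a b c d e k : R).

Lemma cont_pair2 (T : topologicalType) (f : T * R -> R) (x : T) : continuous f -> continuous (fun y => f (x, y)).
Proof.
move=> cf y; apply: (@continuous_comp R (T * R)%type R (fun y => (x, y)) f y _ (cf _)).
exact: (cvg_pair (cvg_cst x) cvg_id).
Qed.

Lemma cont_pair1 f y : continuous f -> continuous (fun x => f (x, y)).
Proof.
move=> cf; apply: (cont_comp (g := fun x => (x, y))) cf.
by apply: cont_mk; [exact: cont_idR|exact: cont_cst].
Qed.

(** The tube lemma: compactness of the segment makes the neighbourhood of [x] independent of [y]. *)
Lemma cont_unif_seg (T : topologicalType) (f : T * R -> R) a b (x : T) e : continuous f -> 0 < e ->
  \forall x' \near x, forall y, a <= y <= b -> `|f (x', y) - f (x, y)| < e.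
Proof.
move=> cf e0.
have /compact_near_coveringP/(_ _ (nbhs x) (fun x' (y : R) => `|f (x', y) - f (x, y)| < e) _) := @segment_compact R a b.
move=> H; have {}H : \forall x' \near x, (`[a, b]%classic : set R) `<=`
    (fun y : R => `|f (x', y) - f (x, y)| < e).
  apply: H => y _.
  have e2 : 0 < e / 2 by rewrite divr_gt0.
  have /cvgrPdist_lt/(_ _ e2) := cf (x, y).
  move=> [[A B] [/= xA yB] AB].
  exists (B, A) => //= -[y' x'] [/= By' Ax'].
  have H1 := AB (x', y') (conj Ax' By').
  have H2 := AB (x, y') (conj (nbhs_singleton xA) By').
  rewrite /= in H1 H2.
  rewrite (_ : f _ - f _ = (f (x, y) - f (x, y')) - (f (x, y) - f (x', y'))); last by ring.
  by apply: le_lt_trans (ler_normB _ _) _; rewrite (splitr e) ltrD.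
apply: filterS H => x' H y yab; apply: H; by rewrite /= in_itv.
Qed.

Lemma cont_J (T : topologicalType) (f : T * R -> R) a b : a <= b -> continuous f ->
  continuous (fun x => J a b (fun y => f (x, y))).
Proof.
move=> ab cf x; apply/cvgrPdist_lt => e e0.
pose k := e / (b - a + 1).
have d0 : 0 < b - a + 1 by lra.
have k0 : 0 < k by rewrite divr_gt0.
near=> x'.
rewrite -JB; [|exact: cont_pair2..].
apply: le_lt_trans (J_abs _ _ _) _.
  by apply: cont_sub; exact: cont_pair2.
apply: (@le_lt_trans _ _ (J a b (fun=> k))).
  apply: J_le => [||y yab]; last 1 first.
  - rewrite distrC; apply: ltW; move: y yab; near: x'.
    exact: cont_unif_seg.
  - by apply/cont_norm/cont_sub; exact: cont_pair2.
  - exact: cont_cst.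
rewrite J_cst// /k mulrAC ltr_pdivrMr// ltr_pM2l//; lra.
Unshelve. all: by end_near. Qed.

Definition JJ a b c d f := J a b (fun x => J c d (fun y => f (x, y))).

Lemma JJD a b c d f g : c <= d -> continuous f -> continuous g ->
  JJ a b c d (fun z => f z + g z) = JJ a b c d f + JJ a b c d g.
Proof.
move=> cd cf cg; rewrite /JJ -JD; [|exact: cont_J..].
by apply: eq_J => x _; rewrite -JD//; exact: cont_pair2.
Qed.

Lemma JJZ a b c d k f : c <= d -> continuous f ->
  JJ a b c d (fun z => k * f z) = k * JJ a b c d f.
Proof.
move=> cd cf; rewrite /JJ -JZ; [|exact: cont_J].
by apply: eq_J => x _; rewrite -JZ//; exact: cont_pair2.
Qed.

Lemma JJB a b c d f g : c <= d -> continuous f -> continuous g ->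
  JJ a b c d (fun z => f z - g z) = JJ a b c d f - JJ a b c d g.
Proof.
move=> cd cf cg; rewrite /JJ -JB; [|exact: cont_J..].
by apply: eq_J => x _; rewrite -JB//; exact: cont_pair2.
Qed.

Lemma eq_JJ a b c d f g :
  (forall x y, a <= x <= b -> c <= y <= d -> f (x, y) = g (x, y)) ->
  JJ a b c d f = JJ a b c d g.
Proof. by move=> fg; apply: eq_J => x xab; apply: eq_J => y ycd; exact: fg. Qed.

Lemma JJ_le a b c d f g : c <= d -> continuous f -> continuous g ->
  (forall x y, a <= x <= b -> c <= y <= d -> f (x, y) <= g (x, y)) ->
  JJ a b c d f <= JJ a b c d g.
Proof.
move=> cd cf cg fg; apply: J_le; [exact: cont_J..|] => x xab.
by apply: J_le => [| |y ycd]; [exact: cont_pair2..|exact: fg].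
Qed.

Lemma JJ_ge0 a b c d f :
  (forall x y, a <= x <= b -> c <= y <= d -> 0 <= f (x, y)) ->
  0 <= JJ a b c d f.
Proof. by move=> f0; apply: J_ge0 => x xab; apply: J_ge0 => y ycd; exact: f0. Qed.

Lemma JJ_cst a b c d k : a <= b -> c <= d ->
  JJ a b c d (fun=> k) = k * (b - a) * (d - c).
Proof. by move=> ab cd; rewrite /JJ !J_cst// mulrAC. Qed.

Lemma JJ_abs a b c d f : c <= d -> continuous f ->
  `|JJ a b c d f| <= JJ a b c d (fun z => `|f z|).
Proof.
move=> cd cf; apply: le_trans (J_abs _ _ _) _; first exact: cont_J.
have cn : continuous (fun z => `|f z|) by exact: cont_norm.
apply: (J_le (cont_norm (cont_J cd cf)) (cont_J cd cn)).
by move=> x _; apply: J_abs; exact: cont_pair2.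
Qed.

Lemma JJ_dct a b c d C (f_ : nat -> R * R -> R) f : a <= b -> c <= d ->
  (forall n, continuous (f_ n)) -> continuous f ->
  (forall n x y, a <= x <= b -> c <= y <= d -> `|f_ n (x, y)| <= C) ->
  (forall x y, a <= x <= b -> c <= y <= d -> f_ ^~ (x, y) @ \oo --> f (x, y)) ->
  (fun n => JJ a b c d (f_ n)) @ \oo --> JJ a b c d f.
Proof.
move=> ab cd cf_ cf fC ff.
apply: (@J_dct _ _ _ (C * (d - c))).
- by move=> n; exact: cont_J.
- exact: cont_J.
- move=> n x xab; apply: le_trans (J_abs _ _ _) _; first exact: cont_pair2.
  rewrite -(J_cst C cd); apply: J_le => [||y ycd]; last exact: fC.
  - by apply: cont_norm; exact: cont_pair2.
  - exact: cont_cst.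
- move=> x xab; apply: (@J_dct _ _ _ C).
  + by move=> n; exact: cont_pair2.
  + exact: cont_pair2.
  + by move=> n y ycd; exact: fC.
  + by move=> y ycd; exact: ff.
Qed.

Lemma cont_swap f : continuous f -> continuous (fun z => f (z.2, z.1)).
Proof.
move=> cf; apply: (cont_comp (g := fun z => (z.2, z.1))) cf.
by apply: cont_mk; [exact: cont_snd|exact: cont_fst].
Qed.

(** On a thin strip [f] is within [e] of a function [g] of the second variable alone, for which both
    iterated integrals are computed directly. *)
Lemma JJ_swap_strip a b c d x f e : c <= d -> a <= b -> continuous f ->
  (forall x' y, a <= x' <= b -> c <= y <= d -> `|f (x', y) - f (x, y)| <= e) ->
  `|JJ a b c d f - JJ c d a b (fun z => f (z.2, z.1))| <= 2 * e * (d - c) * (b - a).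
Proof.
move=> cd ab cf fe.
pose g := fun z : R * R => f (x, z.2).
have cg : continuous g.
  apply: (cont_comp (g := snd) (h := fun y => f (x, y))); last exact: cont_pair2.
  exact: cont_snd.
have gE : JJ a b c d g = JJ c d a b (fun z => g (z.2, z.1)).
  rewrite /JJ /g /= J_cst//.
  under [RHS]eq_J => y _ do rewrite J_cst// mulrC.
  by rewrite mulrC JZ//; exact: cont_pair2.
have csg := cont_swap cg. have csf := cont_swap cf.
have H1 : `|JJ a b c d f - JJ a b c d g| <= e * (b - a) * (d - c).
  rewrite -(JJB _ _ cd cf cg); apply: le_trans (JJ_abs _ _ cd (cont_sub cf cg)) _.
  rewrite -(JJ_cst e ab cd); apply: (JJ_le cd (cont_norm (cont_sub cf cg)) (@cont_cst _ _ e)).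
  by move=> x' y hx hy; exact: fe.
have H2 : `|JJ c d a b (fun z => g (z.2, z.1)) - JJ c d a b (fun z => f (z.2, z.1))|
     <= e * (d - c) * (b - a).
  rewrite -(JJB _ _ ab csg csf); apply: le_trans (JJ_abs _ _ ab (cont_sub csg csf)) _.
  rewrite -(JJ_cst e cd ab); apply: (JJ_le ab (cont_norm (cont_sub csg csf)) (@cont_cst _ _ e)).
  by move=> y x' hy hx; rewrite /g/= distrC; exact: fe.
rewrite mulrAC in H1.
move: H1; rewrite gE => H1.
apply: le_trans (ler_distD (JJ c d a b (fun z => g (z.2, z.1))) _ _) _.
by apply: le_trans (lerD H1 H2) _; rewrite -mulrDl -mulrDl; lra.
Qed.

(** Fubini by differentiation. The difference [D s] of the two iterated integrals over [[a, s]]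
    vanishes at [a], and by the strip estimate it has zero slope everywhere; [dini_le] for [D] and
    [- D] gives [D b = 0]. *)
Lemma JJ_swap a b c d f : a <= b -> c <= d -> continuous f ->
  JJ a b c d f = JJ c d a b (fun z => f (z.2, z.1)).
Proof.
move=> ab cd cf.
pose D s := JJ a s c d f - JJ c d a s (fun z => f (z.2, z.1)).
have csf := cont_swap cf.
have Dadd s t : a <= s -> s <= t ->
    D t - D s = JJ s t c d f - JJ c d s t (fun z => f (z.2, z.1)).
  move=> as_ st; rewrite /D /JJ (J_split (cont_J cd cf) as_ st).
  rewrite (eq_J (f := fun y => J a t (fun x => f (x, y)))
     (g := fun y => J a s (fun x => f (x, y)) + J s t (fun x => f (x, y)))); last first.
    by move=> y _; rewrite (J_split _ as_ st)//; exact: cont_pair1.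
  rewrite JD; last 2 first.
    exact: (cont_J as_ csf).
    exact: (cont_J st csf).
  ring.
have D_ab : D a = 0.
  rewrite /D /JJ Jaa; under eq_J => y _ do rewrite Jaa.
  by rewrite J_cst// mul0r subrr.
have near_D t e : 0 < e -> exists2 r, 0 < r & forall s s', a <= s -> t - r < s -> s <= s' -> s' < t + r ->
    `|D s' - D s| <= e * (s' - s).
  move=> e0; pose k := e / (2 * (d - c + 1)).
  have d0 : 0 < d - c + 1 by lra.
  have k0 : 0 < k by rewrite divr_gt0// mulr_gt0.
  have [r /= r0 H] := cont_unif_seg c d t cf k0.
  exists r => // s s' as_ ts ss' s't; rewrite Dadd//.
  apply: le_trans (@JJ_swap_strip _ _ _ _ t _ k cd ss' cf _) _.
    move=> x' y /andP[sx xs] ycd; apply: ltW; apply: H => //=.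
    by rewrite ltr_norml; apply/andP; split; lra.
  rewrite ler_wpM2r ?subr_ge0//.
  have -> : 2 * k * (d - c) = e * ((d - c) / (d - c + 1)).
    by rewrite /k; field; rewrite gt_eqF.
  by apply: ler_piMr; [exact: ltW|rewrite ler_pdivrMr// mul1r lerDl].
have Dle (sg : R) : `|sg| = 1 -> sg * D b <= sg * D a.
  move=> sg1; apply: (@dini_le _ (fun s => sg * D s) a b ab).
    move=> t at_ tb e e0; have [r r0 H] := near_D t 1 ltr01.
    exists (Num.min r e); first by rewrite lt_min r0 e0.
    move=> s ts sr sb.
    have := H t s at_ _ (ltW ts) _; rewrite ltrBlDr ltrDl r0 => /(_ isT).
    rewrite (lt_le_trans sr) ?lerD2l ?ge_min ?lexx// => /(_ isT) h.
    rewrite -lerBlDl -mulrBr; apply: le_trans (ler_norm _) _.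
    rewrite normrM sg1 mul1r; apply: le_trans h _; rewrite mul1r.
    by rewrite lerBlDl ltW// (lt_le_trans sr)// lerD2l ge_min lexx orbT.
  move=> t at_ tb k k0; have [r r0 H] := near_D t k k0.
  exists r => // s ts st as_; rewrite -mulrBr; apply: le_trans (ler_norm _) _.
  by rewrite normrM sg1 mul1r; apply: H => //; [exact: ltW|rewrite ltrDl].
have h1 := Dle 1 (normr1 _); have := Dle (-1) (normrN1 _).
rewrite D_ab !mulr0 mulN1r in h1 *; rewrite mul1r in h1 => h2.
apply/eqP; rewrite -subr_eq0 -/(D b) eq_le h1; lra.
Qed.

End Plane.

(** * The torus *)

Section Torus.
Variable R : realType.
Implicit Types (f g : R * R -> R) (x y r : R) (z : R * R) (i : bool).

Definition sh i r z : R * R := if i then (z.1 + r, z.2) else (z.1, z.2 + r).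

Definition per f := forall i z, f (sh i 1 z) = f z.

Definition I f := JJ 0 1 0 1 f.

Lemma J_per (g : R -> R) r : continuous g -> (forall x, g (x + 1) = g x) ->
  J 0 1 (fun x => g (x + r)) = J 0 1 g.
Proof.
move=> cg pg.
have pos h s : continuous h -> (forall x, h (x + 1) = h x) -> 0 <= s ->
    J 0 1 (fun x => h (x + s)) = J 0 1 h.
  move=> ch ph s0; rewrite J_shift// add0r.
  have s1 : s <= 1 + s by rewrite lerDr.
  have E1 := J_split ch s0 s1.
  have s2 : 1 <= 1 + s by rewrite lerDl.
  have E2 := J_split ch ler01 s2.
  have E3 : J 1 (1 + s) h = J 0 s h.
    rewrite -(@eq_J _ 0 s (fun x => h (x + 1)) h); last by move=> x _; rewrite ph.
    by rewrite J_shift// add0r (addrC 1).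
  by apply: (addrI (J 0 s h)); rewrite -E1 E2 E3 addrC.
have [r0|r0] := leP 0 r; first exact: pos.
have csh : continuous (fun x => g (x + r)).
  by apply: cont_comp cg; apply: cont_add; [exact: cont_idR|exact: cont_cst].
rewrite -(pos (fun x => g (x + r)) (- r))//.
- by apply: eq_J => x _; rewrite subrK.
- by move=> x; rewrite addrAC pg.
- by rewrite oppr_ge0 ltW.
Qed.

Lemma cont_sh i r : continuous (sh i r).
Proof.
case: i; rewrite /sh.
- by apply: cont_mk; [apply: cont_add; [exact: cont_fst|exact: cont_cst]|exact: cont_snd].
- by apply: cont_mk; [exact: cont_fst|apply: cont_add; [exact: cont_snd|exact: cont_cst]].
Qed.

Lemma cont_fsh f i r : continuous f -> continuous (fun z => f (sh i r z)).
Proof. by move=> cf; apply: cont_comp cf; exact: cont_sh. Qed.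

Lemma shC i j r s z : sh i r (sh j s z) = sh j s (sh i r z).
Proof. by case: i; case: j; rewrite /sh//= addrAC. Qed.

Lemma shD i r s z : sh i r (sh i s z) = sh i (s + r) z.
Proof. by case: i; rewrite /sh/= addrA. Qed.

Lemma sh0 i z : sh i 0 z = z.
Proof. by case: i; case: z => a b; rewrite /sh/= addr0. Qed.

Lemma shK i r z : sh i r (sh i (- r) z) = z.
Proof. by rewrite shD addNr sh0. Qed.

Lemma shKN i r z : sh i (- r) (sh i r z) = z.
Proof. by rewrite shD addrN sh0. Qed.

Lemma per_sh f i r : per f -> per (fun z => f (sh i r z)).
Proof. by move=> pf j z; rewrite shC pf. Qed.

Lemma I_sh f i r : continuous f -> per f -> I (fun z => f (sh i r z)) = I f.
Proof.
move=> cf pf; case: i; rewrite /I /JJ /sh /=.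
- apply: (J_per (g := fun x => J 0 1 (fun y => f (x, y)))); first exact: cont_J.
  by move=> x; apply: eq_J => y _; exact: (pf true (x, y)).
- apply: eq_J => x _; apply: (J_per (g := fun y => f (x, y))); first exact: cont_pair2.
  by move=> y; exact: (pf false (x, y)).
Qed.

Lemma ID f g : continuous f -> continuous g -> I (fun z => f z + g z) = I f + I g.
Proof. by move=> *; exact: JJD. Qed.

Lemma IB f g : continuous f -> continuous g -> I (fun z => f z - g z) = I f - I g.
Proof. by move=> *; exact: JJB. Qed.

Lemma IZ k f : continuous f -> I (fun z => k * f z) = k * I f.
Proof. by move=> *; exact: JJZ. Qed.

Lemma I_cst k : I (fun=> k) = k.
Proof. by rewrite /I JJ_cst// subr0 !mulr1. Qed.

Lemma I_le f g : continuous f -> continuous g -> (forall z, f z <= g z) -> I f <= I g.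
Proof. by move=> cf cg fg; apply: JJ_le. Qed.

Lemma I_ge0 f : (forall z, 0 <= f z) -> 0 <= I f.
Proof. by move=> f0; apply: JJ_ge0. Qed.

Lemma eq_I f g : f =1 g -> I f = I g.
Proof. by move=> fg; apply: eq_JJ. Qed.

Lemma I_dct C (f_ : nat -> R * R -> R) f :
  (forall n, continuous (f_ n)) -> continuous f ->
  (forall n z, `|f_ n z| <= C) ->
  (forall z, f_ ^~ z @ \oo --> f z) ->
  (fun n => I (f_ n)) @ \oo --> I f.
Proof. by move=> cf_ cf fC ff; apply: (@JJ_dct _ _ _ _ _ C). Qed.

End Torus.

(** * Passing to the limit in Dini inequalities *)

Section DiniLimit.
Variable R : realType.
Implicit Types (a b t s r k C : R).

Definition lsc_on a b (e : R -> R) := forall t, a <= t <= b -> forall k, 0 < k ->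
  exists2 r, 0 < r & forall s, a <= s <= b -> `|s - t| < r -> e t - k <= e s.

Let mu := @lebesgue_measure R.

(** [E n] is the integral of [e n] from [a]. Lower semicontinuity gives measurability, and also
    makes [E n] grow at rate at least [e n t - k] just before [t], so that [E n] can compensate an
    error [e n] in a Dini inequality although [e n] need not be continuous. The limit is dominated
    convergence. *)
Lemma lsc_primitives a b C (e : nat -> R -> R) : a <= b ->
  (forall n, lsc_on a b (e n)) ->
  (forall n t, a <= t <= b -> 0 <= e n t <= C) ->
  (forall t, a <= t <= b -> (fun n => e n t) @ \oo --> 0) ->
  exists E : nat -> R -> R,
  [/\ forall n, E n a = 0,
      forall n s t, a <= s -> s <= t -> t <= b -> E n s <= E n t,
      forall n t, a < t -> t <= b -> forall k, 0 < k -> exists2 r, 0 < r &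
        forall s, t - r < s -> s < t -> a <= s -> (e n t - k) * (t - s) <= E n t - E n s
    & (fun n => E n b) @ \oo --> 0].
Proof.
move=> ab lsc eC e0.
have C0 : 0 <= C by have /andP[] := eC 0%N a (introT andP (conj (lexx _) ab)); exact: le_trans.
(* The value [C] outside [[a, b]] is an upper bound of [e n], so the extension stays lower
   semicontinuous on the whole line. *)
pose f n t := if a <= t <= b then e n t else C.
have fC n t : 0 <= f n t <= C.
  by rewrite /f; case: ifPn => [|_]; [exact: eC|rewrite C0 lexx].
have flsc n : lower_semicontinuous (fun t => (f n t)%:E).
  move=> t c; rewrite lte_fin => ct.
  have [tab|tab] := boolP (a <= t <= b).
    have k0 : 0 < (f n t - c) / 2 by rewrite divr_gt0// subr_gt0.
    have [r r0 H] := lsc n t tab _ k0.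
    exists (ball t r); first exact: nbhsx_ballx.
    move=> s; rewrite /ball/= => bs; rewrite lte_fin.
    have [sab|sab] := boolP (a <= s <= b).
      have := H s sab; rewrite distrC => /(_ bs).
      by move: ct; rewrite /f tab sab => ct; lra.
    have := fC n t; rewrite /f (negbTE sab) => /andP[_ fc]; exact: lt_le_trans ct fc.
  have ot : open (~` (`[a, b]%classic : set R)).
    by apply: closed_openC; exact: itv_closed.
  exists (~` `[a, b]%classic).
    by apply: open_nbhs_nbhs; split => //=; rewrite in_itv/=; exact/negP.
  move=> s /=; rewrite in_itv/= => /negP sab.
  by rewrite lte_fin; move: ct; rewrite /f (negbTE tab) (negbTE sab).
have mf n : measurable_fun [set: measurableTypeR R] (f n).
  by apply/measurable_EFinP; apply: lower_semicontinuous_measurable; exact: flsc.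
have fint n c d : mu.-integrable `[c, d] (EFin \o f n).
  apply: measurable_bounded_integrable.
  - exact: measurable_itv.
  - by rewrite /= lebesgue_measure_itv; case: ifP => _; rewrite ltry.
  - exact: measurable_funTS.
  - exists C; split; first exact: num_real.
    move=> x Cx y _; have /andP[h1 h2] := fC n y.
    by rewrite /= ger0_norm//; apply: le_trans h2 (ltW Cx).
have fintoc n c d : mu.-integrable `]c, d] (EFin \o f n).
  by apply: integrableS (fint n c d) => //; exact: subset_itv_oc_cc.
pose E n t := \int[mu]_(x in `[a, t]) f n x.
have EB n s t : a <= s -> s <= t -> E n t - E n s = \int[mu]_(x in `]s, t]) f n x.
  by move=> as_ st; rewrite /E Rintegral_itvB//.
have cstoc k s t : s <= t -> \int[mu]_(x in `]s, t]) k = k * (t - s).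
  move=> st; rewrite Rintegral_cst//= lebesgue_measure_itv/= lte_fin.
  case: ltP => [//|ts]; have -> : t = s by apply/eqP; rewrite eq_le ts st.
  by rewrite /= subrr mulr0.
exists E; split.
- by move=> n; rewrite /E set_itv1 Rintegral_set1.
- move=> n s t as_ st tb; rewrite -subr_ge0 EB//.
  by apply: Rintegral_ge0 => x _; have /andP[] := fC n x.
- move=> n t at_ tb k k0.
  have tab : a <= t <= b by rewrite (ltW at_).
  have [r r0 H] := lsc n t tab k k0; exists r => // s rs st as_.
  rewrite EB ?(ltW st)// -(cstoc _ s t (ltW st)); apply: le_Rintegral => //.
    have ci := J_integrable s t (@cont_cst R R (e n t - k)).
    by apply: integrableS ci => //; exact: subset_itv_oc_cc.
  move=> x /=; rewrite in_itv/= => /andP[sx xt].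
  have xab : a <= x <= b by rewrite (le_trans as_ (ltW sx)) (le_trans xt tb).
  rewrite /f xab; apply: H => //; rewrite distrC ger0_norm ?subr_ge0//; lra.
- have ff' : {ae mu, forall x, `[a, b]%classic x -> (fun n => (f n x)%:E) @ \oo --> 0%E}.
    apply: aeW => x/=; rewrite in_itv/= => xab; apply: cvg_EFin; first exact: nearW.
    by have := e0 x xab; rewrite /f xab.
  have [|||||_ _] := @dominated_convergence _ _ R mu _
     (measurable_itv `[a, b]) (fun n x => (f n x)%:E) (fun=> 0%E) (EFin \o cst C).
  + by move=> n; apply/measurable_EFinP; exact: measurable_funTS.
  + exact: measurable_cst.
  + exact: ff'.
  + exact: (J_integrable a b (@cont_cst R R C)).
  + apply: aeW => x n _; rewrite lee_fin; have /andP[h1 h2] := fC n x.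
    by rewrite ger0_norm.
  rewrite integral0 => H.
  suff : (fun n => (E n b)%:E) @ \oo --> 0%:E by move/fine_cvgP => [].
  apply: cvg_trans H; apply: near_eq_cvg; apply: nearW => n /=.
  by rewrite /E /Rintegral fineK//; apply: integrable_fin_num (fint n a b).
Qed.

Lemma is_derive_continuous (F : R -> R) (x d : R) :
  is_derive x 1 F d -> {for x, continuous F}.
Proof. by case=> dF _; apply/differentiable_continuous/derivable1_diffP. Qed.

(** Subtracting the primitive of [h] and [C] times the primitive of [e n] leaves a function to which
    [dini_le] applies. The result is [F n b - F n a <= J a b h + C * E n b], whose last term tends
    to 0. *)
Lemma dini_limit a b C (h : R -> R) (e F : nat -> R -> R) Fa Fb : a <= b ->
  continuous h -> 0 <= C ->
  (forall n, lsc_on a b (e n)) ->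
  (exists C', forall n t, a <= t <= b -> 0 <= e n t <= C') ->
  (forall t, a <= t <= b -> (fun n => e n t) @ \oo --> 0) ->
  (forall n, right_usc_on a b (F n)) ->
  (forall n t, a < t -> t <= b -> forall k, 0 < k -> exists2 r, 0 < r &
    forall s, t - r < s -> s < t -> a <= s ->
      F n t - F n s <= (h t + C * e n t + k) * (t - s)) ->
  (fun n => F n a) @ \oo --> Fa -> (fun n => F n b) @ \oo --> Fb ->
  Fb - Fa <= J a b h.
Proof.
move=> ab ch C0 lsc [C' eC] e0 usc dF Ha Hb.
(* The primitive [H] introduced next starts to the left of [a], so that it is differentiable at [a]
   as well. *)
have [E [Ea Emon dE Eb]] := lsc_primitives ab lsc eC e0.
pose A := a - 1; pose H t := J A t h.
have dH t : A < t -> forall k, 0 < k -> exists2 r, 0 < r & forall s, t - r < s -> s < t -> A <= s ->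
    (h t - k) * (t - s) <= H t - H s.
  move=> At k k0; have /cvgrPdist_lt/(_ k k0)[r /= r0 Hr] := ch t.
  exists r => // s rs st As; rewrite /H (J_split ch As (ltW st)) addrAC subrr add0r.
  rewrite -(J_cst _ (ltW st)); apply: J_le => [||x /andP[sx xt]]; [exact: cont_cst|exact: ch|].
  have := Hr x; rewrite /ball_/= ger0_norm ?subr_ge0// => /(_ _).
  have -> : t - x < r by lra.
  by move=> /(_ isT) /(le_lt_trans (ler_norm _)); lra.
have key n : F n b - F n a <= J a b h + C * E n b.
  pose G t := F n t - H t - C * E n t.
  have GE : G b <= G a -> F n b - F n a <= J a b h + C * E n b.
    have hA : J A b h = J A a h + J a b h by apply: J_split => //; rewrite /A; lra.
    by rewrite /G /H hA Ea mulr0; lra.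
  apply: GE; apply: dini_le => // [t at_ tb k k0|t at_ tb k k0].
    have At : A < t by rewrite /A; lra.
    have k2 : 0 < k / 2 by rewrite divr_gt0.
    have [r1 r10 H1] := usc n t at_ tb _ k2.
    have /is_derive_continuous/cvgrPdist_lt/(_ _ k2)[r2 /= r20 H2] := J_prim ch At.
    exists (Num.min r1 r2); first by rewrite lt_min r10 r20.
    move=> s ts; rewrite -ltrBlDl lt_min => /andP[sr1 sr2] sb.
    have h1 := H1 s ts _ sb; have {}h1 : F n s <= F n t + k / 2 by apply: h1; lra.
    have := H2 s; rewrite /= ler0_norm ?subr_le0 ?(ltW ts)// opprB => /(_ sr2).
    move=> /(le_lt_trans (ler_norm _)) h2.
    have := Emon n t s at_ (ltW ts) sb; rewrite -subr_ge0 => /(mulr_ge0 C0).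
    by rewrite /G /H mulrBr; lra.
  have At : A < t by rewrite /A; lra.
  pose k' := k / (3 + C).
  have C3 : 0 < 3 + C by lra.
  have k'0 : 0 < k' by rewrite divr_gt0.
  have [r1 r10 H1] := dF n t at_ tb k' k'0.
  have [r2 r20 H2] := dH t At k' k'0.
  have [r3 r30 H3] := dE n t at_ tb k' k'0.
  exists (Num.min r1 (Num.min r2 r3)); first by rewrite !lt_min r10 r20 r30.
  move=> s; rewrite ltrBlDl -ltrBlDr !lt_min => /and3P[s1 s2 s3] st as_.
  have h1 : F n t - F n s <= (h t + C * e n t + k') * (t - s) by apply: H1 => //; lra.
  have h2 : (h t - k') * (t - s) <= H t - H s by apply: H2 => //; rewrite /A; lra.
  have h3 : C * ((e n t - k') * (t - s)) <= C * (E n t - E n s).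
    by apply: ler_wpM2l => //; apply: H3 => //; lra.
  have kE : k = 3 * k' + C * k' by rewrite -mulrDl mulrC /k' divfK// gt_eqF.
  have p0 : 0 <= k' * (t - s) by rewrite mulr_ge0 ?(ltW k'0)// subr_ge0 ltW.
  rewrite /G kE; lra.
have c1 : (fun n => F n b - F n a) @ \oo --> Fb - Fa by exact: cvgB.
have c2 : (fun n => J a b h + C * E n b) @ \oo --> J a b h + C * 0.
  by apply: cvgD; [exact: cvg_cst|apply: cvgM; [exact: cvg_cst|]].
rewrite mulr0 addr0 in c2; exact: ler_cvg_to c1 c2 (nearW _ key).
Qed.

End DiniLimit.

(** * Sup-convolutions *)

Section SupConv.
Variable R : realType.
Implicit Types (x y z : R * R) (i : bool) (r s t k : R) (g : R * R -> R).

Definition d2 x y : R := (x.1 - y.1) ^+ 2 + (x.2 - y.2) ^+ 2.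

Definition crd i z : R := if i then z.1 else z.2.

Definition dist1 x y : R := `|x.1 - y.1| + `|x.2 - y.2|.

Definition Dp i r g z : R := (g (sh i r z) - g z) / r.
Definition Dm i r g z : R := (g z - g (sh i (- r) z)) / r.
Definition D2 i r g z : R := (g (sh i r z) + g (sh i (- r) z) - 2 * g z) / r ^+ 2.

Definition sconv e g z : R := sup [set g y - d2 z y / (2 * e) | y in [set: R * R]].

Lemma d2_ge0 x y : 0 <= d2 x y.
Proof. by rewrite addr_ge0// sqr_ge0. Qed.

Lemma d2xx x : d2 x x = 0.
Proof. by rewrite /d2 !subrr expr0n addr0. Qed.

Lemma d2_crd x y : d2 x y = (crd true x - crd true y) ^+ 2 + (crd false x - crd false y) ^+ 2.
Proof. by []. Qed.

Lemma d2_sh i x y a b : d2 (sh i a x) (sh i b y) =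
  d2 x y + 2 * (crd i x - crd i y) * (a - b) + (a - b) ^+ 2.
Proof. by case: i; rewrite /d2 /sh /crd /=; ring. Qed.

Lemma crd_sq i x y : (crd i x - crd i y) ^+ 2 <= d2 x y.
Proof. by case: i; rewrite /d2 /crd ?lerDl ?lerDr sqr_ge0. Qed.

Lemma cont_d2 x : continuous (d2 x).
Proof.
apply: cont_add; apply: cont_exp; apply: cont_sub; try exact: cont_cst.
- exact: cont_fst.
- exact: cont_snd.
Qed.

Section props.
Variables (e B : R) (g : R * R -> R).
Hypotheses (e0 : 0 < e) (cg : continuous g) (gB : forall z, `|g z| <= B).

Let e2 : 0 < 2 * e. Proof. by rewrite mulr_gt0. Qed.

Let B0 : 0 <= B. Proof. exact: le_trans (normr_ge0 _) (gB (0, 0)). Qed.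

Let g_le z : g z <= B. Proof. exact: le_trans (ler_norm _) (gB z). Qed.

Let g_ge z : - B <= g z. Proof. by have := gB z; rewrite ler_norml => /andP[]. Qed.

Lemma sconv_has_sup z : has_sup [set g y - d2 z y / (2 * e) | y in [set: R * R]].
Proof.
split; first by exists (g z - d2 z z / (2 * e)), z.
exists B => _ [y _ <-]; rewrite lerBlDr; apply: le_trans (g_le y) _.
by rewrite lerDl divr_ge0 ?d2_ge0 ?ltW.
Qed.

Lemma sconv_ub z y : g y - d2 z y / (2 * e) <= sconv e g z.
Proof. by apply: (ub_le_sup (sconv_has_sup z).2); exists y. Qed.

Lemma sconv_ge z : g z <= sconv e g z.
Proof. by have := sconv_ub z z; rewrite d2xx mul0r subr0. Qed.

Lemma sconv_le z k : (forall y, g y - d2 z y / (2 * e) <= k) -> sconv e g z <= k.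
Proof. by move=> H; apply: (sup_le_ub (sconv_has_sup z).1) => _ [y _ <-]. Qed.

Lemma sconv_bound z : `|sconv e g z| <= B.
Proof.
rewrite ler_norml (le_trans (g_ge z) (sconv_ge z))/=.
apply: sconv_le => y; rewrite lerBlDr; apply: le_trans (g_le y) _.
by rewrite lerDl divr_ge0 ?d2_ge0 ?ltW.
Qed.

(** A point that does at least as well as [z] itself satisfies [d2 z y <= 4 * B * e], so the
    supremum is attained on a compact square. The [+ 1] in [r] makes the points outside the square
    strictly worse. *)
Lemma sconv_max z : exists2 y, sconv e g z = g y - d2 z y / (2 * e) & d2 z y <= 4 * B * e.
Proof.
pose r := Num.sqrt (4 * B * e) + 1.
have Be : 0 <= 4 * B * e by rewrite mulr_ge0 ?(ltW e0)// mulr_ge0.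
have r0 : 0 < r by rewrite ltr_wpDl// sqrtr_ge0.
have rE : 4 * B * e < r ^+ 2.
  rewrite -[X in X < _](sqr_sqrtr Be) /r sqrrD1 -addrA ltrDl.
  by rewrite ltr_wpDl// mulrn_wge0// sqrtr_ge0.
pose K := (`[z.1 - r, z.1 + r]%classic `*` `[z.2 - r, z.2 + r]%classic) : set (R * R).
have cK : compact K by apply: compact_setX; exact: segment_compact.
have zK : K z by split; rewrite /= in_itv/=; apply/andP; split; lra.
pose f y := g y - d2 z y / (2 * e).
have cf : continuous f.
  by apply: cont_sub => //; apply: cont_mul; [exact: cont_d2|exact: cont_cst].
have [y Ky Hy] := compact_EVT_max (ex_intro _ z zK) cK (continuous_subspaceT cf).
have fz : f z <= f y by apply: Hy; rewrite inE.
have out x : ~ K x -> 4 * B * e < d2 z x.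
  move=> nK; apply: lt_le_trans rE _; rewrite leNgt; apply/negP => dr.
  have h i : `|crd i z - crd i x| < r.
    rewrite -(ltr_pXn2r (n := 2))//; rewrite ?nnegrE ?normr_ge0 ?(ltW r0)//.
    by rewrite real_normK ?num_real//; apply: le_lt_trans dr; exact: crd_sq.
  apply: nK; split; rewrite /= in_itv/=.
  - by have := h true; rewrite /crd ltr_norml => /andP[]; lra.
  - by have := h false; rewrite /crd ltr_norml => /andP[]; lra.
have small x : f z <= f x -> d2 z x <= 4 * B * e.
  rewrite /f d2xx mul0r subr0 => H.
  have : d2 z x / (2 * e) <= 2 * B by have := g_le x; have := g_ge z; lra.
  by rewrite ler_pdivrMr//; lra.
exists y; last exact: small.
apply/eqP; rewrite eq_le sconv_ub andbT; apply: sconv_le => x.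
have [Kx|nK] := pselect (K x); first by apply: Hy; rewrite inE.
have [fx|fx] := leP (f z) (f x); first by have := small _ fx; have := out _ nK; lra.
exact: ltW (lt_le_trans fx fz).
Qed.

(** The base point moves by [r] while the touching point moves by [s * r]. The free factor [s]
    allows second differences at [z] and at [y] to carry different weights, at a cost of order
    [(1 - s)^2 / e]; [s = 0] expresses semiconvexity. *)
Lemma sconv_touch i z y s r : sconv e g z = g y - d2 z y / (2 * e) ->
  sconv e g z + (g (sh i (s * r) y) - g y)
   + (crd i y - crd i z) / e * ((1 - s) * r) - (1 - s) ^+ 2 * r ^+ 2 / (2 * e)
  <= sconv e g (sh i r z).
Proof.
move=> zy; have := sconv_ub (sh i r z) (sh i (s * r) y); rewrite d2_sh => H.
apply: le_trans _ H; rewrite zy le_eqVlt; apply/orP; left; apply/eqP.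
by field; rewrite gt_eqF.
Qed.

Lemma sconv_touch_max i z y r : sconv e g z = g y - d2 z y / (2 * e) ->
  g (sh i r y) <= g y + (crd i y - crd i z) / e * r + r ^+ 2 / (2 * e).
Proof.
move=> zy; have := sconv_ub z (sh i r y); rewrite zy -{1}(sh0 i z) d2_sh sub0r sqrrN => H.
have E : (d2 z y + 2 * (crd i z - crd i y) * - r + r ^+ 2) / (2 * e) =
   d2 z y / (2 * e) + (crd i y - crd i z) / e * r + r ^+ 2 / (2 * e).
  by field; rewrite gt_eqF.
by rewrite E in H; lra.
Qed.

Lemma sconv_per : per g -> per (sconv e g).
Proof.
move=> pg i z; apply/eqP; rewrite eq_le; apply/andP; split; apply: sconv_le => y.
- have := sconv_ub z (sh i (-1) y); rewrite -[in X in X -> _](pg i (sh i (-1) y)) shK.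
  rewrite -{1}(shKN i 1 z) d2_sh opprK; apply: le_trans.
  by rewrite lerD2l lerN2 ler_pM2r ?invr_gt0//; lra.
- have := sconv_ub (sh i 1 z) (sh i 1 y); rewrite pg d2_sh; apply: le_trans.
  by rewrite lerD2l lerN2 ler_pM2r ?invr_gt0// subrr mulr0 expr0n !addr0.
Qed.

Lemma sconv_lip_step i z r : `|r| <= 1 ->
  `|sconv e g (sh i r z) - sconv e g z| <= (Num.sqrt (4 * B * e) + 1) / e * `|r|.
Proof.
move=> r1.
have H x k : `|k| <= 1 -> sconv e g x - sconv e g (sh i k x) <=
    (Num.sqrt (4 * B * e) + 1) / e * `|k|.
  move=> k1; have [y xy dy] := sconv_max x.
  have := sconv_touch i 0 k xy; rewrite mul0r sh0 subrr addr0 subr0 !mul1r.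
  have Be : 0 <= 4 * B * e by rewrite mulr_ge0 ?(ltW e0)// mulr_ge0.
  have c1 : `|crd i y - crd i x| <= Num.sqrt (4 * B * e).
    rewrite -(sqrtr_sqr (crd i y - crd i x)) ler_sqrt//.
    by apply: le_trans dy; rewrite -sqrrN opprB crd_sq.
  have h1 : - ((crd i y - crd i x) / e * k) <= Num.sqrt (4 * B * e) / e * `|k|.
    apply: le_trans (ler_norm _) _; rewrite normrN !normrM.
    rewrite ler_wpM2r// (gtr0_norm (x := e^-1)) ?invr_gt0//.
    by rewrite ler_wpM2r// invr_ge0 ltW.
  have h2 : 1 ^+ 2 * k ^+ 2 / (2 * e) <= 1 / e * `|k|.
    have -> : 1 ^+ 2 * k ^+ 2 / (2 * e) = `|k| * (`|k| / 2) / e.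
      by rewrite -[in LHS](real_normK (num_real k)); field; rewrite gt_eqF.
    rewrite mul1r mulrC ler_wpM2l ?invr_ge0 ?(ltW e0)//.
    by apply: ler_piMr => //; lra.
  by rewrite mulrDl mulrDl; lra.
rewrite ler_norml; apply/andP; split; last first.
  have := H (sh i r z) (- r); rewrite normrN shKN; exact.
by rewrite lerNl opprB; exact: H.
Qed.

End props.
End SupConv.

Section SupConvCont.
Variable R : realType.
Implicit Types (x y z : R * R) (i : bool) (r s t k : R).

Lemma lip_steps_cont (p : R * R -> R) (L : R) : 0 <= L ->
  (forall i z r, `|r| <= 1 -> `|p (sh i r z) - p z| <= L * `|r|) -> continuous p.
Proof.
move=> L0 pL z; apply/cvgrPdist_lt => k k0.
pose r := Num.min 1 (k / (2 * L + 1)).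
have L1 : 0 < 2 * L + 1 by lra.
have r0 : 0 < r by rewrite lt_min ltr01 divr_gt0.
exists (ball z.1 r, ball z.2 r); first by split; exact: nbhsx_ballx.
move=> y [/= y1 y2].
have E : y = sh false (y.2 - z.2) (sh true (y.1 - z.1) z).
  by rewrite /sh/=; case: (y) => a b /=; congr pair; ring.
have b1 : `|y.1 - z.1| < r by rewrite distrC; exact: y1.
have b2 : `|y.2 - z.2| < r by rewrite distrC; exact: y2.
have r1 : r <= 1 by rewrite ge_min lexx.
have rk : r <= k / (2 * L + 1) by rewrite ge_min lexx orbT.
have h1 := pL true z _ (le_trans (ltW b1) r1).
have h2 := pL false (sh true (y.1 - z.1) z) _ (le_trans (ltW b2) r1).
rewrite -E in h2; rewrite distrC.
apply: le_lt_trans (ler_distD (p (sh true (y.1 - z.1) z)) _ _) _.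
apply: le_lt_trans (lerD h2 h1) _; rewrite -mulrDr.
apply: (@le_lt_trans _ _ (L * (r + r))); first by rewrite ler_wpM2l// lerD ?ltW.
rewrite ler_pdivlMr// in rk; apply: lt_le_trans rk.
by lra.
Qed.

Lemma sconv_cont e B (g : R * R -> R) : 0 < e -> continuous g ->
  (forall z, `|g z| <= B) -> continuous (sconv e g).
Proof.
move=> e0 cg gB; apply: (@lip_steps_cont _ ((Num.sqrt (4 * B * e) + 1) / e)).
  by rewrite divr_ge0 ?(ltW e0)// addr_ge0 ?sqrtr_ge0.
by move=> i z r; exact: sconv_lip_step.
Qed.

End SupConvCont.

(** * Pointwise subsolutions and their sup-convolutions *)

Section PointwiseSub.
Variable R : realType.
Implicit Types (x y z : R * R) (i : bool) (r s t k d : R).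

(** Everything refers to the single point [(z, t)]: an upper bound for backward time quotients,
    first order expansions, and symmetric second differences. The constant [M] is a margin that
    later pays for the dependence of [al] on position. *)
Definition subsol_at (al : R * R -> R -> R) (v : bool -> R * R -> R) (M : R)
    (Q : R * R -> R -> R) z t :=
  exists (tau : R) (pi H : bool -> R),
  [/\ forall k, 0 < k -> exists2 r, 0 < r &
        forall d, 0 < d -> d < r -> Q z t - Q z (t - d) <= (tau + k) * d,
      forall i k, 0 < k -> exists2 r, 0 < r & forall a, `|a| < r ->
        `|Q (sh i a z) t - Q z t - pi i * a| <= k * `|a|,
      forall i k, 0 < k -> exists2 r, 0 < r & forall a, `|a| < r ->
        `|Q (sh i a z) t + Q (sh i (- a) z) t - 2 * Q z t - H i * a ^+ 2| <= k * a ^+ 2 &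
      tau <= al z (Q z t) * (H true + H false)
        - (v true z * pi true + v false z * pi false) - M].

Definition pos (a : R) := Num.max a 0.
Definition neg (a : R) := Num.max (- a) 0.

(** The right-hand side at finite step [r]. The drift is discretised upwind because touching from
    above bounds forward differences from below and backward differences from above, and each must
    enter with the matching sign. The squares stand for the gradient errors of the
    sup-convolution. *)
Definition Rrho (al C0 : R) (v : bool -> R) (p : R * R -> R) r z : R :=
  \sum_(i <- [:: true; false]) (al * D2 i r p z
     + C0 * (Dp i r p z ^+ 2 + Dm i r p z ^+ 2)
     + neg (v i) * Dp i r p z - pos (v i) * Dm i r p z).

Lemma pos_neg a : a = pos a - neg a.
Proof. by rewrite /pos /neg /Num.max; do 2 case: ifP; lra. Qed.

Lemma neg_pos_norm a : neg a + pos a = `|a|.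
Proof.
rewrite /neg /pos; have [w0|w0] := leP 0 a.
  by rewrite max_r ?oppr_le0// add0r ger0_norm.
by rewrite max_l ?oppr_ge0 ?ltW// addr0 ltr0_norm.
Qed.

Lemma pos_ge0 a : 0 <= pos a. Proof. by rewrite /pos le_max lexx orbT. Qed.
Lemma neg_ge0 a : 0 <= neg a. Proof. by rewrite /neg le_max lexx orbT. Qed.

Variables (a0 a1 La Lv V B M T0 : R) (al : R * R -> R -> R) (v : bool -> R * R -> R)
  (Q : R * R -> R -> R).
Hypotheses (a00 : 0 < a0) (La0 : 0 <= La) (Lv0 : 0 <= Lv).
Hypothesis al_bd : forall z q, a0 <= al z q <= a1.
Hypothesis al_lip : forall z y q q', `|al z q - al y q'| <= La * (dist1 z y + `|q - q'|).
Hypothesis v_lip : forall i z y, `|v i z - v i y| <= Lv * dist1 z y.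
Hypothesis v_bd : forall i z, `|v i z| <= V.
Hypothesis cQ : forall t, T0 < t -> continuous (Q^~ t).
Hypothesis QB : forall t, T0 < t -> forall z, `|Q z t| <= B.

Let B0 : 0 <= B.
Proof.
by apply: le_trans (normr_ge0 _) (@QB (T0 + 1) _ (0, 0)); rewrite ltrDl.
Qed.

Definition sc e t := sconv e (Q^~ t).

Section onetime.
Variables (e t : R).
Hypotheses (e0 : 0 < e) (e1 : e <= 1) (Lve : Lv * e <= 1) (T0t : T0 < t).
Hypothesis sub : forall y, subsol_at al v M Q y t.

Let cg := cQ T0t.
Let gB := QB T0t.

(** Since [y] is optimal, [Q] near [y] lies below a parabola of second derivative [1 / e] that
    touches it at [y]; steps of both signs then fix the slope. *)
Lemma touch_slopes z y i tau (pi H : R) :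
  sc e t z = Q y t - d2 z y / (2 * e) ->
  (forall k, 0 < k -> exists2 r, 0 < r & forall a, `|a| < r ->
     `|Q (sh i a y) t - Q y t - pi * a| <= k * `|a|) ->
  (forall k, 0 < k -> exists2 r, 0 < r & forall a, `|a| < r ->
     `|Q (sh i a y) t + Q (sh i (- a) y) t - 2 * Q y t - H * a ^+ 2| <= k * a ^+ 2) ->
  pi = (crd i y - crd i z) / e /\ H <= e^-1 + 0 * tau.
Proof.
move=> zy Hpi HH; split; last first.
  rewrite mul0r addr0; apply/ler_addgt0Pr => k k0; have [r r0 Hr] := HH k k0.
  have a0' : 0 < r / 2 by rewrite divr_gt0.
  have := Hr (r / 2); rewrite gtr0_norm// ltr_pdivrMr// ltr_pMr// ltr1n => /(_ isT).
  have := sconv_touch_max e0 gB i (r / 2) zy; have := sconv_touch_max e0 gB i (- (r / 2)) zy.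
  rewrite ler_norml => m1 m2 /andP[m3 _].
  have : H * (r / 2) ^+ 2 <= (e^-1 + k) * (r / 2) ^+ 2.
    move: m1 m2; rewrite sqrrN mulrN.
    have -> : (r / 2) ^+ 2 / (2 * e) = e^-1 * (r / 2) ^+ 2 / 2 by field; rewrite gt_eqF.
    by rewrite mulrDl; lra.
  by rewrite ler_pM2r// exprn_gt0.
pose w := (crd i y - crd i z) / e.
have le_k k : 0 < k -> `|pi - w| <= 2 * k.
  move=> k0; have [r r0 Hr] := Hpi k k0.
  pose a := Num.min (r / 2) (k * e).
  have a_0 : 0 < a by rewrite lt_min divr_gt0// mulr_gt0.
  have ar : a < r by rewrite gt_min ltr_pdivrMr// ltr_pMr// ltr1n.
  have ae : a ^+ 2 / (2 * e) <= k * a.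
    have ake : a <= k * e by rewrite ge_min lexx orbT.
    rewrite ler_pdivrMr ?mulr_gt0// expr2.
    have := ler_wpM2l (ltW a_0) ake.
    by have : 0 <= a * (k * e); [rewrite mulr_ge0 ?mulr_ge0// ltW|lra].
  have h1 := Hr a; have h2 := Hr (- a); rewrite normrN gtr0_norm// ar in h1 h2.
  have {}h1 := h1 isT; have {}h2 := h2 isT.
  have m1 := sconv_touch_max e0 gB i a zy; have m2 := sconv_touch_max e0 gB i (- a) zy.
  rewrite sqrrN mulrN -/w in m1 m2.
  move: h1 h2; rewrite !ler_norml => /andP[h1 h1'] /andP[h2 h2'].
  have u1 : (pi - w) * a <= 2 * k * a by move: m1 h1; rewrite mulrBl; lra.
  have u2 : - (2 * k) * a <= (pi - w) * a by move: m2 h2; rewrite mulrBl !mulNr mulrN; lra.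
  by rewrite !ler_pM2r// in u1 u2; rewrite u2.
apply/eqP; rewrite -subr_eq0 -normr_le0; apply/ler_addgt0Pr => k k0.
by rewrite add0r; have := le_k (k / 2); rewrite divr_gt0// mulrC divfK//; apply.
Qed.

(** The equation at the touching point, estimated with slopes at most [sqrt (4 B e) / e] and second
    derivatives at most [1 / e]. *)
Definition Cdom := a1 * (2 / e) + 2 * V * Num.sqrt (4 * B * e) / e + `|M|.

(** The maximiser [y] for time [t] is a competitor at time [t - d], so the backward quotient of the
    sup-convolution at [z] is at most that of [Q] at [y]. *)
Lemma sc_time_dom z k : 0 < k -> exists2 r, 0 < r & forall d, 0 < d -> d < r ->
  T0 < t - d -> sc e t z - sc e (t - d) z <= (Cdom + k) * d.
Proof.
move=> k0; have [y zy dy] := sconv_max e0 cg gB z.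
have [tau [pi [H [Htau Hpi HH Heq]]]] := sub y.
have [r r0 Hr] := Htau k k0; exists r => // d d0 dr Td.
have h1 := sconv_ub e0 (QB Td) z y.
have h2 := Hr d d0 dr.
suff tC : tau <= Cdom.
  apply: (@le_trans _ _ ((tau + k) * d)).
    have zy' : sc e t z = _ := zy; rewrite -/(sc e (t - d) z) in h1.
    by apply: le_trans h2; rewrite zy'; lra.
  by rewrite ler_pM2r// lerD2r.
have [p1 H1] := touch_slopes tau zy (Hpi true) (HH true).
have [p2 H2] := touch_slopes tau zy (Hpi false) (HH false).
rewrite mul0r addr0 in H1 H2.
apply: le_trans Heq _.
have /andP[al0 al1] := al_bd y (Q y t).
have Be : 0 <= 4 * B * e by rewrite mulr_ge0 ?(ltW e0)// mulr_ge0.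
have s1 i : `|pi i| <= Num.sqrt (4 * B * e) / e.
  have -> : pi i = (crd i y - crd i z) / e by case: i.
  rewrite normrM (gtr0_norm (x := e^-1)) ?invr_gt0// ler_pM2r ?invr_gt0//.
  rewrite -(sqrtr_sqr (crd i y - crd i z)) ler_sqrt//.
  by apply: le_trans dy; rewrite -sqrrN opprB crd_sq.
have vp i : - (v i y * pi i) <= V * (Num.sqrt (4 * B * e) / e).
  apply: le_trans (ler_norm _) _; rewrite normrN normrM.
  by apply: ler_pM => //; exact: v_bd.
have aH : al y (Q y t) * (H true + H false) <= a1 * (2 / e).
  have h : H true + H false <= 2 / e by rewrite mulrDl mul1r lerD.
  apply: (@le_trans _ _ (al y (Q y t) * (2 / e))).
    by rewrite ler_wpM2l// (le_trans (ltW a00)).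
  by rewrite ler_wpM2r// divr_ge0// ltW.
have := ler_norm (- M); rewrite normrN /Cdom.
have := vp true; have := vp false.
have -> : 2 * V * Num.sqrt (4 * B * e) / e = 2 * (V * (Num.sqrt (4 * B * e) / e)) by rewrite !mulrA.
by lra.
Qed.

(** The first term comes from the mismatch of [al] between [z] and the touching point, the [+ 2]
    from the mismatch of the drift. *)
Definition Cgrad := 2 * La ^+ 2 / a0 * (4 + 2 * B) + 2.

Ltac csec := clear -a00 La0 Lv0 al_bd al_lip v_lip v_bd cQ QB B0 e0 e1 Lve T0t sub cg gB.

(** With [s = sqrt (Ay / A)] the second differences at [z], weighted by [A], match those at [y],
    weighted by [Ay], up to [2 A (1 - s)^2 / e]. The points [z] and [y] differ by [e] times the
    slope, so by the Lipschitz bound [(A - Ay)^2] is of order [e * N], with [N] the squared slope.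
    The factor [1 / e] cancels and a multiple of the squared gradient remains. *)
Lemma sc_pointwise z k : 0 < k -> exists2 r, 0 < r & forall d rho, 0 < d -> d < r ->
  T0 < t - d -> 0 < rho -> rho < r ->
  (sc e t z - sc e (t - d) z) / d
    <= Rrho (al z (sc e t z)) Cgrad (v^~ z) (sc e t) rho z - M + k.
Proof.
move=> k0; have [y zy dy] := sconv_max e0 cg gB z.
have [tau [pi [H [Htau Hpi HH Heq]]]] := sub y.
set p := sc e t; set q := p z; set A := al z q; set Ay := al y (Q y t).
have /andP[A0 A1] := al_bd z q; have /andP[Ay0 Ay1] := al_bd y (Q y t).
rewrite -/A in A0 A1; rewrite -/Ay in Ay0 Ay1 Heq.
have Ap : 0 < A by exact: lt_le_trans A0.
have Ayp : 0 < Ay by exact: lt_le_trans Ay0.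
have piE i : pi i = (crd i y - crd i z) / e.
  by have [] := touch_slopes 0 zy (Hpi i) (HH i).
pose s := Num.sqrt (Ay / A).
have s0 : 0 <= s by exact: sqrtr_ge0.
have s2 : s ^+ 2 = Ay / A by rewrite sqr_sqrtr// divr_ge0// ltW.
have As2 : A * s ^+ 2 = Ay by rewrite s2 mulrC divfK// gt_eqF.
pose N := pi true ^+ 2 + pi false ^+ 2.
have N0 : 0 <= N by rewrite addr_ge0// sqr_ge0.
have d2N : d2 z y = e ^+ 2 * N.
  rewrite /N !piE d2_crd; field; rewrite gt_eqF//.
have eN : e * N <= 4 * B.
  by move: dy; rewrite d2N expr2 -mulrA [X in _ <= X]mulrC ler_pM2l.
pose n1 := `|pi true| + `|pi false|.
have n10 : 0 <= n1 by rewrite addr_ge0.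
have n1N : n1 ^+ 2 <= 2 * N.
  have : 0 <= (`|pi true| - `|pi false|) ^+ 2 by exact: sqr_ge0.
  rewrite /n1 /N sqrrB sqrrD -[pi true ^+ 2]real_normK ?num_real//.
  by rewrite -[pi false ^+ 2]real_normK ?num_real//; lra.
have dist1E : dist1 z y = e * n1.
  have E i : `|crd i z - crd i y| = e * `|pi i|.
    by rewrite piE normrM (gtr0_norm (x := e^-1)) ?invr_gt0// mulrC divfK ?gt_eqF// distrC.
  by rewrite /n1 mulrDr -!E.
have qE : `|q - Q y t| = e * N / 2.
  rewrite /q /p /sc zy d2N.
  have -> : Q y t - e ^+ 2 * N / (2 * e) - Q y t = - (e * N / 2) by field; rewrite gt_eqF.
  by rewrite normrN ger0_norm// divr_ge0// mulr_ge0// ltW.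
have err : A * (2 * ((1 - s) ^+ 2 / e)) <= 2 * La ^+ 2 / a0 * (4 + 2 * B) * N.
  have h1 : (1 - s) ^+ 2 <= (1 - s ^+ 2) ^+ 2.
    have -> : (1 - s ^+ 2) ^+ 2 = (1 - s) ^+ 2 * (1 + s) ^+ 2 by ring.
    by rewrite ler_peMr ?sqr_ge0// exprn_ege1// lerDl.
  have h2 : A * (1 - s ^+ 2) ^+ 2 = (A - Ay) ^+ 2 / A by rewrite s2; field; rewrite gt_eqF.
  have h3 : (A - Ay) ^+ 2 <= (La * (e * n1 + e * N / 2)) ^+ 2.
    have h0 : 0 <= La * (e * n1 + e * N / 2).
      by rewrite mulr_ge0// addr_ge0// ?divr_ge0// mulr_ge0// ltW.
    rewrite -[X in X <= _]real_normK ?num_real// ler_pXn2r ?nnegrE//.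
    by rewrite -dist1E -qE; exact: al_lip.
  have h4 : (e * n1 + e * N / 2) ^+ 2 <= e * ((4 + 2 * B) * N).
    have u1 : (e * n1 + e * N / 2) ^+ 2 <= 2 * (e * n1) ^+ 2 + 2 * (e * N / 2) ^+ 2.
      by have := sqr_ge0 (e * n1 - e * N / 2); rewrite sqrrB sqrrD; lra.
    have u2 : (e * n1) ^+ 2 <= e * (2 * N).
      rewrite exprMn expr2 -mulrA ler_pM2l//.
      apply: le_trans n1N; apply: ler_piMl => //; exact: sqr_ge0.
    have u3 : (e * N / 2) ^+ 2 <= e * (B * N).
      have -> : (e * N / 2) ^+ 2 = e * ((e * N) * N / 4) by field.
      rewrite ler_pM2l// ler_pdivrMr// -mulrA mulrCA mulrC.
      by have := ler_wpM2r N0 eN; lra.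
    have -> : e * ((4 + 2 * B) * N) = 2 * (e * (2 * N)) + 2 * (e * (B * N)) by ring.
    by apply: le_trans u1 _; rewrite lerD// ler_pM2l.
  have h5 : (A - Ay) ^+ 2 / A <= La ^+ 2 * (e * ((4 + 2 * B) * N)) / a0.
    apply: ler_pM; rewrite ?sqr_ge0 ?invr_ge0 ?(ltW Ap)//.
    - by apply: le_trans h3 _; rewrite exprMn ler_wpM2l// sqr_ge0.
    - by rewrite lef_pV2.
  have h6 : A * (1 - s) ^+ 2 <= La ^+ 2 * (e * ((4 + 2 * B) * N)) / a0.
    by apply: le_trans h5; rewrite -h2 ler_pM2l.
  have -> : A * (2 * ((1 - s) ^+ 2 / e)) = 2 * (A * (1 - s) ^+ 2) / e by ring.
  rewrite ler_pdivrMr//.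
  have -> : 2 * La ^+ 2 / a0 * (4 + 2 * B) * N * e = 2 * (La ^+ 2 * (e * ((4 + 2 * B) * N)) / a0) by ring.
  by rewrite ler_pM2l.
have drift : - (v true y * pi true + v false y * pi false) <=
    - (v true z * pi true + v false z * pi false) + 2 * N.
  have h i : - (v i y * pi i) <= - (v i z * pi i) + Lv * (e * n1) * `|pi i|.
    rewrite -lerBlDl opprK addrC -mulrBl; apply: le_trans (ler_norm _) _.
    by rewrite normrM ler_wpM2r// -dist1E; exact: v_lip.
  have h3 : Lv * (e * n1) * `|pi true| + Lv * (e * n1) * `|pi false| <= 2 * N.
    have -> : Lv * (e * n1) * `|pi true| + Lv * (e * n1) * `|pi false| = Lv * e * n1 ^+ 2.
      by rewrite /n1; ring.
    apply: le_trans n1N; apply: ler_piMl => //; exact: sqr_ge0.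
  by have := h true; have := h false; lra.
(* [W] collects the coefficients of the expansion error [k1], so that [W * k1 = k / 2]; the other
   half of [k] is used for the time quotient. *)
pose W := 1 + 2 * A * (s ^+ 2 + 1) + 2 * Cgrad * n1 + 2 * V.
have V0 : 0 <= V by exact: le_trans (normr_ge0 _) (v_bd true (0, 0)).
have Cg0 : 0 <= Cgrad.
  rewrite /Cgrad addr_ge0// mulr_ge0//; last by rewrite addr_ge0// mulr_ge0.
  by rewrite mulr_ge0 ?invr_ge0 ?(ltW a00)// mulr_ge0// sqr_ge0.
have W0 : 0 < W.
  have : 0 <= A * (s ^+ 2 + 1) by rewrite mulr_ge0 ?(ltW Ap)// addr_ge0// sqr_ge0.
  by have := mulr_ge0 Cg0 n10; rewrite /W; lra.
pose k1 := k / (2 * W).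
have k10 : 0 < k1 by rewrite divr_gt0// mulr_gt0.
have [r1 r10 Hr1] := Htau _ (divr_gt0 k0 (ltr0Sn R 1)).
have [r2 r20 Hr2] := HH true k1 k10.
have [r3 r30 Hr3] := HH false k1 k10.
pose r := Num.min r1 (Num.min (r2 / (s + 1)) (Num.min (r3 / (s + 1)) (k1 * e))).
have sp : 0 < s + 1 by rewrite ltr_wpDl.
exists r; first by rewrite /r !lt_min r10 !divr_gt0// mulr_gt0.
move=> d rho d0; rewrite !lt_min => /and4P[dr1 _ _ _] Td rho0 /and4P[_ rr2 rr3 rre].
have lhs : (sc e t z - sc e (t - d) z) / d <= tau + k / 2.
  rewrite ler_pdivrMr//; apply: le_trans (Hr1 d d0 dr1).
  have zy' : sc e t z = _ := zy.
  by have := sconv_ub e0 (QB Td) z y; rewrite -/(sc e (t - d) z) zy'; csec; lra.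
apply: le_trans lhs _.
have sig : rho / (2 * e) <= k1.
  rewrite ler_pdivrMr ?mulr_gt0//; apply: le_trans (ltW rre) _.
  by rewrite mulrCA; have : 0 < k1 * e by [rewrite mulr_gt0]; csec; lra.
have DD i : s ^+ 2 * H i - (1 - s) ^+ 2 / e - k1 * s ^+ 2 <= D2 i rho p z.
  have sr : `|s * rho| < (if i then r2 else r3).
    rewrite ger0_norm ?mulr_ge0// ?(ltW rho0)//.
    have h b : rho < b / (s + 1) -> s * rho < b.
      by rewrite ltr_pdivlMr// => hb; apply: lt_le_trans _ (ltW hb); rewrite mulrDr mulr1 mulrC ltrDl.
    by case: (i); exact: h.
  have hQ : `|Q (sh i (s * rho) y) t + Q (sh i (- (s * rho)) y) t - 2 * Q y t
       - H i * (s * rho) ^+ 2| <= k1 * (s * rho) ^+ 2.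
    by case: i sr => sr; [exact: Hr2|exact: Hr3].
  have t1 := sconv_touch e0 gB i s rho zy; have t2 := sconv_touch e0 gB i s (- rho) zy.
  rewrite sqrrN !mulrN in t2.
  rewrite /D2 ler_pdivlMr ?exprn_gt0//.
  move: hQ; rewrite ler_norml => /andP[hQ _].
  have -> : (s ^+ 2 * H i - (1 - s) ^+ 2 / e - k1 * s ^+ 2) * rho ^+ 2 =
     H i * (s * rho) ^+ 2 - k1 * (s * rho) ^+ 2 - 2 * ((1 - s) ^+ 2 * rho ^+ 2 / (2 * e)).
    by field; rewrite gt_eqF.
  move: t1 t2; rewrite -/(sc e t (sh i rho z)) -/(sc e t (sh i (- rho) z)) -/(sc e t z) -/p -/q.
  by move: hQ; csec; lra.
have DP i : pi i - k1 <= Dp i rho p z.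
  have t1 := sconv_touch e0 gB i 0 rho zy.
  rewrite mul0r sh0 subrr addr0 subr0 !mul1r -piE expr1n mul1r in t1.
  rewrite /Dp ler_pdivlMr//; apply: (@le_trans _ _ (pi i * rho - rho ^+ 2 / (2 * e))).
    by rewrite mulrBl lerD2l lerN2 expr2 mulrAC ler_pM2r.
  by move: t1; rewrite -/(sc e t (sh i rho z)) -/(sc e t z) -/p; csec; lra.
have DM i : Dm i rho p z <= pi i + k1.
  have t1 := sconv_touch e0 gB i 0 (- rho) zy.
  rewrite mul0r sh0 subrr addr0 subr0 !mul1r -piE expr1n mul1r sqrrN mulrN in t1.
  rewrite /Dm ler_pdivrMr//; apply: (@le_trans _ _ (pi i * rho + rho ^+ 2 / (2 * e))).
    by move: t1; rewrite -/(sc e t (sh i (- rho) z)) -/(sc e t z) -/p; csec; lra.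
  by rewrite [X in _ <= X]mulrDl lerD2l expr2 mulrAC ler_pM2r.
have SQ i : pi i ^+ 2 <= Dp i rho p z ^+ 2 + Dm i rho p z ^+ 2 + 2 * `|pi i| * k1.
  have := DP i; have := DM i; set dp := Dp _ _ _ _; set dm := Dm _ _ _ _.
  have := sqr_ge0 dp; have := sqr_ge0 dm; move: (pi i) k10; csec => w k10 q1 q2 hm hp.
  have qk := sqr_ge0 k1.
  have [p0|p0] := leP 0 w.
    rewrite ger0_norm//; suff : w ^+ 2 - 2 * w * k1 <= dp ^+ 2 by lra.
    have [pk|pk] := leP k1 w; last first.
      apply: le_trans q2; rewrite subr_le0 expr2 mulrAC; apply: ler_wpM2r => //; lra.
    have : (w - k1) ^+ 2 <= dp ^+ 2 by rewrite ler_pXn2r ?nnegrE//; lra.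
    by rewrite sqrrB; lra.
  rewrite ltr0_norm//; suff : w ^+ 2 - 2 * - w * k1 <= dm ^+ 2 by lra.
  have [pk|pk] := leP k1 (- w); last first.
    apply: le_trans q1; rewrite subr_le0 -sqrrN expr2 mulrAC; apply: ler_wpM2r => //; lra.
  have : (- w - k1) ^+ 2 <= (- dm) ^+ 2 by rewrite ler_pXn2r ?nnegrE//; lra.
  by rewrite sqrrN sqrrB sqrrN; lra.
have VV i : - (v i z * pi i) <= neg (v i z) * Dp i rho p z - pos (v i z) * Dm i rho p z + V * k1.
  have h1 : neg (v i z) * (pi i - k1) <= neg (v i z) * Dp i rho p z by rewrite ler_wpM2l ?neg_ge0.
  have h2 : pos (v i z) * Dm i rho p z <= pos (v i z) * (pi i + k1) by rewrite ler_wpM2l ?pos_ge0.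
  have h3 : (neg (v i z) + pos (v i z)) * k1 <= V * k1.
    by rewrite ler_pM2r// neg_pos_norm; exact: v_bd.
  have -> : - (v i z * pi i) = - ((pos (v i z) - neg (v i z)) * pi i) by rewrite -pos_neg.
  by move: h1 h2 h3; csec; lra.
have AH : Ay * (H true + H false) <= A * (D2 true rho p z + D2 false rho p z)
     + 2 * La ^+ 2 / a0 * (4 + 2 * B) * N + 2 * A * s ^+ 2 * k1.
  have := ler_wpM2l (ltW Ap) (lerD (DD true) (DD false)).
  by move: err; rewrite -As2; csec; lra.
have CN : Cgrad * N <= Cgrad * (Dp true rho p z ^+ 2 + Dm true rho p z ^+ 2)
    + Cgrad * (Dp false rho p z ^+ 2 + Dm false rho p z ^+ 2) + 2 * Cgrad * n1 * k1.
  by have := ler_wpM2l Cg0 (lerD (SQ true) (SQ false)); rewrite -/N /n1; csec; lra.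
have CE : Cgrad * N = 2 * La ^+ 2 / a0 * (4 + 2 * B) * N + 2 * N by rewrite /Cgrad; ring.
have Wk : W * k1 = k / 2 by rewrite /k1; field; rewrite gt_eqF.
have Ak : 0 <= A * k1 by rewrite mulr_ge0// ltW.
rewrite /Rrho big_cons big_cons big_nil addr0.
move: (VV true) (VV false) Wk Ak AH CN CE drift Heq k10; rewrite /W; csec.
set u1 := Dp _ _ _ _; set u2 := Dp _ _ _ _; set u3 := Dm _ _ _ _; set u4 := Dm _ _ _ _.
set u5 := D2 _ _ _ _; set u6 := D2 _ _ _ _.
move: (2 * La ^+ 2 / a0 * (4 + 2 * B) * N) => T.
lra.
Qed.

End onetime.
End PointwiseSub.

(** * The discrete entropy inequality *)

Section CoreIneq.
Variable R : realType.

Lemma prod_le_norm (x y a b : R) : `|x| <= a -> `|y| <= b -> `|x * y| <= a * b.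
Proof. by move=> xa yb; rewrite normrM; exact: ler_pM. Qed.

(** The pointwise form of the discrete integration by parts. Primes denote values one step [rho]
    away and [d] is the difference quotient of [p]. Half of the good term [a0 eta^2 E1 d^2] pays,
    through the last hypothesis, for all other terms in [d^2]. What is left comes from the slope of
    [fi], from the region where [eta] varies ([m]), from the dependence of [A] on position ([Lz]),
    and from terms of size [rho]. *)
Lemma core_ineq (a0 a1 C0 L Lf Lh Lz La Em DE Ke rho d A A' f fi eta y m E E' E1 ee g : R) :
  0 < rho -> rho <= 1 -> 0 <= Lf -> 0 <= Lh -> 0 <= Lz -> 0 <= La -> 0 <= C0 -> 0 < a0 ->
  0 <= fi -> 0 <= eta <= 1 -> 0 <= m <= 1 -> 0 <= E <= Em -> 0 <= E' <= Em -> 0 <= E1 ->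
  a0 <= A -> a0 <= A' <= a1 -> `|d| <= L -> `|f| <= Lf -> `|y| <= Lh * m ->
  `|g| <= Lz + La * `|d| -> `|ee| <= Ke * rho -> `|E' - E| <= rho * DE ->
  E' - E = rho * (E1 * d + ee) ->
  A' - A = rho * g ->
  Lf + eta ^+ 2 * E + (fi + eta ^+ 2 * E) * (Lz + La + 2 * C0) <= a0 / 2 * (eta ^+ 2 * E1) ->
  - (((fi + rho * f) + (eta + rho * y) ^+ 2 * E') * A' - (fi + eta ^+ 2 * E) * A) / rho * d
   + C0 * ((fi + eta ^+ 2 * E) + ((fi + rho * f) + (eta + rho * y) ^+ 2 * E')) * d ^+ 2
  <= Lf * a1 ^+ 2 + a1 ^+ 2 * Lh ^+ 2 * (E * m ^+ 2) + Lz * (fi + eta ^+ 2 * E)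
     - a0 / 2 * (eta ^+ 2 * E1 * d ^+ 2)
     + rho * (a1 * Lh * Lh * Em * L + a1 * Lh * 2 * DE * L + a1 * Ke * L
        + C0 * (Lf + Lh * (2 + Lh) * Em + DE) * L ^+ 2).
Proof.
move=> r0 r1 Lf0 Lh0 Lz0 La0 C00 a00 fi0 /andP[eta0 eta1] /andP[m0 m1] /andP[E0 EEm]
  /andP[E'0 E'Em] E10 a0A /andP[a0A' A'a1] dL fL yL gL eL EE EEq AEq absb.
have a1_0 : 0 <= a1 by apply: le_trans A'a1; apply: le_trans a0A'; exact: ltW.
have A'0 : 0 <= A' by apply: le_trans a0A'; exact: ltW.
have L0 : 0 <= L by exact: le_trans dL.
have nA' : `|A'| <= a1 by rewrite ger0_norm.
have nE' : `|E'| <= Em by rewrite ger0_norm.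
have Em0 : 0 <= Em by exact: le_trans E0 EEm.
have yLh : `|y| <= Lh by apply: le_trans yL _; rewrite -[X in _ <= X]mulr1 ler_wpM2l.
have X0 : 0 <= eta ^+ 2 by exact: sqr_ge0.
have X1 : `|eta ^+ 2| <= 1 by rewrite ger0_norm// exprn_ile1.
set l := fi + eta ^+ 2 * E.
have l0 : 0 <= l by rewrite /l addr_ge0// mulr_ge0.
have dl : (fi + rho * f) + (eta + rho * y) ^+ 2 * E' =
   l + rho * (f + y * (2 * eta + rho * y) * E' + eta ^+ 2 * (E1 * d + ee)).
  have -> : E' = E + rho * (E1 * d + ee) by rewrite -EEq; ring.
  by rewrite /l; ring.
have dlb : `|f + y * (2 * eta + rho * y) * E' + eta ^+ 2 * (E1 * d + ee)| <=
   Lf + Lh * (2 + Lh) * Em + DE.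
  have b1 : `|2 * eta + rho * y| <= 2 + Lh.
    apply: le_trans (ler_normD _ _) _; rewrite lerD//.
      by rewrite normrM !ger0_norm//; move: eta1; clear; lra.
    by rewrite -[Lh]mul1r; apply: prod_le_norm => //; rewrite ger0_norm// ltW.
  have b2 : `|E1 * d + ee| <= DE.
    by move: EE; rewrite EEq normrM gtr0_norm// ler_pM2l.
  apply: le_trans (ler_normD _ _) _; apply: lerD; last first.
    by rewrite -[DE]mul1r; exact: prod_le_norm.
  apply: le_trans (ler_normD _ _) _; apply: lerD => //.
  by apply: prod_le_norm => //; exact: prod_le_norm.
rewrite dl.
have -> : - ((l + rho * (f + y * (2 * eta + rho * y) * E' + eta ^+ 2 * (E1 * d + ee))) * A'
    - l * A) / rho * d
  = - (l * g * d) - A' * f * d - A' * (y * (2 * eta) * E) * d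
    - rho * (A' * (y * y) * E' * d) - A' * (y * (2 * eta)) * (E' - E) * d
    - A' * eta ^+ 2 * E1 * d ^+ 2 - A' * eta ^+ 2 * ee * d.
  have -> : A = A' - rho * g by rewrite -AEq; ring.
  by rewrite (_ : E' = E + (E' - E)); [field; rewrite gt_eqF|ring].
set w := f + y * (2 * eta + rho * y) * E' + eta ^+ 2 * (E1 * d + ee) in dlb *.
have d20 : 0 <= d ^+ 2 by exact: sqr_ge0.
have nd2 : `|d| ^+ 2 = d ^+ 2 by rewrite real_normK ?num_real.
have h1 : - (l * g * d) <= l * (Lz + (Lz + La) * d ^+ 2).
  have q : `|g * d| <= Lz + (Lz + La) * d ^+ 2.
    rewrite normrM; apply: le_trans (ler_wpM2r (normr_ge0 d) gL) _.
    have : Lz * `|d| <= Lz * (1 + d ^+ 2).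
      by rewrite ler_wpM2l// -nd2; have := sqr_ge0 (`|d| - 1); rewrite sqrrB1; have := normr_ge0 d; clear; lra.
    by rewrite -nd2; clear; lra.
  rewrite -mulrA -mulrN; apply: ler_wpM2l => //.
  by apply: le_trans q; rewrite -normrN ler_norm.
have h2 : - (A' * f * d) <= Lf * (a1 ^+ 2 + d ^+ 2).
  apply: (@le_trans _ _ (Lf * (a1 * `|d|))).
    apply: le_trans (ler_norm _) _; rewrite normrN !normrM mulrA (mulrC Lf).
    by rewrite ler_wpM2r//; apply: ler_pM.
  rewrite ler_wpM2l// -nd2; have := sqr_ge0 (a1 - `|d|); rewrite sqrrB.
  by have := sqr_ge0 a1; have := sqr_ge0 `|d|; clear; lra.
have h3 : - (A' * (y * (2 * eta) * E) * d) <= E * (eta ^+ 2 * d ^+ 2) + a1 ^+ 2 * Lh ^+ 2 * (E * m ^+ 2).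
  have q : `|A' * y| <= a1 * (Lh * m) by exact: prod_le_norm.
  have -> : - (A' * (y * (2 * eta) * E) * d) = E * (- (2 * (A' * y) * (eta * d))) by ring.
  have -> : E * (eta ^+ 2 * d ^+ 2) + a1 ^+ 2 * Lh ^+ 2 * (E * m ^+ 2) =
     E * ((eta * d) ^+ 2 + (a1 * (Lh * m)) ^+ 2) by ring.
  apply: ler_wpM2l => //.
  have q2 : (A' * y) ^+ 2 <= (a1 * (Lh * m)) ^+ 2.
    rewrite -[X in X <= _]real_normK ?num_real// ler_pXn2r ?nnegrE//.
    by rewrite !mulr_ge0.
  by have := sqr_ge0 (A' * y + eta * d); rewrite sqrrD; move: q2; clear; lra.
have h4 : - (A' * (y * y) * E' * d) <= a1 * Lh * Lh * Em * L.
  apply: le_trans (ler_norm _) _; rewrite normrN; apply: prod_le_norm => //.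
  by apply: prod_le_norm => //; rewrite -mulrA; apply: prod_le_norm => //; exact: prod_le_norm.
have h5 : - (A' * (y * (2 * eta)) * (E' - E) * d) <= rho * (a1 * Lh * 2 * DE * L).
  have -> : rho * (a1 * Lh * 2 * DE * L) = a1 * (Lh * 2) * (rho * DE) * L by ring.
  apply: le_trans (ler_norm _) _; rewrite normrN; apply: prod_le_norm => //.
  apply: prod_le_norm => //; apply: prod_le_norm => //; apply: prod_le_norm => //.
  by rewrite normrM !ger0_norm//; move: eta1; clear; lra.
have h6 : a0 * (eta ^+ 2 * E1 * d ^+ 2) <= A' * eta ^+ 2 * E1 * d ^+ 2.
  have -> : A' * eta ^+ 2 * E1 * d ^+ 2 = A' * (eta ^+ 2 * E1 * d ^+ 2) by ring.
  by apply: ler_wpM2r => //; apply: mulr_ge0 => //; exact: mulr_ge0.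
have h7 : - (A' * eta ^+ 2 * ee * d) <= rho * (a1 * Ke * L).
  have -> : rho * (a1 * Ke * L) = a1 * 1 * (Ke * rho) * L by ring.
  apply: le_trans (ler_norm _) _; rewrite normrN; apply: prod_le_norm => //.
  by apply: prod_le_norm => //; exact: prod_le_norm.
have h8 : C0 * w * d ^+ 2 <= C0 * (Lf + Lh * (2 + Lh) * Em + DE) * L ^+ 2.
  rewrite -(mulrA C0 w) -(mulrA C0 (_ + DE)); apply: ler_wpM2l => //.
  apply: le_trans (ler_norm _) _; apply: prod_le_norm => //.
  by rewrite normrX ler_pXn2r ?nnegrE.
have h9 := ler_wpM2r d20 absb.
have r0' := ltW r0.
have h4' := ler_wpM2l r0' h4.
have h8' := ler_wpM2l r0' h8.
rewrite -/l in h9.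
move: h1 h2 h3 h4' h5 h6 h7 h8' h9; clear; lra.
Qed.

End CoreIneq.

(** Continuity by recursion on the syntax of the function. The leaves are taken from the context,
    which is why continuity facts are introduced before each call. *)
Ltac ct :=
  lazymatch goal with
  | |- forall x, continuous_at x (fun _ => ?k) => exact: cont_cst
  | |- forall x, continuous_at x (fun u => (@?g u) + - (@?h u)) => refine (@cont_sub _ _ g h _ _); ct
  | |- forall x, continuous_at x (fun u => (@?g u) + (@?h u)) => refine (@cont_add _ _ g h _ _); ct
  | |- forall x, continuous_at x (fun u => (@?g u) * (@?h u)) => refine (@cont_mul _ _ g h _ _); ct
  | |- forall x, continuous_at x (fun u => - (@?g u)) => refine (@cont_opp _ _ g _); ct
  | |- forall x, continuous_at x (fun u => `|@?g u|) => refine (@cont_norm _ _ g _); ct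
  | |- forall x, continuous_at x (fun u => (@?g u) ^+ ?n) => refine (@cont_exp _ _ g n _); ct
  | |- forall x, continuous_at x (fun u => Num.max (@?g u) (@?h u)) => refine (@cont_max _ _ g h _ _); ct
  | |- forall x, continuous_at x (fun u => Num.min (@?g u) (@?h u)) => refine (@cont_min _ _ g h _ _); ct
  | |- forall x, continuous_at x (fun u => fst u) => exact (@cont_fst _)
  | |- forall x, continuous_at x (fun u => snd u) => exact (@cont_snd _)
  | |- forall x, continuous_at x (fun u => ?f (sh ?i ?r u)) => refine (@cont_fsh _ f i r _); ct
  | |- forall x, continuous_at x (fun u => ?f (sh ?i ?r (sh ?j ?s u))) =>
      refine (@cont_fsh _ (fun u => f (sh i r u)) j s _); ct
  | |- forall x, continuous_at x (fun u => u) => exact (@cont_idR _)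
  | |- _ => first [ assumption | eassumption
      | match goal with H : forall i : bool, _ |- _ => solve [exact (H _)] end | done ]
  end.

Section DiscreteEstimate.
Variable R : realType.
Implicit Types (z : R * R) (i : bool) (r rho : R) (f g : R * R -> R).

Lemma perD f g : per f -> per g -> per (fun z => f z + g z).
Proof. by move=> pf pg i z; rewrite pf pg. Qed.
Lemma perM f g : per f -> per g -> per (fun z => f z * g z).
Proof. by move=> pf pg i z; rewrite pf pg. Qed.
Lemma per_comp (h : R -> R) f : per f -> per (fun z => h (f z)).
Proof. by move=> pf i z; rewrite pf. Qed.

(** Translation invariance moves the shift from one factor to the other; this is the discrete
    integration by parts. *)
Lemma I_shl i r f g : continuous f -> continuous g -> per f -> per g ->
  I (fun z => f z * g (sh i (- r) z)) = I (fun z => f (sh i r z) * g z).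
Proof.
move=> cf cg pf pg; rewrite -(@I_sh _ (fun z => f z * g (sh i (- r) z)) i r).
- by apply: eq_I => z; rewrite shKN.
- by ct.
- by apply: perM => //; exact: per_sh.
Qed.

Lemma I_le_cst f g k : continuous f -> continuous g -> (forall z, f z <= g z + k) ->
  I f <= I g + k.
Proof.
move=> cf cg fg; rewrite -[k in X in _ <= X]I_cst -ID//; last exact: cont_cst.
by apply: I_le => //; ct.
Qed.

Lemma cont_pos f : continuous f -> continuous (fun z => pos (f z)).
Proof. by move=> cf; rewrite /pos; ct. Qed.

Lemma cont_neg f : continuous f -> continuous (fun z => neg (f z)).
Proof. by move=> cf; rewrite /neg; ct. Qed.

Lemma pos_lip (x y : R) : `|pos x - pos y| <= `|x - y|.
Proof.
have := ler_norm (x - y); have := ler_norm (- (x - y)); rewrite normrN.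
by rewrite ler_norml /pos; case: (leP x 0); case: (leP y 0) => *; apply/andP; split; lra.
Qed.

Variables (a0 a1 C0 L F Lf Lh Lz La Em KE Ke V Lv Kv rho0 : R).
Variables (p A fi eta m e e1 la : R * R -> R) (v : bool -> R * R -> R).
Hypotheses (cp : continuous p) (cA : continuous A) (cfi : continuous fi)
  (ceta : continuous eta) (cm : continuous m) (ce : continuous e) (ce1 : continuous e1)
  (cla : continuous la) (cv : forall i, continuous (v i)).
Hypotheses (pp : per p) (pA : per A) (pfi : per fi) (peta : per eta) (pm : per m)
  (pe : per e) (pe1 : per e1) (pla : per la) (pv : forall i, per (v i)).
Hypotheses (rho00 : 0 < rho0) (rho01 : rho0 <= 1) (a00 : 0 < a0) (C00 : 0 <= C0)
  (L0 : 0 <= L) (Lf0 : 0 <= Lf) (Lh0 : 0 <= Lh) (Lz0 : 0 <= Lz) (La0 : 0 <= La)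
  (KE0 : 0 <= KE) (Ke0 : 0 <= Ke) (Lv0 : 0 <= Lv).
Hypothesis pL : forall i z r, `|r| <= 1 -> `|p (sh i r z) - p z| <= L * `|r|.
Hypothesis Abd : forall z, a0 <= A z <= a1.
Hypothesis AL : forall i z r, `|A (sh i r z) - A z| <= Lz * `|r| + La * `|p (sh i r z) - p z|.
Hypothesis fib : forall z, 0 <= fi z <= F.
Hypothesis fiL : forall i z r, `|fi (sh i r z) - fi z| <= Lf * `|r|.
Hypothesis etab : forall z, 0 <= eta z <= 1.
Hypothesis mb : forall z, 0 <= m z <= 1.
Hypothesis etaL : forall i z r, `|r| <= rho0 -> `|eta (sh i r z) - eta z| <= Lh * m z * `|r|.
Hypothesis eb : forall z, 0 <= e z <= Em.
Hypothesis e1b : forall z, 0 <= e1 z.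
Hypothesis lab : forall z, 0 <= la z.
Hypothesis eL : forall i z r, `|e (sh i r z) - e z| <= KE * `|p (sh i r z) - p z|.
Hypothesis eT : forall i z r, `|e (sh i r z) - e z - e1 z * (p (sh i r z) - p z)|
   <= Ke * (p (sh i r z) - p z) ^+ 2.
Hypothesis laT : forall i z r, `|la (sh i r z) - la z - e z * (p (sh i r z) - p z)|
   <= Ke * (p (sh i r z) - p z) ^+ 2.
Hypothesis absb : forall z, Lf + eta z ^+ 2 * e z
  + (fi z + eta z ^+ 2 * e z) * (Lz + La + 2 * C0) <= a0 / 2 * (eta z ^+ 2 * e1 z).
Hypothesis vb : forall i z, `|v i z| <= V.
Hypothesis vL : forall i z r, `|v i (sh i r z) - v i z| <= Lv * `|r|.
Hypothesis vdiv : forall z r, 0 < r -> r < rho0 ->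
  `|Dm true r (v true) z + Dm false r (v false) z| <= Kv * r.

(** The multiplier of the equation: the derivative in [p] of the entropy density
    [fi * p + eta^2 * la p], as [e] is the derivative of [la]. *)
Definition ell z := fi z + eta z ^+ 2 * e z.

Let cell : continuous ell. Proof. by rewrite /ell; ct. Qed.
Let pell : per ell.
Proof. by apply: perD => //; apply: perM => //; apply: (per_comp (fun x => x ^+ 2)). Qed.

Lemma cont_Dp i r f : continuous f -> continuous (Dp i r f).
Proof. by move=> cf; rewrite /Dp; ct. Qed.
Lemma cont_Dm i r f : continuous f -> continuous (Dm i r f).
Proof. by move=> cf; rewrite /Dm; ct. Qed.
Lemma per_Dp i r f : per f -> per (Dp i r f).
Proof. by move=> pf j z; rewrite /Dp shC !pf. Qed.

Lemma DmE i r f z : Dm i r f z = Dp i r f (sh i (- r) z).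
Proof. by rewrite /Dm /Dp shK. Qed.

Lemma DpL i z rho : 0 < rho -> rho < rho0 -> `|Dp i rho p z| <= L.
Proof.
move=> r0 rr; rewrite /Dp normrM normfV ler_pdivrMr ?normr_gt0 ?gt_eqF//.
by apply: pL; rewrite gtr0_norm//; apply: ltW (lt_le_trans rr rho01).
Qed.

Let DE := KE * L.
Definition Kell := Lf + Lh * (2 + Lh) * Em + DE.

Lemma ellL i z rho : 0 < rho -> rho < rho0 -> `|ell (sh i rho z) - ell z| <= Kell * rho.
Proof.
move=> r0 rr; rewrite /ell.
have nr : `|rho| = rho by rewrite gtr0_norm.
have h1 := fiL i z rho; rewrite nr in h1.
have h2 := etaL i z; have {}h2 := h2 rho; rewrite nr in h2; have {}h2 := h2 (ltW rr).
have /andP[m0 m1] := mb z.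
have {}h2 : `|eta (sh i rho z) - eta z| <= Lh * rho.
  by apply: le_trans h2 _; rewrite ler_wpM2r ?(ltW r0)// ler_piMr.
have h3 := pL i z; have {}h3 := h3 rho; rewrite nr in h3.
have {}h3 := h3 (ltW (lt_le_trans rr rho01)).
have h4 : `|e (sh i rho z) - e z| <= DE * rho.
  by apply: le_trans (eL i z rho) _; rewrite /DE -mulrA ler_wpM2l.
have /andP[t0 t1] := etab z; have /andP[t2 t3] := etab (sh i rho z).
have /andP[e0 em] := eb z; have /andP[e2 em2] := eb (sh i rho z).
have Em0 : 0 <= Em by exact: le_trans em.
have -> : fi (sh i rho z) + eta (sh i rho z) ^+ 2 * e (sh i rho z) - (fi z + eta z ^+ 2 * e z)
  = (fi (sh i rho z) - fi z) + (eta (sh i rho z) - eta z) * (eta (sh i rho z) + eta z) * e (sh i rho z)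
    + eta z ^+ 2 * (e (sh i rho z) - e z) by ring.
have -> : Kell * rho = Lf * rho + Lh * rho * (2 + Lh) * Em + 1 * (DE * rho) by rewrite /Kell; ring.
apply: le_trans (ler_normD _ _) _; apply: lerD; last first.
  by apply: prod_le_norm => //; rewrite ger0_norm ?sqr_ge0// exprn_ile1.
apply: le_trans (ler_normD _ _) _; apply: lerD => //.
apply: prod_le_norm; last by rewrite ger0_norm.
apply: prod_le_norm => //; rewrite ger0_norm ?addr_ge0//.
by apply: (@le_trans _ _ 2); [lra|rewrite lerDl].
Qed.

(** Summation by parts, together with a shift of the backward square to a forward one, brings the
    integrand to the form [G] treated by [core_ineq]. *)
Lemma main_dir i rho : 0 < rho -> rho < rho0 ->
  I (fun z => ell z * (A z * D2 i rho p z + C0 * (Dp i rho p z ^+ 2 + Dm i rho p z ^+ 2)))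
  <= Lf * a1 ^+ 2 + a1 ^+ 2 * Lh ^+ 2 * I (fun z => e z * m z ^+ 2) + Lz * I ell
     - a0 / 2 * I (fun z => eta z ^+ 2 * e1 z * Dp i rho p z ^+ 2)
     + rho * (a1 * Lh * Lh * Em * L + a1 * Lh * 2 * DE * L + a1 * (Ke * L ^+ 2) * L
        + C0 * Kell * L ^+ 2).
Proof.
move=> r0 rr; set d := Dp i rho p.
have cd : continuous d by exact: cont_Dp.
have pd : per d by exact: per_Dp.
set g := fun z => ell z * A z.
have cg : continuous g by rewrite /g; ct.
have pg : per g by exact: perM.
have rn0 : rho != 0 by rewrite gt_eqF.
pose G z := - (g (sh i rho z) - g z) / rho * d z + C0 * (ell z + ell (sh i rho z)) * d z ^+ 2.
have cG : continuous G by rewrite /G; ct.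
have -> : I (fun z => ell z * (A z * D2 i rho p z + C0 * (d z ^+ 2 + Dm i rho p z ^+ 2))) = I G.
  rewrite (@eq_I _ _ (fun z => rho^-1 * (g z * d z - g z * d (sh i (- rho) z))
      + (C0 * (ell z * d z ^+ 2) + C0 * (ell z * (fun y => d y ^+ 2) (sh i (- rho) z))))); last first.
    move=> z; rewrite DmE -/d /g /D2.
    have -> : p (sh i rho z) = p z + rho * d z by rewrite /d /Dp; field.
    have -> : p (sh i (- rho) z) = p z - rho * d (sh i (- rho) z) by rewrite /d /Dp shK; field.
    by field.
  rewrite ID; [|by ct..]; rewrite IZ; last by ct.
  rewrite IB; [|by ct..]; rewrite (I_shl i rho cg cd pg pd).
  rewrite ID; [|by ct..]; rewrite !IZ; [|by ct..].
  have cd2 : continuous (fun y => d y ^+ 2) by ct.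
  have pd2 : per (fun y => d y ^+ 2) by exact: (per_comp (fun x => x ^+ 2)).
  rewrite (I_shl i rho cell cd2 pell pd2).
  rewrite -IB; [|by ct..]; rewrite -!IZ; [|by ct..]; rewrite -!ID; [|by ct..].
  by apply: eq_I => z; rewrite /G; field.
set K := rho * _.
have -> : Lf * a1 ^+ 2 + a1 ^+ 2 * Lh ^+ 2 * I (fun z => e z * m z ^+ 2) + Lz * I ell
     - a0 / 2 * I (fun z => eta z ^+ 2 * e1 z * d z ^+ 2) + K =
   I (fun z => Lf * a1 ^+ 2 + a1 ^+ 2 * Lh ^+ 2 * (e z * m z ^+ 2) + Lz * ell z
     - a0 / 2 * (eta z ^+ 2 * e1 z * d z ^+ 2)) + K.
  rewrite [in RHS]IB; [|by ct..]; do 2 (rewrite [in RHS]ID; [|by ct..]).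
  by rewrite I_cst !IZ; [|by ct..].
apply: I_le_cst; [by []|by ct|] => z.
have /andP[t0 t1] := etab z.
have nr : `|rho| = rho by rewrite gtr0_norm.
have r1 : rho <= 1 by exact: ltW (lt_le_trans rr rho01).
have pE : p (sh i rho z) - p z = rho * d z by rewrite /d /Dp; field.
have := @core_ineq R a0 a1 C0 L Lf Lh Lz La Em DE (Ke * L ^+ 2) rho (d z) (A z) (A (sh i rho z))
  ((fi (sh i rho z) - fi z) / rho) (fi z) (eta z) ((eta (sh i rho z) - eta z) / rho) (m z)
  (e z) (e (sh i rho z)) (e1 z) ((e (sh i rho z) - e z) / rho - e1 z * d z)
  ((A (sh i rho z) - A z) / rho).
have -> : fi z + rho * ((fi (sh i rho z) - fi z) / rho) = fi (sh i rho z) by field.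
have -> : eta z + rho * ((eta (sh i rho z) - eta z) / rho) = eta (sh i rho z) by field.
rewrite /G /g /K /Kell /ell mulNr; apply => //.
- by have /andP[] := fib z.
- by have /andP[] := Abd z.
- exact: DpL.
- by rewrite normrM normfV nr ler_pdivrMr// -[X in Lf * X]nr.
- by rewrite normrM normfV nr ler_pdivrMr// -[X in _ * X]nr; apply: etaL; rewrite nr ltW.
- rewrite normrM normfV nr ler_pdivrMr//; apply: le_trans (AL i z rho) _.
  by rewrite pE normrM nr mulrDl (mulrC rho) mulrA.
- have -> : (e (sh i rho z) - e z) / rho - e1 z * d z
    = (e (sh i rho z) - e z - e1 z * (p (sh i rho z) - p z)) / rho by rewrite pE; field.
  rewrite normrM normfV nr ler_pdivrMr//; apply: le_trans (eT i z rho) _.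
  rewrite pE exprMn (_ : Ke * L ^+ 2 * rho * rho = Ke * (rho ^+ 2 * L ^+ 2)); last by ring.
  apply: ler_wpM2l => //; rewrite ler_wpM2l ?sqr_ge0//.
  by rewrite -[d z ^+ 2]real_normK ?num_real// ler_pXn2r ?nnegrE//; exact: DpL.
- apply: le_trans (eL i z rho) _; rewrite pE normrM nr mulrCA ler_wpM2l ?(ltW r0)//.
  by rewrite ler_wpM2l//; exact: DpL.
- by field.
- by field.
Qed.

Lemma I_Dp_parts i rho f g : 0 < rho -> continuous f -> continuous g -> per f -> per g ->
  I (fun z => f z * Dp i rho g z) = - I (fun z => g z * Dm i rho f z).
Proof.
move=> r0 cf cg pf pg; have rn0 : rho != 0 by rewrite gt_eqF.
rewrite (@eq_I _ _ (fun z => rho^-1 * (f z * g (sh i rho z) - f z * g z))); last first.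
  by move=> z; rewrite /Dp; field.
rewrite (@eq_I _ (fun z => g z * _) (fun z => rho^-1 * (g z * f z - g z * f (sh i (- rho) z)))); last first.
  by move=> z; rewrite /Dm; field.
do 2 (rewrite IZ; [|by ct]; rewrite IB; [|by ct..]); rewrite (I_shl i rho cg cf pg pf).
rewrite -mulrN opprB; congr (_ * (_ - _)); apply: eq_I => z; exact: mulrC.
Qed.

Hypothesis laM : exists Lam, forall z, la z <= Lam.

Ltac csec := clear -cp cA cfi ceta cm ce ce1 cla cv pp pA pfi peta pm pe pe1 pla pv rho00
  rho01 a00 C00 L0 Lf0 Lh0 Lz0 La0 KE0 Ke0 Lv0 pL Abd AL fib fiL etab mb etaL eb e1b lab eL eT
  laT absb vb vL vdiv cell pell laM.

(** Up to [O(rho)] the upwind expression is [- ell v Dp p], because [ell * pos v] is Lipschitz, and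
    [ell * Dp p] is [fi * Dp p + eta^2 * Dp la]. Summation by parts then throws the differences on
    [fi * v] and [eta^2 * v]. *)
Lemma upwind_dir i rho : 0 < rho -> rho < rho0 ->
  I (fun z => ell z * (neg (v i z) * Dp i rho p z - pos (v i z) * Dm i rho p z))
  <= I (fun z => p z * Dm i rho (fun y => fi y * v i y) z)
   + I (fun z => la z * Dm i rho (fun y => eta y ^+ 2 * v i y) z)
   + rho * ((Kell * V + (F + Em) * Lv) * L + V * Ke * L ^+ 2).
Proof.
move=> r0 rr; have rn0 : rho != 0 by rewrite gt_eqF.
have nr : `|rho| = rho by rewrite gtr0_norm.
have V0 : 0 <= V by exact: le_trans (vb true (0, 0)).
have ln z : 0 <= ell z <= F + Em.
  have /andP[f0 f1] := fib z; have /andP[e0 em] := eb z; have /andP[t0 t1] := etab z.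
  rewrite /ell addr_ge0//= ?mulr_ge0 ?sqr_ge0// lerD//; apply: le_trans em.
  by apply: ler_piMl => //; rewrite exprn_ile1.
have cvi := @cv i; have pvi := @pv i.
have cpv := cont_pos cvi; have cnv := cont_neg cvi.
set d := Dp i rho p.
have cd : continuous d by exact: cont_Dp.
have pd : per d by exact: per_Dp.
pose k z := ell z * pos (v i z).
have ck : continuous k by rewrite /k; ct.
have pk : per k by apply: perM => //; exact: (per_comp (@pos R)).
have -> : I (fun z => ell z * (neg (v i z) * d z - pos (v i z) * Dm i rho p z)) =
    I (fun z => (k z - k (sh i rho z)) * d z - ell z * v i z * d z).
  rewrite (@eq_I _ _ (fun z => (k z * d z - k z * d (sh i (- rho) z)) - ell z * v i z * d z)); last first.
    move=> z; rewrite DmE -/d /k; have := pos_neg (v i z).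
    by move: (pos (v i z)) (neg (v i z)) => P N ->; ring.
  rewrite IB; [|by ct..]; rewrite IB; [|by ct..]; rewrite (I_shl i rho ck cd pk pd).
  rewrite -IB; [|by ct..]; rewrite -IB; [|by ct..].
  by apply: eq_I => z; ring.
have cfv : continuous (fun z => fi z * v i z) by ct.
have cxv : continuous (fun z => eta z ^+ 2 * v i z) by ct.
have pfv : per (fun z => fi z * v i z) by exact: perM.
have pxv : per (fun z => eta z ^+ 2 * v i z).
  by apply: perM => //; exact: (per_comp (fun x => x ^+ 2)).
have E1 := I_Dp_parts i r0 cfv cp pfv pp; have E2 := I_Dp_parts i r0 cxv cla pxv pla.
rewrite -/d in E1.
have cdl : continuous (Dp i rho la) by exact: cont_Dp.
have -> : I (fun z => p z * Dm i rho (fun y => fi y * v i y) z)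
   + I (fun z => la z * Dm i rho (fun y => eta y ^+ 2 * v i y) z) =
   I (fun z => - (fi z * v i z * d z) - (eta z ^+ 2 * v i z * Dp i rho la z)).
  rewrite (@eq_I _ (fun z => - _ - _) (fun z => (-1) * (fi z * v i z * d z + eta z ^+ 2 * v i z * Dp i rho la z))).
    by rewrite IZ; [|by ct]; rewrite ID; [|by ct..]; rewrite E1 E2; ring.
  by move=> z; ring.
apply: I_le_cst; [by ct|by ct|] => z.
have dL := DpL i z r0 rr; rewrite -/d in dL.
have /andP[t0 t1] := etab z.
have vz := vb i z.
have h1 : (k z - k (sh i rho z)) * d z <= rho * (Kell * V + (F + Em) * Lv) * L.
  apply: le_trans (ler_norm _) _; apply: prod_le_norm => //.
  have -> : k z - k (sh i rho z) = - ((ell (sh i rho z) - ell z) * pos (v i z)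
     + ell (sh i rho z) * (pos (v i (sh i rho z)) - pos (v i z))) by rewrite /k; ring.
  rewrite normrN; apply: le_trans (ler_normD _ _) _; rewrite [leRHS]mulrDr; apply: lerD.
    rewrite mulrA (mulrC rho); apply: prod_le_norm; first exact: ellL.
    by rewrite ger0_norm ?pos_ge0//; apply: le_trans vz; rewrite -neg_pos_norm lerDr neg_ge0.
  rewrite mulrCA; apply: prod_le_norm; first by have /andP[l0 l1] := ln (sh i rho z); rewrite ger0_norm.
  by apply: le_trans (pos_lip _ _) _; apply: le_trans (vL _ _ _) _; rewrite nr mulrC.
have h2 : - (eta z ^+ 2 * e z * v i z * d z) <= - (eta z ^+ 2 * v i z * Dp i rho la z)
    + rho * (V * Ke * L ^+ 2).
  have pE : p (sh i rho z) - p z = rho * d z by rewrite /d /Dp; field.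
  have := laT i z rho; rewrite pE => hl.
  have -> : eta z ^+ 2 * v i z * Dp i rho la z = eta z ^+ 2 * e z * v i z * d z
     + eta z ^+ 2 * v i z * ((la (sh i rho z) - la z - e z * (rho * d z)) / rho).
    by rewrite /Dp; field.
  rewrite opprD -addrA lerDl addrC subr_ge0; apply: le_trans (ler_norm _) _.
  have -> : rho * (V * Ke * L ^+ 2) = 1 * V * (Ke * (rho * L ^+ 2)) by ring.
  apply: prod_le_norm; last first.
    rewrite normrM normfV nr ler_pdivrMr//; apply: le_trans hl _; rewrite -mulrA ler_wpM2l//.
    rewrite exprMn (_ : rho * L ^+ 2 * rho = rho ^+ 2 * L ^+ 2); last by ring.
    rewrite ler_wpM2l ?sqr_ge0//.
    by rewrite -[d z ^+ 2]real_normK ?num_real// ler_pXn2r ?nnegrE.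
  by apply: prod_le_norm => //; rewrite ger0_norm ?sqr_ge0// exprn_ile1.
move: h1 h2; rewrite /ell; move: (d z) (Dp i rho la z) => D1 D2; csec; lra.
Qed.

(** The discrete divergence of [v] is [O(rho)], so only the differences of [eta^2] matter, and these
    are controlled by [m]. *)
Lemma sum_Dm_cutoff rho z : 0 < rho -> rho < rho0 ->
  Dm true rho (fun y => eta y ^+ 2 * v true y) z + Dm false rho (fun y => eta y ^+ 2 * v false y) z
  <= 4 * V * Lh * m z + Kv * rho.
Proof.
move=> r0 rr; have rn0 : rho != 0 by rewrite gt_eqF.
have nr : `|- rho| = rho by rewrite normrN gtr0_norm.
have V0 : 0 <= V by exact: le_trans (vb true (0, 0)).
have /andP[t0 t1] := etab z; have /andP[m0 m1] := mb z.
have K i : Dm i rho (fun y => eta y ^+ 2 * v i y) z <= eta z ^+ 2 * Dm i rho (v i) z + 2 * V * Lh * m z.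
  have -> : Dm i rho (fun y => eta y ^+ 2 * v i y) z = eta z ^+ 2 * Dm i rho (v i) z
     + v i (sh i (- rho) z) * ((eta z + eta (sh i (- rho) z)) * ((eta z - eta (sh i (- rho) z)) / rho)).
    by rewrite /Dm; field.
  rewrite lerD2l; apply: le_trans (ler_norm _) _.
  have -> : 2 * V * Lh * m z = V * (2 * (Lh * m z)) by ring.
  apply: prod_le_norm => //; apply: prod_le_norm.
    by have /andP[s0 s1] := etab (sh i (- rho) z); rewrite ger0_norm ?addr_ge0//; move: t1 s1; csec; lra.
  rewrite normrM normfV (gtr0_norm r0) ler_pdivrMr// distrC.
  by have := @etaL i z (- rho); rewrite nr; apply; exact: ltW.
have := vdiv z r0 rr; set D1 := Dm true _ _ _; set D2 := Dm false _ _ _ => hv.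
have h : eta z ^+ 2 * (D1 + D2) <= Kv * rho.
  apply: le_trans (ler_norm _) _; rewrite -[X in _ <= X]mul1r; apply: prod_le_norm => //.
  by rewrite ger0_norm ?sqr_ge0// exprn_ile1.
by move: h (K true) (K false); rewrite -/D1 -/D2; csec; lra.
Qed.

Lemma disc_est : exists K, forall rho, 0 < rho -> rho < rho0 ->
  I (fun z => ell z * Rrho (A z) C0 (v^~ z) p rho z)
  <= I (fun z => p z * (Dm true rho (fun y => fi y * v true y) z + Dm false rho (fun y => fi y * v false y) z))
   + 4 * V * Lh * I (fun z => la z * m z)
   + 2 * (Lf * a1 ^+ 2 + a1 ^+ 2 * Lh ^+ 2 * I (fun z => e z * m z ^+ 2) + Lz * I ell)
   - a0 / 2 * (I (fun z => eta z ^+ 2 * e1 z * Dp true rho p z ^+ 2)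
             + I (fun z => eta z ^+ 2 * e1 z * Dp false rho p z ^+ 2)) + K * rho.
Proof.
have [Lam laLam] := laM.
have Kv0 : 0 <= Kv.
  have r2 : 0 < rho0 / 2 by rewrite divr_gt0.
  have := @vdiv (0, 0) (rho0 / 2) r2; rewrite ltr_pdivrMr// ltr_pMr// ltr1n => /(_ isT).
  by move=> /(le_trans (normr_ge0 _)); rewrite pmulr_lge0.
set K1 := a1 * Lh * Lh * Em * L + a1 * Lh * 2 * DE * L + a1 * (Ke * L ^+ 2) * L + C0 * Kell * L ^+ 2.
set K2 := (Kell * V + (F + Em) * Lv) * L + V * Ke * L ^+ 2.
exists (2 * K1 + 2 * K2 + Lam * Kv) => rho r0 rr.
have ct1 := @cv true; have ct2 := @cv false.
have cpt := cont_pos ct1; have cpf := cont_pos ct2; have cnt := cont_neg ct1; have cnf := cont_neg ct2.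
have d1 := @cont_Dp true rho _ cp; have d2 := @cont_Dp false rho _ cp.
have d3 := @cont_Dm true rho _ cp; have d4 := @cont_Dm false rho _ cp.
have d5 : continuous (D2 true rho p) by rewrite /D2; ct.
have d6 : continuous (D2 false rho p) by rewrite /D2; ct.
have q1 : continuous (Dm true rho (fun y => fi y * v true y)) by apply: cont_Dm; ct.
have q2 : continuous (Dm false rho (fun y => fi y * v false y)) by apply: cont_Dm; ct.
have q3 : continuous (Dm true rho (fun y => eta y ^+ 2 * v true y)) by apply: cont_Dm; ct.
have q4 : continuous (Dm false rho (fun y => eta y ^+ 2 * v false y)) by apply: cont_Dm; ct.
pose mn i z := ell z * (A z * D2 i rho p z + C0 * (Dp i rho p z ^+ 2 + Dm i rho p z ^+ 2)).
pose up i z := ell z * (neg (v i z) * Dp i rho p z - pos (v i z) * Dm i rho p z).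
have cmn i : continuous (mn i) by case: i; rewrite /mn; ct.
have cup i : continuous (up i) by case: i; rewrite /up; ct.
rewrite (@eq_I _ _ (fun z => (mn true z + up true z) + (mn false z + up false z))); last first.
  by move=> z; rewrite /Rrho !big_cons big_nil /mn /up; ring.
have cmt := cmn true; have cmf := cmn false; have cut := cup true; have cuf := cup false.
rewrite ID; [|by ct..]; rewrite ID; [|by ct..]; rewrite ID; [|by ct..].
have b1 := main_dir true r0 rr; have b2 := main_dir false r0 rr.
have b3 := upwind_dir true r0 rr; have b4 := upwind_dir false r0 rr.
have -> : I (fun z => p z * (Dm true rho (fun y => fi y * v true y) z + Dm false rho (fun y => fi y * v false y) z))
  = I (fun z => p z * Dm true rho (fun y => fi y * v true y) z) + I (fun z => p z * Dm false rho (fun y => fi y * v false y) z).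
  by rewrite -ID; [|by ct..]; apply: eq_I => z; rewrite mulrDr.
have b5 : I (fun z => la z * Dm true rho (fun y => eta y ^+ 2 * v true y) z)
  + I (fun z => la z * Dm false rho (fun y => eta y ^+ 2 * v false y) z)
  <= 4 * V * Lh * I (fun z => la z * m z) + Lam * Kv * rho.
  rewrite -ID; [|by ct..]; rewrite -IZ; [|by ct].
  apply: I_le_cst; [by ct|by ct|] => z; rewrite -mulrDr.
  apply: le_trans (ler_wpM2l (lab z) (sum_Dm_cutoff z r0 rr)) _.
  rewrite mulrDr; apply: lerD; first by rewrite mulrCA.
  by rewrite -mulrA; apply: ler_wpM2r => //; rewrite mulr_ge0// ltW.
move: b1 b2 b3 b4 b5; rewrite -/K1 -/K2 -/(mn true) -/(mn false) -/(up true) -/(up false).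
csec; lra.
Qed.

End DiscreteEstimate.

(** * Powers of the positive part as convex profiles *)

Section PowerProfile.
Variable R : realType.
Implicit Types (x y W : R) (n : nat).

Definition pw n x : R := pos x ^+ n.

Lemma pow_taylor n W : 0 <= W -> exists2 K, 0 <= K & forall x y, 0 <= x <= W -> 0 <= y <= W ->
  0 <= x ^+ n.+1 - y ^+ n.+1 - n.+1%:R * y ^+ n * (x - y) <= K * (x - y) ^+ 2.
Proof.
move=> W0; elim: n => [|n [K K0 IH]].
  by exists 0 => // x y _ _; rewrite !expr1 expr0 mulr1 mul1r subrr mul0r lexx.
have W1 : 0 <= n.+1%:R * W ^+ n by rewrite mulr_ge0// exprn_ge0.
exists (W * K + n.+1%:R * W ^+ n); first by rewrite addr_ge0// mulr_ge0.
move=> x y xW yW; have /andP[x0 xW'] := xW; have /andP[y0 yW'] := yW.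
have -> : x ^+ n.+2 - y ^+ n.+2 - n.+2%:R * y ^+ n.+1 * (x - y) =
  x * (x ^+ n.+1 - y ^+ n.+1 - n.+1%:R * y ^+ n * (x - y)) + n.+1%:R * y ^+ n * (x - y) ^+ 2.
  by rewrite -[n.+2%:R]natr1 !exprS; ring.
have /andP[t0 tK] := IH x y xW yW; set T := x ^+ n.+1 - _ - _ in t0 tK *.
have y1 : 0 <= n.+1%:R * y ^+ n by rewrite mulr_ge0// exprn_ge0.
apply/andP; split; first by rewrite addr_ge0// mulr_ge0// sqr_ge0.
rewrite [leRHS]mulrDl; apply: lerD; first by rewrite -mulrA; exact: ler_pM.
by apply: ler_wpM2r; [exact: sqr_ge0|apply: ler_wpM2l => //; rewrite lerXn2r ?nnegrE].
Qed.

Lemma posE x : pos x = if 0 <= x then x else 0.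
Proof. by rewrite /pos; case: leP. Qed.

Lemma pw_taylor n W : 0 <= W -> exists2 K, 0 <= K & forall x y, x <= W -> y <= W ->
  0 <= pw n.+2 x - pw n.+2 y - n.+2%:R * pw n.+1 y * (x - y) <= K * (x - y) ^+ 2.
Proof.
move=> W0; have [K K0 HK] := pow_taylor n.+1 W0.
have Wn : 0 <= W ^+ n by exact: exprn_ge0.
have nW : 0 <= n.+2%:R * W ^+ n by rewrite mulr_ge0.
have [U U0 UE] : exists2 U, 0 <= U & U = n.+2%:R * W ^+ n by exists (n.+2%:R * W ^+ n).
exists (K + U + W ^+ n); first by rewrite !addr_ge0.
move=> x y xW yW; have s0 := sqr_ge0 (x - y); rewrite !(mulrDl _ _ ((x - y) ^+ 2)).
have big u : 0 <= u -> u * (x - y) ^+ 2 >= 0 by move=> u0; rewrite mulr_ge0.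
rewrite /pw !posE; case: (leP 0 x) => x0; case: (leP 0 y) => y0.
- have /andP[h1 h2] := HK x y (introT andP (conj x0 xW)) (introT andP (conj y0 yW)).
  rewrite h1/=; apply: le_trans h2 _.
  by have := big _ U0; have := big _ Wn; lra.
- rewrite !expr0n/= mulr0 mul0r !subr0 exprn_ge0//=.
  apply: (@le_trans _ _ (W ^+ n * (x - y) ^+ 2)); last first.
    by have := big _ U0; have := big _ K0; lra.
  rewrite -addn2 exprD; apply: ler_pM; rewrite ?exprn_ge0//.
    by rewrite lerXn2r ?nnegrE.
  by rewrite lerXn2r ?nnegrE//; lra.
- rewrite expr0n/= sub0r.
  have E1 : - y ^+ n.+2 - n.+2%:R * y ^+ n.+1 * (x - y) =
     y ^+ n.+1 * (n.+2%:R * (y - x) - y) by rewrite [y ^+ n.+2]exprS; ring.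
  have yx : y <= y - x by lra.
  have h : y <= n.+2%:R * (y - x).
    apply: le_trans yx _; apply: ler_peMl; [lra|by rewrite ler1n].
  rewrite E1; apply/andP; split; first by rewrite mulr_ge0 ?exprn_ge0// subr_ge0.
  apply: (@le_trans _ _ (U * (x - y) ^+ 2)); last first.
    by have := big _ K0; have := big _ Wn; lra.
  rewrite UE; have -> : n.+2%:R * W ^+ n * (x - y) ^+ 2 = (W ^+ n * (y - x)) * (n.+2%:R * (y - x)) by ring.
  apply: ler_pM; rewrite ?exprn_ge0 ?subr_ge0//; last by lra.
  rewrite exprSr; apply: ler_pM; rewrite ?exprn_ge0//.
  by rewrite lerXn2r ?nnegrE.
- by rewrite !expr0n/= mulr0 mul0r !subr0 lexx/= !addr_ge0 ?big.
Qed.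

Lemma pw_lip n W : 0 <= W -> exists2 K, 0 <= K & forall x y, x <= W -> y <= W ->
  `|pw n x - pw n y| <= K * `|x - y|.
Proof.
move=> W0; elim: n => [|n [K K0 IH]].
  by exists 0 => // x y _ _; rewrite /pw !expr0 subrr normr0 mul0r.
exists (W * K + W ^+ n); first by rewrite addr_ge0 ?exprn_ge0// mulr_ge0.
move=> x y xW yW.
have pb z : z <= W -> `|pos z| <= W by move=> zW; rewrite ger0_norm ?pos_ge0// posE; case: ifP.
have -> : pw n.+1 x - pw n.+1 y = pos x * (pw n x - pw n y) + pw n y * (pos x - pos y).
  by rewrite /pw !exprS; ring.
apply: le_trans (ler_normD _ _) _; rewrite mulrDl -mulrA; apply: lerD; apply: prod_le_norm => //.
- exact: pb.
- exact: IH.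
- by rewrite normrX lerXn2r ?nnegrE//; exact: pb.
- exact: pos_lip.
Qed.

Lemma pw_ge0 n x : 0 <= pw n x.
Proof. by rewrite exprn_ge0// pos_ge0. Qed.

Lemma pw_le n x W : 0 <= W -> x <= W -> pw n x <= W ^+ n.
Proof.
move=> W0 xW; rewrite /pw lerXn2r ?nnegrE ?pos_ge0//.
by rewrite posE; case: ifP.
Qed.

Lemma cont_pw (T : topologicalType) n (f : T -> R) : continuous f -> continuous (fun z => pw n (f z)).
Proof.
move=> cf; apply: cont_exp; apply: cont_max => //; exact: cont_cst.
Qed.

Lemma sum6 (a b c d e f : R) : 0 <= a -> 0 <= b -> 0 <= c -> 0 <= d -> 0 <= e -> 0 <= f ->
  exists K, [/\ 0 <= K, a <= K, b <= K, c <= K & [/\ d <= K, e <= K & f <= K]].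
Proof. by move=> *; exists (a + b + c + d + e + f); split; [lra..|split; lra]. Qed.

(** A single constant for all the facts needed about [E], its derivative [E1] and its primitive
    [la]. The last clause is the convexity of [la]; it bounds time differences of the entropy by [E]
    times time differences of the solution. *)
Lemma profile n W kap c : 0 <= W -> 0 <= kap ->
  let E x := kap * pw n.+2 (x - c) in
  let E1 x := kap * n.+2%:R * pw n.+1 (x - c) in
  let la x := kap / n.+3%:R * pw n.+3 (x - c) in
  exists2 K, 0 <= K & forall x y, x - c <= W -> y - c <= W ->
  [/\ 0 <= E x <= K, 0 <= E1 x /\ 0 <= la x <= K, `|E x - E y| <= K * `|x - y| /\ `|la x - la y| <= K * `|x - y|,
      `|E x - E y - E1 y * (x - y)| <= K * (x - y) ^+ 2 /\
      `|la x - la y - E y * (x - y)| <= K * (x - y) ^+ 2 & la x - la y <= E x * (x - y)].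
Proof.
move=> W0 k0 E E1 la.
have [K1 K10 H1] := pw_taylor n W0; have [K2 K20 H2] := pw_taylor n.+1 W0.
have [K3 K30 H3] := pw_lip n.+2 W0; have [K4 K40 H4] := pw_lip n.+3 W0.
have n3 : (0 : R) < n.+3%:R by rewrite ltr0n.
have n30 : (n.+3%:R : R) != 0 by rewrite gt_eqF.
have kn : 0 <= kap / n.+3%:R by rewrite divr_ge0.
have p1 := mulr_ge0 k0 K10; have p2 := mulr_ge0 kn K20; have p3 := mulr_ge0 k0 K30.
have p4 := mulr_ge0 kn K40; have p5 := mulr_ge0 k0 (exprn_ge0 n.+2 W0).
have p6 := mulr_ge0 kn (exprn_ge0 n.+3 W0).
have [K [K0 k1 k2 k3 [k4 k5 k6]]] := sum6 p1 p2 p3 p4 p5 p6.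
have le_ u z t : 0 <= t -> z <= u * t -> u <= K -> z <= K * t.
  by move=> t0 zu uK; apply: le_trans zu _; exact: ler_wpM2r.
exists K => //.
move=> x y xW yW.
have xy : x - y = (x - c) - (y - c) by ring.
have /andP[a1 a2] := H1 _ _ xW yW; have /andP[b1 b2] := H2 _ _ xW yW.
have /andP[b3 b4] := H2 _ _ yW xW.
have c3 := H3 _ _ xW yW; have c4 := H4 _ _ xW yW.
rewrite -xy in a1 a2 b1 b2 c3 c4.
split.
- rewrite /E mulr_ge0 ?pw_ge0//=; apply: (@le_trans _ _ (kap * W ^+ n.+2)); last by [].
  by rewrite ler_wpM2l// pw_le.
- split; first by rewrite !mulr_ge0 ?pw_ge0.
  rewrite /la mulr_ge0 ?pw_ge0//=; apply: (@le_trans _ _ (kap / n.+3%:R * W ^+ n.+3)); last by [].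
  by rewrite ler_wpM2l// pw_le.
- split; [apply: (le_ (kap * K3))|apply: (le_ (kap / n.+3%:R * K4))] => //.
  + by rewrite -mulrBr normrM (ger0_norm k0) -[leRHS]mulrA; exact: ler_wpM2l.
  + by rewrite -mulrBr normrM (ger0_norm kn) -[leRHS]mulrA; exact: ler_wpM2l.
- split; [apply: (le_ (kap * K1))|apply: (le_ (kap / n.+3%:R * K2))]; rewrite ?sqr_ge0//.
  + have -> : E x - E y - E1 y * (x - y) = kap * (pw n.+2 (x - c) - pw n.+2 (y - c) - n.+2%:R * pw n.+1 (y - c) * (x - y)).
      by rewrite /E /E1; ring.
    by rewrite normrM (ger0_norm k0) (ger0_norm a1) -[leRHS]mulrA; exact: ler_wpM2l.
  + have -> : la x - la y - E y * (x - y) = kap / n.+3%:R * (pw n.+3 (x - c) - pw n.+3 (y - c) - n.+3%:R * pw n.+2 (y - c) * (x - y)).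
      by rewrite /la /E; field.
    by rewrite normrM (ger0_norm kn) (ger0_norm b1) -[leRHS]mulrA; exact: ler_wpM2l.
- rewrite -subr_ge0; have := mulr_ge0 kn b3.
  have -> // : kap / n.+3%:R * (pw n.+3 (y - c) - pw n.+3 (x - c) - n.+3%:R * pw n.+2 (x - c) * (y - c - (x - c)))
    = E x * (x - y) - (la x - la y) by rewrite /la /E; field.
Qed.

End PowerProfile.

(** * Sup-convolutions as functions of time *)

Section SupConvTime.
Variable R : realType.
Implicit Types (x y z : R * R) (i : bool) (r s t k d e : R) (Q : R * R -> R -> R).

(** Upper semicontinuity jointly in space and in forward time. Together with the same property of
    [- Q] it is forward continuity. *)
Definition fusc Q z t := forall k, 0 < k -> exists2 r, 0 < r &
  forall y s, `|y.1 - z.1| < r -> `|y.2 - z.2| < r -> t <= s -> s < t + r -> Q y s <= Q z t + k.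

(** All maximisers lie in one compact square, which makes the forward semicontinuity at its points
    uniform. *)
Lemma sc_fusc Q B T0 e t x k :
  (forall s, T0 < s -> continuous (Q^~ s)) -> (forall s, T0 < s -> forall z, `|Q z s| <= B) ->
  0 < e -> T0 < t ->
  (forall y, `|y.1 - x.1| <= Num.sqrt (4 * B * e) -> `|y.2 - x.2| <= Num.sqrt (4 * B * e) -> fusc Q y t) ->
  0 < k -> exists2 r, 0 < r & forall s, t < s -> s < t + r -> sc Q e s x <= sc Q e t x + k.
Proof.
move=> cQ QB e0 Tt HK k0; set R0 := Num.sqrt _ in HK.
pose K := (`[x.1 - R0, x.1 + R0]%classic `*` `[x.2 - R0, x.2 + R0]%classic) : set (R * R).
have cK : compact K by apply: compact_setX; exact: segment_compact.
move/compact_near_coveringP : cK => /(_ R (t^'+)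
  (fun s y => Q y s - d2 x y / (2 * e) <= sc Q e t x + k) _) [].
  move=> y [/=]; rewrite !in_itv/= => /andP[y1 y2] /andP[y3 y4].
  have k2 : 0 < k / 2 by rewrite divr_gt0.
  have [||r r0 Hr] := HK y _ _ _ k2; [by rewrite ler_norml; lra..|].
  have ke : 0 < k * e by rewrite mulr_gt0.
  have Hd : \forall y' \near y, `|d2 x y - d2 x y'| < k * e.
    by have /cvgrPdist_lt/(_ _ ke) := @cont_d2 R x y.
  have Hb : \forall y' \near y, `|y'.1 - y.1| < r /\ `|y'.2 - y.2| < r.
    exists (ball y.1 r, ball y.2 r); first by split; exact: nbhsx_ballx.
    by move=> y' [/= b1 b2]; rewrite !(distrC (y'.1)) (distrC (y'.2)).
  exists ([set y' | `|d2 x y - d2 x y'| < k * e /\ (`|y'.1 - y.1| < r /\ `|y'.2 - y.2| < r)],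
     [set s | t < s /\ s < t + r]).
    split; first exact: filterI.
    exists r => //= s; rewrite /= ltr_distlC => /andP[_ ?] ?; split => //.
  move=> [y' s] /= [[dy [b1 b2]] [ts st]].
  have := Hr y' s b1 b2 (ltW ts) st.
  have := sconv_ub e0 (QB t Tt) x y; rewrite -/(sc Q e t x).
  have : d2 x y / (2 * e) <= d2 x y' / (2 * e) + k / 2.
    rewrite ler_pdivrMr ?mulr_gt0// mulrDl divfK ?gt_eqF ?mulr_gt0//.
    by move: dy; rewrite ltr_norml => /andP[_]; lra.
  by lra.
move=> r /= r0 Hr; exists r => // s ts st.
have [y yE dy] := sconv_max e0 (cQ s (lt_trans Tt ts)) (QB s (lt_trans Tt ts)) x.
rewrite [leLHS]yE.
have c i : `|crd i y - crd i x| <= R0.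
  rewrite -(sqrtr_sqr (crd i y - crd i x)) ler_wsqrtr//.
  by apply: le_trans dy; rewrite -sqrrN opprB crd_sq.
apply: (Hr s) => //.
  by rewrite /= ltr_distlC; apply/andP; split; lra.
have := c true; have := c false; rewrite /crd !ler_norml => /andP[? ?] /andP[? ?].
by split; rewrite /= in_itv/=; apply/andP; split; lra.
Qed.

(* The forward semicontinuity assumption is what upgrades the pointwise bound
   on backward difference quotients to one that is uniform in the quotient. *)
Lemma sc_dom (a0 a1 V B M T0 : R) (al : R -> R * R -> R -> R) (v : bool -> R * R -> R) Q e ta tb x :
  0 < a0 -> (forall t z q, a0 <= al t z q <= a1) -> (forall i z, `|v i z| <= V) ->
  (forall s, T0 < s -> continuous (Q^~ s)) -> (forall s, T0 < s -> forall z, `|Q z s| <= B) ->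
  0 < e -> T0 < ta ->
  (forall t y, T0 < t -> t <= tb -> subsol_at (al t) v M Q y t) ->
  (forall y, `|y.1 - x.1| <= Num.sqrt (4 * B * e) -> `|y.2 - x.2| <= Num.sqrt (4 * B * e) ->
     forall t, ta <= t -> t < tb -> fusc Q y t) ->
  forall s t, ta <= s -> s <= t -> t <= tb -> sc Q e t x - sc Q e s x <= Cdom a1 V B M e * (t - s).
Proof.
move=> a00 al_bd v_bd cQ QB e0 T0ta sub HK s t tas st ttb; set C := Cdom _ _ _ _ _.
suff : sc Q e t x - C * t <= sc Q e s x - C * s by lra.
apply: (@dini_le R (fun u => sc Q e u x - C * u) s t st) => [u su ut k k0|u su ut k k0].
  have k2 : 0 < k / 2 by rewrite divr_gt0.
  have Tu : T0 < u by lra.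
  have [|r r0 Hr] := sc_fusc (x := x) cQ QB e0 Tu _ k2.
    by move=> y y1 y2; apply: HK => //; lra.
  exists (Num.min r (k / 2 / (`|C| + 1))); first by rewrite lt_min r0 divr_gt0// ltr_wpDl.
  move=> w uw; rewrite -ltrBlDl lt_min => /andP[w1 w2] wt.
  have := Hr w uw; rewrite -ltrBlDl w1 => /(_ isT).
  rewrite ltr_pdivlMr ?ltr_wpDl// in w2.
  have : - (C * (w - u)) <= `|C| * (w - u).
    by rewrite -mulNr; apply: ler_wpM2r; [lra|rewrite -normrN ler_norm].
  by lra.
have Tu : T0 < u by exact: lt_le_trans T0ta (le_trans tas (ltW su)).
have ub : u <= tb by exact: le_trans ut ttb.
have [r r0 Hr] := sc_time_dom a00 (al_bd u) v_bd cQ QB e0 Tu (fun y => sub u y Tu ub) x k0.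
exists r => // w rw wu sw.
have := Hr (u - w); rewrite subr_gt0 wu (_ : u - w < r); last by lra.
rewrite (_ : u - (u - w) = w); last by ring.
move=> /(_ isT isT); rewrite (lt_le_trans T0ta (le_trans tas sw)) => /(_ isT).
by rewrite -/C; lra.
Qed.

(** The maximiser at time [t] is a competitor at nearby times, and [Q] is continuous in time
    there. *)
Lemma sc_lsc Q B T0 e t x k : (forall s, T0 < s -> forall z, `|Q z s| <= B) ->
  (forall s, T0 < s -> continuous (Q^~ s)) ->
  (forall z s, T0 < s -> {for s, continuous (Q z)}) -> 0 < e -> T0 < t -> 0 < k ->
  exists2 r, 0 < r & forall s, `|s - t| < r -> sc Q e t x - k <= sc Q e s x.
Proof.
move=> QB cQ tQ e0 Tt k0.
have [y yE _] := sconv_max e0 (cQ t Tt) (QB t Tt) x.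
have /cvgrPdist_lt/(_ k k0)[r /= r0 Hr] := tQ y t Tt.
exists (Num.min r (t - T0)); first by rewrite lt_min r0 subr_gt0.
move=> s; rewrite lt_min => /andP[sr sT].
have Ts : T0 < s by move: sT; rewrite ltr_norml => /andP[]; lra.
have := sconv_ub e0 (QB s Ts) x y; rewrite -/(sc Q e s x).
rewrite /sc yE; have := Hr s; rewrite /= distrC sr => /(_ isT).
by rewrite ltr_norml => /andP[_]; lra.
Qed.

Lemma sc_cvg Q B T0 (e : nat -> R) t x : (forall s, T0 < s -> forall z, `|Q z s| <= B) ->
  (forall s, T0 < s -> continuous (Q^~ s)) -> T0 < t ->
  (forall n, 0 < e n) -> e @ \oo --> 0 -> (fun n => sc Q (e n) t x) @ \oo --> Q x t.
Proof.
move=> QB cQ Tt e0 ec; apply/cvgrPdist_le => k k0.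
have /cvgrPdist_lt/(_ k k0)[[A1 A2] /= [n1 n2] HA] := cQ t Tt x.
have [r r0 Hr] : exists2 r, 0 < r & forall y, `|y.1 - x.1| < r -> `|y.2 - x.2| < r ->
    `|Q x t - Q y t| < k.
  have [r1 /= r10 H1] := n1; have [r2 /= r20 H2] := n2.
  exists (Num.min r1 r2); first by rewrite lt_min r10.
  move=> y; rewrite !lt_min => /andP[y1 _] /andP[_ y2]; apply: HA; split => /=.
  - by apply: H1; rewrite /= distrC.
  - by apply: H2; rewrite /= distrC.
have B0 : 0 <= B by apply: le_trans (normr_ge0 _) (QB t Tt x).
have B1 : 0 < 4 * B + 1 by lra.
have r2 : 0 < r ^+ 2 / (4 * B + 1) by rewrite divr_gt0// exprn_gt0.
have /cvgrPdist_lt/(_ _ r2)[N _ HN] := ec.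
exists N => // n /= Nn; have := HN n Nn; rewrite /= sub0r normrN gtr0_norm// => en.
have ge := sconv_ge (e0 n) (QB t Tt) x.
rewrite ler0_norm ?subr_le0// opprB lerBlDr.
have [y yE dy] := sconv_max (e0 n) (cQ t Tt) (QB t Tt) x.
have c i : `|crd i y - crd i x| < r.
  rewrite -(ltr_pXn2r (n := 2))//; rewrite ?nnegrE ?normr_ge0 ?(ltW r0)//.
  rewrite real_normK ?num_real// -sqrrN opprB.
  apply: le_lt_trans (crd_sq i x y) _; apply: le_lt_trans dy _.
  rewrite ltr_pdivlMr// in en; apply: le_lt_trans en.
  by have := e0 n; lra.
have := Hr y (c true) (c false); rewrite ltr_norml => /andP[h _].
rewrite /sc yE; have : 0 <= d2 x y / (2 * e n) by rewrite divr_ge0 ?d2_ge0// mulr_ge0// ltW.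
by lra.
Qed.

Lemma sconv_D2 e B (g : R * R -> R) i r z : 0 < e -> continuous g -> (forall z, `|g z| <= B) ->
  r != 0 -> - e^-1 <= D2 i r (sconv e g) z.
Proof.
move=> e0 cg gB rn; have [y yE _] := sconv_max e0 cg gB z.
have := sconv_touch e0 gB i 0 r yE; have := sconv_touch e0 gB i 0 (- r) yE.
rewrite !mul0r sh0 subrr addr0 subr0 !mul1r sqrrN expr1n mul1r => h1 h2.
rewrite /D2 ler_pdivlMr; last by rewrite exprn_even_gt0.
have : - e^-1 * r ^+ 2 = - (r ^+ 2 / (2 * e)) - r ^+ 2 / (2 * e) by field; rewrite gt_eqF.
by lra.
Qed.

(** Induction with [(a + b)^2 <= (1 + 1/n) a^2 + (1 + n) b^2], the weights for which the constants
    close up exactly: [(1 + 1/n) n^2 + (1 + n) = (n + 1)^2]. *)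
Lemma I_sq_shift i r N (p : R * R -> R) : continuous p -> per p ->
  I (fun z => (p (sh i (N%:R * r) z) - p z) ^+ 2) <= N%:R ^+ 2 * I (fun z => (p (sh i r z) - p z) ^+ 2).
Proof.
move=> cp pp.
have cs k : continuous (fun z => (p (sh i k z) - p z) ^+ 2) by ct.
elim: N => [|[|N] IH].
- rewrite mul0r expr0n/= mul0r (@eq_I _ _ (fun=> 0)) ?I_cst// => z.
  by rewrite sh0 subrr expr0n.
- by rewrite !mul1r expr1n mul1r.
- set n := N.+1 in IH *.
  have n0 : 0 < n%:R :> R by rewrite ltr0n.
  have nn0 : n%:R != 0 :> R by rewrite gt_eqF.
  have : I (fun z => (p (sh i (n.+1%:R * r) z) - p z) ^+ 2) <=
    I (fun z => (1 + n%:R^-1) * (p (sh i (n%:R * r) z) - p z) ^+ 2 +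
       (1 + n%:R) * (fun y => (p (sh i r y) - p y) ^+ 2) (sh i (n%:R * r) z)).
    apply: I_le => [||z]; [exact: cs|by ct|].
    rewrite shD (_ : n%:R * r + r = n.+1%:R * r); last by rewrite -natr1; ring.
    set a := p (sh i (n%:R * r) z); set b := p (sh i (n.+1%:R * r) z); set c := p z.
    have := sqr_ge0 ((a - c) - n%:R * (b - a)).
    rewrite -(subr_ge0 ((b - c) ^+ 2)) => h.
    have -> : (1 + n%:R^-1) * (a - c) ^+ 2 + (1 + n%:R) * (b - a) ^+ 2 - (b - c) ^+ 2
      = ((a - c) - n%:R * (b - a)) ^+ 2 / n%:R by field.
    by rewrite divr_ge0// ltW.
  rewrite ID; [|by ct|by ct].
  rewrite !IZ; [|by ct|by ct].
  rewrite (I_sh (f := fun y => (p (sh i r y) - p y) ^+ 2)); [|exact: cs|]; last first.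
    by move=> j z; rewrite shC !pp.
  move=> h; apply: le_trans h _.
  set A := I _ in IH *; set D := I _ in IH *.
  have h1 : (1 + n%:R^-1) * A <= (1 + n%:R^-1) * (n%:R ^+ 2 * D).
    by apply: ler_wpM2l => //; rewrite addr_ge0// invr_ge0 ltW.
  apply: le_trans (lerD h1 (lexx _)) _; rewrite -[n.+1%:R]natr1 le_eqVlt; apply/orP; left.
  by apply/eqP; field.
Qed.

End SupConvTime.

(** * The entropy inequality for subsolutions *)

Lemma lim_le (R : realType) (u w : nat -> R) a b : u @ \oo --> a -> w @ \oo --> b ->
  (forall n, u n <= w n) -> a <= b.
Proof. by move=> c1 c2 H; exact: ler_cvg_to c1 c2 (nearW _ H). Qed.

Lemma lim_norm (R : realType) (u : nat -> R) (a : R) : u @ \oo --> a -> (fun n => `|u n|) @ \oo --> `|a|.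
Proof. by move=> c; exact: cvg_norm. Qed.

Lemma cvg_seqP (R : realType) (g : R -> R) (t l : R) : g x @[x --> t] --> l <->
  (forall u : nat -> R, u @ \oo --> t -> (fun n => g (u n)) @ \oo --> l).
Proof.
split=> [gl u ut|H]; first exact: cvg_comp ut gl.
apply/cvgrPdist_lt => e e0; apply: contrapT => Hn.
have /choice[u Hu] : forall n : nat, exists s, `|t - s| < n.+1%:R^-1 /\ e <= `|l - g s|.
  move=> n; apply: contrapT => Hs; apply: Hn; exists (n.+1%:R^-1); first by rewrite /= invr_gt0.
  by move=> s /= st; rewrite ltNge; apply/negP => lt; apply: Hs; exists s.
have ut : u @ \oo --> t.
  apply/cvgrPdist_lt => k k0; have /cvgrPdist_lt/(_ _ k0)[N _ HN] := @cvg_harmonic R.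
  exists N => // n Nn; have := HN n Nn; rewrite /harmonic/= sub0r normrN gtr0_norm ?invr_gt0//.
  by apply: lt_trans; exact: (Hu n).1.
have /cvgrPdist_lt/(_ _ e0)[N _ HN] := H u ut.
by have := HN N (leqnn N); rewrite /= ltNge (Hu N).2.
Qed.

Lemma cont_I_time (R : realType) (C : R) (f : R * R -> R -> R) :
  (forall t, continuous (f^~ t)) -> (forall z t, `|f z t| <= C) ->
  (forall z, continuous (f z)) -> continuous (fun t => I (f^~ t)).
Proof.
move=> cf fC ft t; apply/cvg_seqP => u ut.
apply: (@I_dct R C (fun n => f^~ (u n)) (f^~ t)) => // z.
have /cvg_seqP H := ft z t; exact: H.
Qed.

Section MainInequality.
Variable R : realType.
Implicit Types (x y z : R * R) (i : bool) (r s t k d e : R).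
Variables (a0 a1 La Lz Lv Kv V B M T0 F Lf Lh K lam1 rh R0 ta tb : R).
Variables (al : R -> R * R -> R -> R) (v : bool -> R * R -> R) (Q : R * R -> R -> R).
Variables (fi eta m W : R * R -> R) (E E1 la : R -> R).
Hypotheses (a00 : 0 < a0) (La0 : 0 <= La) (Lz0 : 0 <= Lz) (Lv0 : 0 <= Lv) (Lf0 : 0 <= Lf)
  (Lh0 : 0 <= Lh) (K0 : 0 <= K) (lam10 : 0 <= lam1) (rh0 : 0 < rh) (rh1 : rh < 1) (R00 : 0 < R0)
  (T0ta : T0 < ta) (tab : ta <= tb).
Hypothesis al_bd : forall t z q, a0 <= al t z q <= a1.
Hypothesis al_lip : forall t z y q q', `|al t z q - al t y q'| <= Lz * dist1 z y + La * `|q - q'|.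
Hypothesis al_per : forall t q, per (fun z => al t z q).
Hypothesis v_lip : forall i z y, `|v i z - v i y| <= Lv * dist1 z y.
Hypothesis v_bd : forall i z, `|v i z| <= V.
Hypothesis v_per : forall i, per (v i).
Hypothesis v_div : forall z r, 0 < r -> r < 1 -> `|Dm true r (v true) z + Dm false r (v false) z| <= Kv * r.
Hypothesis cQ : forall t, T0 < t -> continuous (Q^~ t).
Hypothesis QB : forall t, T0 < t -> forall z, `|Q z t| <= B.
Hypothesis pQ : forall t, T0 < t -> per (Q^~ t).
Hypothesis tQ : forall z t, T0 < t -> {for t, continuous (Q z)}.
Hypothesis sub : forall t y, T0 < t -> t <= tb -> subsol_at (al t) v M Q y t.
Hypotheses (cfi : continuous fi) (ceta : continuous eta) (cm : continuous m) (cW : continuous W)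
  (pfi : per fi) (peta : per eta) (pm : per m).
Hypothesis fib : forall z, 0 <= fi z <= F.
Hypothesis fiL : forall i z r, `|fi (sh i r z) - fi z| <= Lf * `|r|.
Hypothesis etab : forall z, 0 <= eta z <= 1.
Hypothesis mb : forall z, 0 <= m z <= 1.
Hypothesis etaL : forall i z r, `|r| <= rh -> `|eta (sh i r z) - eta z| <= Lh * m z * `|r|.
Hypothesis Wlim : forall z, (fun n : nat => Dm true (rh / n.+2%:R) (fun y => fi y * v true y) z
   + Dm false (rh / n.+2%:R) (fun y => fi y * v false y) z) @ \oo --> W z.
Hypotheses (cE : continuous E) (cE1 : continuous E1) (cla : continuous la).
Hypothesis prof : forall x y : R, `|x| <= B -> `|y| <= B ->
  [/\ 0 <= E x <= K, 0 <= E1 x /\ 0 <= la x <= K, `|E x - E y| <= K * `|x - y| /\ `|la x - la y| <= K * `|x - y|,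
      `|E x - E y - E1 y * (x - y)| <= K * (x - y) ^+ 2 /\
      `|la x - la y - E y * (x - y)| <= K * (x - y) ^+ 2 & la x - la y <= E x * (x - y)].
Hypothesis absb : forall z (x : R), `|x| <= B -> Lf + eta z ^+ 2 * E x
  + (fi z + eta z ^+ 2 * E x) * (Lz + La + 2 * Cgrad a0 (Lz + La) B) <= a0 / 2 * (eta z ^+ 2 * E1 x).
Hypothesis lam1_le : forall z (x : R), `|x| <= B -> lam1 <= eta z ^+ 2 * E1 x.
Hypothesis MLz : 2 * Lz <= M.
(** Forward semicontinuity is asked only within distance [R0] of the supports of [fi] and [eta]: the
    barrier argument, which serves to prove it, knows it only on a part of the torus. *)
Hypothesis supp : forall x, fi x != 0 \/ eta x != 0 -> forall y, `|y.1 - x.1| <= R0 ->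
  `|y.2 - x.2| <= R0 -> forall t, ta <= t -> t < tb -> fusc Q y t.

Let B0 : 0 <= B.
Proof. by apply: le_trans (normr_ge0 _) (@QB ta T0ta (0, 0)). Qed.

Let V0 : 0 <= V. Proof. exact: le_trans (normr_ge0 _) (v_bd true (0, 0)). Qed.

Let F0 : 0 <= F. Proof. by have /andP[] := fib (0, 0); exact: le_trans. Qed.

Let cv i : continuous (v i).
Proof.
apply: (@lip_steps_cont _ _ Lv Lv0) => j z r _; apply: le_trans (v_lip _ _ _) _.
by rewrite /dist1; case: j; rewrite /sh/= subrr normr0 ?addr0 ?add0r addrAC subrr add0r.
Qed.

Let a10 : 0 <= a1.
Proof. by have /andP[h] := al_bd 0 (0, 0) 0; apply: le_trans; apply: le_trans h; exact: ltW. Qed.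

Let Cg := Cgrad a0 (Lz + La) B.

Let Cg0 : 0 <= Cg.
Proof.
rewrite /Cg /Cgrad addr_ge0// mulr_ge0//; last by rewrite addr_ge0// mulr_ge0.
by rewrite mulr_ge0 ?invr_ge0 ?(ltW a00)// mulr_ge0// sqr_ge0.
Qed.

Definition lyap (p : R * R -> R) := I (fun z => fi z * p z + eta z ^+ 2 * la (p z)).

(** The bound for the growth of [lyap] that remains as the step of the discrete estimate tends to 0.
    The energy is recorded at the fixed step [rh], so that the expression still makes sense for the
    limit [Q]. *)
Definition rate (p : R * R -> R) :=
  I (fun z => p z * W z) + 4 * V * Lh * I (fun z => la (p z) * m z)
  + 2 * (Lf * a1 ^+ 2 + a1 ^+ 2 * Lh ^+ 2 * I (fun z => E (p z) * m z ^+ 2)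
       + Lz * I (fun z => fi z + eta z ^+ 2 * E (p z)))
  - M * I (fun z => fi z + eta z ^+ 2 * E (p z))
  - a0 / 2 * lam1 * (I (fun z => Dp true rh p z ^+ 2) + I (fun z => Dp false rh p z ^+ 2)).

Let Wb := 2 * (Lf * V + F * Lv).

Let Dmb z r : 0 < r -> `|Dm true r (fun y => fi y * v true y) z
   + Dm false r (fun y => fi y * v false y) z| <= Wb.
Proof.
move=> r0; have q i : `|Dm i r (fun y => fi y * v i y) z| <= Lf * V + F * Lv.
  rewrite /Dm normrM normfV (gtr0_norm r0) ler_pdivrMr//.
  set z' := sh i (- r) z.
  have -> : fi z * v i z - fi z' * v i z' = (fi z - fi z') * v i z + fi z' * (v i z - v i z') by ring.
  rewrite [leRHS]mulrDl; apply: le_trans (ler_normD _ _) _; apply: lerD.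
    rewrite mulrAC; apply: prod_le_norm => //; rewrite distrC; apply: le_trans (fiL _ _ _) _.
    by rewrite normrN gtr0_norm.
  rewrite -mulrA; apply: prod_le_norm; first by have /andP[f0 f1] := fib z'; rewrite ger0_norm.
  rewrite distrC; apply: le_trans (v_lip _ _ _) _; rewrite /z' /dist1.
  by case: (i); rewrite /sh/= subrr normr0 ?addr0 ?add0r addrAC subrr add0r normrN gtr0_norm.
rewrite /Wb mulrDl mul1r; apply: le_trans (ler_normD _ _) _; exact: lerD.
Qed.

Section fixed_e.
Variable e : R.
Hypotheses (e0 : 0 < e) (e1 : e <= 1) (Lve : Lv * e <= 1) (eR : Num.sqrt (4 * B * e) <= R0).

Let Cd := Cdom a1 V B M e.

Let dom x : fi x != 0 \/ eta x != 0 -> forall s t, ta <= s -> s <= t -> t <= tb ->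
  sc Q e t x - sc Q e s x <= Cd * (t - s).
Proof.
move=> fx; apply: (@sc_dom R a0 a1 V B M T0 al v Q e ta tb x) => // y y1 y2 t tat ttb.
by apply: (supp fx) => //; [exact: le_trans y1 eR|exact: le_trans y2 eR].
Qed.

Let cp t : T0 < t -> continuous (sc Q e t).
Proof. by move=> Tt; exact: (sconv_cont e0 (cQ Tt) (QB Tt)). Qed.

Let pB t z : T0 < t -> `|sc Q e t z| <= B.
Proof. by move=> Tt; exact: (sconv_bound e0 (QB Tt)). Qed.

Let pp t : T0 < t -> per (sc Q e t).
Proof. by move=> Tt; exact: (sconv_per e0 (QB Tt) (pQ Tt)). Qed.

Let ellb t z : T0 < t -> 0 <= fi z + eta z ^+ 2 * E (sc Q e t z) <= F + K.
Proof.
move=> Tt; have /andP[f0 f1] := fib z; have /andP[t0 t1] := etab z.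
have [/andP[E0 EK] _ _ _ _] := prof (pB z Tt) (pB z Tt).
rewrite addr_ge0//= ?mulr_ge0 ?sqr_ge0// lerD//; apply: le_trans EK.
by apply: ler_piMl => //; rewrite exprn_ile1.
Qed.

Let L := (Num.sqrt (4 * B * e) + 1) / e.

Let L0 : 0 <= L. Proof. by rewrite divr_ge0 ?(ltW e0)// addr_ge0// sqrtr_ge0. Qed.

Lemma disc_sc t : T0 < t -> exists K', forall rho, 0 < rho -> rho < rh ->
  I (fun z => (fi z + eta z ^+ 2 * E (sc Q e t z)) *
      Rrho (al t z (sc Q e t z)) Cg (v^~ z) (sc Q e t) rho z)
  <= I (fun z => sc Q e t z * (Dm true rho (fun y => fi y * v true y) z + Dm false rho (fun y => fi y * v false y) z))
   + 4 * V * Lh * I (fun z => la (sc Q e t z) * m z)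
   + 2 * (Lf * a1 ^+ 2 + a1 ^+ 2 * Lh ^+ 2 * I (fun z => E (sc Q e t z) * m z ^+ 2)
        + Lz * I (fun z => fi z + eta z ^+ 2 * E (sc Q e t z)))
   - a0 / 2 * (I (fun z => eta z ^+ 2 * E1 (sc Q e t z) * Dp true rho (sc Q e t) z ^+ 2)
             + I (fun z => eta z ^+ 2 * E1 (sc Q e t z) * Dp false rho (sc Q e t) z ^+ 2)) + K' * rho.
Proof.
move=> Tt; set p := sc Q e t.
have cpt : continuous p := cp Tt; have ppt : per p := pp Tt; have bp z : `|p z| <= B := pB z Tt.
have pL i z r : `|r| <= 1 -> `|p (sh i r z) - p z| <= L * `|r|.
  by move=> r1; exact: (sconv_lip_step e0 (cQ Tt) (QB Tt)).
have d1 i z r : dist1 (sh i r z) z = `|r|.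
  by rewrite /dist1; case: i; rewrite /sh/= subrr normr0 ?addr0 ?add0r addrAC subrr add0r.
pose A z := al t z (p z).
have AL i z r : `|A (sh i r z) - A z| <= Lz * `|r| + La * `|p (sh i r z) - p z|.
  by rewrite /A; apply: le_trans (al_lip _ _ _ _ _) _; rewrite d1.
have cA : continuous A.
  apply: (@lip_steps_cont _ _ (Lz + La * L)); first by rewrite addr_ge0// mulr_ge0.
  move=> i z r r1; apply: le_trans (AL i z r) _; rewrite mulrDl lerD2l -mulrA ler_wpM2l//.
  exact: pL.
have pA : per A by move=> i z; rewrite /A ppt al_per.
have P1 i z r := prof (bp (sh i r z)) (bp z).
apply: (@disc_est R a0 a1 Cg L F Lf Lh Lz La K K K V Lv Kv rh p A fi eta m
   (fun z => E (p z)) (fun z => E1 (p z)) (fun z => la (p z)) v) => //.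
- exact: cont_comp cpt cE.
- exact: cont_comp cpt cE1.
- exact: cont_comp cpt cla.
- exact: per_comp.
- exact: per_comp.
- exact: ltW.
- by move=> z; exact: al_bd.
- by move=> z; have [] := P1 true z 0; rewrite sh0.
- by move=> z; have [_ []] := prof (bp z) (bp z).
- by move=> z; have [_ [_ /andP[]]] := prof (bp z) (bp z).
- by move=> i z r; have [_ _ []] := P1 i z r.
- by move=> i z r; have [_ _ _ []] := P1 i z r.
- by move=> i z r; have [_ _ _ []] := P1 i z r.
- by move=> z; exact: absb.
- by move=> i z r; apply: le_trans (v_lip _ _ _) _; rewrite d1.
- by move=> z r r0 rr; apply: v_div => //; exact: lt_trans rr rh1.
- by exists K => z; have [_ [_ /andP[]]] := prof (bp z) (bp z).
Qed.

Let Rlow t : T0 < t -> exists2 C, 0 <= C & forall z rho, 0 < rho -> rho < rh ->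
  - C <= Rrho (al t z (sc Q e t z)) Cg (v^~ z) (sc Q e t) rho z.
Proof.
move=> Tt; exists (2 * (a1 * e^-1 + V * L)).
  by rewrite mulr_ge0// addr_ge0// mulr_ge0// invr_ge0 ltW.
move=> z rho r0 rr; set p := sc Q e t.
have r1 : rho <= 1 by exact: ltW (lt_trans rr rh1).
have /andP[A0 A1] := al_bd t z (p z).
have D2l i : - (a1 * e^-1) <= al t z (p z) * D2 i rho p z.
  have := sconv_D2 i z e0 (cQ Tt) (QB Tt) (lt0r_neq0 r0); rewrite -/(sc Q e t) -/p => h.
  apply: (@le_trans _ _ (al t z (p z) * - e^-1)); last first.
    by apply: ler_wpM2l => //; apply: le_trans A0; exact: ltW.
  by rewrite mulrN lerN2; apply: ler_wpM2r => //; rewrite invr_ge0 ltW.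
have dp i z' : `|Dp i rho p z'| <= L.
  rewrite /Dp normrM normfV ler_pdivrMr ?normr_gt0 ?lt0r_neq0//.
  by apply: (sconv_lip_step e0 (cQ Tt) (QB Tt)); rewrite gtr0_norm.
have vl i : - (V * L) <= neg (v i z) * Dp i rho p z - pos (v i z) * Dm i rho p z.
  have h1 : - (neg (v i z) * L) <= neg (v i z) * Dp i rho p z.
    by rewrite -mulrN ler_wpM2l ?neg_ge0//; have := dp i z; rewrite ler_norml => /andP[].
  have h2 : pos (v i z) * Dm i rho p z <= pos (v i z) * L.
    by rewrite DmE ler_wpM2l ?pos_ge0//; have := dp i (sh i (- rho) z); rewrite ler_norml => /andP[].
  have : (neg (v i z) + pos (v i z)) * L <= V * L.
    by rewrite neg_pos_norm ler_wpM2r.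
  by move: h1 h2; lra.
have q i : 0 <= Cg * (Dp i rho p z ^+ 2 + Dm i rho p z ^+ 2).
  by rewrite mulr_ge0// addr_ge0// sqr_ge0.
rewrite /Rrho big_cons big_cons big_nil addr0.
move: (D2l true) (D2l false) (vl true) (vl false) (q true) (q false); lra.
Qed.

Let cA t : T0 < t -> continuous (fun z => al t z (sc Q e t z)).
Proof.
move=> Tt; apply: (@lip_steps_cont _ _ (Lz + La * L)); first by rewrite addr_ge0// mulr_ge0.
move=> i z r r1; apply: le_trans (al_lip _ _ _ _ _) _.
rewrite (_ : dist1 _ _ = `|r|); last first.
  by rewrite /dist1; case: i; rewrite /sh/= subrr normr0 ?addr0 ?add0r addrAC subrr add0r.
rewrite mulrDl lerD2l -mulrA ler_wpM2l//; exact: (sconv_lip_step e0 (cQ Tt) (QB Tt)).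
Qed.

Let cR t rho : T0 < t -> continuous (fun z => Rrho (al t z (sc Q e t z)) Cg (v^~ z) (sc Q e t) rho z).
Proof.
move=> Tt; rewrite (_ : (fun z => _) = fun z =>
    (al t z (sc Q e t z) * D2 true rho (sc Q e t) z
     + Cg * (Dp true rho (sc Q e t) z ^+ 2 + Dm true rho (sc Q e t) z ^+ 2)
     + neg (v true z) * Dp true rho (sc Q e t) z - pos (v true z) * Dm true rho (sc Q e t) z)
  + (al t z (sc Q e t z) * D2 false rho (sc Q e t) z
     + Cg * (Dp false rho (sc Q e t) z ^+ 2 + Dm false rho (sc Q e t) z ^+ 2)
     + neg (v false z) * Dp false rho (sc Q e t) z - pos (v false z) * Dm false rho (sc Q e t) z)); last first.
  by apply/funext => z; rewrite /Rrho !big_cons big_nil addr0.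
have h1 := cA Tt; have h2 := cp Tt.
have ct1 := @cv true; have ct2 := @cv false.
have cpt := cont_pos ct1; have cpf := cont_pos ct2; have cnt := cont_neg ct1; have cnf := cont_neg ct2.
have q1 := @cont_Dp R true rho _ h2; have q2 := @cont_Dp R false rho _ h2.
have q3 := @cont_Dm R true rho _ h2; have q4 := @cont_Dm R false rho _ h2.
have q5 : continuous (D2 true rho (sc Q e t)) by rewrite /D2; ct.
have q6 : continuous (D2 false rho (sc Q e t)) by rewrite /D2; ct.
by ct.
Qed.

(** A Fatou argument by contradiction. Along times [s n] violating the bound, let [h n] be [ell]
    times the excess of the discrete right-hand side over the backward quotient. Its negative part
    tends to 0 by [sc_pointwise] and is bounded by [dom] and [Rlow], so its integral tends to 0;
    then the discrete estimate contradicts the choice of [s n]. *)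
Lemma lyap_dini t : ta < t -> t <= tb -> forall k, 0 < k -> exists2 r, 0 < r &
  forall s, t - r < s -> s < t -> ta <= s ->
    lyap (sc Q e t) - lyap (sc Q e s) <= (rate (sc Q e t) + k) * (t - s).
Proof.
move=> tat ttb k k0; apply: contrapT => Hn.
have /choice[s Hs] : forall n : nat, exists s, [/\ t - n.+1%:R^-1 < s, s < t, ta <= s &
    (rate (sc Q e t) + k) * (t - s) < lyap (sc Q e t) - lyap (sc Q e s)].
  move=> n; apply: contrapT => Hs; apply: Hn; exists (n.+1%:R^-1); first by rewrite invr_gt0.
  move=> s s1 s2 s3; rewrite leNgt; apply/negP => lt; apply: Hs; exists s; split => //.
have Tt : T0 < t by exact: lt_trans T0ta tat.
have Ts n : T0 < s n by have [_ _ h _] := Hs n; exact: lt_le_trans T0ta h.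
have ds n : 0 < t - s n by have [_ h _ _] := Hs n; rewrite subr_gt0.
set p := sc Q e t in Hs.
(* Integer fractions of [rh], so that [I_sq_shift] bounds the energy at step [rh] by the energy at
   step [rho n]. *)
pose rho (n : nat) := rh / n.+2%:R.
have rho0 n : 0 < rho n by rewrite divr_gt0.
have rhor n : rho n < rh by rewrite ltr_pdivrMr// ltr_pMr// ltr1n.
pose l z := fi z + eta z ^+ 2 * E (p z).
pose q n z := (p z - sc Q e (s n) z) / (t - s n).
pose Rn n z := Rrho (al t z (p z)) Cg (v^~ z) p (rho n) z.
pose h n z := l z * (Rn n z - M - q n z).
have cpt : continuous p := cp Tt.
have cEp : continuous (fun z => E (p z)) := cont_comp cpt cE.
have clp : continuous (fun z => la (p z)) := cont_comp cpt cla.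
have cE1p : continuous (fun z => E1 (p z)) := cont_comp cpt cE1.
have cl : continuous l by rewrite /l; ct.
have cps n : continuous (sc Q e (s n)) := cp (Ts n).
have cq n : continuous (q n) by have := cps n; rewrite /q => c; ct.
have cRn n : continuous (Rn n) := @cR t (rho n) Tt.
have ch n : continuous (h n) by have c1 := cq n; have c2 := cRn n; rewrite /h; ct.
have lb z : 0 <= l z <= F + K := ellb z Tt.
have [CR CR0 HCR] := Rlow Tt.
have FK0 : 0 <= F + K by exact: addr_ge0.
have negh n z : 0 <= neg (h n z) <= (F + K) * (CR + `|M| + `|Cd|).
  have /andP[l0 l1] := lb z.
  have Cs : 0 <= CR + `|M| + `|Cd| by rewrite !addr_ge0.
  have FC := mulr_ge0 FK0 Cs.
  rewrite neg_ge0 /neg ge_max FC andbT.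
  (* The bound [dom] is available only where [fi] or [eta] is nonzero; where [l] vanishes, so does
     [h n]. *)
  have [l00|ln] := eqVneq (l z) 0.
    by rewrite /h l00 mul0r oppr0.
  have fx : fi z != 0 \/ eta z != 0.
    have [f0|f0] := eqVneq (fi z) 0; last by left.
    right; apply: contra_neq ln => et; by rewrite /l f0 et expr0n/= mul0r addr0.
  have hq : q n z <= `|Cd|.
    rewrite /q ler_pdivrMr//; apply: (@le_trans _ _ (Cd * (t - s n))).
      by have [_ h1 h2 _] := Hs n; apply: dom => //; exact: ltW.
    by apply: ler_wpM2r; [exact: ltW|exact: ler_norm].
  have hR := HCR z (rho n) (rho0 n) (rhor n).
  rewrite /h -mulrN; apply: (@le_trans _ _ (l z * (CR + `|M| + `|Cd|))); last first.
    exact: ler_wpM2r.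
  apply: ler_wpM2l => //; have := ler_norm M; move: hq hR; rewrite /Rn -/p; lra.
have Ineg : (fun n => I (fun z => neg (h n z))) @ \oo --> 0.
  rewrite -[X in _ --> X](I_cst (0 : R)); apply: (I_dct (C := (F + K) * (CR + `|M| + `|Cd|))).
  - by move=> n; apply: cont_neg; exact: ch.
  - exact: cont_cst.
  - by move=> n z; have /andP[n0 n1] := negh n z; rewrite ger0_norm.
  - move=> z; apply/cvgrPdist_le => k' k'0.
    have FK1 : 0 < F + K + 1 by rewrite ltr_wpDl.
    have k''0 : 0 < k' / (F + K + 1) by rewrite divr_gt0.
    have LzLa : 0 <= Lz + La by exact: addr_ge0.
    have all' : forall z y q q', `|al t z q - al t y q'| <= (Lz + La) * (dist1 z y + `|q - q'|).
      move=> z' y q' q''; apply: le_trans (al_lip _ _ _ _ _) _.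
      have d1 : 0 <= dist1 z' y by rewrite addr_ge0.
      have := mulr_ge0 Lz0 (normr_ge0 (q' - q'')); have := mulr_ge0 La0 d1; lra.
    have [r r0 Hr] := sc_pointwise a00 LzLa (al_bd t) all' v_lip v_bd cQ QB e0 e1 Lve Tt (fun y => sub y Tt ttb) z k''0.
    have /cvgrPdist_lt/(_ r r0)[N1 _ HN1] := @cvg_harmonic R.
    exists N1 => // n /= N1n; rewrite sub0r normrN.
    have /andP[n0 _] := negh n z; rewrite ger0_norm// /neg ge_max (ltW k'0) andbT.
    have [s1 s2 s3 _] := Hs n.
    have hn : n.+1%:R^-1 < r.
      by have := HN1 n N1n; rewrite /harmonic/= sub0r normrN gtr0_norm// invr_gt0.
    have := Hr (t - s n) (rho n) (ds n); rewrite (_ : t - (t - s n) = s n) => [H|]; last by ring.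
    have {}H : q n z <= Rn n z - M + k' / (F + K + 1).
      apply: H => //; first by move: (n.+1%:R^-1) hn s1 => w hn1 s1; lra.
      apply: lt_trans hn; rewrite /rho ltr_pdivrMr// mulrC -ltr_pdivrMr ?invr_gt0// invrK.
      by apply: lt_trans (_ : 1 * n.+1%:R < _); rewrite ?ltr_pM2r// mul1r ltr_nat.
    have /andP[l0 l1] := lb z.
    rewrite /h -mulrN; apply: (@le_trans _ _ (l z * (k' / (F + K + 1)))).
      by apply: ler_wpM2l => //; move: H; lra.
    rewrite mulrCA; apply: ler_piMr; first exact: ltW.
    by rewrite ler_pdivrMr// mul1r; lra.
have [K' HK'] := disc_sc Tt.
pose Un n := I (fun z => p z * (Dm true (rho n) (fun y => fi y * v true y) z + Dm false (rho n) (fun y => fi y * v false y) z)).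
have cUn : Un @ \oo --> I (fun z => p z * W z).
  apply: (I_dct (C := B * Wb)).
  - move=> n; have cf1 := @cv true; have cf2 := @cv false.
    have c1 : continuous (Dm true (rho n) (fun y => fi y * v true y)) by apply: cont_Dm; ct.
    have c2 : continuous (Dm false (rho n) (fun y => fi y * v false y)) by apply: cont_Dm; ct.
    by ct.
  - by ct.
  - by move=> n z; apply: prod_le_norm; [exact: pB|exact: Dmb].
  - by move=> z; apply: cvgM; [exact: cvg_cst|exact: Wlim].
have step n : k <= (Un n - I (fun z => p z * W z)) + K' * rho n + I (fun z => neg (h n z)).
  have [s1 s2 s3 s4] := Hs n.
  have cpn := cps n; have cqn := cq n; have cRnn := cRn n; have chn := ch n; have cnh := cont_neg chn.
  have clps : continuous (fun z => la (sc Q e (s n) z)) := cont_comp cpn cla.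
  have b1 : lyap p - lyap (sc Q e (s n)) <= (t - s n) * I (fun z => l z * q n z).
    rewrite /lyap -IB; [|by ct..]; rewrite -IZ; [|by ct].
    apply: I_le => [||z]; [by ct|by ct|].
    have -> : (t - s n) * (l z * q n z) = l z * (p z - sc Q e (s n) z).
      by rewrite /q; field; rewrite gt_eqF.
    have [_ _ _ _ hc] := prof (pB z Tt) (pB z (Ts n)); rewrite -/p in hc.
    have := ler_wpM2l (sqr_ge0 (eta z)) hc; rewrite /l; lra.
  have b2 : rate p + k < I (fun z => l z * q n z).
    by have := lt_le_trans s4 b1; rewrite [X in _ < X]mulrC ltr_pM2r.
  have b3 : I (fun z => l z * q n z) = I (fun z => l z * Rn n z) - M * I l - I (h n).
    rewrite -IZ// -IB; [|by ct..]; rewrite -IB; [|by ct..].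
    by apply: eq_I => z; rewrite /h; ring.
  have b4 : - I (h n) <= I (fun z => neg (h n z)).
    rewrite -mulN1r -IZ//; apply: I_le => [||z]; [by ct|by []|].
    by rewrite mulN1r /neg le_max lexx.
  have b5 := HK' (rho n) (rho0 n) (rhor n).
  have b6 i : lam1 * I (fun z => Dp i rh p z ^+ 2) <= I (fun z => eta z ^+ 2 * E1 (p z) * Dp i (rho n) p z ^+ 2).
    have cD := @cont_Dp R i (rho n) _ cpt.
    apply: (@le_trans _ _ (lam1 * I (fun z => Dp i (rho n) p z ^+ 2))).
      apply: ler_wpM2l => //.
      have := I_sq_shift i (rho n) n.+2 cpt (pp Tt).
      rewrite (_ : n.+2%:R * rho n = rh); last by rewrite /rho mulrCA divff ?mulr1// pnatr_eq0.
      move=> hh.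
      have cs r : continuous (fun z => (p (sh i r z) - p z) ^+ 2) by ct.
      have E2 r : 0 < r -> I (fun z => Dp i r p z ^+ 2) = (r ^+ 2)^-1 * I (fun z => (p (sh i r z) - p z) ^+ 2).
        move=> r0; rewrite -IZ//; apply: eq_I => z; rewrite /Dp exprMn mulrC exprVn//.
      rewrite !E2// mulrC ler_pdivrMr ?exprn_gt0//; apply: le_trans hh _.
      rewrite [leRHS]mulrAC mulrC; rewrite -[leRHS]mulrA mulrC; rewrite le_eqVlt; apply/orP; left; apply/eqP.
      by rewrite /rho; field; rewrite !gt_eqF// ltr0n.
    rewrite -IZ; last by ct.
    apply: I_le => [||z]; [by ct|by ct|].
    by apply: ler_wpM2r; [exact: sqr_ge0|apply: lam1_le; exact: pB].
  have a02 : 0 <= a0 / 2 by rewrite divr_ge0// ltW.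
  have b7 := ler_wpM2l a02 (lerD (b6 true) (b6 false)).
  move: b2; rewrite b3 /rate.
  move: b4 b5 b7; rewrite -/p -/l -/(Rn n) -/(Un n).
  set x1 := I _; set x2 := I _; set x3 := I _; set x4 := I _; set x5 := I _; set x6 := I _.
  set x7 := I _; set x8 := I _; set x9 := I _.
  lra.
have lim0 : (fun n => (Un n - I (fun z => p z * W z)) + K' * rho n + I (fun z => neg (h n z))) @ \oo --> 0 + K' * 0 + 0.
  apply: cvgD => //; apply: cvgD.
    by rewrite -(subrr (I (fun z => p z * W z))); apply: cvgB => //; exact: cvg_cst.
  apply: cvgM; first exact: cvg_cst.
  rewrite -(mulr0 rh); apply: cvgM; first exact: cvg_cst.
  have H : (fun n : nat => @harmonic R n.+1) @ \oo --> 0 by rewrite cvg_shiftS; exact: cvg_harmonic.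
  exact: H.
have ck : (fun _ : nat => k) @ \oo --> k by exact: cvg_cst.
have H0 : k <= 0 + K' * 0 + 0 := lim_le ck lim0 step.
by move: H0; rewrite mulr0 !addr0 leNgt k0.
Qed.

End fixed_e.

Lemma sc_right_lyap e : 0 < e -> Num.sqrt (4 * B * e) <= R0 ->
  right_usc_on ta tb (fun t => lyap (sc Q e t)).
Proof.
move=> e0 eR t tat ttb k k0; set C : R := `|Cdom a1 V B M e|.
have FK0 : 0 <= F + K by exact: addr_ge0.
have C0 : 0 <= C := normr_ge0 _.
have C1 : 0 < (F + K) * C + 1 by have := mulr_ge0 FK0 C0; lra.
exists (k / ((F + K) * C + 1)); first by rewrite divr_gt0.
move=> s ts; rewrite -ltrBlDl ltr_pdivlMr// => sk stb.
have Tt : T0 < t by exact: lt_le_trans T0ta tat.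
have Ts : T0 < s by exact: lt_trans Tt ts.
have st0 : 0 <= s - t by rewrite subr_ge0 ltW.
have c1 : continuous (sc Q e t) := sconv_cont e0 (cQ Tt) (QB Tt).
have c2 : continuous (sc Q e s) := sconv_cont e0 (cQ Ts) (QB Ts).
have c3 : continuous (fun z => la (sc Q e t z)) := cont_comp c1 cla.
have c4 : continuous (fun z => la (sc Q e s z)) := cont_comp c2 cla.
apply: (@le_trans _ _ (lyap (sc Q e t) + (F + K) * C * (s - t))); last first.
  by rewrite lerD2l; apply: le_trans (ltW sk); rewrite mulrC ler_wpM2l// lerDl.
rewrite /lyap; apply: I_le_cst; [by ct|by ct|] => z.
have bt := sconv_bound e0 (QB Tt) z; have bs := sconv_bound e0 (QB Ts) z.
have [/andP[E0 EK] _ _ _ hc] := prof bs bt.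
have /andP[f0 f1] := fib z; have /andP[t0 t1] := etab z.
have X0 := sqr_ge0 (eta z).
have l0 : 0 <= fi z + eta z ^+ 2 * E (sc Q e s z) by rewrite addr_ge0// mulr_ge0.
have l1 : fi z + eta z ^+ 2 * E (sc Q e s z) <= F + K.
  by rewrite lerD//; apply: le_trans EK; apply: ler_piMl => //; rewrite exprn_ile1.
apply: (@le_trans _ _ (fi z * sc Q e t z + eta z ^+ 2 * la (sc Q e t z)
   + (fi z + eta z ^+ 2 * E (sc Q e s z)) * (sc Q e s z - sc Q e t z))).
  by have := ler_wpM2l X0 hc; rewrite /sc; lra.
rewrite lerD2l; have [fz|fx] : (fi z = 0 /\ eta z = 0) \/ (fi z != 0 \/ eta z != 0).
  have [?|?] := eqVneq (fi z) 0; have [?|?] := eqVneq (eta z) 0; by [left|right; left|right; right].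
  by rewrite fz.1 fz.2 expr0n/= mul0r addr0 mul0r mulr_ge0// mulr_ge0// addr_ge0.
have h : sc Q e s z - sc Q e t z <= Cdom a1 V B M e * (s - t).
  apply: (@sc_dom R a0 a1 V B M T0 al v Q e ta tb z) => //; last exact: ltW.
  by move=> y y1 y2; apply: (supp fx); [exact: le_trans y1 eR|exact: le_trans y2 eR].
rewrite -mulrA; apply: le_trans (ler_wpM2l l0 h) _.
apply: (@le_trans _ _ ((fi z + eta z ^+ 2 * E (sc Q e s z)) * (C * (s - t)))).
  by apply: ler_wpM2l => //; apply: ler_wpM2r => //; exact: ler_norm.
by apply: ler_wpM2r => //; exact: mulr_ge0.
Qed.

Definition rate0 (t : R) := I (fun z => Q z t * W z) + 2 * Lf * a1 ^+ 2
  + 4 * V * Lh * I (fun z => la (Q z t) * m z) + 2 * a1 ^+ 2 * Lh ^+ 2 * I (fun z => E (Q z t) * m z ^+ 2)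
  - a0 / 2 * lam1 * (I (fun z => Dp true rh (Q^~ t) z ^+ 2) + I (fun z => Dp false rh (Q^~ t) z ^+ 2)).

Let Wbound z : `|W z| <= Wb.
Proof.
have Hn n : `|Dm true (rh / n.+2%:R) (fun y => fi y * v true y) z
   + Dm false (rh / n.+2%:R) (fun y => fi y * v false y) z| <= Wb.
  by apply: Dmb; rewrite divr_gt0.
have c := lim_norm (@Wlim z).
have c2 : (fun _ : nat => Wb) @ \oo --> Wb by exact: cvg_cst.
exact: lim_le c c2 Hn.
Qed.

Let Crate := Wb + 4 * V * Lh * K + 2 * a1 ^+ 2 * Lh ^+ 2 * K + a0 / 2 * lam1 * (16 * B / rh ^+ 2).

(** Each integral in [rate] is Lipschitz in [p] on the range considered, so replacing [p] by [Q]
    costs a multiple of the integral of [p - Q], which is nonnegative. The terms in [Lz] are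
    absorbed by those in [M]. *)
Lemma rate_le e t : 0 < e -> ta <= t -> t <= tb ->
  rate (sc Q e t) <= rate0 t + Crate * I (fun z => sc Q e t z - Q z t).
Proof.
move=> e0 tat ttb; have Tt : T0 < t by exact: lt_le_trans T0ta tat.
set p := sc Q e t; set d := fun z => p z - Q z t.
have cp : continuous p := sconv_cont e0 (cQ Tt) (QB Tt).
have cq : continuous (Q^~ t) := cQ Tt.
have pB z : `|p z| <= B := sconv_bound e0 (QB Tt) z.
have pp : per p := sconv_per e0 (QB Tt) (pQ Tt).
have cd : continuous d by rewrite /d; ct.
have pd : per d by move=> i z; rewrite /d pp (pQ Tt).
have d0 z : 0 <= d z by rewrite subr_ge0; exact: (sconv_ge e0 (QB Tt)).
have nd z : `|p z - Q z t| = d z by rewrite ger0_norm// d0.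
have cEp : continuous (fun z => E (p z)) := cont_comp cp cE.
have clp : continuous (fun z => la (p z)) := cont_comp cp cla.
have PQ z := prof (pB z) (QB Tt z).
have h1 : I (fun z => p z * W z) <= I (fun z => Q z t * W z) + Wb * I d.
  rewrite -IZ// -ID; [|by ct..]; apply: I_le => [||z]; [by ct|by ct|].
  have -> : p z * W z = Q z t * W z + W z * d z by rewrite /d; ring.
  rewrite lerD2l; apply: ler_wpM2r => //; exact: le_trans (ler_norm _) (Wbound z).
have cEq : continuous (fun z => E (Q z t)) := cont_comp cq cE.
have clq : continuous (fun z => la (Q z t)) := cont_comp cq cla.
have lm (g : R -> R) : continuous (fun z => g (p z)) -> continuous (fun z => g (Q z t)) ->
    (forall z, `|g (p z) - g (Q z t)| <= K * `|p z - Q z t|) ->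
    forall n, I (fun z => g (p z) * m z ^+ n) <= I (fun z => g (Q z t) * m z ^+ n) + K * I d.
  move=> cg cgq gL n; rewrite -IZ// -ID; [|by ct..]; apply: I_le => [||z]; [by ct|by ct|].
  have /andP[m0 m1] := mb z; rewrite -lerBlDl -mulrBl.
  apply: le_trans (ler_norm _) _; rewrite -[leRHS]mulr1; apply: prod_le_norm.
    by rewrite -nd.
  by rewrite ger0_norm ?exprn_ge0// exprn_ile1.
have h2 : I (fun z => la (p z) * m z) <= I (fun z => la (Q z t) * m z) + K * I d.
  by apply: (lm la _ _ _ 1%N) => // z; have [_ _ []] := PQ z.
have h3 : I (fun z => E (p z) * m z ^+ 2) <= I (fun z => E (Q z t) * m z ^+ 2) + K * I d.
  by apply: (lm E _ _ _ 2%N) => // z; have [_ _ []] := PQ z.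
have h4 : 0 <= I (fun z => fi z + eta z ^+ 2 * E (p z)).
  apply: I_ge0 => z; have /andP[f0 f1] := fib z; rewrite addr_ge0// mulr_ge0 ?sqr_ge0//.
  by have [/andP[]] := prof (pB z) (pB z).
have h5 i : I (fun z => Dp i rh (Q^~ t) z ^+ 2) <= I (fun z => Dp i rh p z ^+ 2) + 8 * B / rh ^+ 2 * I d.
  have cD1 := @cont_Dp R i rh _ cp; have cD2 := @cont_Dp R i rh _ cq.
  have Id : I (fun z => d (sh i rh z) + d z) = 2 * I d.
    by rewrite ID ?I_sh//; [ring|ct].
  have -> : 8 * B / rh ^+ 2 * I d = I (fun z => 4 * B / rh ^+ 2 * (d (sh i rh z) + d z)).
    by rewrite IZ; [rewrite Id; field; rewrite gt_eqF|ct].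
  rewrite -ID; [|by ct..]; apply: I_le => [||z]; [by ct|by ct|].
  rewrite -lerBlDl.
  have -> : Dp i rh (Q^~ t) z ^+ 2 - Dp i rh p z ^+ 2 =
    ((d z - d (sh i rh z)) * ((Q (sh i rh z) t + p (sh i rh z)) - (Q z t + p z))) / rh ^+ 2.
    by rewrite /d /Dp; field; rewrite gt_eqF.
  have -> : 4 * B / rh ^+ 2 * (d (sh i rh z) + d z) = ((d (sh i rh z) + d z) * (4 * B)) / rh ^+ 2.
    by field; rewrite gt_eqF.
  rewrite ler_pM2r ?invr_gt0 ?exprn_gt0//; apply: le_trans (ler_norm _) _; apply: prod_le_norm.
    apply: le_trans (ler_normB _ _) _.
    by rewrite (ger0_norm (d0 z)) (ger0_norm (d0 (sh i rh z))) addrC.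
  have := pB z; have := pB (sh i rh z); have := QB Tt z; have := QB Tt (sh i rh z).
  rewrite !ler_norml => /andP[? ?] /andP[? ?] /andP[? ?] /andP[? ?].
  by apply/andP; split; lra.
have Vh : 0 <= 4 * V * Lh by rewrite !mulr_ge0.
have ah : 0 <= a1 ^+ 2 * Lh ^+ 2 by rewrite mulr_ge0 ?sqr_ge0.
have al0 : 0 <= a0 / 2 * lam1 by rewrite mulr_ge0// divr_ge0// ltW.
have k2 := ler_wpM2l Vh h2; have k3 := ler_wpM2l ah h3.
have k4 : 0 <= (M - 2 * Lz) * I (fun z => fi z + eta z ^+ 2 * E (p z)) by rewrite mulr_ge0// subr_ge0.
have k5 := ler_wpM2l al0 (lerD (h5 true) (h5 false)).
rewrite /rate /rate0 /Crate.
move: h1 k2 k3 k4 k5.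
set x1 := I _; set x2 := I _; set x3 := I _; set x4 := I _; set x5 := I _; set x6 := I _.
set x7 := I _; set x8 := I _; set x9 := I _; set x10 := I _; set x11 := I _; set x12 := I _.
have -> : 16 * B / rh ^+ 2 = 2 * (8 * B / rh ^+ 2) by field; rewrite gt_eqF.
move: (8 * B / rh ^+ 2) => y0.
lra.
Qed.

(** Stopping time at the ends of the window makes the rate a continuous function on the whole line,
    as the lemmas on [J] require. *)
Let clamp (t : R) := Num.max ta (Num.min t tb).

Let clampP t : ta <= clamp t <= tb.
Proof. by rewrite /clamp le_max lexx ge_max tab ge_min lexx orbT. Qed.

Let clampE t : ta <= t -> t <= tb -> clamp t = t.
Proof. by move=> h1 h2; rewrite /clamp min_l// max_r. Qed.

Let Tclamp t : T0 < clamp t.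
Proof. by have /andP[h _] := clampP t; exact: lt_le_trans T0ta h. Qed.

Let cQclamp z : continuous (fun t => Q z (clamp t)).
Proof.
move=> t; apply: (continuous_comp (f := clamp)); last exact: tQ.
have : continuous clamp by apply: cont_max; [exact: cont_cst|apply: cont_min; [exact: cont_idR|exact: cont_cst]].
exact.
Qed.

Let B0' z t : `|Q z (clamp t)| <= B. Proof. exact: QB. Qed.

Lemma rate0_cont : continuous (fun t => rate0 (clamp t)).
Proof.
have cD i : continuous (fun t => I (fun z => Dp i rh (Q^~ (clamp t)) z ^+ 2)).
  apply: (@cont_I_time R ((2 * B / rh) ^+ 2) (fun z t => Dp i rh (Q^~ (clamp t)) z ^+ 2)).
  - by move=> t; have c := @cont_Dp R i rh _ (cQ (Tclamp t)); ct.
  - move=> z t; rewrite normrX lerXn2r ?nnegrE ?divr_ge0 ?mulr_ge0 ?(ltW rh0)//.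
    rewrite /Dp normrM normfV (gtr0_norm rh0) ler_pM2r ?invr_gt0//.
    by apply: le_trans (ler_normB _ _) _; have := B0' z t; have := B0' (sh i rh z) t; lra.
  - by move=> z; have c1 := @cQclamp z; have c2 := @cQclamp (sh i rh z); rewrite /Dp; ct.
have c1 : continuous (fun t => I (fun z => Q z (clamp t) * W z)).
  apply: (@cont_I_time R (B * Wb) (fun z t => Q z (clamp t) * W z)).
  - by move=> t; have c := cQ (Tclamp t); ct.
  - by move=> z t; apply: prod_le_norm.
  - by move=> z; have c := @cQclamp z; ct.
have cg (g : R -> R) n : continuous g -> (forall x : R, `|x| <= B -> `|g x| <= K) ->
    continuous (fun t => I (fun z => g (Q z (clamp t)) * m z ^+ n)).
  move=> cg gK; apply: (@cont_I_time R K (fun z t => g (Q z (clamp t)) * m z ^+ n)).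
  - by move=> t; have c := cont_comp (cQ (Tclamp t)) cg; ct.
  - move=> z t; rewrite -[K]mulr1; apply: prod_le_norm; first exact: gK.
    by have /andP[m0 m1] := mb z; rewrite ger0_norm ?exprn_ge0// exprn_ile1.
  - by move=> z; have c := cont_comp (@cQclamp z) cg; ct.
have c4 := cg la 1%N cla; have c5 := cg E 2 cE.
have {}c4 : continuous (fun t => I (fun z => la (Q z (clamp t)) * m z)).
  by apply: c4 => x xB; have [_ [_ /andP[l0 l1]] _ _ _] := prof xB xB; rewrite ger0_norm.
have {}c5 : continuous (fun t => I (fun z => E (Q z (clamp t)) * m z ^+ 2)).
  by apply: c5 => x xB; have [/andP[l0 l1] _ _ _ _] := prof xB xB; rewrite ger0_norm.
by have c2 := @cD true; have c3 := @cD false; rewrite /rate0; ct.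
Qed.

Let defect e t := I (fun z => sc Q e t z - Q z t).

(** Again Fatou: in time the sup-convolution is lower semicontinuous and [Q] is continuous, so the
    negative part of the change tends to 0 pointwise and boundedly. *)
Let defect_lsc e : 0 < e -> lsc_on ta tb (defect e).
Proof.
move=> e0 t /andP[tat ttb] k k0; apply: contrapT => Hn.
have /choice[s Hs] : forall n : nat, exists s, [/\ ta <= s <= tb, `|s - t| < n.+1%:R^-1 &
    defect e s < defect e t - k].
  move=> n; apply: contrapT => Hs; apply: Hn; exists (n.+1%:R^-1); first by rewrite invr_gt0.
  by move=> s s1 s2; rewrite leNgt; apply/negP => lt; apply: Hs; exists s; split.
have Tt : T0 < t by exact: lt_le_trans T0ta tat.
have Ts n : T0 < s n by have [/andP[h _] _ _] := Hs n; exact: lt_le_trans T0ta h.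
have cp u : T0 < u -> continuous (sc Q e u) by move=> Tu; exact: (sconv_cont e0 (cQ Tu) (QB Tu)).
have pB u z : T0 < u -> `|sc Q e u z| <= B by move=> Tu; exact: (sconv_bound e0 (QB Tu)).
pose g n z := (sc Q e (s n) z - Q z (s n)) - (sc Q e t z - Q z t).
have cs n : continuous (g n).
  by have c1 := cp _ (Ts n); have c2 := cp _ Tt; have c3 := cQ (Ts n); have c4 := cQ Tt; rewrite /g; ct.
have Ineg : (fun n => I (fun z => neg (g n z))) @ \oo --> 0.
  rewrite -[X in _ --> X](I_cst (0 : R)); apply: (I_dct (C := 4 * B)).
  - by move=> n; apply: cont_neg; exact: cs.
  - exact: cont_cst.
  - move=> n z; rewrite ger0_norm ?neg_ge0// /neg ge_max mulr_ge0// andbT.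
    have := pB _ z (Ts n); have := pB _ z Tt; have := QB (Ts n) z; have := QB Tt z.
    rewrite /g !ler_norml => /andP[? ?] /andP[? ?] /andP[? ?] /andP[? ?]; lra.
  - move=> z; apply/cvgrPdist_le => k' k'0.
    have k2 : 0 < k' / 2 by rewrite divr_gt0.
    have [r1 r10 H1] := @sc_lsc R Q B T0 e t z (k' / 2) QB cQ tQ e0 Tt k2.
    have /cvgrPdist_lt/(_ _ k2)[r2 /= r20 H2] := @tQ z t Tt.
    have r0 : 0 < Num.min r1 r2 by rewrite lt_min r10.
    have /cvgrPdist_lt/(_ _ r0)[N1 _ HN1] := @cvg_harmonic R.
    exists N1 => // n /= N1n; rewrite sub0r normrN ger0_norm ?neg_ge0// /neg ge_max (ltW k'0) andbT.
    have := HN1 n N1n; rewrite /harmonic/= sub0r normrN gtr0_norm ?invr_gt0// lt_min => /andP[n1 n2].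
    have [_ s2 _] := Hs n.
    have h1 := H1 (s n) (lt_trans s2 n1).
    have := H2 (s n); rewrite /= distrC (lt_trans s2 n2) => /(_ isT); rewrite ltr_norml => /andP[h2 _].
    by rewrite /g; lra.
have step n : k <= I (fun z => neg (g n z)).
  have [_ _ s3] := Hs n.
  have c1 := cp _ (Ts n); have c2 := cp _ Tt; have c3 := cQ (Ts n); have c4 := cQ Tt; have c5 := @cs n.
  have : - I (g n) <= I (fun z => neg (g n z)).
    rewrite -mulN1r -IZ//; apply: I_le => [||z]; [by ct|exact: cont_neg|].
    by rewrite mulN1r /neg le_max lexx.
  have -> : I (g n) = defect e (s n) - defect e t by rewrite /defect -IB; [|by ct..].
  by lra.
have ck : (fun _ : nat => k) @ \oo --> k by exact: cvg_cst.
by have := lim_le ck Ineg step; rewrite leNgt k0.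
Qed.

(** For parameters [e n] tending to 0 the differential inequality holds up to a multiple of
    [defect (e n)], which tends to 0 pointwise and boundedly; [dini_limit] removes it. *)
Theorem main_inequality : lyap (Q^~ tb) - lyap (Q^~ ta) <= J ta tb (fun t => rate0 (clamp t)).
Proof.
(* Small enough for [Lv * e <= 1] and for every maximiser to stay within [R0]. *)
pose e1 := Num.min (1 / (1 + Lv)) (R0 ^+ 2 / (4 * B + 1)).
have B1 : 0 < 4 * B + 1 by rewrite ltr_wpDl// mulr_ge0.
have Lv1 : 0 < 1 + Lv by rewrite ltr_pwDl.
have e10 : 0 < e1 by rewrite lt_min !divr_gt0// exprn_gt0.
pose e (n : nat) := e1 / n.+1%:R.
have e0 n : 0 < e n by rewrite divr_gt0.
have ele n : e n <= e1 by rewrite ler_pdivrMr// ler_peMr ?(ltW e10)// ler1n.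
have e_1 n : e n <= 1.
  apply: le_trans (ele n) _; by rewrite /e1 ge_min ler_pdivrMr// mul1r lerDl Lv0.
have Lve n : Lv * e n <= 1.
  apply: le_trans (ler_wpM2l Lv0 (ele n)) _.
  apply: (@le_trans _ _ (Lv * (1 / (1 + Lv)))); first by apply: ler_wpM2l => //; rewrite ge_min lexx.
  by rewrite mulrA mulr1 ler_pdivrMr// mul1r; lra.
have eR n : Num.sqrt (4 * B * e n) <= R0.
  rewrite -(gtr0_norm R00) -sqrtr_sqr ler_wsqrtr//.
  apply: (@le_trans _ _ (4 * B * (R0 ^+ 2 / (4 * B + 1)))).
    by apply: ler_wpM2l; [rewrite mulr_ge0|apply: le_trans (ele n) _; rewrite ge_min lexx orbT].
  by rewrite mulrA ler_pdivrMr// mulrC; apply: ler_wpM2l; [exact: sqr_ge0|lra].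
have ec : e @ \oo --> 0.
  rewrite -(mulr0 e1); apply: cvgM; first exact: cvg_cst.
  exact: cvg_harmonic.
have pB n t z : T0 < t -> `|sc Q (e n) t z| <= B.
  by move=> Tt; exact: (sconv_bound (e0 n) (QB Tt)).
have cp n t : T0 < t -> continuous (sc Q (e n) t).
  by move=> Tt; exact: (sconv_cont (e0 n) (cQ Tt) (QB Tt)).
have scc t z : T0 < t -> (fun n => sc Q (e n) t z) @ \oo --> Q z t.
  by move=> Tt; exact: (sc_cvg (x := z) QB cQ Tt e0 ec).
have lyapc t : T0 < t -> (fun n => lyap (sc Q (e n) t)) @ \oo --> lyap (Q^~ t).
  move=> Tt; apply: (I_dct (C := F * B + K)).
  - by move=> n; have c1 := cp n _ Tt; have c2 := cont_comp c1 cla; ct.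
  - by have c1 := cQ Tt; have c2 := cont_comp c1 cla; ct.
  - move=> n z; have := pB n _ z Tt => b; have [_ [_ /andP[l0 l1]] _ _ _] := prof b b.
    have /andP[f0 f1] := fib z; have /andP[t0 t1] := etab z.
    apply: le_trans (ler_normD _ _) _; apply: lerD; first by apply: prod_le_norm => //; rewrite ger0_norm.
    rewrite -[K]mul1r; apply: prod_le_norm; last by rewrite ger0_norm.
    by rewrite ger0_norm ?sqr_ge0// exprn_ile1.
  - move=> z; apply: cvgD; first by apply: cvgM; [exact: cvg_cst|exact: scc].
    apply: cvgM; first exact: cvg_cst.
    have /cvg_seqP H := @cla (Q z t); exact: H _ (scc _ z Tt).
have Crate0 : 0 <= Crate.
  have Wb0 : 0 <= Wb by exact: le_trans (normr_ge0 _) (Wbound (0, 0)).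
  have ? : 0 <= a0 / 2 * lam1 by rewrite mulr_ge0// divr_ge0// ltW.
  have h1 : 0 <= 4 * V * Lh * K by rewrite !mulr_ge0.
  have h2 : 0 <= 2 * a1 ^+ 2 * Lh ^+ 2 * K by rewrite !mulr_ge0 ?exprn_ge0.
  have h3 : 0 <= 16 * B / rh ^+ 2 by rewrite divr_ge0 ?mulr_ge0 ?exprn_ge0 ?(ltW rh0).
  by rewrite /Crate !addr_ge0// mulr_ge0.
have Tt t : ta <= t -> T0 < t by exact: lt_le_trans.
apply: (dini_limit (C := Crate) (e := fun n => defect (e n)) (F := fun n t => lyap (sc Q (e n) t))) => //.
- exact: rate0_cont.
- by move=> n; exact: defect_lsc.
- exists (2 * B) => n t /andP[tat ttb]; rewrite /defect.
  have c1 := cp n _ (Tt _ tat); have c2 := cQ (Tt _ tat).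
  rewrite I_ge0/=; last by move=> z; rewrite subr_ge0; exact: (sconv_ge (e0 n) (QB (Tt _ tat))).
  rewrite -[leRHS]I_cst; apply: I_le => [||z]; [by ct|by ct|].
  have := pB n _ z (Tt _ tat); have := QB (Tt _ tat) z.
  by rewrite !ler_norml => /andP[? ?] /andP[? ?]; lra.
- move=> t /andP[tat ttb]; rewrite -[X in _ --> X](I_cst (0 : R)); apply: (I_dct (C := 2 * B)).
  + by move=> n; have c1 := cp n _ (Tt _ tat); have c2 := cQ (Tt _ tat); ct.
  + exact: cont_cst.
  + move=> n z; apply: le_trans (ler_normB _ _) _.
    by have := pB n _ z (Tt _ tat); have := QB (Tt _ tat) z; lra.
  + move=> z; rewrite -(subrr (Q z t)); apply: cvgB; [exact: scc (Tt _ tat)|exact: cvg_cst].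
- by move=> n; exact: sc_right_lyap.
- move=> n t tat ttb k k0.
  have [r r0 Hr] := lyap_dini (e0 n) (e_1 n) (Lve n) (eR n) tat ttb k0.
  exists r => // s s1 s2 s3; apply: le_trans (Hr s s1 s2 s3) _.
  apply: ler_wpM2r; first by rewrite subr_ge0 ltW.
  rewrite lerD2r clampE//; last exact: ltW.
  by apply: rate_le => //; exact: ltW.
- by apply: lyapc; exact: Tt.
- by apply: lyapc; exact: Tt.
Qed.

End MainInequality.

(** * Taylor expansions, periodicity and category *)

Section Calculus.
Variable R : realType.
Implicit Types (x y r k e : R) (g : R -> R).

Lemma taylor1 g x (l : R) : is_derive x (1 : R) g l -> forall k, 0 < k -> exists2 r, 0 < r &
  forall a, `|a| < r -> `|g (x + a) - g x - l * a| <= k * `|a|.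
Proof.
case=> dg <- k k0.
have /cvgrPdist_le/(_ k k0)[r /= r0 Hr] :
  (fun h => h^-1 *: ((g \o shift x) (h *: (1 : R)) - g x)) @ (0 : R)^' --> 'D_1 g x := dg.
exists r => // a ar; have [->|an] := eqVneq a 0.
  by rewrite addr0 subrr mulr0 subr0 normr0 mulr0.
have := Hr a; rewrite /= sub0r normrN ar => /(_ isT an).
rewrite /shift /= distrC => h.
have {}h : `|a^-1 * (g (x + a) - g x) - 'D_1 g x| <= k.
  by move: h; rewrite /= /GRing.scale/= mulr1 (addrC a).
have -> : g (x + a) - g x - 'D_1 g x * a = (a^-1 * (g (x + a) - g x) - 'D_1 g x) * a by field.
by rewrite normrM ler_wpM2r.
Qed.

Lemma mvt g g1 a b : a <= b -> (forall y, is_derive y (1 : R) g (g1 y)) ->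
  exists2 c, a <= c <= b & g b - g a = g1 c * (b - a).
Proof.
move=> ab dg; have cg : {within `[a, b], continuous g}.
  by apply: continuous_subspaceT => y; exact: is_derive_continuous (dg y).
have [c] := MVT_segment ab (fun y _ => dg y) cg.
by rewrite in_itv/= => cab E; exists c.
Qed.

Lemma lip_deriv g g1 (C : R) : (forall y, is_derive y (1 : R) g (g1 y)) -> (forall y, `|g1 y| <= C) ->
  forall x y, `|g x - g y| <= C * `|x - y|.
Proof.
move=> dg gC.
have H a b : a <= b -> `|g b - g a| <= C * `|b - a|.
  by move=> ab; have [c _ ->] := mvt ab dg; rewrite normrM ler_wpM2r.
move=> x y; case: (leP y x) => [|/ltW] xy; first exact: H.
by rewrite distrC (distrC x); exact: H.
Qed.

(** The mean value theorem for the even function [g (x + y) + g (x - y) - H y^2] leaves a difference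
    of values of [g1], for which the first order expansion at [x] suffices. *)
Lemma taylor2 g g1 x (H : R) : (forall y, is_derive y (1 : R) g (g1 y)) ->
  is_derive x (1 : R) g1 H -> forall k, 0 < k -> exists2 r, 0 < r &
  forall a, `|a| < r -> `|g (x + a) + g (x - a) - 2 * g x - H * a ^+ 2| <= k * a ^+ 2.
Proof.
move=> dg dg1 k k0; have k2 : 0 < k / 2 by rewrite divr_gt0.
have [r r0 Hr] := taylor1 dg1 k2; exists r => //.
suff main a : 0 <= a -> a < r -> `|g (x + a) + g (x - a) - 2 * g x - H * a ^+ 2| <= k * a ^+ 2.
  move=> a ar; have [a0|/ltW a0] := leP 0 a; first by apply: main => //; rewrite ger0_norm in ar.
  have := main (- a); rewrite opprK sqrrN (addrC (g (x - a))); apply; rewrite ?oppr_ge0//.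
  by rewrite ler0_norm in ar.
move=> a0 ar.
pose u y := g (x + y) + g (x - y) - H * y ^+ 2.
pose u1 y := g1 (x + y) - g1 (x - y) - H * (2 * y).
have du y : is_derive y (1 : R) u (u1 y).
  have d1 : is_derive y (1 : R) (fun y => g (x + y)) (g1 (x + y)).
    have ds : is_derive y (1 : R) (fun y => x + y) 1.
      rewrite -[X in is_derive _ _ _ X]add0r; exact: is_deriveD.
    have := @is_derive1_comp R g (fun y => x + y) y (g1 (x + y)) 1 (dg _) ds.
    by rewrite mulr1.
  have d2 : is_derive y (1 : R) (fun y => g (x - y)) (- g1 (x - y)).
    have ds : is_derive y (1 : R) (fun y => x - y) (- 1).
      rewrite -[X in is_derive _ _ _ X]add0r; exact: is_deriveD.
    have := @is_derive1_comp R g (fun y => x - y) y (g1 (x - y)) (- 1) (dg _) ds.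
    by rewrite mulrN1.
  have d3 : is_derive y (1 : R) (fun y => y ^+ 2) (2 * y).
    have := @is_deriveX R _ id 2 y 1 1 (is_derive_id _ _).
    by rewrite /= expr1 /GRing.scale/= mulr1.
  have d4 : is_derive y (1 : R) (fun y => H * y ^+ 2) (H * (2 * y)).
    exact: (is_deriveZ H d3).
  by rewrite /u /u1; apply: is_deriveB; apply: is_deriveD.
have [c /andP[c0 ca] E] := mvt a0 du.
have -> : g (x + a) + g (x - a) - 2 * g x - H * a ^+ 2 = u1 c * a.
  by rewrite subr0 in E; rewrite -E /u !addr0 !subr0 expr0n/= mulr0; ring.
rewrite normrM (ger0_norm a0) (_ : k * a ^+ 2 = k * a * a); last by ring.
apply: ler_wpM2r => //.
have cr : `|c| < r by rewrite ger0_norm//; exact: le_lt_trans ca ar.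
have h1 := Hr c cr; have h2 := Hr (- c); rewrite normrN in h2; have {}h2 := h2 cr.
have -> : u1 c = (g1 (x + c) - g1 x - H * c) - (g1 (x - c) - g1 x - H * - c) by rewrite /u1; ring.
apply: le_trans (ler_normB _ _) _; apply: le_trans (lerD h1 h2) _.
rewrite (ger0_norm c0) -mulrDl -splitr; by apply: ler_wpM2l => //; exact: ltW.
Qed.

End Calculus.

(** * Uniformity and positivity on the torus *)

Section Periodic.
Variable R : realType.
Implicit Types (x y z : R * R) (i : bool) (r k e : R).

Lemma per_nat (f : R * R -> R) i (n : nat) z : per f -> f (sh i n%:R z) = f z.
Proof.
move=> pf; elim: n => [|n IH]; first by rewrite sh0.
by rewrite -IH -(pf i (sh i n%:R z)) shD natr1.
Qed.

Lemma per_int (f : R * R -> R) i (n : int) z : per f -> f (sh i n%:~R z) = f z.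
Proof.
case: n => n pf; first exact: per_nat.
by rewrite NegzE mulrNz -(per_nat i n.+1 (sh i _ z) pf) shK.
Qed.

(* [near_rep x0 z] is congruent to [z] modulo the period lattice and lies in
   the unit square centred at [x0]. *)
Definition near_rep x0 z : R * R :=
  (z.1 - (Num.floor (z.1 - x0.1 + 1/2))%:~R, z.2 - (Num.floor (z.2 - x0.2 + 1/2))%:~R).

Lemma near_repP x0 z : `|(near_rep x0 z).1 - x0.1| <= 1/2 /\ `|(near_rep x0 z).2 - x0.2| <= 1/2.
Proof.
have H (a b : R) : `|a - (Num.floor (a - b + 1/2))%:~R - b| <= 1/2.
  have := floor_le_tmp (a - b + 1/2); have := floorD1_gt (a - b + 1/2).
  by rewrite intrD ler_norml; lra.
by split; exact: H.
Qed.

Lemma near_rep_per (T : Type) (F : R * R -> T) x0 z :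
  (forall i n y, F (sh i n%:~R y) = F y) -> F (near_rep x0 z) = F z.
Proof.
move=> pF; rewrite -(pF true (Num.floor (z.1 - x0.1 + 1/2)) (near_rep x0 z)).
rewrite -(pF false (Num.floor (z.2 - x0.2 + 1/2))) /near_rep /sh/= !subrK.
by case: z.
Qed.

Lemma unif_per (f : R * R -> R) e : continuous f -> per f -> 0 < e -> exists2 r, 0 < r &
  forall x y, `|y.1 - x.1| <= r -> `|y.2 - x.2| <= r -> `|f y - f x| <= e.
Proof.
move=> cf pf e0; have e2 : 0 < e / 2 by rewrite divr_gt0.
pose K := (`[- (1/2), 1/2]%classic `*` `[- (1/2), 1/2]%classic) : set (R * R).
have cK : compact K by apply: compact_setX; exact: segment_compact.
move/compact_near_coveringP : cK => /(_ R ((0 : R)^'+)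
  (fun r x => forall y, `|y.1 - x.1| <= r -> `|y.2 - x.2| <= r -> `|f y - f x| <= e) _) [].
  move=> x _.
  have /cvgrPdist_lt/(_ _ e2)[[A1 A2] /= [[r1 /= r10 H1] [r2 /= r20 H2]] HA] := cf x.
  pose r := Num.min r1 r2 / 2.
  have m0 : 0 < Num.min r1 r2 by rewrite lt_min r10.
  have r0 : 0 < r by rewrite divr_gt0.
  have HB y : `|y.1 - x.1| < 2 * r -> `|y.2 - x.2| < 2 * r -> `|f x - f y| < e / 2.
    rewrite /r (mulrC 2) divfK// !lt_min => /andP[y1 _] /andP[_ y2]; apply: HA; split => /=.
    - by apply: H1; rewrite /= distrC.
    - by apply: H2; rewrite /= distrC.
  exists ([set x' | `|x'.1 - x.1| < r /\ `|x'.2 - x.2| < r], [set s | 0 < s /\ s < r]).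
    split.
      exists (ball x.1 r, ball x.2 r); first by split; exact: nbhsx_ballx.
      by move=> y' [/= b1 b2]; rewrite !(distrC (y'.1)) (distrC (y'.2)).
    exists r => //= s; rewrite /= sub0r normrN => sr s0; split => //.
    by rewrite gtr0_norm in sr.
  move=> [x' s] /= [[d1 d2] [s0 sr]] y y1 y2.
  have h1 := HB x'; have h2 := HB y.
  have {}h1 : `|f x - f x'| < e / 2 by apply: h1; lra.
  have {}h2 : `|f x - f y| < e / 2.
    apply: h2.
    - have := ler_distD x'.1 y.1 x.1; lra.
    - have := ler_distD x'.2 y.2 x.2; lra.
  have := ler_distD (f x) (f y) (f x'); rewrite (distrC (f y) (f x)); lra.
move=> r /= r0 Hr; exists (r / 2); first by rewrite divr_gt0.
have HK : K `<=` (fun x => forall y, `|y.1 - x.1| <= r / 2 -> `|y.2 - x.2| <= r / 2 -> `|f y - f x| <= e).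
  apply: Hr => /=; last by rewrite divr_gt0.
  by rewrite /= sub0r normrN gtr0_norm ?divr_gt0// ltr_pdivrMr// ltr_pMr// ltr1n.
move=> x y y1 y2.
pose F (d : R * R) := fun x => `|f (x.1 + d.1, x.2 + d.2) - f x|.
have E : F (y.1 - x.1, y.2 - x.2) x = `|f y - f x|.
  by rewrite /F/= !(addrC x.1) !(addrC x.2) !subrK; case: (y).
rewrite -E -(near_rep_per (F := F _) (0, 0)); last first.
  move=> i n w; rewrite /F (per_int i n w pf); congr `|_ - _|.
  rewrite -[RHS](per_int i n _ pf); congr f.
  by case: i; rewrite /sh/=; congr pair; ring.
move: (near_rep (0, 0) x) (near_repP (0, 0) x) => w [w1 w2].
rewrite /F/=; apply: HK => /=.
- by split; rewrite /= in_itv/= -ler_norml; [move: w1|move: w2]; rewrite /= subr0.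
- by rewrite [X in `|X|](_ : _ = y.1 - x.1)//; ring.
- by rewrite [X in `|X|](_ : _ = y.2 - x.2)//; ring.
Qed.

Lemma I_eq0 (f : R * R -> R) z : continuous f -> per f -> (forall z, 0 <= f z) -> I f <= 0 -> f z = 0.
Proof.
move=> cf pf f0 If; apply/eqP; rewrite eq_le f0 andbT leNgt; apply/negP => fz.
(* Translated so that [z] becomes the centre of the unit square, away from its boundary. *)
pose g w := f (sh true (z.1 - 1/2) (sh false (z.2 - 1/2) w)).
have cg : continuous g by rewrite /g; ct.
have Ig : I g <= 0.
  rewrite /g (I_sh (f := fun w => f (sh true (z.1 - 1/2) w))); [|by ct|exact: per_sh].
  by rewrite I_sh.
have g0 w : 0 <= g w by exact: f0.
have gE : g (1/2, 1/2) = f z.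
  by rewrite /g /sh/= !(addrC (1/2)) !subrK; case: (z).
have e0 : 0 < f z / 2 by rewrite divr_gt0.
have [[A1 A2] /= [[r1 /= r10 H1] [r2 /= r20 H2]] HA] : \forall w \near (1/2 : R, 1/2 : R), `|g (1/2, 1/2) - g w| < f z / 2.
  by have /cvgrPdist_lt/(_ _ e0) := cg (1/2, 1/2).
pose d := Num.min (1/2) (Num.min (r1 / 2) (r2 / 2)).
have d0 : 0 < d by rewrite !lt_min !divr_gt0.
have [dh d1 d2] : [/\ d <= 1/2, d < r1 & d < r2].
  split; first by rewrite ge_min lexx.
  - by rewrite !gt_min (_ : r1 / 2 < r1) ?orbT// ltr_pdivrMr// ltr_pMr// ltr1n.
  - by rewrite !gt_min (_ : r2 / 2 < r2) ?orbT// ltr_pdivrMr// ltr_pMr// ltr1n.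
have low (x y : R) : 1/2 - d <= x <= 1/2 + d -> 1/2 - d <= y <= 1/2 + d -> f z / 2 <= g (x, y).
  move=> xd yd; have := HA (x, y); rewrite gE.
  have h1 : A1 x by apply: H1; rewrite /= ltr_norml; lra.
  have h2 : A2 y by apply: H2; rewrite /= ltr_norml; lra.
  by move=> /(_ (conj h1 h2)); rewrite /= ltr_norml => /andP[]; lra.
have cJ := cont_J (ler01 : 0 <= 1 :> R) cg.
have sub1 (h : R -> R) : continuous h -> (forall x : R, 0 <= h x) -> J (1/2 - d) (1/2 + d) h <= J 0 1 h.
  move=> ch h0; rewrite (@J_split R 0 (1/2 - d) 1 h ch); [|lra|lra].
  rewrite (@J_split R (1/2 - d) (1/2 + d) 1 h ch); [|lra|lra].
  by rewrite addrCA lerDl addr_ge0// J_ge0.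
have : f z / 2 * (2 * d) * (2 * d) <= I g.
  apply: le_trans (sub1 _ cJ _) => [|x]; last by apply: J_ge0.
  have -> : f z / 2 * (2 * d) * (2 * d) = J (1/2 - d) (1/2 + d) (fun=> f z / 2 * (2 * d)).
    by rewrite J_cst; [congr (_ * _); ring|lra].
  apply: J_le => // [|x xd]; first exact: cont_cst.
  have cx : continuous (fun y : R => g (x, y)) by exact: cont_pair2.
  apply: le_trans (sub1 _ cx _) => //.
  have -> : f z / 2 * (2 * d) = J (1/2 - d) (1/2 + d) (fun=> f z / 2).
    by rewrite J_cst; [congr (_ * _); ring|lra].
  apply: J_le => // [|y yd]; first exact: cont_cst.
  exact: low.
have : 0 < f z / 2 * (2 * d) * (2 * d) by rewrite !mulr_gt0.
lra.
Qed.

End Periodic.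

(** * A Baire category lemma *)

Section BaireClosed.
Variable R : realType.
Notation X := (R * R * R)%type.

Definition near3 (r : R) (x y : X) := [/\ `|y.1.1 - x.1.1| < r, `|y.1.2 - x.1.2| < r & `|y.2 - x.2| < r].

(** If no [En n] contained a portion of [E], boxes centred at points of [E] could be chosen, each
    inside the previous one and at most half its size, the next one avoiding [En 0], the next
    [En 1], and so on. Their common point lies in [E], since [E] is closed, and in no [En n]. *)
Lemma baire_closed (E : set X) (En : nat -> set X) (x0 : X) (r0 : R) :
  E x0 -> 0 < r0 ->
  (forall x, ~ E x -> exists2 r, 0 < r & forall y, near3 r x y -> ~ E y) ->
  (forall n x, near3 r0 x0 x -> ~ En n x -> exists2 r, 0 < r & forall y, near3 r x y -> ~ En n y) ->
  (forall x, E x -> near3 r0 x0 x -> exists n, En n x) ->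
  exists n x r, [/\ E x, 0 < r, forall y, near3 r x y -> near3 r0 x0 y &
    forall y, near3 r x y -> E y -> En n y].
Proof.
move=> Ex0 r00 cE cEn EEn; apply: contrapT => Hno.
have step (n : nat) (s : X * R) : E s.1 -> 0 < s.2 -> (forall y, near3 s.2 s.1 y -> near3 r0 x0 y) ->
  exists s' : X * R, [/\ E s'.1, 0 < s'.2, s'.2 <= s.2 / 2, near3 (s.2 / 2) s.1 s'.1 &
     forall y, near3 s'.2 s'.1 y -> ~ En n y].
  case: s => x r /= Ex r0' sub.
  have [y [ny Ey nE]] : exists y, [/\ near3 (r / 2) x y, E y & ~ En n y].
    apply: contrapT => H; apply: Hno; exists n, x, (r / 2); split => //.
    - by rewrite divr_gt0.
    - by move=> y [h1 h2 h3]; apply: sub; split; lra.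
    - by move=> y ny Ey; apply: contrapT => nE; apply: H; exists y.
  have ny0 : near3 r0 x0 y by apply: sub; case: ny => h1 h2 h3; split; lra.
  have [d d0 Hd] := cEn n y ny0 nE.
  exists (y, Num.min d (r / 2)); split => //=.
  - by rewrite lt_min d0 divr_gt0.
  - by rewrite ge_min lexx orbT.
  - by move=> w [h1 h2 h3]; apply: Hd; move: h1 h2 h3; rewrite !lt_min => /andP[? _] /andP[? _] /andP[? _].
pose good (s : X * R) := [/\ E s.1, 0 < s.2 & forall y, near3 s.2 s.1 y -> near3 r0 x0 y].
have /choice[F HF] : forall ns : nat * (X * R), exists s', good ns.2 ->
   [/\ E s'.1, 0 < s'.2, s'.2 <= ns.2.2 / 2, near3 (ns.2.2 / 2) ns.2.1 s'.1 &
     forall y, near3 s'.2 s'.1 y -> ~ En ns.1 y].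
  move=> [n s]; have [[g1 g2 g3]|ng] := pselect (good s); last by exists s.
  by have [s' Hs'] := step n s g1 g2 g3; exists s'.
pose fix S n := if n is n'.+1 then F (n', S n') else (x0, r0).
have gS n : good (S n).
  elim: n => [//|n IH]; have [h1 h2 h3 h4 h5] := HF (n, S n) IH.
  split => // y ny; case: IH => _ _; apply; case: ny h4 => a1 a2 a3 [b1 b2 b3].
  by split; [have := ler_distD (S n.+1).1.1.1 y.1.1 (S n).1.1.1|
             have := ler_distD (S n.+1).1.1.2 y.1.2 (S n).1.1.2|
             have := ler_distD (S n.+1).1.2 y.2 (S n).1.2]; move: h3 a1 a2 a3 b1 b2 b3; rewrite /=; lra.
have HS n := HF (n, S n) (gS n).
pose c (j : 'I_3) (x : X) : R := match val j with 0%N => x.1.1 | 1%N => x.1.2 | _ => x.2 end.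
have rr n : (S n).2 <= r0 / 2 ^+ n.
  elim: n => [|n IH]; first by rewrite expr0 divr1.
  have [_ _ h _ _] := HS n; apply: le_trans h _; rewrite exprS invfM mulrA (mulrAC r0).
  by rewrite ler_pM2r ?invr_gt0.
have cc j n m : `|c j (S (n + m)%N).1 - c j (S n).1| <= (S n).2 - (S (n + m)%N).2.
  elim: m => [|m IH]; first by rewrite addn0 !subrr normr0.
  rewrite addnS; have [_ _ h1 [b1 b2 b3] _] := HS (n + m)%N.
  have bj : `|c j (S (n + m).+1).1 - c j (S (n + m)%N).1| <= (S (n + m)%N).2 / 2.
    by case: j {IH} => [[|[|[|]]]]//= ?; rewrite /c/=; exact: ltW.
  have := ler_distD (c j (S (n + m)%N).1) (c j (S (n + m).+1).1) (c j (S n).1).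
  by move: h1 bj IH; rewrite /=; lra.
have lim j : exists l, forall n, `|l - c j (S n).1| <= (S n).2.
  (* The limit of each coordinate is the supremum of the left end points of the nested intervals. *)
  pose lo n := c j (S n).1 - (S n).2.
  have hub : has_sup [set lo n | n in [set: nat]].
    split; first by exists (lo 0%N), 0%N.
    exists (c j (S 0%N).1 + (S 0%N).2) => _ [n _ <-].
    have := cc j 0%N n; rewrite add0n ler_norml => /andP[_]; have [_ h _] := gS n.
    by rewrite /lo; lra.
  exists (sup [set lo n | n in [set: nat]]) => n; rewrite ler_distl; apply/andP; split.
    by apply: (ub_le_sup hub.2); exists n.
  apply: (sup_le_ub hub.1) => _ [m _ <-]; rewrite /lo.
  have [p1 p2] : 0 < (S n).2 /\ 0 < (S m).2 by have [_ ? _] := gS n; have [_ ? _] := gS m.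
  have [nm|/ltnW mn] := leqP n m.
    by have := cc j n (m - n)%N; rewrite subnKC// ler_norml => /andP[]; lra.
  by have := cc j m (n - m)%N; rewrite subnKC// ler_norml => /andP[]; lra.
have [l1 H1] := lim (@Ordinal 3 0 isT); have [l2 H2] := lim (@Ordinal 3 1 isT).
have [l3 H3] := lim (@Ordinal 3 2 isT).
pose l : X := (l1, l2, l3).
have near_l d : 0 < d -> exists n, near3 d l (S n).1.
  move=> d0; have d1 : 0 < d / r0 by rewrite divr_gt0.
  have [n Hn] : exists n : nat, (2 ^+ n)^-1 < d / r0.
    have /cvgrPdist_lt/(_ _ d1)[N _ HN] := @cvg_harmonic R.
    exists N.+1; have := HN N (leqnn N); rewrite /harmonic/= sub0r normrN gtr0_norm ?invr_gt0//.
    apply: le_lt_trans; rewrite lef_pV2 ?posrE ?exprn_gt0// -natrX ler_nat.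
    exact: ltnW (ltn_expl _ _).
  have sd : (S n).2 < d by apply: le_lt_trans (rr n) _; rewrite mulrC -ltr_pdivlMr.
  exists n; split; rewrite distrC.
  - exact: le_lt_trans (H1 n) sd.
  - exact: le_lt_trans (H2 n) sd.
  - exact: le_lt_trans (H3 n) sd.
have El : E l.
  apply: contrapT => nE; have [d d0 Hd] := cE l nE; have [n Hn] := near_l d d0.
  by have [h _ _] := gS n; exact: Hd Hn h.
have inn n : near3 (S n).2 (S n).1 l.
  have [_ p1 h3 [b1 b2 b3] _] := HS n.
  have a1 := H1 n.+1; have a2 := H2 n.+1; have a3 := H3 n.+1.
  by split; [have := ler_distD (S n.+1).1.1.1 l.1.1 (S n).1.1.1|
             have := ler_distD (S n.+1).1.1.2 l.1.2 (S n).1.1.2|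
             have := ler_distD (S n.+1).1.2 l.2 (S n).1.2];
     move: h3 a1 a2 a3 b1 b2 b3; rewrite /c/=; lra.
have [n Hn] := EEn l El (inn 0%N).
by have [_ _ _ _ h] := HS n; exact: h (inn n.+1) Hn.
Qed.

End BaireClosed.

(** * Barriers and forward continuity in time *)

Section Clip.
Variable R : realType.
Implicit Types x y : R.

(** The truncation of [x] to [[0, 1]], written with [pos] so as to inherit its Lipschitz bound. *)
Definition clip x := 1 - pos (1 - pos x).

Lemma clip01 x : 0 <= clip x <= 1.
Proof.
have := pos_ge0 x; have := pos_ge0 (1 - pos x); rewrite /clip (posE (1 - _)).
by case: ifP; lra.
Qed.

Lemma clip1 x : 1 <= x -> clip x = 1.
Proof. move=> h; have px : pos x = x by rewrite posE (le_trans ler01 h).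
by rewrite /clip px posE; case: leP; lra. Qed.

Lemma clip0 x : x <= 0 -> clip x = 0.
Proof. by move=> h; rewrite /clip [pos x]posE; case: leP => h1; rewrite posE; case: leP; lra. Qed.

Lemma clip_lip x y : `|clip x - clip y| <= `|x - y|.
Proof.
rewrite /clip (_ : _ - _ = pos (1 - pos y) - pos (1 - pos x)); last by ring.
apply: le_trans (pos_lip _ _) _; rewrite (_ : _ - _ = pos x - pos y); last by ring.
exact: pos_lip.
Qed.

End Clip.

Lemma ltr_sub_between (R : realType) (t r s u : R) : t - r < s -> s <= u -> t - u < r.
Proof. lra. Qed.

Section Solutions.
Variable R : realType.
Implicit Types (x y z : R * R) (i : bool) (r s t k d e q : R) (P Q : R * R -> R -> R)
  (v : bool -> R * R -> R).

(** The equation expressed by expansions at one point, a form that is stable under translations in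
    space and under changing the sign of [P]. *)
Definition sol_at (a : R -> R) v P z t := exists (tau : R) (pi H : bool -> R),
  [/\ forall k, 0 < k -> exists2 r, 0 < r & forall d, `|d| < r ->
        `|P z (t + d) - P z t - tau * d| <= k * `|d|,
      forall i k, 0 < k -> exists2 r, 0 < r & forall d, `|d| < r ->
        `|P (sh i d z) t - P z t - pi i * d| <= k * `|d|,
      forall i k, 0 < k -> exists2 r, 0 < r & forall d, `|d| < r ->
        `|P (sh i d z) t + P (sh i (- d) z) t - 2 * P z t - H i * d ^+ 2| <= k * d ^+ 2 &
      tau = a (P z t) * (H true + H false) - (v true z * pi true + v false z * pi false)].

Definition diffusion (a0 a1 La : R) (a : R -> R) := [/\ 0 < a0, 0 <= La, forall q, a0 <= a q <= a1 &
  forall q q', `|a q - a q'| <= La * `|q - q'|].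

Definition drift (V Lv Kv : R) v := [/\ 0 <= Lv, forall i, per (v i),
  forall i z y, `|v i z - v i y| <= Lv * dist1 z y, forall i z, `|v i z| <= V &
  forall z r, 0 < r -> r < 1 -> `|Dm true r (v true) z + Dm false r (v false) z| <= Kv * r].

Definition solution (B : R) (a : R -> R) v P := [/\ forall t, 0 < t -> continuous (P^~ t),
  forall t, 0 < t -> per (P^~ t), forall t, 0 < t -> forall z, `|P z t| <= B &
  forall z t, 0 < t -> sol_at a v P z t].

Lemma diffusion_opp (a0 a1 La : R) (a : R -> R) : diffusion a0 a1 La a -> diffusion a0 a1 La (fun q => a (- q)).
Proof.
case=> h1 h2 h3 h4; split=> // q q'; apply: le_trans (h4 _ _) _.
by rewrite -opprD normrN.
Qed.

(** The class of equations is invariant under [P -> - P], so each upper estimate gives a lower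
    one. *)
Lemma solution_opp (B : R) (a : R -> R) v P : solution B a v P -> solution B (fun q => a (- q)) v (fun z t => - P z t).
Proof.
case=> h1 h2 h3 h4; split.
- by move=> t t0; have c := h1 t t0; ct.
- by move=> t t0 i z; rewrite (h2 t t0 i z).
- by move=> t t0 z; rewrite normrN; exact: h3.
move=> z t t0; have [tau [pi [H [e1 e2 e3 e4]]]] := h4 z t t0.
exists (- tau), (fun i => - pi i), (fun i => - H i); split.
- move=> k k0; have [r r0 Hr] := e1 k k0; exists r => // d /Hr.
  by rewrite -normrN; congr (`|_| <= _); ring.
- move=> i k k0; have [r r0 Hr] := e2 i k k0; exists r => // d /Hr.
  by rewrite -normrN; congr (`|_| <= _); ring.
- move=> i k k0; have [r r0 Hr] := e3 i k k0; exists r => // d /Hr.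
  by rewrite -normrN; congr (`|_| <= _); ring.
- by rewrite opprK e4; ring.
Qed.

Lemma solution_time_cont (B : R) (a : R -> R) v P z t : solution B a v P -> 0 < t -> {for t, continuous (P z)}.
Proof.
case=> _ _ _ h4 t0; have [tau [_ [_ [e1 _ _ _]]]] := h4 z t t0.
have [r r0 Hr] := e1 1 ltr01.
have D1 : 0 < `|tau| + 1 by rewrite ltr_wpDl.
apply/cvgrPdist_lt => k k0; exists (Num.min r (k / (`|tau| + 1))) => /=.
  by rewrite lt_min r0 divr_gt0.
move=> s; rewrite /= distrC lt_min ltr_pdivlMr// => /andP[sr sk].
have := Hr (s - t) sr; rewrite (addrC t) subrK mul1r => h; rewrite distrC.
apply: le_lt_trans sk; rewrite mulrDr mulr1.
have -> : P z s - P z t = (s - t) * tau + (P z s - P z t - tau * (s - t)) by ring.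
by apply: le_trans (ler_normD _ _) _; rewrite normrM lerD2l.
Qed.

Lemma is_derive_scale (F F1 : R -> R) (w y : R) : (forall u : R, is_derive u (1 : R) F (F1 u)) ->
  is_derive y (1 : R) (fun b : R => F (w * b)) (w * F1 (w * y)).
Proof.
move=> dF; have dl : is_derive y (1 : R) (fun b : R => w * b) w.
  by have := is_deriveZ w (is_derive_id y (1 : R)); rewrite /GRing.scale/= mulr1.
by have := @is_derive1_comp R F (fun b : R => w * b) y _ _ (dF _) dl; rewrite mulrC.
Qed.

(** A periodic substitute for a parabola, vanishing exactly at the integers. *)
Definition well (y : R) := 1 - cos (2 * pi * y).
Definition well1 (y : R) := 2 * pi * sin (2 * pi * y).
Definition well2 (y : R) := (2 * pi) ^+ 2 * cos (2 * pi * y).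

Lemma is_derive_well (y : R) : is_derive y (1 : R) well (well1 y).
Proof.
have h := @is_derive_scale cos (fun u => - sin u) (2 * pi) y (fun u => is_derive_cos u).
rewrite /well /well1 (_ : 2 * pi * sin (2 * pi * y) = 0 - 2 * pi * - sin (2 * pi * y)); last by ring.
exact: (is_deriveB (is_derive_cst (1 : R) y (1 : R)) h).
Qed.

Lemma is_derive_well1 (y : R) : is_derive y (1 : R) well1 (well2 y).
Proof.
have h := @is_derive_scale sin cos (2 * pi) y (fun u => is_derive_sin u).
have := is_deriveZ (2 * pi) h; rewrite /GRing.scale/= => h2.
by rewrite /well1 /well2 expr2 -mulrA.
Qed.

Lemma norm_sin (y : R) : `|sin y| <= 1.
Proof. by rewrite ler_norml sin_geN1 sin_le1. Qed.
Lemma norm_cos (y : R) : `|cos y| <= 1.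
Proof. by rewrite ler_norml cos_geN1 cos_le1. Qed.

Lemma pi20 : 0 <= 2 * pi :> R.
Proof. by rewrite mulr_ge0// pi_ge0. Qed.

Lemma well1_bd (y : R) : `|well1 y| <= 2 * pi.
Proof.
rewrite /well1 normrM (ger0_norm pi20) -[leRHS]mulr1; apply: ler_wpM2l; [exact: pi20|exact: norm_sin].
Qed.

Lemma well2_bd (y : R) : `|well2 y| <= (2 * pi) ^+ 2.
Proof.
rewrite /well2 normrM (ger0_norm (exprn_ge0 2 pi20)) -[leRHS]mulr1.
by apply: ler_wpM2l; [exact: exprn_ge0 pi20|exact: norm_cos].
Qed.

Lemma well_bd (y : R) : 0 <= well y <= 2.
Proof. by rewrite /well; have := cos_geN1 (2 * pi * y); have := cos_le1 (2 * pi * y); lra. Qed.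

Lemma well0 : well 0 = 0. Proof. by rewrite /well mulr0 cos0 subrr. Qed.

Lemma wellD1 (y : R) : well (y + 1) = well y.
Proof. by rewrite /well mulrDr mulr1 mulr_natl cosD2pi. Qed.

Lemma well_gt (y r : R) : 0 < r -> r <= 1/2 -> r <= `|y| -> `|y| <= 1/2 -> well r <= well y.
Proof.
move=> r0 r1 ry y1; rewrite /well lerD2l lerN2.
have -> : cos (2 * pi * y) = cos (2 * pi * `|y|).
  have [yy|yy] := leP 0 y; [by rewrite ger0_norm|by rewrite ltr0_norm// mulrN cosN].
have p0 := pi_gt0 R.
have h (u : R) : 0 <= u -> u <= 1/2 -> 2 * pi * u \in `[0, pi].
  move=> u0 u1; rewrite in_itv/= mulr_ge0 ?pi20//=.
  by have := ler_wpM2l pi20 u1; lra.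
have [] := leP (cos (2 * pi * `|y|)) (cos (2 * pi * r)) => //.
rewrite ltr_cos ?h// ?(ltW r0)//.
by rewrite ltr_pM2l ?mulr_gt0// ltNge ry.
Qed.

Lemma well_pos r : 0 < r -> r <= 1/2 -> 0 < well r.
Proof.
move=> r0 r1; rewrite /well subr_gt0 -[X in _ < X]cos0.
have p0 := pi_gt0 R.
rewrite ltr_cos ?in_itv/= ?lexx ?pi_ge0//.
  by rewrite !mulr_gt0.
apply/andP; split; first by rewrite mulr_ge0 ?pi20// ltW.
by have := ler_wpM2l pi20 r1; lra.
Qed.

Definition bowl x0 z := well (z.1 - x0.1) + well (z.2 - x0.2).

Lemma bowl_sh x0 i d z : bowl x0 (sh i d z) - bowl x0 z =
  well (crd i z - crd i x0 + d) - well (crd i z - crd i x0).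
Proof. by case: i; rewrite /bowl /sh /crd/=; [rewrite (addrAC z.1)|rewrite (addrAC z.2)]; ring. Qed.

Lemma bowl_bd x0 z : 0 <= bowl x0 z <= 4.
Proof. by rewrite /bowl; have := well_bd (z.1 - x0.1); have := well_bd (z.2 - x0.2); lra. Qed.

Lemma bowl_per x0 : per (bowl x0).
Proof. by move=> i z; apply/eqP; rewrite -subr_eq0 bowl_sh wellD1 subrr. Qed.

Lemma bowl_lip x0 z y : `|bowl x0 z - bowl x0 y| <= 2 * pi * dist1 z y.
Proof.
have h := lip_deriv is_derive_well well1_bd.
have -> : bowl x0 z - bowl x0 y = (well (z.1 - x0.1) - well (y.1 - x0.1))
  + (well (z.2 - x0.2) - well (y.2 - x0.2)) by rewrite /bowl; ring.
apply: le_trans (ler_normD _ _) _; rewrite /dist1 mulrDr; apply: lerD.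
- by apply: le_trans (h _ _) _; rewrite (_ : z.1 - x0.1 - (y.1 - x0.1) = z.1 - y.1)//; ring.
- by apply: le_trans (h _ _) _; rewrite (_ : z.2 - x0.2 - (y.2 - x0.2) = z.2 - y.2)//; ring.
Qed.

Lemma bowl_cont x0 : continuous (bowl x0).
Proof.
apply: (@lip_steps_cont _ _ (2 * pi)); first exact: pi20.
move=> i z r _; apply: le_trans (bowl_lip _ _ _) _.
by rewrite /dist1; case: i; rewrite /sh/= subrr normr0 ?addr0 ?add0r addrAC subrr add0r.
Qed.

(** * Comparison with a barrier *)

Section Barrier.
Variables (a0 a1 La V Lv Kv B : R) (a : R -> R) (v : bool -> R * R -> R) (P : R * R -> R -> R).
Hypotheses (Ha : diffusion a0 a1 La a) (Hv : drift V Lv Kv v) (HP : solution B a v P).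
Variables (x0 : R * R) (t0 tb c0 L : R) (N : nat).
Hypotheses (t00 : 0 < t0) (t0b : t0 < tb) (L0 : 0 <= L).

Let a00 : 0 < a0. Proof. by case: Ha. Qed.
Let La0 : 0 <= La. Proof. by case: Ha. Qed.
Let V0 : 0 <= V. Proof. by case: Hv => _ _ _ h _; exact: le_trans (h true (0, 0)). Qed.
Let a10 : 0 <= a1.
Proof. by case: Ha => h _ /(_ 0) /andP[h1 h2] _; apply: le_trans h2; apply: le_trans h1; exact: ltW. Qed.
Let B0 : 0 <= B. Proof. by case: HP => _ _ h _; exact: le_trans (h t0 t00 (0, 0)). Qed.

Let Lz := La * (L * (2 * pi)).
(** The slope in time that dominates diffusion and drift of [L * bowl] and still leaves the margin
    [2 * Lz] required of [M]. *)
Definition barrier_speed := 2 * Lz + a1 * (2 * (L * (2 * pi) ^+ 2)) + 2 * (V * (L * (2 * pi))).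
Definition barrier z t := c0 + L * bowl x0 z + barrier_speed * (t - t0).
(** Time is stopped at [tb], so that the uniform bounds hold at all later times. *)
Definition excess z t := P z (Num.min t tb) - barrier z (Num.min t tb).

Definition excess_bound := B + (`|c0| + L * 4 + barrier_speed * (tb + t0)).
Let BQ := excess_bound.

Let Lz0 : 0 <= Lz. Proof. by rewrite !mulr_ge0// pi_ge0. Qed.
Let sp0 : 0 <= barrier_speed.
Proof. by rewrite /barrier_speed !addr_ge0 ?mulr_ge0 ?exprn_ge0 ?mulr_ge0 ?pi_ge0. Qed.
Let BQ0 : 0 <= BQ.
Proof.
by rewrite /BQ /excess_bound !addr_ge0// mulr_ge0// addr_ge0 ?ltW// (lt_trans t00).
Qed.

Lemma barrier_lip z y t : `|barrier z t - barrier y t| <= L * (2 * pi) * dist1 z y.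
Proof.
have -> : barrier z t - barrier y t = L * (bowl x0 z - bowl x0 y) by rewrite /barrier; ring.
by rewrite normrM (ger0_norm L0) -(mulrA L); apply: ler_wpM2l => //; exact: bowl_lip.
Qed.

Lemma barrier_cont t : continuous (barrier^~ t).
Proof. by have c := @bowl_cont x0; rewrite /barrier; ct. Qed.

Let Tmin t : t0 / 2 < t -> 0 < Num.min t tb.
Proof. by move=> h; rewrite lt_min (lt_trans t00 t0b) andbT; apply: lt_trans h; rewrite divr_gt0. Qed.

Let cQ t : t0 / 2 < t -> continuous (excess^~ t).
Proof.
move=> h; have [c _ _ _] := HP; have {}c := c _ (Tmin h).
by have c2 := @barrier_cont (Num.min t tb); rewrite /excess; ct.
Qed.

Let pQ t : t0 / 2 < t -> per (excess^~ t).
Proof.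
move=> h i z; have [_ c _ _] := HP; have {}c := c _ (Tmin h) i z.
by rewrite /excess c /barrier bowl_per.
Qed.

Let QB t : t0 / 2 < t -> forall z, `|excess z t| <= BQ.
Proof.
move=> h z; have [_ _ c _] := HP; have {}c := c _ (Tmin h) z.
apply: le_trans (ler_normB _ _) _; rewrite /BQ /excess_bound lerD//.
have /andP[b0 b1] := bowl_bd x0 z.
apply: le_trans (ler_normD _ _) _; apply: lerD.
  apply: le_trans (ler_normD _ _) _; apply: lerD => //.
  by rewrite normrM !ger0_norm// ler_wpM2l.
rewrite normrM (ger0_norm sp0); apply: ler_wpM2l => //.
have m1 : Num.min t tb <= tb by rewrite ge_min lexx orbT.
have m2 := Tmin h.
by move: (Num.min t tb) m1 m2 => w m1 m2; move: t00 t0b => t00' t0b'; rewrite ler_norml; apply/andP; split; lra.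
Qed.

Let tQ z t : t0 / 2 < t -> {for t, continuous (excess z)}.
Proof.
move=> h; have c := solution_time_cont (z := z) HP (Tmin h).
have cm : continuous (fun t : R => Num.min t tb).
  by apply: cont_min; [exact: cont_idR|exact: cont_cst].
have cP : {for t, continuous (fun t => P z (Num.min t tb))}.
  by apply: (continuous_comp (f := fun t => Num.min t tb)); [exact: cm|exact: c].
have cG : continuous (fun t => barrier z (Num.min t tb)) by rewrite /barrier; ct.
exact: (continuousB cP (cG t)).
Qed.

(** Seen from the excess, the diffusion coefficient depends on position through the barrier, with
    Lipschitz constant [Lz] in space. *)
Let al (t : R) z q := a (q + barrier z (Num.min t tb)).

Lemma excess_subsol t y : t0 / 2 < t -> t <= tb ->
  subsol_at (al t) v (2 * Lz) excess y t.
Proof.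
move=> h ttb; have t_0 : 0 < t by apply: lt_trans h; rewrite divr_gt0.
have [_ _ _ hs] := HP; have [tau [pi' [H [e1 e2 e3 e4]]]] := hs y t t_0.
have mt : Num.min t tb = t by rewrite min_l.
pose u i := crd i y - crd i x0.
have L1 : 0 < 2 * (L + 1) by rewrite mulr_gt0// ltr_wpDl.
have Lk k : 0 < k -> L * (k / (2 * (L + 1))) <= k / 2.
  move=> k0; rewrite mulrCA ler_pM2l// ler_pdivrMr//; lra.
exists (tau - barrier_speed), (fun i => pi' i - L * well1 (u i)), (fun i => H i - L * well2 (u i)); split.
- move=> k k0; have [r r0 Hr] := e1 k k0; exists r => // d d0 dr.
  have := Hr (- d); rewrite normrN gtr0_norm// => /(_ dr); rewrite ler_norml => /andP[h1 _].
  have mtd : Num.min (t - d) tb = t - d by rewrite min_l//; lra.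
  by rewrite /excess mt mtd /barrier; move: h1; lra.
- move=> i k k0; have k2 : 0 < k / 2 by rewrite divr_gt0.
  have [r1 r10 H1] := e2 i (k / 2) k2.
  have [r2 r20 H2] := taylor1 (is_derive_well (u i)) (divr_gt0 k0 L1).
  exists (Num.min r1 r2); first by rewrite lt_min r10.
  move=> d; rewrite lt_min => /andP[/H1 h1 /H2 h2]; rewrite /excess mt.
  rewrite (_ : _ - _ - _ = (P (sh i d y) t - P y t - pi' i * d)
    - L * (bowl x0 (sh i d y) - bowl x0 y - well1 (u i) * d)); last by rewrite /barrier; ring.
  rewrite bowl_sh -/(u i); apply: le_trans (ler_normB _ _) _; rewrite [k]splitr mulrDl.
  apply: lerD => //; rewrite normrM (ger0_norm L0).
  by apply: le_trans (ler_wpM2l L0 h2) _; rewrite mulrA; apply: ler_wpM2r => //; exact: Lk.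
- move=> i k k0; have k2 : 0 < k / 2 by rewrite divr_gt0.
  have [r1 r10 H1] := e3 i (k / 2) k2.
  have [r2 r20 H2] := taylor2 is_derive_well (is_derive_well1 (u i)) (divr_gt0 k0 L1).
  exists (Num.min r1 r2); first by rewrite lt_min r10.
  move=> d; rewrite lt_min => /andP[/H1 h1 /H2 h2]; rewrite /excess mt.
  have b1 := bowl_sh x0 i d y; have b2 := bowl_sh x0 i (- d) y; rewrite -/(u i) in b1 b2.
  rewrite (_ : _ - _ - _ = (P (sh i d y) t + P (sh i (- d) y) t - 2 * P y t - H i * d ^+ 2)
    - L * ((bowl x0 (sh i d y) - bowl x0 y) + (bowl x0 (sh i (- d) y) - bowl x0 y) - well2 (u i) * d ^+ 2)); last first.
    by rewrite /barrier; ring.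
  rewrite b1 b2 (_ : well (u i + d) - well (u i) + (well (u i - d) - well (u i)) =
     well (u i + d) + well (u i - d) - 2 * well (u i)); last by ring.
  apply: le_trans (ler_normB _ _) _; rewrite [k]splitr [leRHS]mulrDl.
  apply: lerD => //; rewrite normrM (ger0_norm L0).
  apply: le_trans (ler_wpM2l L0 h2) _; rewrite mulrA; apply: ler_wpM2r; [exact: sqr_ge0|exact: Lk].
- have alE : al t y (excess y t) = a (P y t) by rewrite /al /excess mt subrK.
  rewrite alE e4.
  have [_ _ /(_ (P y t)) /andP[ha0 ha1] _] := Ha; have [_ _ _ vb _] := Hv.
  have w2 i : a (P y t) * (L * well2 (u i)) <= a1 * (L * (2 * pi) ^+ 2).
    apply: le_trans (ler_norm _) _; rewrite normrM (ger0_norm (le_trans (ltW a00) ha0)).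
    apply: ler_pM => //; first exact: le_trans (ltW a00) ha0.
    by rewrite normrM (ger0_norm L0); apply: ler_wpM2l => //; exact: well2_bd.
  have w1 i : - (v i y * (L * well1 (u i))) <= V * (L * (2 * pi)).
    apply: le_trans (ler_norm _) _; rewrite normrN normrM; apply: ler_pM => //.
    by rewrite normrM (ger0_norm L0); apply: ler_wpM2l => //; exact: well1_bd.
  move: (w1 true) (w1 false) (w2 true) (w2 false); rewrite /barrier_speed; lra.
Qed.

Variable mu : R.
Hypotheses (mu0 : 0 < mu)
  (HN : BQ * (1 + Lz + La + 2 * Cgrad a0 (Lz + La) BQ) <= a0 / 2 * N.+2%:R)
  (Hmu : forall z t, t0 <= t -> t <= tb -> - (2 * mu) < excess z t ->
     forall s, t0 <= s -> s < tb -> fusc P z s).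

Let la (x : R) : R := 1 / N.+3%:R * pw N.+3 (x - 0).
Let E (x : R) : R := 1 * pw N.+2 (x - 0).
Let E1 (x : R) : R := 1 * N.+2%:R * pw N.+1 (x - 0).

Let cla : continuous la.
Proof. by have c := @cont_pw R R N.+3 (fun x : R => x - 0); rewrite /la; apply: cont_mul; [exact: cont_cst|apply: c; ct]. Qed.
Let cE : continuous E.
Proof. by have c := @cont_pw R R N.+2 (fun x : R => x - 0); rewrite /E; apply: cont_mul; [exact: cont_cst|apply: c; ct]. Qed.
Let cE1 : continuous E1.
Proof. by have c := @cont_pw R R N.+1 (fun x : R => x - 0); rewrite /E1; apply: cont_mul; [exact: cont_cst|apply: c; ct]. Qed.

Let la_neg (x : R) : x <= 0 -> la x = 0.
Proof. by move=> x0'; rewrite /la subr0 /pw /pos max_r// expr0n mulr0. Qed.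
Let E_neg (x : R) : x <= 0 -> E x = 0.
Proof. by move=> x0'; rewrite /E subr0 /pw /pos max_r// expr0n mulr0. Qed.
Let la_ge0 (x : R) : 0 <= la x.
Proof. by rewrite /la mulr_ge0 ?pw_ge0// divr_ge0. Qed.

Definition total_excess t := I (fun z => la (excess z t)).

Lemma excess_fusc z s : t0 <= s -> s < tb -> fusc P z s -> fusc excess z s.
Proof.
move=> t0s stb h k k0; have k2 : 0 < k / 2 by rewrite divr_gt0.
have sp0' := sp0; have t0b' := t0b.
have [r r0 Hr] := h _ k2.
have D0 : 0 < 4 * (L * (2 * pi) + barrier_speed) + 4.
  by have := mulr_ge0 L0 (pi20); move: sp0; lra.
pose r1 := k / (4 * (L * (2 * pi) + barrier_speed) + 4).
have r10 : 0 < r1 by rewrite divr_gt0.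
exists (Num.min r (Num.min r1 (tb - s))); first by rewrite !lt_min r0 r10 subr_gt0.
move=> y s'; rewrite !lt_min => /and3P[y1 y1' _] /and3P[y2 y2' _] ss' s's.
have sr : s' - s < Num.min r (Num.min r1 (tb - s)) by lra.
move: sr; rewrite !lt_min => /and3P[s1 s2 s3].
rewrite /excess !min_l; [|lra|lra].
have h1 : P y s' <= P z s + k / 2 by apply: Hr => //; lra.
have h2 := barrier_lip z y s.
have h3 : L * (2 * pi) * dist1 z y <= L * (2 * pi) * (2 * r1).
  by apply: ler_wpM2l; [rewrite mulr_ge0 ?pi20|rewrite /dist1 !(distrC z.1) !(distrC z.2); lra].
have h4 : 0 <= barrier_speed * (s' - s) by rewrite mulr_ge0// subr_ge0.
have h5 : L * (2 * pi) * (2 * r1) <= k / 2.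
  have -> : k / 2 = r1 * (4 * (L * (2 * pi) + barrier_speed) + 4) / 2 by rewrite /r1 divfK// gt_eqF.
  have := mulr_ge0 (mulr_ge0 L0 pi20) (ltW r10); have := mulr_ge0 sp0 (ltW r10); move: r10; lra.
move: h2; rewrite ler_norml => /andP[_ h2].
by move: h1 h2 h3 h4 h5; rewrite /barrier; lra.
Qed.

(** The cutoff [eta] is made from the sup-convolution [p] of the excess at the final time [t], which
    unlike the excess is known to be Lipschitz: it is 1 where [p >= - mu / 2] and 0 where
    [p <= - mu]. The marker [m] is positive only where the excess at time [t] is negative, and there
    [la] and [E] vanish. Hence the rate is 0 at time [t], and by continuity at most [k] shortly
    before. *)
Lemma total_excess_dini t : t0 < t -> t <= tb -> forall k, 0 < k -> exists2 r, 0 < r &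
  forall s, t - r < s -> s < t -> t0 <= s -> total_excess t - total_excess s <= k * (t - s).
Proof.
move=> t0t ttb k k0.
have t00' := t00; have t0b' := t0b; have mu0' := mu0; have BQ0' := BQ0.
have Tt : t0 / 2 < t by lra.
pose f := excess^~ t.
have cf : continuous f := cQ Tt. have pf : per f := pQ Tt. have fB z : `|f z| <= BQ := QB Tt z.
have mu4 : 0 < mu / 4 by rewrite divr_gt0.
(* With this modulus, the excess at time [t] stays above [- 3 mu / 2] within distance [rho] of the
   support of [eta], so [Hmu] applies there. *)
have [rho rho0 Hrho] := unif_per cf pf mu4.
have B1 : 0 < 4 * BQ + 1 by rewrite ltr_wpDl// mulr_ge0.
pose e := rho ^+ 2 / (4 * BQ + 1).
have e0 : 0 < e by rewrite divr_gt0// exprn_gt0.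
have eR : Num.sqrt (4 * BQ * e) <= rho.
  rewrite -(gtr0_norm rho0) -sqrtr_sqr ler_wsqrtr// /e mulrA ler_pdivrMr// mulrC.
  by apply: ler_wpM2l; [exact: sqr_ge0|lra].
pose p := sconv e f.
have pge z : f z <= p z := sconv_ge e0 fB z.
have ple z : p z <= f z + mu / 4.
  have [y yE dy] := sconv_max e0 cf fB z.
  have c i : `|crd i y - crd i z| <= rho.
    apply: le_trans eR; rewrite -(sqrtr_sqr (crd i y - crd i z)) ler_wsqrtr//.
    by apply: le_trans dy; rewrite -sqrrN opprB crd_sq.
  have := Hrho z y (c true) (c false); rewrite ler_norml => /andP[_ h].
  have : 0 <= d2 z y / (2 * e) by rewrite divr_ge0 ?d2_ge0// mulr_ge0// ltW.
  by rewrite /p yE; lra.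
have cp : continuous p := sconv_cont e0 cf fB.
have pp : per p := sconv_per e0 fB pf.
pose Lp := (Num.sqrt (4 * BQ * e) + 1) / e.
have Lp0 : 0 <= Lp by rewrite divr_ge0 ?(ltW e0)// addr_ge0// sqrtr_ge0.
have pL i z r : `|r| <= 1 -> `|p (sh i r z) - p z| <= Lp * `|r|.
  by move=> r1; exact: (sconv_lip_step e0 cf fB).
pose eta z := clip (2 + 2 / mu * p z).
pose m z := clip (- (4 / mu) * f z).
have ceta : continuous eta by rewrite /eta /clip /pos; ct.
have cm : continuous m by rewrite /m /clip /pos; ct.
pose rh := Num.min rho (1/2).
have rh0 : 0 < rh by rewrite lt_min rho0 divr_gt0.
have rh1 : rh < 1 by rewrite gt_min; apply/orP; right; lra.
have eta1 z : - (mu / 2) <= p z -> eta z = 1.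
  move=> h; apply: clip1; have : 2 / mu * - (mu / 2) <= 2 / mu * p z by rewrite ler_pM2l ?divr_gt0.
  by rewrite (_ : 2 / mu * - (mu / 2) = -1); [lra|field; rewrite gt_eqF].
have eta_supp z : eta z != 0 -> - mu < p z.
  move=> h; rewrite ltNge; apply/negP => pz; move/eqP: h; apply; apply: clip0.
  have : 2 / mu * p z <= 2 / mu * - mu by rewrite ler_pM2l ?divr_gt0.
  by rewrite (_ : 2 / mu * - mu = -2); [lra|field; rewrite gt_eqF].
have etaL i z r : `|r| <= rh -> `|eta (sh i r z) - eta z| <= 2 / mu * Lp * m z * `|r|.
  rewrite le_min => /andP[r1 r2].
  have [fz|fz] := leP (f z) (- (mu / 4)).
    have -> : m z = 1.
      apply: clip1; have : 4 / mu * f z <= 4 / mu * - (mu / 4) by rewrite ler_pM2l ?divr_gt0.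
      by rewrite (_ : 4 / mu * - (mu / 4) = -1); [lra|field; rewrite gt_eqF].
    rewrite mulr1; apply: le_trans (clip_lip _ _) _.
    rewrite (_ : _ - _ = 2 / mu * (p (sh i r z) - p z)); last by ring.
    rewrite normrM gtr0_norm ?divr_gt0// -mulrA; apply: ler_wpM2l; first by rewrite divr_ge0// ltW.
    by apply: pL; lra.
  have h1 : - (mu / 2) <= p z by apply: le_trans (pge z); lra.
  have h2 : - (mu / 2) <= p (sh i r z).
    apply: le_trans (pge _); have := Hrho z (sh i r z).
    have -> : `|(sh i r z).1 - z.1| <= rho = true.
      by case: i; rewrite /sh/= ?subrr ?normr0 ?(ltW rho0)// addrAC subrr add0r.
    have -> : `|(sh i r z).2 - z.2| <= rho = true.
      by case: i; rewrite /sh/= ?subrr ?normr0 ?(ltW rho0)// addrAC subrr add0r.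
    by move=> /(_ isT isT); rewrite ler_norml => /andP[h _]; lra.
  rewrite (eta1 _ h1) (eta1 _ h2) subrr normr0.
  have mm : 0 <= 2 / mu by rewrite divr_ge0// ltW.
  have /andP[m0 _] := clip01 (- (4 / mu) * f z).
  by apply: mulr_ge0 => //; apply: mulr_ge0 => //; exact: mulr_ge0.
have [K K0 prof] := profile N (W := BQ) (kap := 1) 0 BQ0 ler01.
have [Lv0 vp vL vb vd] := Hv.
have [_ _ abd aL] := Ha.
have supp x : (fun=> 0 : R) x != 0 \/ eta x != 0 -> forall y, `|y.1 - x.1| <= rho ->
   `|y.2 - x.2| <= rho -> forall s, t0 <= s -> s < tb -> fusc excess y s.
  case; [by rewrite eqxx|] => /eta_supp h y y1 y2 s t0s stb.
  apply: excess_fusc => //; apply: (Hmu (t := t)) => //; first exact: ltW.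
  have := Hrho x y y1 y2; rewrite ler_norml => /andP[h1 _]; have := ple x.
  by rewrite -/(f y); lra.
have al_bd t' z q : a0 <= al t' z q <= a1 by exact: abd.
have al_lip t' z y q q' : `|al t' z q - al t' y q'| <= Lz * dist1 z y + La * `|q - q'|.
  apply: le_trans (aL _ _) _; rewrite /Lz -mulrA -mulrDr; apply: ler_wpM2l => //.
  rewrite (_ : q + _ - _ = (barrier z (Num.min t' tb) - barrier y (Num.min t' tb)) + (q - q')); last by ring.
  by apply: le_trans (ler_normD _ _) _; rewrite lerD2r; exact: barrier_lip.
have al_per t' q : per (fun z => al t' z q) by move=> i z; rewrite /al /barrier bowl_per.
have absb z (x : R) : `|x| <= BQ -> 0 + eta z ^+ 2 * E x
  + ((fun=> 0) z + eta z ^+ 2 * E x) * (Lz + La + 2 * Cgrad a0 (Lz + La) BQ) <= a0 / 2 * (eta z ^+ 2 * E1 x).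
  move=> xB; have xW : x <= BQ := le_trans (ler_norm _) xB.
  set c := Lz + La + _; rewrite !add0r -{1}(mulr1 (eta z ^+ 2 * E x)) -mulrDr.
  rewrite -mulrA [leRHS]mulrCA; apply: ler_wpM2l; first exact: sqr_ge0.
  have H : pos x * (1 + c) <= a0 / 2 * N.+2%:R.
    apply: le_trans HN; rewrite /c !addrA; apply: ler_wpM2r.
      have Cg0 : 0 <= Cgrad a0 (Lz + La) BQ.
        rewrite /Cgrad addr_ge0// mulr_ge0//; last by rewrite addr_ge0// mulr_ge0.
        by rewrite mulr_ge0 ?invr_ge0 ?(ltW a00)// mulr_ge0// sqr_ge0.
      by rewrite !addr_ge0// mulr_ge0.
    by rewrite posE; case: ifP.
  have -> : E x * (1 + c) = pw N.+1 x * (pos x * (1 + c)).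
    by rewrite /E subr0 /pw exprSr; ring.
  have -> : a0 / 2 * E1 x = pw N.+1 x * (a0 / 2 * N.+2%:R).
    by rewrite /E1 subr0; move: (N.+2%:R) => N2; ring.
  by apply: ler_wpM2l => //; exact: pw_ge0.
have T0t : t0 / 2 < t0 by rewrite ltr_pdivrMr// ltr_pMr// ltr1n.
have profQ (x y : R) : `|x| <= BQ -> `|y| <= BQ -> _ := fun hx hy =>
  prof x y (eq_ind_r (fun u => u <= BQ) (le_trans (ler_norm _) hx) (subr0 x))
           (eq_ind_r (fun u => u <= BQ) (le_trans (ler_norm _) hy) (subr0 y)).
have W0 z : (fun n : nat => Dm true (rh / n.+2%:R) (fun y => (fun=> 0) y * v true y) z
   + Dm false (rh / n.+2%:R) (fun y => (fun=> 0) y * v false y) z) @ \oo --> (0 : R).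
  rewrite (_ : (fun n : nat => _) = fun=> 0); first exact: cvg_cst.
  by apply/funext => n; rewrite /Dm !mul0r subrr mul0r addr0.
pose h0 s := rate0 a0 a1 V 0 (2 / mu * Lp) 0 rh excess m (fun=> 0) E la s.
have ML s : t0 <= s -> s < t -> lyap (fun=> 0) eta la (excess^~ t) - lyap (fun=> 0) eta la (excess^~ s)
   <= J s t (fun u => h0 (Num.max s (Num.min u t))).
  move=> t0s st.
  apply: (@main_inequality R a0 a1 La Lz Lv Kv V BQ (2 * Lz) (t0 / 2) 0 0 (2 / mu * Lp) K 0 rh rho s t
    al v excess (fun=> 0) eta m (fun=> 0) E E1 la) => //.
  - by rewrite mulr_ge0// divr_ge0// ltW.
  - exact: lt_le_trans T0t t0s.
  - exact: ltW.
  - by move=> t' y h h'; apply: excess_subsol => //; exact: le_trans h' ttb.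
  - exact: cont_cst.
  - exact: cont_cst.
  - by move=> i z; rewrite /eta pp.
  - by move=> z; rewrite lexx.
  - by move=> i z r; rewrite subrr normr0 mul0r.
  - by move=> z; exact: clip01.
  - by move=> z; exact: clip01.
  - move=> z x _; rewrite mulr_ge0 ?sqr_ge0// /E1 !mulr_ge0 ?pw_ge0//.
  - by move=> x hx y y1 y2 u su ut; apply: (supp x hx) => //; [exact: le_trans t0s su|exact: lt_le_trans ut ttb].
have ch : continuous (fun u => h0 (Num.max t0 (Num.min u t))).
  apply: (@rate0_cont R a0 a1 Lv V BQ (t0 / 2) 0 0 (2 / mu * Lp) K 0 rh t0 t
    v excess (fun=> 0) m (fun=> 0) E E1 la) => //.
  - exact: ltW.
  - exact: cont_cst.
  - by move=> z; rewrite lexx.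
  - by move=> i z r; rewrite subrr normr0 mul0r.
  - by move=> z; exact: clip01.
have h0t : h0 t = 0.
  have q1 : I (fun z => la (excess z t) * m z) = 0.
    rewrite (@eq_I _ _ (fun=> 0)) ?I_cst// => z; have [fz|fz] := leP (f z) 0.
      by rewrite la_neg// mul0r.
    by rewrite /m clip0 ?mulr0// mulNr oppr_le0 mulr_ge0 ?divr_ge0 ?(ltW mu0)// ltW.
  have q2 : I (fun z => E (excess z t) * m z ^+ 2) = 0.
    rewrite (@eq_I _ _ (fun=> 0)) ?I_cst// => z; have [fz|fz] := leP (f z) 0.
      by rewrite E_neg// mul0r.
    by rewrite /m clip0 ?expr0n ?mulr0// mulNr oppr_le0 mulr_ge0 ?divr_ge0 ?(ltW mu0)// ltW.
  have q3 : I (fun z => excess z t * 0) = 0.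
    by rewrite (@eq_I _ _ (fun=> 0)) ?I_cst// => z; rewrite mulr0.
  by rewrite /h0 /rate0 q1 q2 q3; ring.
have /cvgrPdist_lt/(_ k k0)[r /= r0 Hr] := ch t.
exists r => // s s1 s2 s3.
have Ts : t0 / 2 < s by exact: lt_le_trans T0t s3.
have e1 : total_excess t <= lyap (fun=> 0) eta la (excess^~ t).
  have c1 := cont_comp (cQ Tt) cla; apply: I_le => [||z]; [exact: c1|by ct|].
  rewrite mul0r add0r; have [fz|fz] := leP (f z) 0; first by rewrite la_neg// mulr0.
  rewrite eta1 ?expr1n ?mul1r//; apply: le_trans (pge z); apply: le_trans (ltW fz).
  by rewrite oppr_le0 divr_ge0// ltW.
have e2 : lyap (fun=> 0) eta la (excess^~ s) <= total_excess s.
  have cq := cQ Ts; have c1 := cont_comp cq cla; apply: I_le => [||z]; [by ct|exact: c1|].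
  rewrite mul0r add0r; apply: ler_piMl => //.
  by have /andP[h1 h2] := clip01 (2 + 2 / mu * p z); rewrite exprn_ile1.
apply: le_trans (lerB e1 e2) _; apply: le_trans (ML s s3 s2) _.
have -> : J s t (fun u => h0 (Num.max s (Num.min u t))) = J s t (fun u => h0 (Num.max t0 (Num.min u t))).
  by apply: eq_J => u /andP[su ut]; rewrite !max_r// le_min ?su ?(ltW s2) ?(le_trans s3 su) ?(le_trans s3 (ltW s2)).
rewrite -(J_cst _ (ltW s2)); apply: J_le => [||u /andP[su ut]]; [exact: ch|exact: cont_cst|].
have := Hr u; rewrite /= (_ : Num.max t0 (Num.min t t) = t); last by rewrite minxx max_r// ltW.
rewrite h0t sub0r normrN ger0_norm ?subr_ge0// => h.
by apply: le_trans (ler_norm _) _; apply: ltW; apply: h; exact: ltr_sub_between s1 su.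
Qed.

Lemma excess_le0 : (forall z, excess z t0 <= 0) -> forall t z, t0 <= t -> t <= tb -> excess z t <= 0.
Proof.
move=> H0 t z t0t ttb.
have T0 u : t0 / 2 < Num.max t0 u by rewrite lt_max ltr_pdivrMr// ltr_pMr// ltr1n.
have [K K0 prof] := profile N (W := BQ) (kap := 1) 0 BQ0 ler01.
have cS : continuous (fun u => total_excess (Num.max t0 u)).
  apply: (@cont_I_time R K (fun z u => la (excess z (Num.max t0 u)))).
  - by move=> u; exact: cont_comp (cQ (T0 u)) cla.
  - move=> y u; have h : excess y (Num.max t0 u) - 0 <= BQ.
      by rewrite subr0; exact: le_trans (ler_norm _) (QB (T0 u) y).
    by have [_ [_ /andP[l0 l1]] _ _ _] := prof _ _ h h; rewrite ger0_norm.
  - move=> y; apply: (cont_comp (g := fun u => excess y (Num.max t0 u))) cla => u.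
    apply: (continuous_comp (f := fun u => Num.max t0 u)); last exact: tQ.
    have : continuous (fun u : R => Num.max t0 u) by apply: cont_max; [exact: cont_cst|exact: cont_idR].
    exact.
have le0 : total_excess t <= total_excess t0.
  apply: (@dini_le R total_excess t0 t t0t) => [u t0u ut k k0|u t0u ut k k0].
    have /cvgrPdist_lt/(_ k k0)[r /= r0 Hr] := cS u.
    exists r => // s us sr st; have := Hr s; rewrite /= !max_r//; last by apply: le_trans t0u (ltW us).
    rewrite ltr0_norm ?subr_lt0// opprB => h; have : s - u < r by lra.
    by move=> /h; rewrite ltr_norml => /andP[]; lra.
  by apply: total_excess_dini => //; exact: le_trans ut ttb.
have E0 : total_excess t0 = 0.
  by rewrite /total_excess (@eq_I _ _ (fun=> 0)) ?I_cst// => y; rewrite la_neg.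
have Tt : t0 / 2 < t by apply: lt_le_trans t0t; rewrite ltr_pdivrMr// ltr_pMr// ltr1n.
have : la (excess z t) = 0.
  apply: (@I_eq0 R (fun z => la (excess z t))) => //.
  - by have c := cont_comp (cQ Tt) cla.
  - by move=> i y; rewrite (pQ Tt i y).
  - by apply: le_trans le0 _; rewrite E0.
rewrite leNgt => l0; apply/negP => ez; move: l0; apply/eqP.
by rewrite /la subr0 /pw posE (ltW ez) mulf_neq0// ?expf_neq0 ?gt_eqF// divr_gt0// ltr0n.
Qed.

End Barrier.
End Solutions.

Section ForwardContinuity.
Variable R : realType.
Implicit Types (x y z : R * R) (i : bool) (r s t k d e q : R) (P Q : R * R -> R -> R)
  (v : bool -> R * R -> R).

Lemma cont_box (f : R * R -> R) x e : continuous f -> 0 < e -> exists2 r, 0 < r &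
  forall y, `|y.1 - x.1| < r -> `|y.2 - x.2| < r -> `|f x - f y| < e.
Proof.
move=> cf e0; have /cvgrPdist_lt/(_ _ e0)[[A1 A2] /= [[r1 /= r10 H1] [r2 /= r20 H2]] HA] := cf x.
exists (Num.min r1 r2); first by rewrite lt_min r10.
move=> y; rewrite !lt_min => /andP[y1 _] /andP[_ y2]; apply: HA; split => /=.
- by apply: H1; rewrite /= distrC.
- by apply: H2; rewrite /= distrC.
Qed.

Lemma fusc_per P t i (n : int) y : (forall s, t <= s -> per (P^~ s)) ->
  fusc P (sh i n%:~R y) t = fusc P y t.
Proof.
move=> pP; have main (m : int) z : fusc P z t -> fusc P (sh i m%:~R z) t.
  move=> h k k0; have [r r0 Hr] := h k k0; exists r => // w s w1 w2 ts st.
  rewrite -(per_int i (- m) w (pP s ts)) (per_int i m z (pP t (lexx t))).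
  apply: Hr => //; rewrite mulrNz.
  - by case: i w1 w2 {h} => w1 w2; rewrite /sh/= in w1 *; rewrite // -addrA -opprD (addrC m%:~R).
  - by case: i w1 w2 {h} => w1 w2; rewrite /sh/= in w2 *; rewrite // -addrA -opprD (addrC m%:~R).
apply/propext; split; last exact: main.
by move=> /(main (- n)); rewrite mulrNz shKN.
Qed.

Lemma barrier_speed_ge0 (a1 La V L : R) : 0 <= a1 -> 0 <= La -> 0 <= V -> 0 <= L ->
  0 <= barrier_speed a1 La V L.
Proof.
by move=> *; rewrite /barrier_speed !addr_ge0 ?mulr_ge0 ?exprn_ge0 ?mulr_ge0 ?pi_ge0.
Qed.

Lemma excess_bound_ge0 (a1 La V B t0 tb c0 L : R) : 0 <= B -> 0 <= barrier_speed a1 La V L ->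
  0 < t0 -> t0 < tb -> 0 <= L -> 0 <= excess_bound a1 La V B t0 tb c0 L.
Proof.
move=> B0 s0 t00 t0b L0; rewrite /excess_bound !addr_ge0 ?mulr_ge0// addr_ge0// ltW//.
exact: lt_trans t00 t0b.
Qed.

Section T1.
Variables (a0 a1 La V Lv Kv B : R) (v : bool -> R * R -> R).
Hypothesis Hv : drift V Lv Kv v.

Ltac rlra := repeat match goal with
  | H : is_true (_ <= _) |- _ => revert H | H : is_true (_ < _) |- _ => revert H
  | H : @eq (Real.sort _) _ _ |- _ => revert H
  end; clear -Hv a0 a1 La B; lra.

(** The barrier starts [k / 2] above [P x0 t0], hence at least [k / 4] above [P] on the square of
    radius [rho], and [L] makes it exceed [B] by more than [k] outside that square. Where only the
    Lipschitz bound is known, [P] changes by at most [k / 8] from its value at [t0] during the short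
    time [h], so the excess stays below [- k / 8 = - 2 mu]. Thus every point at which the comparison
    asks for forward semicontinuity is one that has it. *)
Lemma fusc_of_box (a : R -> R) P x0 t0 r n : diffusion a0 a1 La a -> solution B a v P ->
  0 < t0 -> 0 < r -> 0 <= n ->
  (forall x t, `|x.1 - x0.1| < r -> `|x.2 - x0.2| < r -> t0 <= t -> t < t0 + r -> fusc P x t \/
    forall s, t0 <= s -> s < t0 + r -> `|P x s - P x t| <= n * `|s - t|) ->
  fusc P x0 t0.
Proof.
move=> Ha HP t00 r0 n0 Hbox k k0.
have [cP pP PB _] := HP.
have k4 : 0 < k / 4 by rewrite divr_gt0.
have [rho0 rho00 Hrho] := cont_box x0 (cP t0 t00) k4.
pose rho := Num.min rho0 (Num.min r (1/2)).
have rhop : 0 < rho by rewrite !lt_min rho00 r0 divr_gt0.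
have rho12 : rho <= 1/2 by rewrite !ge_min lexx !orbT.
have rhor : rho <= r by rewrite !ge_min lexx orbT.
have rhorho : rho <= rho0 by rewrite ge_min lexx.
have B0 : 0 <= B by exact: le_trans (PB t0 t00 (0, 0)).
have w0 := well_pos rhop rho12.
pose L := (2 * B + k) / well rho.
have L0 : 0 <= L by rewrite divr_ge0 ?(ltW w0)//; rlra.
pose c0 := P x0 t0 + k / 2.
have n1 : 0 < 16 * (n + 1) by rlra.
pose h := Num.min (r / 2) (k / (16 * (n + 1))).
have h0 : 0 < h by rewrite lt_min !divr_gt0.
have hr : h < r by rewrite gt_min; apply/orP; left; rlra.
have hn : n * h <= k / 16.
  apply: (@le_trans _ _ (n * (k / (16 * (n + 1))))); first by apply: ler_wpM2l => //; rewrite ge_min lexx orbT.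
  rewrite mulrA ler_pdivrMr// (_ : k / 16 * (16 * (n + 1)) = k * n + k); last by field.
  by rewrite mulrC lerDl ltW.
pose tb := t0 + h.
have t0b : t0 < tb by rewrite ltrDl.
pose mu := k / 16. have mu0 : 0 < mu by rewrite divr_gt0.
have a00 : 0 < a0 by case: Ha.
have La0 : 0 <= La by case: Ha.
have V0 : 0 <= V by case: Hv => _ _ _ h' _; exact: le_trans (h' true (0, 0)).
have a10 : 0 <= a1.
  by case: Ha => h1 _ /(_ 0) /andP[h2 h3] _; apply: le_trans h3; apply: le_trans h2; exact: ltW.
pose G := barrier a1 La V x0 t0 c0 L; pose ex := excess a1 La V P x0 t0 tb c0 L.
pose Lz := La * (L * (2 * pi)); pose BQ := excess_bound a1 La V B t0 tb c0 L.
have sp0 : 0 <= barrier_speed a1 La V L.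
  exact: barrier_speed_ge0.
have Lz0 : 0 <= Lz := mulr_ge0 La0 (mulr_ge0 L0 (pi20 R)).
have BQ0 : 0 <= BQ.
  exact: (excess_bound_ge0 c0 B0 sp0 t00 t0b L0).
have exE z t : t <= tb -> ex z t = P z t - G z t by move=> ttb; rewrite /ex /excess min_l.
have GE z t : t0 <= t -> c0 + L * bowl x0 z <= G z t.
  by move=> t0t; rewrite /G /barrier lerDl mulr_ge0// subr_ge0.
have out z t : `|z.1 - x0.1| <= 1/2 -> `|z.2 - x0.2| <= 1/2 ->
    rho <= `|z.1 - x0.1| \/ rho <= `|z.2 - x0.2| -> t0 <= t -> t <= tb -> ex z t <= - k.
  move=> z1 z2 zr t0t ttb; rewrite exE//.
  have Lw : 2 * B + k <= L * bowl x0 z.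
    have -> : 2 * B + k = L * well rho by rewrite /L divfK// gt_eqF.
    apply: ler_wpM2l => //; rewrite /bowl; have /andP[b1 _] := well_bd (z.1 - x0.1).
    have /andP[b2 _] := well_bd (z.2 - x0.2).
    by case: zr => zr; [have := well_gt rhop rho12 zr z1|have := well_gt rhop rho12 zr z2]; rlra.
  have := GE z t t0t; have := PB t (lt_le_trans t00 t0t) z; have := PB t0 t00 x0.
  rewrite !ler_norml /c0 => /andP[p1 p2] /andP[p3 p4]; rlra.
have inn z : `|z.1 - x0.1| < rho -> `|z.2 - x0.2| < rho -> P z t0 <= c0 - k / 4.
  move=> z1 z2; have := Hrho z (lt_le_trans z1 rhorho) (lt_le_trans z2 rhorho).
  by rewrite ltr_norml /c0 => /andP[h1 h2]; rlra.
have exper t i (m : int) z : t0 <= t -> t <= tb -> ex (sh i m%:~R z) t = ex z t.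
  move=> t0t ttb; have pt := pP t (lt_le_trans t00 t0t).
  by rewrite !exE// (per_int i m z pt) /G /barrier (per_int i m z (@bowl_per R x0)).
have t0tb := ltW t0b.
have neg0 z : ex z t0 <= 0.
  rewrite -(near_rep_per (F := fun z => ex z t0) x0 z); last by move=> i m y; exact: exper.
  move: (near_rep x0 z) (near_repP x0 z) => w [w1 w2].
  have [r1|r1] := leP rho `|w.1 - x0.1|; first by have := out w t0 w1 w2 (or_introl r1) (lexx t0) t0tb; rlra.
  have [r2|r2] := leP rho `|w.2 - x0.2|; first by have := out w t0 w1 w2 (or_intror r2) (lexx t0) t0tb; rlra.
  have := inn w r1 r2; have := GE w t0 (lexx t0); rewrite exE//.
  have /andP[b0 _] := bowl_bd x0 w; have := mulr_ge0 L0 b0; rlra.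
have Hmu z t : t0 <= t -> t <= tb -> - (2 * mu) < ex z t ->
    forall s, t0 <= s -> s < tb -> fusc P z s.
  move=> t0t ttb ez s t0s stb.
  have s0 : 0 < s by exact: lt_le_trans t00 t0s.
  have ps u : s <= u -> per (P^~ u) by move=> su; apply: pP; exact: lt_le_trans s0 su.
  rewrite -(near_rep_per (F := fun z => fusc P z s) x0 z); last by move=> i m y; exact: fusc_per.
  move: ez; rewrite -(near_rep_per (F := fun z => ex z t) x0 z); last by move=> i m y; exact: exper.
  move: (near_rep x0 z) (near_repP x0 z) => w [w1 w2] ez.
  have [r1|r1] := leP rho `|w.1 - x0.1|.
    by have := out w t w1 w2 (or_introl r1) t0t ttb; rewrite /mu in ez; rlra.
  have [r2|r2] := leP rho `|w.2 - x0.2|.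
    by have := out w t w1 w2 (or_intror r2) t0t ttb; rewrite /mu in ez; rlra.
  have sr : s < t0 + r by apply: lt_trans stb _; rewrite ltrD2l.
  have [//|lip] := Hbox w s (lt_le_trans r1 rhor) (lt_le_trans r2 rhor) t0s sr.
  have tr : t < t0 + r by apply: le_lt_trans ttb _; rewrite ltrD2l.
  have l1 := lip t t0t tr.
  have l2 : `|P w t0 - P w s| <= n * `|t0 - s| by apply: lip => //; rewrite ltrDl.
  have d1 : n * `|t - s| <= k / 16.
    apply: le_trans hn; apply: ler_wpM2l => //; rewrite ler_norml; apply/andP.
    by move: t0t ttb t0s stb h0; rewrite /tb; rlra.
  have d2 : n * `|t0 - s| <= k / 16.
    apply: le_trans hn; apply: ler_wpM2l => //; rewrite ler_norml; apply/andP.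
    by move: t0s stb h0; rewrite /tb; rlra.
  have := inn w r1 r2; have := GE w t t0t; move: ez; rewrite exE// /mu.
  have /andP[b0 _] := bowl_bd x0 w; have := mulr_ge0 L0 b0.
  by move: (le_trans l1 d1) (le_trans l2 d2); rewrite !ler_norml => /andP[? ?] /andP[? ?]; rlra.
have Cg0 : 0 <= Cgrad a0 (Lz + La) BQ.
  have LL : 0 <= Lz + La by rewrite addr_ge0.
  rewrite /Cgrad addr_ge0// mulr_ge0//; last by rewrite addr_ge0// mulr_ge0.
  by rewrite mulr_ge0 ?invr_ge0 ?(ltW a00)// mulr_ge0// sqr_ge0.
have [N HN] : exists N : nat, BQ * (1 + Lz + La + 2 * Cgrad a0 (Lz + La) BQ) <= a0 / 2 * N.+2%:R.
  pose X := BQ * (1 + Lz + La + 2 * Cgrad a0 (Lz + La) BQ) / (a0 / 2).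
  have X0 : 0 <= X by rewrite divr_ge0 ?divr_ge0 ?(ltW a00)// mulr_ge0// !addr_ge0// mulr_ge0.
  exists (Num.bound X); rewrite [leRHS]mulrC -ler_pdivrMr ?divr_gt0// -/X.
  apply: ltW; apply: lt_le_trans (archi_boundP X0) _; rewrite ler_nat; exact: leq_trans (leqnSn _) (leqnSn _).
have main := @excess_le0 R a0 a1 La V Lv Kv B a v P Ha Hv HP x0 t0 tb c0 L N t00 t0b L0 mu mu0 HN Hmu neg0.
pose r1 := Num.min h (k / (16 * L * pi + 4 * barrier_speed a1 La V L + 4)).
have D0 : 0 < 16 * L * pi + 4 * barrier_speed a1 La V L + 4.
  by have := mulr_ge0 L0 (pi_ge0 R); rlra.
have r10 : 0 < r1 by rewrite lt_min h0 divr_gt0.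
exists r1 => // y s y1 y2 t0s sr.
have r1h : r1 <= h by rewrite ge_min lexx.
have r1k : r1 * (16 * L * pi + 4 * barrier_speed a1 La V L + 4) <= k.
  by rewrite -ler_pdivlMr// ge_min lexx orbT.
have stb : s <= tb by rewrite /tb; rlra.
have := main s y t0s stb; rewrite -/(ex y s) exE// /G /barrier.
have b1 : L * bowl x0 y <= L * (2 * pi * (2 * r1)).
  apply: ler_wpM2l => //; have := bowl_lip x0 y x0.
  rewrite {2}/bowl !subrr well0 addr0 subr0 => /(le_trans (ler_norm _)) hb; apply: le_trans hb _.
  by apply: ler_wpM2l; [exact: pi20|rewrite /dist1; rlra].
have b2 : barrier_speed a1 La V L * (s - t0) <= barrier_speed a1 La V L * r1.
  by apply: ler_wpM2l => //; rlra.
by rewrite /c0; rlra.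
Qed.

(** Points without a neighbourhood of forward continuity form a closed set. Differentiability in
    time covers it by the sets [En n] of points where [P] is [n]-Lipschitz in time at scale
    [1 / (n + 1)]. Near a portion inside one [En n] each point is good or Lipschitz, so
    [fusc_of_box] makes all of them good, a contradiction. *)
Lemma solution_fusc2 (a : R -> R) P : diffusion a0 a1 La a -> solution B a v P ->
  forall x t, 0 < t -> fusc P x t /\ fusc (fun z t => - P z t) x t.
Proof.
move=> Ha HP x1 t1 t10; have [cP pP PB Psol] := HP.
have HP' := solution_opp HP; have Ha' := diffusion_opp Ha.
pose good (w : R * R * R) := exists2 r, 0 < r & forall w', near3 r w w' ->
  fusc P w'.1 w'.2 /\ fusc (fun z t => - P z t) w'.1 w'.2.
suff G : good (x1, t1).
  by have [r r0 Hr] := G; have := Hr (x1, t1); apply; split; rewrite /= subrr normr0.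
apply: contrapT => nG.
have tc : 0 < t1 / 4 by rewrite divr_gt0.
pose En (n : nat) : set (R * R * R) := [set w | forall s, t1 / 4 < s -> `|s - w.2| < n.+1%:R^-1 ->
   `|P w.1 s - P w.1 w.2| <= n%:R * `|s - w.2|].
have r00 : 0 < t1 / 2 by rewrite divr_gt0.
have tnear (w : R * R * R) : near3 (t1 / 2) (x1, t1) w -> t1 / 2 < w.2.
  by case=> _ _ /=; rewrite ltr_norml => /andP[]; rlra.
have [||| n [[x t] [r [Ew r0 sub HE]]]] := @baire_closed R [set w | ~ good w] En (x1, t1) (t1 / 2) nG r00.
- move=> w /contrapT[r r0 Hr]; exists (r / 2); first by rewrite divr_gt0.
  move=> w' [h1 h2 h3] /=; apply; exists (r / 2); first by rewrite divr_gt0.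
  move=> w'' [g1 g2 g3]; apply: Hr; split.
  + by have := ler_distD w'.1.1 w''.1.1 w.1.1; rlra.
  + by have := ler_distD w'.1.2 w''.1.2 w.1.2; rlra.
  + by have := ler_distD w'.2 w''.2 w.2; rlra.
(* Closedness of [En n] without joint continuity of [P]: if a nearby point [(x', t')] were in
   [En n], its defining bound used at time [t] and at time [s] would control [P x' t'] by values at
   these two fixed times, where continuity in space suffices. *)
- move=> n [x t] nx nE; have xt := tnear _ nx; rewrite /= in xt.
  have t_0 : 0 < t by rlra.
  have [s [s1 s2 s3]] : exists s, [/\ t1 / 4 < s, `|s - t| < n.+1%:R^-1 & n%:R * `|s - t| < `|P x s - P x t|].
    apply: contrapT => H; apply: nE => s /= s1 s2; rewrite leNgt; apply/negP => s3.
    by apply: H; exists s.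
  have s0 : 0 < s by rlra.
  pose g := `|P x s - P x t| - n%:R * `|s - t|.
  have g0 : 0 < g by rewrite subr_gt0.
  have g8 : 0 < g / 8 by rewrite divr_gt0.
  have [ra ra0 Ha1] := cont_box x (cP s s0) g8.
  have [rb rb0 Hb1] := cont_box x (cP t t_0) g8.
  have d0 : 0 < n.+1%:R^-1 - `|s - t| by rewrite subr_gt0.
  have n8 : 0 < g / (8 * n.+1%:R) by rewrite divr_gt0// mulr_gt0// ltr0n.
  pose rr := Num.min (Num.min ra rb) (Num.min (n.+1%:R^-1 - `|s - t|) (Num.min (n.+1%:R^-1) (Num.min (g / (8 * n.+1%:R)) (t - t1 / 4)))).
  have rr0 : 0 < rr by rewrite !lt_min ra0 rb0 d0 n8 invr_gt0 ltr0n/= subr_gt0; rlra.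
  exists rr => // -[x' t'] [] /=; rewrite !lt_min => /andP[/andP[a1' b1'] _] /andP[/andP[a2' b2'] _].
  move=> /andP[_ /and4P[c1 c2 c3 c4]] HE.
  have h1 : `|P x' s - P x' t'| <= n%:R * `|s - t'|.
    apply: HE => //=; have := ler_distD t s t'; rewrite (distrC t t').
    by move: (n.+1%:R^-1) c1 => W c1 hh; rlra.
  have h2 : `|P x' t - P x' t'| <= n%:R * `|t - t'|.
    by apply: HE => /=; [rlra|rewrite distrC].
  have h3 := Ha1 x' a1' a2'; have h4 := Hb1 x' b1' b2'.
  have h5 : n%:R * `|t - t'| <= g / 8.
    apply: (@le_trans _ _ (n.+1%:R * (g / (8 * n.+1%:R)))); last first.
      have n1 : n.+1%:R != 0 :> R by rewrite pnatr_eq0.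
      by rewrite le_eqVlt; apply/orP; left; apply/eqP; move: (n.+1%:R) n1 => W n1; field.
    by apply: ler_pM => //; rewrite ?ler_nat// distrC ltW.
  have h6 : n%:R * `|s - t'| <= n%:R * `|s - t| + n%:R * `|t - t'|.
    by rewrite -mulrDr; apply: ler_wpM2l => //; exact: ler_distD.
  have h7 := ler_distD (P x' s) (P x s) (P x t); have h8 := ler_distD (P x' t') (P x' s) (P x t).
  have h9 := ler_distD (P x' t) (P x' t') (P x t).
  rewrite (distrC (P x' t') (P x' t)) in h9; rewrite (distrC (P x' t) (P x t)) in h9.
  have gE : `|P x s - P x t| = g + n%:R * `|s - t| by rewrite /g subrK.
  move: (n%:R * `|s - t|) (n%:R * `|t - t'|) (n%:R * `|s - t'|) h1 h2 h5 h6 gE h7 h8 h9 h3 h4 g0.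
  by move=> ? ? ? ? ? ? ? gE *; move: gE; rlra.
- move=> [x t] _ /tnear /= xt; have t_0 : 0 < t by rlra.
  have [tau [_ [_ [e1 _ _ _]]]] := Psol x t t_0.
  have [r r0 Hr] := e1 1 ltr01.
  have D1 : 0 <= `|tau| + 1 + r^-1 by rewrite !addr_ge0// invr_ge0 ltW.
  exists (Num.bound (`|tau| + 1 + r^-1)) => s /= s1 s2.
  have hb := archi_boundP D1; set N := Num.bound _ in hb s2 *.
  have sr : `|s - t| < r.
    apply: lt_le_trans s2 _; rewrite -[r]invrK lef_pV2 ?posrE ?invr_gt0 ?ltr0n//.
    apply: (@le_trans _ _ N%:R); last by rewrite ler_nat.
    by apply: le_trans (ltW hb); rewrite lerDr addr_ge0.
  have := Hr (s - t) sr; rewrite (addrC t) subrK mul1r => h.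
  have -> : P x s - P x t = (s - t) * tau + (P x s - P x t - tau * (s - t)) by ring.
  apply: le_trans (ler_normD _ _) _; rewrite normrM.
  apply: (@le_trans _ _ (`|s - t| * (`|tau| + 1))); first by rewrite [leRHS]mulrDr mulr1 lerD2l.
  rewrite mulrC; apply: ler_wpM2r => //; apply: le_trans (ltW hb).
  by rewrite lerDl invr_ge0 ltW.
apply: Ew; pose d := Num.min r (n.+1%:R^-1) / 4.
have m0 : 0 < Num.min r (n.+1%:R^-1) by rewrite lt_min r0 invr_gt0 ltr0n.
have d0 : 0 < d by rewrite divr_gt0.
have dr : 2 * d < r.
  by have : Num.min r (n.+1%:R^-1) <= r by [rewrite ge_min lexx]; rewrite /d; rlra.
have dn : 2 * d < n.+1%:R^-1.
  have : Num.min r (n.+1%:R^-1) <= n.+1%:R^-1 by rewrite ge_min lexx orbT.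
  by rewrite /d; move: m0; set W := n.+1%:R^-1; move: W => W m0 hh; rlra.
exists d => // -[x' t'] [] /= x1' x2' tt'.
have t'0 : t1 / 2 < t'.
  have := tnear (x', t'); rewrite /=; apply; apply: sub; split => /=; rlra.
have box (Q : R * R -> R -> R) : (forall x s t, `|Q x s - Q x t| = `|P x s - P x t|) ->
   (forall w, good w -> fusc Q w.1 w.2) ->
   forall x'' t'', `|x''.1 - x'.1| < d -> `|x''.2 - x'.2| < d -> t' <= t'' -> t'' < t' + d ->
   fusc Q x'' t'' \/ forall s, t' <= s -> s < t' + d -> `|Q x'' s - Q x'' t''| <= n%:R * `|s - t''|.
  move=> QE Qg x'' t'' y1 y2 tt1 tt2.
  have [gw|bw] := pselect (good (x'', t'')); first by left; exact: Qg gw.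
  right=> s ts st; rewrite QE; have := HE (x'', t''); rewrite /En/=; apply => //.
  - split => /=.
    + by have := ler_distD x'.1 x''.1 x.1; rlra.
    + by have := ler_distD x'.2 x''.2 x.2; rlra.
    + by have := ler_distD t' t'' t; have : `|t'' - t'| <= d by [rewrite ger0_norm; rlra]; rlra.
  - rlra.
  - apply: lt_trans dn; rewrite ltr_norml; apply/andP; split; rlra.
have t'p : 0 < t' by rlra.
have goodf (w : R * R * R) : good w -> fusc P w.1 w.2 /\ fusc (fun z t => - P z t) w.1 w.2.
  by case=> rg rg0; apply; split; rewrite subrr normr0.
split.
- apply: (@fusc_of_box a P x' t' d n%:R) => //; apply: box => // w gw; by have [] := goodf w gw.
- apply: (@fusc_of_box _ (fun z t => - P z t) x' t' d n%:R Ha' HP') => //; apply: box => [w s1 s2|w gw].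
    by rewrite -opprD normrN.
  by have [] := goodf w gw.
Qed.

End T1.
End ForwardContinuity.

(** * Energy, weak formulation and moment decay *)

Section Consequences.
Variable R : realType.
Implicit Types (z : R * R) (i : bool) (r s t k c : R).

Section Fixed.
Variables (a0 a1 La V Lv Kv B : R) (a : R -> R) (v : bool -> R * R -> R) (P : R * R -> R -> R).
Hypotheses (Ha : diffusion a0 a1 La a) (Hv : drift V Lv Kv v) (HP : solution B a v P).
Variables (n : nat) (T1 : R).
Hypothesis T10 : 0 < T1.
Hypothesis HN : (2 * B + 1) * (2 + 2 * (La + 2 * Cgrad a0 La B)) <= a0 / 2 * n.+2%:R.

Let C := La + 2 * Cgrad a0 La B.

Let a00 : 0 < a0. Proof. by case: Ha. Qed.
Let La0 : 0 <= La. Proof. by case: Ha. Qed.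
Let B0 : 0 <= B. Proof. by case: HP => _ _ h _; exact: le_trans (h T1 T10 (0, 0)). Qed.
Let C0 : 0 <= C.
Proof.
rewrite /C addr_ge0// mulr_ge0// /Cgrad addr_ge0// mulr_ge0//; last by rewrite addr_ge0// mulr_ge0.
by rewrite mulr_ge0 ?invr_ge0 ?(ltW a00)// mulr_ge0// sqr_ge0.
Qed.

Let Pc z t := P z (Num.max T1 t).

Let Tm t : 0 < Num.max T1 t. Proof. by rewrite lt_max T10. Qed.

Let cPc t : continuous (Pc^~ t). Proof. by case: HP => h _ _ _; exact: h. Qed.
Let pPc t : per (Pc^~ t). Proof. by case: HP => _ h _ _; exact: h. Qed.
Let PcB z t : `|Pc z t| <= B. Proof. by case: HP => _ _ h _; exact: h. Qed.
Lemma solution_clamp_cont z : continuous (Pc z).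
Proof.
move=> t; apply: (continuous_comp (f := fun t => Num.max T1 t)).
  have : continuous (fun u : R => Num.max T1 u) by apply: cont_max; [exact: cont_cst|exact: cont_idR].
  exact.
exact: (solution_time_cont (z := z) HP (Tm t)).
Qed.

Lemma cont_I_mul (W : R * R -> R) : continuous W -> (exists Wb, forall z, `|W z| <= Wb) ->
  continuous (fun t => I (fun z => Pc z t * W z)).
Proof.
move=> cW [Wb HW]; apply: (@cont_I_time R (B * Wb) (fun z t => Pc z t * W z)).
- by move=> t; have c := @cPc t; ct.
- by move=> z t; exact: prod_le_norm.
- by move=> z; have c := @solution_clamp_cont z; ct.
Qed.

Lemma cont_I_Dp i r : r != 0 -> continuous (fun t => I (fun z => Dp i r (Pc^~ t) z ^+ 2)).
Proof.
move=> r0; apply: (@cont_I_time R ((2 * B / `|r|) ^+ 2) (fun z t => Dp i r (Pc^~ t) z ^+ 2)).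
- by move=> t; have c := @cont_Dp R i r _ (@cPc t); ct.
- move=> z t; rewrite normrX lerXn2r ?nnegrE ?divr_ge0 ?mulr_ge0//.
  rewrite /Dp normrM normfV ler_pM2r ?invr_gt0 ?normr_gt0//.
  by apply: le_trans (ler_normB _ _) _; have := PcB z t; have := PcB (sh i r z) t; lra.
- by move=> z; have c1 := @solution_clamp_cont z; have c2 := @solution_clamp_cont (sh i r z); rewrite /Dp; ct.
Qed.

(** [W] is the transport [v . grad fi], obtained as the limit of discrete divergences of [fi * v].
    Only backward differences occur, so one-sided derivatives of [fi] are enough. *)
Definition test_fun (F Lf : R) (fi W : R * R -> R) :=
  [/\ continuous fi /\ continuous W, per fi, forall z, `|fi z| <= F,
      forall i z r, `|fi (sh i r z) - fi z| <= Lf * `|r| &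
      forall z k, 0 < k -> exists2 r0, 0 < r0 & forall r, 0 < r -> r < r0 ->
        `|Dm true r (fun y => fi y * v true y) z + Dm false r (fun y => fi y * v false y) z - W z| <= k].

(** The main inequality without cutoff ([eta = 1], [m = 0]) and without dependence of the
    coefficient on position ([Lz = M = 0]), now that forward semicontinuity holds everywhere. *)
Lemma global_ml F Lf fi W kap c lam1 rh s t : 0 <= kap -> 0 <= Lf -> 0 < rh -> rh < 1 -> 0 <= lam1 ->
  test_fun F Lf fi W -> (forall z, 0 <= fi z) ->
  (forall x : R, `|x| <= B -> Lf + kap * pw n.+2 (x - c) + (F + kap * pw n.+2 (x - c)) * C
     <= a0 / 2 * (kap * n.+2%:R * pw n.+1 (x - c))) ->
  (forall x : R, `|x| <= B -> lam1 <= kap * n.+2%:R * pw n.+1 (x - c)) ->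
  T1 <= s -> s <= t ->
  I (fun z => fi z * Pc z t + kap / n.+3%:R * pw n.+3 (Pc z t - c))
  - I (fun z => fi z * Pc z s + kap / n.+3%:R * pw n.+3 (Pc z s - c))
  + a0 / 2 * lam1 * J s t (fun u => I (fun z => Dp true rh (Pc^~ u) z ^+ 2) + I (fun z => Dp false rh (Pc^~ u) z ^+ 2))
  <= J s t (fun u => I (fun z => Pc z u * W z)) + 2 * Lf * a1 ^+ 2 * (t - s).
Proof.
move=> kap0 Lf0 rh0 rh1 lam0 [[cfi cW] pfi fib fiL Wl] fi0 absb lam1E T1s st.
have [Lv0 vp vL vb vd] := Hv; have [_ _ abd aL] := Ha; have [cP pP PB Psol] := HP.
have s0 : 0 < s by exact: lt_le_trans T10 T1s.
have Bc0 : 0 <= B + `|c| by rewrite addr_ge0.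
have [K K0 prof] := profile n c Bc0 kap0.
pose E (x : R) := kap * pw n.+2 (x - c). pose E1 (x : R) := kap * n.+2%:R * pw n.+1 (x - c).
pose la (x : R) := kap / n.+3%:R * pw n.+3 (x - c).
have cpw m : continuous (fun x : R => pw m (x - c)).
  by apply: (@cont_pw R R m (fun x => x - c)); ct.
have xc (x : R) : `|x| <= B -> x - c <= B + `|c|.
  by move=> h; have := ler_norm x; have := ler_norm (- c); rewrite normrN; lra.
have ML := @main_inequality R a0 a1 La 0 Lv Kv V B 0 0 F Lf 0 K lam1 rh 1 s t (fun _ _ q => a q) v P
  fi (fun=> 1) (fun=> 0) W E E1 la.
have Wseq z : (fun m : nat => Dm true (rh / m.+2%:R) (fun y => fi y * v true y) z
   + Dm false (rh / m.+2%:R) (fun y => fi y * v false y) z) @ \oo --> W z.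
  apply/cvgrPdist_le => k k0; have [r0 r00 Hr] := Wl z k k0.
  have /cvgrPdist_lt/(_ _ r00)[N _ HNN] := @cvg_harmonic R.
  exists N => // m /= Nm; rewrite distrC; apply: Hr; first by rewrite divr_gt0.
  have := HNN m Nm; rewrite /harmonic/= sub0r normrN gtr0_norm ?invr_gt0//; apply: lt_trans.
  rewrite ltr_pdivrMr// mulrC -ltr_pdivrMr ?invr_gt0// invrK.
  by apply: lt_trans (_ : 1 * m.+1%:R < _); rewrite ?ltr_pM2r// mul1r ltr_nat.
have clampE u : s <= u -> u <= t -> Num.max s (Num.min u t) = u by move=> h1 h2; rewrite min_l// max_r.
have PcE z u : s <= u -> Pc z u = P z u by move=> su; rewrite /Pc max_r// (le_trans T1s).
have c1 : continuous (fun u => I (fun z => Pc z u * W z)).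
  apply: cont_I_mul => //; exists (2 * (Lf * V + F * Lv)) => z.
  have Hn m : `|Dm true (rh / m.+2%:R) (fun y => fi y * v true y) z
     + Dm false (rh / m.+2%:R) (fun y => fi y * v false y) z| <= 2 * (Lf * V + F * Lv).
    set r := rh / _; have r0 : 0 < r by rewrite divr_gt0.
    have q i : `|Dm i r (fun y => fi y * v i y) z| <= Lf * V + F * Lv.
      rewrite /Dm normrM normfV (gtr0_norm r0) ler_pdivrMr//.
      set z' := sh i (- r) z.
      have -> : fi z * v i z - fi z' * v i z' = (fi z - fi z') * v i z + fi z' * (v i z - v i z') by ring.
      rewrite [leRHS]mulrDl; apply: le_trans (ler_normD _ _) _; apply: lerD.
        rewrite mulrAC; apply: prod_le_norm => //; rewrite distrC; apply: le_trans (fiL _ _ _) _.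
        by rewrite normrN gtr0_norm.
      rewrite -mulrA; apply: prod_le_norm => //.
      rewrite distrC; apply: le_trans (vL _ _ _) _; rewrite /z' /dist1.
      by case: (i); rewrite /sh/= subrr normr0 ?addr0 ?add0r addrAC subrr add0r normrN gtr0_norm.
    rewrite mulrDl mul1r; apply: le_trans (ler_normD _ _) _; exact: lerD.
  have cc := lim_norm (@Wseq z).
  have c2 : (fun _ : nat => 2 * (Lf * V + F * Lv)) @ \oo --> 2 * (Lf * V + F * Lv) by exact: cvg_cst.
  exact: lim_le cc c2 Hn.
have c2 : continuous (fun u => I (fun z => Dp true rh (Pc^~ u) z ^+ 2)).
  by apply: cont_I_Dp; rewrite gt_eqF.
have c3 : continuous (fun u => I (fun z => Dp false rh (Pc^~ u) z ^+ 2)).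
  by apply: cont_I_Dp; rewrite gt_eqF.
have {ML}ML : lyap fi (fun=> 1) la (P^~ t) - lyap fi (fun=> 1) la (P^~ s)
   <= J s t (fun u => rate0 a0 a1 V Lf 0 lam1 rh P (fun=> 0) W E la (Num.max s (Num.min u t))).
  apply: ML => //.
  - by move=> _ z y q q'; rewrite mul0r add0r.
  - by move=> z u u0; exact: (solution_time_cont (z := z) HP u0).
  - move=> u y u0 _; have [tau [pi' [H [e1 e2 e3 e4]]]] := Psol y u u0.
    exists tau, pi', H; split => //; last by rewrite e4 subr0.
    move=> k k0; have [r r0 Hr] := e1 k k0; exists r => // d d0 dr.
    have := Hr (- d); rewrite normrN gtr0_norm// => /(_ dr); rewrite ler_norml => /andP[h1 _].
    by move: h1; lra.
  - exact: cont_cst.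
  - exact: cont_cst.
  - by move=> z; rewrite fi0 (le_trans (ler_norm _) (fib z)).
  - by move=> z; rewrite ler01 lexx.
  - by move=> z; rewrite ler01 lexx.
  - by move=> i z r _; rewrite subrr normr0 !mul0r.
  - by apply: cont_mul; [exact: cont_cst|exact: cpw].
  - by apply: cont_mul; [exact: cont_cst|exact: cpw].
  - by apply: cont_mul; [exact: cont_cst|exact: cpw].
  - by move=> x y xB yB; exact: (prof x y (xc x xB) (xc y yB)).
  - move=> z x xB; rewrite expr1n !mul1r add0r.
    apply: le_trans (absb x xB); rewrite lerD2l; apply: ler_wpM2r; first exact: C0.
    by rewrite lerD2r (le_trans (ler_norm _) (fib z)).
  - by move=> z x xB; rewrite expr1n mul1r; exact: lam1E.
  - move=> x _ y _ _ u su ut; have u0 : 0 < u by exact: lt_le_trans s0 su.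
    by have [] := solution_fusc2 Hv Ha HP y u0.
have LE u : s <= u -> lyap fi (fun=> 1) la (P^~ u) = I (fun z => fi z * Pc z u + kap / n.+3%:R * pw n.+3 (Pc z u - c)).
  by move=> su; apply: eq_I => z; rewrite expr1n mul1r PcE.
rewrite -(LE s (lexx s)) -(LE t st) -lerBrDr; apply: le_trans ML _; rewrite -JZ; last by ct.
rewrite -(J_cst _ st) -JD; [|exact: c1|exact: cont_cst].
rewrite -JB; [|by ct|by ct].
rewrite (@eq_J _ s t _ (fun u => I (fun z => Pc z u * W z) + 2 * Lf * a1 ^+ 2
   - a0 / 2 * lam1 * (I (fun z => Dp true rh (Pc^~ u) z ^+ 2) + I (fun z => Dp false rh (Pc^~ u) z ^+ 2)))).
  by apply: J_le => [||u _]; [by ct|by ct|].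
move=> u /andP[su ut]; rewrite clampE// /rate0 expr0n/= !mulr0 !mul0r !addr0.
have E3 i : I (fun z => Dp i rh (P^~ u) z ^+ 2) = I (fun z => Dp i rh (Pc^~ u) z ^+ 2).
  by apply: eq_I => z; rewrite /Dp !PcE.
by rewrite !E3; congr (_ + _ - _); apply: eq_I => z; rewrite PcE.
Qed.

(** The shift by [B + 1] keeps the base of the power between 1 and [2 * B + 1], so the profile is
    uniformly convex on the range of [P]. *)
Definition entropy (t : R) := I (fun z => 1 / n.+3%:R * pw n.+3 (Pc z t - - (B + 1))).

Let wE (x : R) : `|x| <= B -> 1 <= pos (x - - (B + 1)) <= 2 * B + 1.
Proof.
have B0' := B0; rewrite ler_norml => /andP[x1 x2]; rewrite posE opprK.
by rewrite ifT; move: x1 x2 B0'; lra.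
Qed.

Let absb F Lf kap (x : R) : 0 <= Lf -> 0 <= F -> Lf + F + 1 <= kap -> `|x| <= B ->
  Lf + kap * pw n.+2 (x - - (B + 1)) + (F + kap * pw n.+2 (x - - (B + 1))) * C
  <= a0 / 2 * (kap * n.+2%:R * pw n.+1 (x - - (B + 1))).
Proof.
move=> Lf0 F0 kF xB; have /andP[w1 w2] := wE xB; rewrite /pw.
set w := pos _ in w1 w2 *; have k0 : 0 <= kap by lra.
have y1 : 1 <= w ^+ n.+1 by exact: exprn_ege1.
have y0 : 0 <= w ^+ n.+1 by lra.
set E := kap * w ^+ n.+2.
have kE : kap <= E by rewrite /E ler_peMr// exprn_ege1.
have e1 : Lf + E + (F + E) * C <= E * (2 + 2 * C).
  have : F * C <= E * C by apply: ler_wpM2r => //; lra.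
  by lra.
apply: le_trans e1 _; rewrite /E exprSr.
have -> : kap * (w ^+ n.+1 * w) * (2 + 2 * C) = (kap * w ^+ n.+1) * (w * (2 + 2 * C)) by ring.
have -> : a0 / 2 * (kap * n.+2%:R * w ^+ n.+1) = (kap * w ^+ n.+1) * (a0 / 2 * n.+2%:R).
  by move: (n.+2%:R) => N2; ring.
apply: ler_wpM2l; first exact: mulr_ge0.
apply: le_trans HN; apply: ler_wpM2r => //.
by have C0' := C0; lra.
Qed.

Let cpw (m : nat) (c : R) : continuous (fun x : R => pw m (x - c)).
Proof. by apply: (@cont_pw R R m (fun x : R => x - c)); ct. Qed.

Let lyapE (fi : R * R -> R) kap c t : continuous fi ->
  I (fun z => fi z * Pc z t + kap / n.+3%:R * pw n.+3 (Pc z t - c)) =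
  I (fun z => fi z * Pc z t) + kap * I (fun z => 1 / n.+3%:R * pw n.+3 (Pc z t - c)).
Proof.
move=> cfi; have cp := @cPc t; have c1 := cont_comp cp (@cpw n.+3 c).
rewrite -IZ; [|by ct]; rewrite -ID; [|by ct..].
by apply: eq_I => z; congr (_ + _); rewrite mul1r -mulrA.
Qed.

Lemma test_fun0 : test_fun 0 0 (fun=> 0) (fun=> 0).
Proof.
split=> //; [by split; exact: cont_cst|by move=> z; rewrite normr0|
  by move=> i z r; rewrite subrr normr0 mul0r|].
by move=> z k k0; exists 1 => // r _ _; rewrite /Dm !mul0r subrr mul0r addr0 subrr normr0 ltW.
Qed.

Lemma test_fun_addc F Lf fi W c : test_fun F Lf fi W -> test_fun (F + `|c|) Lf (fun z => fi z + c) W.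
Proof.
case=> [[cfi cW] pfi fib fiL Wl]; have [_ _ _ _ vd] := Hv; split.
- by split => //; ct.
- by move=> i z; rewrite pfi.
- by move=> z; apply: le_trans (ler_normD _ _) _; rewrite lerD2r.
- by move=> i z r; rewrite opprD addrACA subrr addr0.
move=> z k k0; have k2 : 0 < k / 2 by rewrite divr_gt0.
have [r0 r00 Hr] := Wl z _ k2.
have D0 : 0 < 2 * (`|c| * `|Kv| + 1) by rewrite mulr_gt0// ltr_wpDl// mulr_ge0.
exists (Num.min r0 (Num.min 1 (k / (2 * (`|c| * `|Kv| + 1))))); first by rewrite !lt_min r00 ltr01 divr_gt0.
move=> r rp; rewrite !lt_min => /and3P[r1 r2 r3].
have -> : Dm true r (fun y => (fi y + c) * v true y) z + Dm false r (fun y => (fi y + c) * v false y) z - W z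
  = (Dm true r (fun y => fi y * v true y) z + Dm false r (fun y => fi y * v false y) z - W z)
   + c * (Dm true r (v true) z + Dm false r (v false) z) by rewrite /Dm; ring.
apply: le_trans (ler_normD _ _) _; rewrite [k]splitr; apply: lerD; first exact: Hr.
rewrite normrM; apply: (@le_trans _ _ (`|c| * (`|Kv| * r))).
  apply: ler_wpM2l => //; apply: le_trans (vd z r rp r2) _.
  by apply: ler_wpM2r; [exact: ltW|exact: ler_norm].
rewrite mulrA; rewrite ltr_pdivlMr// in r3.
have : 0 <= r by exact: ltW.
by move: r3; lra.
Qed.

Lemma entropy_energy rh s t : 0 < rh -> rh < 1 -> T1 <= s -> s <= t ->
  a0 / 2 * J s t (fun u => I (fun z => Dp true rh (Pc^~ u) z ^+ 2) + I (fun z => Dp false rh (Pc^~ u) z ^+ 2))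
  <= entropy s - entropy t.
Proof.
move=> rh0 rh1 T1s st.
have H := @global_ml 0 0 (fun=> 0) (fun=> 0) 1 (- (B + 1)) 1 rh s t ler01 (lexx 0) rh0 rh1 ler01 test_fun0
  (fun=> lexx 0) _ _ T1s st.
have {}H := H (fun x xB => absb (lexx 0) (lexx 0) _ xB).
have {}H : I (fun z => (fun=> 0) z * Pc z t + 1 / n.+3%:R * pw n.+3 (Pc z t - - (B + 1)))
  - I (fun z => (fun=> 0) z * Pc z s + 1 / n.+3%:R * pw n.+3 (Pc z s - - (B + 1)))
  + a0 / 2 * 1 * J s t (fun u => I (fun z => Dp true rh (Pc^~ u) z ^+ 2) + I (fun z => Dp false rh (Pc^~ u) z ^+ 2))
  <= J s t (fun u => I (fun z => Pc z u * 0)) + 2 * 0 * a1 ^+ 2 * (t - s).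
  apply: H; first by rewrite !add0r.
  move=> x xB; have /andP[w1 w2] := wE xB; rewrite mul1r /pw -[X in X <= _]mul1r.
  by apply: ler_pM => //; [rewrite ler1n|exact: exprn_ege1].
move: H; rewrite !lyapE; [|exact: cont_cst..].
have I0 (f : R * R -> R) : I (fun z => (fun=> 0) z * f z) = 0.
  by rewrite (@eq_I _ _ (fun=> 0)) ?I_cst// => z; rewrite mul0r.
have -> : J s t (fun u => I (fun z => Pc z u * 0)) = 0.
  rewrite (@eq_J _ s t _ (fun=> 0)); first by rewrite J_cst// mul0r.
  by move=> u _; rewrite (@eq_I _ _ (fun=> 0)) ?I_cst// => z; rewrite mulr0.
rewrite !I0 -/(entropy s) -/(entropy t) !mul1r mulr1 mulr0 !mul0r !add0r; lra.
Qed.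

(** Adding [kap = Lf + F + 1] times the entropy to the linear functional makes the absorbing
    condition [absb] true. The price is the same multiple of the entropy drop. *)
Lemma weak_ub F Lf fi W s t : 0 <= Lf -> test_fun F Lf fi W -> (forall z, 0 <= fi z) ->
  T1 <= s -> s <= t ->
  I (fun z => fi z * Pc z t) - I (fun z => fi z * Pc z s) - J s t (fun u => I (fun z => Pc z u * W z))
  <= 2 * Lf * a1 ^+ 2 * (t - s) + (Lf + F + 1) * (entropy s - entropy t).
Proof.
move=> Lf0 tf fi0 T1s st; have [[cfi _] _ fib _ _] := tf.
have F0 : 0 <= F by apply: le_trans (normr_ge0 _) (fib (0, 0)).
have k0 : 0 <= Lf + F + 1 by lra.
have h0 : 0 < (1 / 2 : R) by lra.
have h1 : (1 / 2 : R) < 1 by lra.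
have H := @global_ml F Lf fi W (Lf + F + 1) (- (B + 1)) 0 (1/2) s t k0 Lf0 h0 h1 (lexx 0) tf fi0 _ _ T1s st.
have {}H := H (fun x xB => absb Lf0 F0 (lexx _) xB).
have {}H : I (fun z => fi z * Pc z t + (Lf + F + 1) / n.+3%:R * pw n.+3 (Pc z t - - (B + 1)))
  - I (fun z => fi z * Pc z s + (Lf + F + 1) / n.+3%:R * pw n.+3 (Pc z s - - (B + 1)))
  + a0 / 2 * 0 * J s t (fun u => I (fun z => Dp true (1/2) (Pc^~ u) z ^+ 2) + I (fun z => Dp false (1/2) (Pc^~ u) z ^+ 2))
  <= J s t (fun u => I (fun z => Pc z u * W z)) + 2 * Lf * a1 ^+ 2 * (t - s).
  by apply: H => x _; rewrite !mulr_ge0// pw_ge0.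
move: H; rewrite !lyapE// -/(entropy s) -/(entropy t) mulr0 mul0r addr0.
by set x1 := J _ _ _; set x2 := I _; set x3 := I _; lra.
Qed.

(** With [fi = 0] both sides of the absorbing condition contain the factor [(x - c)_+ ^ (n + 1)],
    and what remains follows from [HN] for every level [c]. *)
Lemma level_nonincr c s t : `|c| <= B -> T1 <= s -> s <= t ->
  I (fun z => pw n.+3 (Pc z t - c)) <= I (fun z => pw n.+3 (Pc z s - c)).
Proof.
move=> cB T1s st.
have h0 : 0 < (1 / 2 : R) by lra.
have h1 : (1 / 2 : R) < 1 by lra.
have H := @global_ml 0 0 (fun=> 0) (fun=> 0) 1 c 0 (1/2) s t ler01 (lexx 0) h0 h1 (lexx 0) test_fun0
  (fun=> lexx 0) _ _ T1s st.
have {}H : I (fun z => (fun=> 0) z * Pc z t + 1 / n.+3%:R * pw n.+3 (Pc z t - c))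
  - I (fun z => (fun=> 0) z * Pc z s + 1 / n.+3%:R * pw n.+3 (Pc z s - c))
  + a0 / 2 * 0 * J s t (fun u => I (fun z => Dp true (1/2) (Pc^~ u) z ^+ 2) + I (fun z => Dp false (1/2) (Pc^~ u) z ^+ 2))
  <= J s t (fun u => I (fun z => Pc z u * 0)) + 2 * 0 * a1 ^+ 2 * (t - s).
  apply: H => [x xB|x _]; last by rewrite !mulr_ge0// pw_ge0.
  rewrite !add0r !mul1r /pw; set w := pos (x - c).
  have w2 : w <= 2 * B.
    rewrite /w posE; case: ifP => _; last by rewrite mulr_ge0.
    by move: xB cB; rewrite !ler_norml => /andP[? ?] /andP[? ?]; lra.
  have w0 : 0 <= w ^+ n.+1 by rewrite exprn_ge0// pos_ge0.
  rewrite (exprSr w n.+1) (_ : _ + _ * C = w ^+ n.+1 * (w * (1 + C))); last by ring.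
  rewrite [leRHS](_ : _ = w ^+ n.+1 * (a0 / 2 * n.+2%:R)); last by move: (n.+2%:R) => N2; ring.
  apply: ler_wpM2l => //; apply: le_trans HN.
  by rewrite -/C; have C0' := C0; have B0' := B0; apply: ler_pM; rewrite ?pos_ge0//; move: (C) C0' B0' w2 => D; lra.
move: H; rewrite !lyapE; [|exact: cont_cst..].
have I0 (f : R * R -> R) : I (fun z => (fun=> 0) z * f z) = 0.
  by rewrite (@eq_I _ _ (fun=> 0)) ?I_cst// => z; rewrite mul0r.
have -> : J s t (fun u => I (fun z => Pc z u * 0)) = 0.
  rewrite (@eq_J _ s t _ (fun=> 0)); first by rewrite J_cst// mul0r.
  by move=> u _; rewrite (@eq_I _ _ (fun=> 0)) ?I_cst// => z; rewrite mulr0.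
have c1 := cont_comp (@cPc t) (@cpw n.+3 c); have c2 := cont_comp (@cPc s) (@cpw n.+3 c).
rewrite !I0 !IZ// !mul1r !mulr0 !mul0r !add0r addr0 -mulrBr pmulr_rle0 ?invr_gt0 ?ltr0n//.
by rewrite subr_le0.
Qed.

Lemma entropy_bound t : 0 <= entropy t <= (2 * B + 1) ^+ n.+3.
Proof.
apply/andP; split; first by apply: I_ge0 => z; rewrite mulr_ge0 ?pw_ge0// divr_ge0.
rewrite -[leRHS]I_cst; have c1 := cont_comp (@cPc t) (@cpw n.+3 (- (B + 1))).
apply: I_le => [||z]; [by ct|exact: cont_cst|].
have /andP[w1 w2] := wE (PcB z t).
rewrite mul1r ler_pdivrMl ?ltr0n//; apply: (@le_trans _ _ ((2 * B + 1) ^+ n.+3)).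
  by rewrite lerXn2r ?nnegrE//; lra.
by apply: ler_peMl; rewrite ?ler1n// exprn_ge0//; lra.
Qed.

End Fixed.

Section TwoSided.
Variables (a0 a1 La V Lv Kv B : R) (a : R -> R) (v : bool -> R * R -> R) (P : R * R -> R -> R).
Hypotheses (Ha : diffusion a0 a1 La a) (Hv : drift V Lv Kv v) (HP : solution B a v P).
Variables (n : nat) (T1 : R).
Hypothesis T10 : 0 < T1.
Hypothesis HN : (2 * B + 1) * (2 + 2 * (La + 2 * Cgrad a0 La B)) <= a0 / 2 * n.+2%:R.

Let Ha' := diffusion_opp Ha.
Let HP' := solution_opp HP.

Definition entropy2 t := entropy B P n T1 t + entropy B (fun z t => - P z t) n T1 t.

Lemma entropy_nonincr s t : T1 <= s -> s <= t -> entropy B P n T1 t <= entropy B P n T1 s /\ entropy B (fun z t => - P z t) n T1 t <= entropy B (fun z t => - P z t) n T1 s.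
Proof.
move=> T1s st; have a00 : 0 < a0 by case: Ha.
have h0 : 0 < (1 / 2 : R) by lra.
have h1 : (1 / 2 : R) < 1 by lra.
have a02 : 0 <= a0 / 2 by rewrite divr_ge0// ltW.
have E1 := entropy_energy Ha Hv HP T10 HN h0 h1 T1s st.
have E2 := entropy_energy Ha' Hv HP' T10 HN h0 h1 T1s st.
have pos0 (Q : R * R -> R -> R) : 0 <= J s t (fun u => I (fun z => Dp true (1/2) (Q^~ u) z ^+ 2) + I (fun z => Dp false (1/2) (Q^~ u) z ^+ 2)).
  by apply: J_ge0 => u _; rewrite addr_ge0// I_ge0// => z; exact: sqr_ge0.
by split; rewrite -subr_ge0; [apply: le_trans E1|apply: le_trans E2]; apply: mulr_ge0.
Qed.

(** A test function of either sign is split as [(fi + F) - F]: the first part is tested against [P],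
    the constant [F] against [- P], and both are nonnegative. This is why [entropy2] adds the
    entropies of [P] and [- P]. *)
Lemma weak_upper F Lf fi W s t : 0 <= Lf -> test_fun v F Lf fi W -> T1 <= s -> s <= t ->
  I (fun z => fi z * P z (Num.max T1 t)) - I (fun z => fi z * P z (Num.max T1 s))
   - J s t (fun u => I (fun z => P z (Num.max T1 u) * W z))
  <= 2 * Lf * a1 ^+ 2 * (t - s) + (Lf + 2 * F + 1) * (entropy2 s - entropy2 t).
Proof.
move=> Lf0 tf T1s st; have [[cfi cW] _ fib _ _] := tf.
have F0 : 0 <= F by apply: le_trans (normr_ge0 _) (fib (0, 0)).
have Fh : F + 1 <= Lf + 2 * F + 1 by lra.
have t1 := test_fun_addc Hv F tf; have t2 := test_fun_addc Hv F (test_fun0 v).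
have p1 z : 0 <= fi z + F by have := fib z; rewrite ler_norml => /andP[]; lra.
have p2 z : 0 <= (fun=> 0 : R) z + F by rewrite add0r.
have U1 := weak_ub Ha Hv HP T10 HN Lf0 t1 p1 T1s st.
have U2 := weak_ub Ha' Hv HP' T10 HN (lexx 0) t2 p2 T1s st.
have [e1 e2] := entropy_nonincr T1s st.
have J0 : J s t (fun u => I (fun z : R * R => - P z (Num.max T1 u) * 0)) = 0.
  rewrite (@eq_J _ s t _ (fun=> 0)); first by rewrite J_cst// mul0r.
  by move=> u _; rewrite (@eq_I _ _ (fun=> 0)) ?I_cst// => z; rewrite mulr0.
have Tm u : 0 < Num.max T1 u by rewrite lt_max T10.
have cP u : continuous (fun z => P z (Num.max T1 u)) by case: HP => h _ _ _; exact: h.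
have IE u : I (fun z => (fi z + F) * P z (Num.max T1 u)) + I (fun z => F * - P z (Num.max T1 u))
   = I (fun z => fi z * P z (Num.max T1 u)).
  have c := @cP u; rewrite -ID; [|by ct..]; apply: eq_I => z; ring.
rewrite J0 mulr0 !mul0r add0r subr0 (ger0_norm F0) add0r in U2.
rewrite (ger0_norm F0) in U1.
rewrite -(IE t) -(IE s) /entropy2.
have m1 : (F + 1) * (entropy B (fun z t => - P z t) n T1 s - entropy B (fun z t => - P z t) n T1 t)
   <= (Lf + 2 * F + 1) * (entropy B (fun z t => - P z t) n T1 s - entropy B (fun z t => - P z t) n T1 t).
  by apply: ler_wpM2r Fh; rewrite subr_ge0.
move: U1 U2 m1; rewrite (_ : Lf + (F + F) + 1 = Lf + 2 * F + 1); last by ring.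
set x1 := I _; set x2 := I _; set x3 := I _; set x4 := I _; set x5 := J _ _ _.
clear p1 p2; lra.
Qed.

End TwoSided.
End Consequences.

(** * The cellular flow and its test functions *)

Section Bumps.
Variable R : realType.
Implicit Types (z : R * R) (i : bool) (r s t c x y w l : R).

Definition co i z := if i then z.1 else z.2.

Lemma co_sh i j r z : co i (sh j r z) = if i == j then co i z + r else co i z.
Proof. by case: i; case: j. Qed.

Lemma cont_co i : continuous (co i).
Proof. by case: i; [exact: cont_fst|exact: cont_snd]. Qed.

(** The integer [n] with [n < x <= n + 1]. Intervals are closed on the right because only backward
    differences are taken: [sig] is then constant just to the left of every point. *)
Definition base x : R := (Num.ceil x)%:~R - 1.

Lemma baseP x : base x < x <= base x + 1.
Proof.
rewrite /base; have := ceil_ge x; have := ceilB1_lt x; rewrite intrD => h1 h2.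
by rewrite h1 subrK h2.
Qed.

Lemma base_uniq x (n : int) : n%:~R < x <= n%:~R + 1 -> base x = n%:~R.
Proof.
move=> /andP[h1 h2]; have /andP[b1 b2] := baseP x; move: b1 b2; rewrite /base.
set N := Num.ceil x => b1 b2; rewrite -(intrB _ N 1); congr (_%:~R).
have e1 : (N - 1 < n + 1)%R by rewrite -(ltr_int R) intrB intrD; apply: lt_le_trans h2.
have e2 : (n < N)%R by rewrite -(ltr_int R); apply: lt_le_trans h1 _; rewrite -[N%:~R](subrK 1).
by apply/eqP; rewrite eq_le -ltzD1 e1 lerBrDr lezD1.
Qed.

Lemma base_int x : exists n : int, base x = n%:~R.
Proof. by exists (Num.ceil x - 1); rewrite intrB. Qed.

Definition sig w x : R := (x <= base x + w)%R%:R.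

Lemma sig_per w x : sig w (x + 1) = sig w x.
Proof.
have [n hn] := base_int x; have := baseP x; rewrite hn => /andP[h1 h2].
have -> : sig w (x + 1) = (x + 1 <= (n + 1)%:~R + w)%R%:R.
  by rewrite /sig (@base_uniq _ (n + 1)) // intrD ltrD2r h1 lerD2r.
by rewrite /sig hn intrD addrAC lerD2r.
Qed.

Lemma sig1 x : sig 1 x = 1.
Proof. by rewrite /sig; have /andP[_ ->] := baseP x. Qed.

Lemma sig_add w w' x : 0 < w -> 0 < w' -> w + w' <= 1 -> sig (w + w') x = sig w x + sig w' (x - w).
Proof.
move=> w0 w0' ww; have [n hn] := base_int x; have := baseP x; rewrite hn => /andP[h1 h2].
rewrite /sig hn; case: (lerP x (n%:~R + w)) => xw.
  rewrite (@base_uniq (x - w) (n - 1)); last by rewrite intrB; apply/andP; split; lra.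
  rewrite intrB (_ : (x <= _) = true); last by apply/idP; lra.
  by rewrite (_ : (x - w <= _) = false) ?addr0//; apply/negbTE; rewrite -ltNge; lra.
rewrite (@base_uniq (x - w) n); last by apply/andP; split; lra.
by rewrite add0r lerBlDr addrA addrAC -addrA addrCA addrA.
Qed.

Lemma sig01 w x : sig w x = 0 \/ sig w x = 1.
Proof. by rewrite /sig; case: (_ <= _); [right|left]. Qed.

Lemma sig_left w x : 0 < w -> exists2 r0, 0 < r0 & forall r, 0 <= r -> r < r0 -> sig w (x - r) = sig w x.
Proof.
move=> w0; have [n hn] := base_int x; have := baseP x; rewrite hn => /andP[h1 h2].
pose r1 := if x <= n%:~R + w then 1 else x - (n%:~R + w).
have r10 : 0 < r1 by rewrite /r1; case: ifP => // /negbT; rewrite -ltNge subr_gt0.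
exists (Num.min (x - n%:~R) r1); first by rewrite lt_min subr_gt0 h1.
move=> r r0; rewrite lt_min => /andP[rn rr].
rewrite /sig hn (@base_uniq (x - r) n); last by apply/andP; split; lra.
congr (_%:R); move: rr; rewrite /r1; case: ifP => [h _|/negbT h rr].
  by congr (nat_of_bool _); apply/idP; lra.
by congr (nat_of_bool _); apply/negbTE; move: h; rewrite -!ltNge; lra.
Qed.

(* Between a point where the cutoff is on and one where it is off there is an end point of a cutoff interval, where f vanishes. *)
Lemma sig_lip w (f : R -> R) L : 0 < w -> w <= 1 -> 0 <= L -> (forall x y, `|f x - f y| <= L * `|x - y|) ->
  (forall n : int, f n%:~R = 0) -> (forall n : int, f (n%:~R + w) = 0) ->
  forall x y, `|sig w x * f x - sig w y * f y| <= L * `|x - y|.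
Proof.
move=> w0 w1 L0 fL f0 fw.
have one x y : sig w x = 1 -> sig w y = 0 -> `|f x| <= L * `|x - y|.
  have [n hn] := base_int x; have := baseP x; rewrite /sig hn => /andP[h1 h2].
  case: (lerP x (n%:~R + w)) => xw; last by move/eqP; rewrite eq_sym oner_eq0.
  move=> _ sy; have [yx|xy] := lerP y x.
    have yn : y <= n%:~R.
      rewrite leNgt; apply/negP => ny; move: sy; rewrite (@base_uniq y n); last by apply/andP; split; lra.
      by rewrite (_ : _ <= _ = true) => [/eqP|]; [rewrite oner_eq0|apply/idP; lra].
    have := fL x n%:~R; rewrite f0 subr0 => h; apply: le_trans h _; apply: ler_wpM2l => //.
    by rewrite !ger0_norm; lra.
  have yn : n%:~R + w <= y.
    rewrite leNgt; apply/negP => ny; move: sy; rewrite (@base_uniq y n); last by apply/andP; split; lra.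
    by rewrite (_ : _ <= _ = true) => [/eqP|]; [rewrite oner_eq0|apply/idP; lra].
  have := fL x (n%:~R + w); rewrite fw subr0 => h; apply: le_trans h _; apply: ler_wpM2l => //.
  by rewrite !ler0_norm; lra.
move=> x y; have [sx|sx] := sig01 w x; have [sy|sy] := sig01 w y; rewrite sx sy ?mul0r ?mul1r.
- by rewrite subr0 normr0 mulr_ge0.
- by rewrite sub0r normrN distrC; exact: one.
- by rewrite subr0; exact: one.
- exact: fL.
Qed.

Lemma lip_cont (f : R -> R) L : (forall x y, `|f x - f y| <= L * `|x - y|) -> continuous f.
Proof.
move=> fL x; apply/cvgrPdist_lt => e e0.
have L1 : 0 < `|L| + 1 by rewrite ltr_wpDl.
exists (e / (`|L| + 1)); rewrite /= ?divr_gt0// => y; rewrite /= ltr_pdivlMr// => h.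
apply: le_lt_trans (fL x y) _; apply: le_lt_trans h; rewrite mulrC.
by apply: ler_wpM2l => //; have := ler_norm L; lra.
Qed.

Lemma sum_sig (N : nat) l x : 0 < l -> N%:R * l = 1 -> \sum_(i < N) sig l (x - i%:R * l) = 1.
Proof.
move=> l0 Nl.
have H (k : nat) : (k < N)%N -> \sum_(i < k.+1) sig l (x - i%:R * l) = sig (k.+1%:R * l) x.
  elim: k => [|k IH] kN; first by rewrite big_ord1 mul0r subr0 mul1r.
  rewrite big_ord_recr/= IH; last exact: ltnW.
  have e : k.+2%:R * l = k.+1%:R * l + l by rewrite -[k.+2%:R]natr1 mulrDl mul1r.
  rewrite e; apply/esym/sig_add => //; first by rewrite mulr_gt0.
  by rewrite -e -[leRHS]Nl ler_pM2r// ler_nat.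
case: N Nl H => [|N] Nl H; first by move: Nl; rewrite mul0r => /eqP; rewrite eq_sym oner_eq0.
by rewrite H// Nl sig1.
Qed.

Lemma sig_pick (N : nat) l x : 0 < l -> N%:R * l = 1 ->
  exists i0 : 'I_N, forall i : 'I_N, sig l (x - i%:R * l) = (i == i0)%:R.
Proof.
move=> l0 Nl; have S := sum_sig x l0 Nl.
have [i0 h] : exists i0 : 'I_N, sig l (x - i0%:R * l) = 1.
  apply: contrapT => hn; move: S; rewrite big1 => [/eqP|i _]; first by rewrite eq_sym oner_eq0.
  by have [//|h] := sig01 l (x - i%:R * l); case: hn; exists i.
exists i0 => i; case: eqVneq => [->//|ne].
move: S; rewrite (bigD1 i0)//= h -[RHS]addr0 => /addrI/eqP.
rewrite psumr_eq0 => [/allP/(_ i)|j _]; first by rewrite mem_index_enum ne => /(_ isT)/eqP.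
by rewrite /sig ler0n.
Qed.

End Bumps.

(** * Lipschitz test functions and duality with the energy *)

Section TestFunctions.
Variable R : realType.
Implicit Types (z : R * R) (i : bool) (r s t k c x y : R) (f g h H : R * R -> R).

Lemma I_norm_le f c : continuous f -> (forall z, `|f z| <= c) -> `|I f| <= c.
Proof.
move=> cf fc; rewrite ler_norml; apply/andP; split.
  rewrite -[leLHS](@I_cst R); apply: I_le => // [|z]; first exact: cont_cst.
  by have := fc z; rewrite ler_norml => /andP[].
rewrite -[leRHS](@I_cst R); apply: I_le => // [|z]; first exact: cont_cst.
exact: le_trans (ler_norm _) (fc z).
Qed.

Definition bl f := exists F L, [/\ 0 <= F, 0 <= L, forall z, `|f z| <= F &
  forall i z r, `|f (sh i r z) - f z| <= L * `|r|].

Lemma bl_cont f : bl f -> continuous f.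
Proof.
move=> [F [L [F0 L0 fF fL]]] z; apply/cvgrPdist_lt => e e0.
have D0 : 0 < 2 * L + 1 by lra.
have r0 : 0 < e / (2 * L + 1) by rewrite divr_gt0.
exists (ball z.1 (e / (2 * L + 1)), ball z.2 (e / (2 * L + 1))).
  by split; exact: nbhsx_ballx.
move=> [y1 y2] [/= h1 h2]; rewrite /ball/= in h1 h2.
have -> : (y1, y2) = sh false (y2 - z.2) (sh true (y1 - z.1) z) by rewrite /sh/= !subrKC.
rewrite distrC; set z' := sh true _ _.
have -> : f (sh false (y2 - z.2) z') - f z = (f (sh false (y2 - z.2) z') - f z') + (f z' - f z) by ring.
apply: le_lt_trans (ler_normD _ _) _; apply: le_lt_trans (lerD (fL _ _ _) (fL _ _ _)) _.
rewrite distrC (distrC y1) -mulrDr.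
have d : `|z.2 - y2| + `|z.1 - y1| <= 2 * (e / (2 * L + 1)) by lra.
apply: le_lt_trans (ler_wpM2l L0 d) _; rewrite mulrCA mulrA mulrA ltr_pdivrMr//; lra.
Qed.

Lemma bl_cst c : bl (fun=> c).
Proof. by exists `|c|, 0; split => // *; rewrite ?subrr ?normr0 ?mul0r. Qed.

Lemma bl_add f g : bl f -> bl g -> bl (fun z => f z + g z).
Proof.
move=> [F [L [F0 L0 fF fL]]] [G [M [G0 M0 gG gM]]]; exists (F + G), (L + M); split; rewrite ?addr_ge0//.
  by move=> z; apply: le_trans (ler_normD _ _) _; exact: lerD.
move=> i z r; rewrite opprD addrACA mulrDl; apply: le_trans (ler_normD _ _) _; exact: lerD.
Qed.

Lemma bl_opp f : bl f -> bl (fun z => - f z).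
Proof.
move=> [F [L [F0 L0 fF fL]]]; exists F, L; split=> //; first by move=> z; rewrite normrN.
by move=> i z r; rewrite -opprD normrN.
Qed.

Lemma bl_mul f g : bl f -> bl g -> bl (fun z => f z * g z).
Proof.
move=> [F [L [F0 L0 fF fL]]] [G [M [G0 M0 gG gM]]]; exists (F * G), (F * M + L * G).
split; rewrite ?addr_ge0 ?mulr_ge0//; first by move=> z; exact: prod_le_norm.
move=> i z r.
have -> : f (sh i r z) * g (sh i r z) - f z * g z =
  f (sh i r z) * (g (sh i r z) - g z) + (f (sh i r z) - f z) * g z by ring.
rewrite [leRHS]mulrDl; apply: le_trans (ler_normD _ _) _; apply: lerD.
  by rewrite -mulrA; apply: prod_le_norm.
by rewrite mulrAC; apply: prod_le_norm.
Qed.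

Lemma bl_exp f n : bl f -> bl (fun z => f z ^+ n).
Proof.
move=> bf; elim: n => [|n IH]; first by rewrite (_ : (fun z => f z ^+ 0) = fun=> 1) ?funeqE//; exact: bl_cst.
by rewrite (_ : (fun z => f z ^+ n.+1) = fun z => f z * f z ^+ n) ?funeqE => [|z]; [exact: bl_mul|rewrite exprS].
Qed.

Lemma bl_comp f (ph : R -> R) F L : bl f -> (forall x, `|ph x| <= F) ->
  (forall x y, `|ph x - ph y| <= L * `|x - y|) -> bl (fun z => ph (f z)).
Proof.
move=> [G [M [G0 M0 gG gM]]] pF pL.
have F0 : 0 <= F by apply: le_trans (pF 0).
have L0 : 0 <= L by have := pL 1 0; rewrite subr0 normr1 mulr1; apply: le_trans.
exists F, (L * M); split; rewrite ?mulr_ge0// => i z r.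
by apply: le_trans (pL _ _) _; rewrite -mulrA; apply: ler_wpM2l.
Qed.

Lemma bl_co i (ph : R -> R) F L : (forall x, `|ph x| <= F) ->
  (forall x y, `|ph x - ph y| <= L * `|x - y|) -> bl (fun z => ph (co i z)).
Proof.
move=> pF pL.
have F0 : 0 <= F by apply: le_trans (pF 0).
have L0 : 0 <= L by have := pL 1 0; rewrite subr0 normr1 mulr1; apply: le_trans.
exists F, L; split=> // j z r; rewrite co_sh; case: ifP => _; last by rewrite subrr normr0 mulr_ge0.
by apply: le_trans (pL _ _) _; rewrite addrAC subrr add0r.
Qed.

Lemma bl_sh f i r : bl f -> bl (fun z => f (sh i r z)).
Proof.
move=> [F [L [F0 L0 fF fL]]]; exists F, L; split=> // j z s; first by rewrite shC; exact: fL.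
Qed.

Definition dlim i f z (l : R) := forall k, 0 < k -> exists2 r0, 0 < r0 &
  forall r, 0 < r -> r < r0 -> `|Dm i r f z - l| <= k.

Lemma dlim_local i f z (F : R -> R) l :
  (exists2 r0, 0 < r0 & forall r, 0 <= r -> r < r0 -> f (sh i (- r) z) = F (co i z - r)) ->
  is_derive (co i z) (1 : R) F l -> dlim i f z l.
Proof.
move=> [r0 r00 fF] dF k k0; have [r1 r10 H1] := taylor1 dF k0.
exists (Num.min r0 r1); first by rewrite lt_min r00.
move=> r rp; rewrite lt_min => /andP[h0 h1].
have := H1 (- r); rewrite normrN gtr0_norm// => /(_ h1).
have e : f z = F (co i z) by have := fF 0 (lexx 0) r00; rewrite oppr0 sh0 addr0.
rewrite /Dm e (fF _ (ltW rp) h0) => h.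
rewrite -(ler_pM2r rp) -[X in _ * X <= _](gtr0_norm rp) -normrM mulrBl divfK ?gt_eqF//.
by rewrite -normrN; apply: le_trans h; rewrite le_eqVlt; apply/orP; left; apply/eqP; congr `|_|; ring.
Qed.

Lemma dlim_seq i f z l : dlim i f z l -> (fun n : nat => Dm i (n.+2%:R^-1) f z) @ \oo --> l.
Proof.
move=> H; apply/cvgrPdist_le => k k0; have [r0 r00 Hr] := H k k0.
have /cvgrPdist_lt/(_ _ r00)[N _ HN] := @cvg_harmonic R.
exists N => // n /= Nn; rewrite distrC; apply: Hr; first by rewrite invr_gt0.
have := HN n Nn; rewrite /harmonic/= sub0r normrN gtr0_norm ?invr_gt0//; apply: le_lt_trans.
by rewrite lef_pV2 ?posrE// ler_nat.
Qed.

Lemma test_fun_dlim V Lv Kv v f W (d : bool -> R * R -> R) F L : drift V Lv Kv v ->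
  0 <= F -> 0 <= L -> (forall z, `|f z| <= F) -> (forall i z r, `|f (sh i r z) - f z| <= L * `|r|) ->
  continuous f -> continuous W -> per f ->
  (forall i z, dlim i f z (d i z)) -> (forall z, v true z * d true z + v false z * d false z = W z) ->
  test_fun v F L f W.
Proof.
move=> [Lv0 vp vL vb vd] F0 L0 fF fL cf cW pf dl WE; split=> // z k k0.
have V0 : 0 <= V by apply: le_trans (vb true (0, 0)).
have k1 : 0 < k / 2 / (2 * V + 1) by rewrite !divr_gt0//; lra.
have [r1 r10 H1] := dl true z _ k1; have [r2 r20 H2] := dl false z _ k1.
set K := F * `|Kv| + 2 * (L * Lv) + 1.
have K0 : 0 < K by rewrite /K ltr_wpDl// addr_ge0 ?mulr_ge0.
exists (Num.min (Num.min r1 r2) (Num.min 1 (k / 2 / K))); first by rewrite !lt_min r10 r20 ltr01 !divr_gt0.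
move=> r r0; rewrite !lt_min => /andP[/andP[h1 h2] /andP[h3 h4]].
have rn0 : r != 0 by rewrite gt_eqF.
have vD i : `|Dm i r (v i) z| <= Lv.
  rewrite /Dm normrM normfV (gtr0_norm r0) ler_pdivrMr//; apply: le_trans (vL _ _ _) _.
  apply: ler_wpM2l => //; rewrite /dist1.
  by case: (i); rewrite /sh/= subrr normr0 ?addr0 ?add0r opprD opprK addrA subrr add0r gtr0_norm.
have E i : Dm i r (fun y : R * R => f y * v i y) z = (Dm i r f z - d i z) * v i z + d i z * v i z
   + f z * Dm i r (v i) z + (f (sh i (- r) z) - f z) * Dm i r (v i) z by rewrite /Dm; field.
rewrite !E -WE.
have -> : forall a1 b1 c1 d1 a2 b2 c2 d2 w1 w2 : R,
  a1 * w1 + b1 * w1 + f z * c1 + d1 + (a2 * w2 + b2 * w2 + f z * c2 + d2) - (w1 * b1 + w2 * b2)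
  = a1 * w1 + a2 * w2 + (f z * (c1 + c2) + (d1 + d2)) by move=> *; ring.
have q i : `|(f (sh i (- r) z) - f z) * Dm i r (v i) z| <= (L * r) * Lv.
  by apply: prod_le_norm => //; have := fL i z (- r); rewrite normrN (gtr0_norm r0).
have p1 : `|(Dm true r f z - d true z) * v true z| <= k / 2 / (2 * V + 1) * V.
  by apply: prod_le_norm => //; exact: H1.
have p2 : `|(Dm false r f z - d false z) * v false z| <= k / 2 / (2 * V + 1) * V.
  by apply: prod_le_norm => //; exact: H2.
have p3 : `|f z * (Dm true r (v true) z + Dm false r (v false) z)| <= F * (`|Kv| * r).
  apply: prod_le_norm => //; apply: le_trans (vd z r r0 h3) _.
  by apply: ler_wpM2r; [exact: ltW|exact: ler_norm].
rewrite ltr_pdivlMr// in h4.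
have e1 : k / 2 / (2 * V + 1) * V + k / 2 / (2 * V + 1) * V <= k / 2.
  rewrite -mulrDr -[leRHS]mulr1 -mulrA; apply: ler_wpM2l; first by rewrite divr_ge0// ltW.
  by rewrite mulrC ler_pdivrMr; lra.
have e2 : F * (`|Kv| * r) + (L * r * Lv + L * r * Lv) <= k / 2.
  by apply: le_trans (ltW h4); rewrite /K; have := ltW r0; lra.
rewrite [k]splitr; apply: le_trans (ler_normD _ _) _; apply: lerD.
  by apply: le_trans (ler_normD _ _) _; apply: le_trans (lerD p1 p2) _.
apply: le_trans (ler_normD _ _) _; apply: le_trans e2; apply: lerD => //.
by apply: le_trans (ler_normD _ _) _; exact: lerD.
Qed.

(** Summation by parts turns [p * Dm H] into [- H * Dp p], Young's inequality with parameter [lam]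
    separates the two factors, and the step tends to 0. Averages against a derivative [h] are thus
    bounded through the square norm of its primitive [H]. *)
Lemma dual_est (B E lam s t : R) (p : R -> R * R -> R) i H h : s <= t -> 0 < lam ->
  (forall u, continuous (p u)) -> (forall u, per (p u)) -> (forall u z, `|p u z| <= B) ->
  (forall z, continuous (fun u => p u z)) ->
  bl H -> per H -> continuous h -> (forall z, dlim i H z (h z)) ->
  (forall r, 0 < r -> r < 1 -> J s t (fun u => I (fun z => Dp i r (p u) z ^+ 2)) <= E) ->
  J s t (fun u => I (fun z => p u z * h z)) <= lam / 2 * E + (t - s) / (2 * lam) * I (fun z => H z ^+ 2).
Proof.
move=> st lam0 cp pp pB pt bH pH ch dl EE.
have cH := bl_cont bH; have [F [L [F0 L0 HF HL]]] := bH.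
have B0 : 0 <= B by apply: le_trans (pB 0 (0, 0)).
pose rn (n : nat) : R := n.+2%:R^-1.
have rn0 n : 0 < rn n by rewrite invr_gt0.
have rn1 n : rn n < 1 by rewrite invf_lt1// ltr1n.
have DL r z : 0 < r -> `|Dm i r H z| <= L.
  move=> r0; rewrite /Dm normrM normfV (gtr0_norm r0) ler_pdivrMr// distrC.
  by have := HL i z (- r); rewrite normrN (gtr0_norm r0).
have cD r : continuous (Dm i r H) by exact: cont_Dm.
have hL z : `|h z| <= L.
  have c1 := lim_norm (dlim_seq (@dl z)); have c2 : (fun _ : nat => L) @ \oo --> L by exact: cvg_cst.
  by apply: lim_le c1 c2 _ => n; exact: DL.
have cI (W : R * R -> R) : continuous W -> (forall z, `|W z| <= L) -> continuous (fun u => I (fun z => p u z * W z)).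
  move=> cW WL; apply: (@cont_I_time R (B * L) (fun z u => p u z * W z)).
  - by move=> u; have c := @cp u; ct.
  - by move=> z u; exact: prod_le_norm.
  - by move=> z; have c := @pt z; ct.
have lim1 : (fun n => J s t (fun u => I (fun z => p u z * Dm i (rn n) H z))) @ \oo -->
    J s t (fun u => I (fun z => p u z * h z)).
  apply: (@J_dct R s t (B * L)).
  - by move=> n; apply: cI => // z; exact: DL.
  - exact: cI.
  - move=> n u _; have c := @cp u; have c2 := cD (rn n).
    by apply: I_norm_le => [|z]; [ct|apply: prod_le_norm => //; exact: DL].
  - move=> u _; apply: (@I_dct R (B * L)).
    + by move=> n; have c := @cp u; have c2 := cD (rn n); ct.
    + by have c := @cp u; ct.
    + by move=> n z; apply: prod_le_norm => //; exact: DL.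
    + move=> z; apply: cvgM; first exact: cvg_cst.
      exact: (dlim_seq (@dl z)).
have c2 : (fun _ : nat => lam / 2 * E + (t - s) / (2 * lam) * I (fun z => H z ^+ 2)) @ \oo -->
  lam / 2 * E + (t - s) / (2 * lam) * I (fun z => H z ^+ 2) by exact: cvg_cst.
apply: lim_le lim1 c2 _ => n.
have cDp u : continuous (Dp i (rn n) (p u)) by apply: cont_Dp.
have cJ : continuous (fun u => I (fun z => Dp i (rn n) (p u) z ^+ 2)).
  apply: (@cont_I_time R ((2 * B / rn n) ^+ 2) (fun z u => Dp i (rn n) (p u) z ^+ 2)).
  - by move=> u; have c := cDp u; ct.
  - move=> z u; rewrite normrX lerXn2r ?nnegrE ?divr_ge0 ?mulr_ge0 ?(ltW (rn0 n))//.
    rewrite /Dp normrM normfV (gtr0_norm (rn0 n)) ler_pM2r ?invr_gt0//.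
    by apply: le_trans (ler_normB _ _) _; have := pB u z; have := pB u (sh i (rn n) z); lra.
  - by move=> z; have c1 := @pt z; have c3 := @pt (sh i (rn n) z); rewrite /Dp; ct.
apply: (@le_trans _ _ (J s t (fun u => lam / 2 * I (fun z => Dp i (rn n) (p u) z ^+ 2) + 1 / (2 * lam) * I (fun z => H z ^+ 2)))).
  apply: J_le.
  - by apply: cI => // z; exact: DL.
  - by ct.
  move=> u _; have c := cDp u; have pu := @cp u.
  have -> : I (fun z => p u z * Dm i (rn n) H z) = - I (fun z => H z * Dp i (rn n) (p u) z).
    by rewrite (I_Dp_parts i (rn0 n) cH pu pH (pp u)) opprK.
  rewrite -mulN1r -!IZ; [|by ct..]; rewrite -ID; [|by ct..]; apply: I_le; [by ct|by ct|] => z.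
  set D := Dp _ _ _ _; have e : lam / 2 * D ^+ 2 + 1 / (2 * lam) * H z ^+ 2 - -1 * (H z * D) = lam / 2 * (D + H z / lam) ^+ 2.
    by field; rewrite gt_eqF.
  by rewrite -subr_ge0 e mulr_ge0 ?sqr_ge0// divr_ge0// ltW.
rewrite JD; [|by ct|exact: cont_cst]; rewrite JZ// J_cst//.
apply: lerD; first by apply: ler_wpM2l; [rewrite divr_ge0// ltW|exact: EE].
by rewrite le_eqVlt; apply/orP; left; apply/eqP; field; rewrite gt_eqF.
Qed.

End TestFunctions.

(** * Geometry of the cellular flow *)

Section CellularFlow.
Variable R : realType.
Variable m : nat.
Hypothesis m0 : (0 < m)%N.
Implicit Types (z : R * R) (i j : bool) (r t x y A : R).

Definition om : R := 2 * pi * m%:R.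
(** The side of one cell, half a wavelength of the flow. *)
Definition len : R := (2 * m%:R)^-1.
Definition sn x := sin (om * x).
Definition cs x := cos (om * x).

Let mR : 0 < m%:R :> R. Proof. by rewrite ltr0n. Qed.

Lemma om_gt0 : 0 < om. Proof. by rewrite mulr_gt0// mulr_gt0// pi_gt0. Qed.
Lemma len_gt0 : 0 < len. Proof. by rewrite invr_gt0 mulr_gt0. Qed.
Lemma om_len : om * len = pi. Proof. by rewrite /om /len; field; rewrite gt_eqF. Qed.
Lemma len_half : len <= 1 / 2.
Proof.
have h : 1 <= m%:R :> R by rewrite ler1n.
by rewrite /len mul1r lef_pV2 ?posrE ?mulr_gt0// ler_peMr.
Qed.
Lemma cells_len : (2 * m)%:R * len = 1.
Proof. by rewrite /len natrM mulfV// mulf_neq0// ?gt_eqF. Qed.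

Lemma sn_cs x : cs x ^+ 2 = 1 - sn x ^+ 2. Proof. exact: cos2sin2. Qed.
Lemma sn_len x : sn (x + len) = - sn x. Proof. by rewrite /sn mulrDr om_len sinDpi. Qed.
Lemma cs_len x : cs (x + len) = - cs x. Proof. by rewrite /cs mulrDr om_len cosDpi. Qed.
Let omE : om = (pi *+ 2) *+ m. Proof. by rewrite /om mulr_natr mulr_natl. Qed.
Lemma sn_per x : sn (x + 1) = sn x.
Proof.
by rewrite /sn mulrDr mulr1 {2}omE (periodicn (@sinD2pi R)).
Qed.
Lemma cs_per x : cs (x + 1) = cs x.
Proof.
by rewrite /cs mulrDr mulr1 {2}omE (periodicn (@cosD2pi R)).
Qed.
Lemma sn_int (n : int) x : sn (x + n%:~R) = sn x.
Proof.
have p : per (fun z => sn z.1) by case=> [z|z]; rewrite /sh/= ?sn_per.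
exact: (per_int true n (x, 0) p).
Qed.
Lemma cs_int (n : int) x : cs (x + n%:~R) = cs x.
Proof.
have p : per (fun z => cs z.1) by case=> [z|z]; rewrite /sh/= ?cs_per.
exact: (per_int true n (x, 0) p).
Qed.
Lemma sn0 : sn 0 = 0. Proof. by rewrite /sn mulr0 sin0. Qed.
Lemma cs0 : cs 0 = 1. Proof. by rewrite /cs mulr0 cos0. Qed.

Lemma der_sn x : is_derive x (1 : R) sn (om * cs x).
Proof. exact: (is_derive_scale om x (fun u => is_derive_sin u)). Qed.
Lemma der_cs x : is_derive x (1 : R) cs (- (om * sn x)).
Proof.
have := @is_derive_scale R cos (fun u => - sin u) om x (fun u => is_derive_cos u).
by rewrite mulrN.
Qed.
Lemma sn_le1 x : `|sn x| <= 1. Proof. exact: norm_sin. Qed.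
Lemma cs_le1 x : `|cs x| <= 1. Proof. exact: norm_cos. Qed.
Lemma sn_lip x y : `|sn x - sn y| <= om * `|x - y|.
Proof.
apply: (lip_deriv der_sn) => u; rewrite normrM (gtr0_norm om_gt0) ler_piMr//; first exact: ltW om_gt0.
exact: cs_le1.
Qed.
Lemma cs_lip x y : `|cs x - cs y| <= om * `|x - y|.
Proof.
apply: (lip_deriv der_cs) => u; rewrite normrN normrM (gtr0_norm om_gt0) ler_piMr//; first exact: ltW om_gt0.
exact: sn_le1.
Qed.

Definition bump x := sig len x * sn x.

Lemma bump_lip x y : `|bump x - bump y| <= om * `|x - y|.
Proof.
have l2 := len_half; apply: sig_lip; [exact: len_gt0|lra|exact: ltW om_gt0|exact: sn_lip|..] => n.
  by rewrite -[n%:~R]add0r sn_int sn0.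
by rewrite addrC sn_int -[len]add0r sn_len sn0 oppr0.
Qed.
Lemma bump_per x : bump (x + 1) = bump x.
Proof. by rewrite /bump sig_per sn_per. Qed.
Lemma bump01 x : 0 <= bump x <= 1.
Proof.
rewrite /bump; have [->|h] := sig01 len x; first by rewrite mul0r lexx ler01.
rewrite h mul1r (le_trans (ler_norm _) (sn_le1 x)) andbT.
have [n hn] := base_int x; have := baseP x; rewrite hn => /andP[h1 _].
move: h; rewrite /sig hn; case: lerP => [h2 _|_ /eqP]; last by rewrite eq_sym oner_eq0.
rewrite -(sn_int (- n)) mulrNz /sn; apply: sin_ge0_pi; rewrite -om_len; have w0 := om_gt0.
by rewrite mulr_ge0 ?subr_ge0 ?(ltW w0) ?(ltW h1)//= ler_pM2l// lerBlDl.
Qed.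
Lemma bump_len x : bump (x + len) = - (sig len (x + len) * sn x).
Proof. by rewrite /bump sn_len mulrN. Qed.

Lemma sig2_add x : sig (2 * len) (x + len) = sig len (x + len) + sig len x.
Proof.
have l2 := len_half; rewrite (_ : 2 * len = len + len); last by ring.
by rewrite sig_add ?len_gt0 ?addrK//; lra.
Qed.

(** A raised cosine centred at the integers and supported on the two adjacent intervals of length
    [len]. It vanishes at their ends, hence is Lipschitz, and it localises to one edge between
    cells. *)
Definition hat x := sig (2 * len) (x + len) * ((1 + cs x) / 2).

Lemma hat_lip x y : `|hat x - hat y| <= om * `|x - y|.
Proof.
have l2 := len_half; have l0 := len_gt0; have o0 := om_gt0.
have H : forall x y, `|sig (2 * len) x * ((1 + cs (x - len)) / 2) - sig (2 * len) y * ((1 + cs (y - len)) / 2)| <= om * `|x - y|.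
  have csB u : cs (u - len) = - cs u by rewrite -[in RHS](subrK len u) cs_len opprK.
  apply: (sig_lip (f := fun x => (1 + cs (x - len)) / 2)); [lra|lra|exact: ltW|..].
  - move=> u w; rewrite -mulrBl opprD addrACA subrr add0r normrM [X in _ * X]ger0_norm//.
    have := cs_lip (u - len) (w - len); rewrite opprB addrA subrK.
    have := normr_ge0 (cs (u - len) - cs (w - len)); lra.
  - by move=> n; rewrite csB -[n%:~R]add0r cs_int cs0 subrr mul0r.
  - move=> n; have -> : n%:~R + 2 * len - len = 0 + len + n%:~R by ring.
    by rewrite cs_int cs_len cs0 subrr mul0r.
by have := H (x + len) (y + len); rewrite !addrK opprD addrACA subrr addr0.
Qed.
Lemma hat_per x : hat (x + 1) = hat x.
Proof. by rewrite /hat addrAC sig_per cs_per. Qed.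
Lemma hat01 x : 0 <= hat x <= 1.
Proof.
have := cs_le1 x; rewrite ler_norml => /andP[h1 h2].
by rewrite /hat; have [->|->] := sig01 (2 * len) (x + len); rewrite ?mul0r ?mul1r ?lexx ?ler01//; lra.
Qed.

(** The stream function on one cell, extended by 0 to the rest of the period. The other cells are
    reached by translating the solution instead. *)
Definition psi z := bump z.1 * bump z.2.

Lemma psiE i z : psi z = bump (co i z) * bump (co (~~ i) z).
Proof. by case: i => //=; rewrite /psi mulrC. Qed.

Lemma psi01 z : 0 <= psi z <= 1.
Proof.
have /andP[a0 a1] := bump01 z.1; have /andP[b0 b1] := bump01 z.2.
by rewrite mulr_ge0//= mulr_ile1.
Qed.

Lemma bl_bump i : bl (fun z => bump (co i z)).
Proof.
apply: (bl_co i (F := 1) (L := om)) => [x|x y]; last exact: bump_lip.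
by have /andP[a0 a1] := bump01 x; rewrite ger0_norm.
Qed.
Lemma bl_sn i : bl (fun z => sn (co i z)).
Proof. exact: (bl_co i sn_le1 sn_lip). Qed.
Lemma bl_cs i : bl (fun z => cs (co i z)).
Proof. exact: (bl_co i cs_le1 cs_lip). Qed.
Lemma bl_hat i : bl (fun z => hat (co i z)).
Proof.
apply: (bl_co i (F := 1) (L := om)) => [x|x y]; last exact: hat_lip.
by have /andP[a0 a1] := hat01 x; rewrite ger0_norm.
Qed.
Lemma bl_psi : bl psi. Proof. exact: (bl_mul (bl_bump true) (bl_bump false)). Qed.

Lemma per_co i (f : R -> R) : (forall x, f (x + 1) = f x) -> per (fun z => f (co i z)).
Proof. by move=> pf j z; rewrite co_sh; case: ifP. Qed.
Lemma per_psi : per psi.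
Proof. exact: (perM (per_co true bump_per) (per_co false bump_per)). Qed.

Definition vel A i z : R := if i then v1 A m z.1 z.2 else v2 A m z.1 z.2.

Lemma velE A i z : vel A i z = (if i then -1 else 1) * (A * (2 * pi)) * (sn (co i z) * cs (co (~~ i) z)).
Proof.
by case: i; rewrite /vel /v1 /v2 /u1 /u2 /sn /cs /om/= !mulrA; ring.
Qed.

Lemma vel_len A i j z : vel A i (sh j len z) = vel (- A) i z.
Proof.
by rewrite !velE !co_sh; case: i; case: j; rewrite /= ?sn_len ?cs_len; ring.
Qed.

Lemma sn_taylor x r : 0 < r -> `|(sn x - sn (x - r)) / r - om * cs x| <= om ^+ 2 * r.
Proof.
move=> r0; have w0 := om_gt0.
have xr : x - r <= x by lra.
have [c /andP[c1 c2] e] := mvt xr der_sn.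
rewrite e opprB addrA (addrC x) addrK mulfK ?gt_eqF// -mulrBr normrM gtr0_norm// expr2 -mulrA ler_pM2l//.
apply: le_trans (cs_lip _ _) _; rewrite ler_pM2l//.
by rewrite ler_norml; apply/andP; split; lra.
Qed.

Lemma drift_vel A : drift (`|A| * (2 * pi)) (`|A| * (2 * pi) * om) (2 * (`|A| * (2 * pi) * om ^+ 2)) (vel A).
Proof.
have p0 : 0 < pi :> R := pi_gt0 R; have w0 := om_gt0.
set C := `|A| * (2 * pi); have C0 : 0 <= C by rewrite mulr_ge0//; lra.
have CE i : `|(if i then -1 else 1 : R) * (A * (2 * pi))| = C.
  by rewrite normrM [X in X * _](_ : _ = 1) ?mul1r; [rewrite normrM (ger0_norm (_ : 0 <= 2 * pi))//; lra|case: i; rewrite ?normrN normr1].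
have part i z r : 0 < r -> `|Dm i r (vel A i) z - (if i then -1 else 1) * (A * (2 * pi)) * (om * cs z.1 * cs z.2)| <= C * om ^+ 2 * r.
  move=> r0; rewrite /Dm !velE !co_sh eqxx (_ : (~~ i == i) = false); last by case: (i).
  set K := _ * (A * (2 * pi)).
  have -> : (K * (sn (co i z) * cs (co (~~ i) z)) - K * (sn (co i z + - r) * cs (co (~~ i) z))) / r - K * (om * cs z.1 * cs z.2)
    = K * (((sn (co i z) - sn (co i z - r)) / r - om * cs (co i z)) * cs (co (~~ i) z)).
    have -> : om * cs z.1 * cs z.2 = om * cs (co i z) * cs (co (~~ i) z) by case: (i) => //=; ring.
    by field; rewrite gt_eqF.
  rewrite normrM CE -mulrA; apply: ler_wpM2l => //; rewrite -[leRHS]mulr1.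
  by apply: prod_le_norm; [exact: sn_taylor|exact: cs_le1].
split.
- by rewrite mulr_ge0// ltW.
- by move=> i j z; rewrite !velE !co_sh; case: i; case: j; rewrite /= ?sn_per ?cs_per.
- move=> i z y; rewrite !velE -mulrBr normrM CE -[leRHS]mulrA; apply: ler_wpM2l => //.
  have -> : sn (co i z) * cs (co (~~ i) z) - sn (co i y) * cs (co (~~ i) y) =
    (sn (co i z) - sn (co i y)) * cs (co (~~ i) z) + sn (co i y) * (cs (co (~~ i) z) - cs (co (~~ i) y)) by ring.
  apply: (@le_trans _ _ (om * `|co i z - co i y| * 1 + 1 * (om * `|co (~~ i) z - co (~~ i) y|))).
    apply: le_trans (ler_normD _ _) _; apply: lerD; apply: prod_le_norm;
      [exact: sn_lip|exact: cs_le1|exact: sn_le1|exact: cs_lip].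
  by rewrite mulr1 mul1r -mulrDr /dist1; case: (i) => //=; rewrite addrC.
- move=> i z; rewrite velE normrM CE -[leRHS]mulr1; apply: ler_wpM2l => //; rewrite -[leRHS]mulr1.
  by apply: prod_le_norm; [exact: sn_le1|exact: cs_le1].
move=> z r r0 r1; have p1 := part true z r r0; have p2 := part false z r r0.
set X := om * cs z.1 * cs z.2 in p1 p2.
have -> : Dm true r (vel A true) z + Dm false r (vel A false) z =
  (Dm true r (vel A true) z - -1 * (A * (2 * pi)) * X) + (Dm false r (vel A false) z - 1 * (A * (2 * pi)) * X) by ring.
apply: le_trans (ler_normD _ _) _; rewrite (_ : _ * r = C * om ^+ 2 * r + C * om ^+ 2 * r); last by ring.
exact: lerD.
Qed.

Definition cell (c : nat * nat) z := sh true (c.1%:R * len) (sh false (c.2%:R * len) z).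

(** A translation by one cell side reverses the flow, so all cells look alike up to the sign of the
    amplitude. *)
Lemma vel_cell A c : exists A', `|A'| = `|A| /\ forall i z, vel A i (cell c z) = vel A' i z.
Proof.
have H j (n : nat) B : exists A', `|A'| = `|B| /\ forall i z, vel B i (sh j (n%:R * len) z) = vel A' i z.
  elim: n => [|n [A' [e1 e2]]]; first by exists B; split=> // i z; rewrite mul0r sh0.
  exists (- A'); split=> [|i z]; first by rewrite normrN.
  have -> : sh j (n.+1%:R * len) z = sh j (n%:R * len) (sh j len z) by rewrite shD -natr1 mulrDl mul1r addrC.
  by rewrite e2 vel_len.
have [A1 [e1 h1]] := H true c.1 A; have [A2 [e2 h2]] := H false c.2 A1.
by exists A2; split=> [|i z]; [rewrite e2|rewrite /cell h1 h2].
Qed.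

End CellularFlow.

Lemma sol_at_sh (R : realType) (a : R -> R) v (P : R * R -> R -> R) j (s : R) z t :
  sol_at a v P (sh j s z) t ->
  sol_at a (fun i y => v i (sh j s y)) (fun y t => P (sh j s y) t) z t.
Proof.
move=> [tau [pi' [H [e1 e2 e3 e4]]]]; exists tau, pi', H; split=> // i k k0.
  by have [r r0 Hr] := e2 i k k0; exists r => // d /Hr; rewrite shC.
by have [r r0 Hr] := e3 i k k0; exists r => // d /Hr; rewrite !(shC i j).
Qed.

Lemma solution_sh (R : realType) (B : R) (a : R -> R) v (P : R * R -> R -> R) j (s : R) :
  solution B a v P -> solution B a (fun i z => v i (sh j s z)) (fun z t => P (sh j s z) t).
Proof.
case=> h1 h2 h3 h4; split.
- by move=> t t0; exact: cont_fsh (h1 t t0).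
- by move=> t t0 i z; rewrite shC h2.
- by move=> t t0 z; exact: h3.
- by move=> z t t0; apply: sol_at_sh; exact: h4.
Qed.

(** * The boundary layer profile *)

Section Calculus.
Variable R : realType.
Implicit Types (f g : R -> R) (x l k : R).

Definition der f x l := is_derive x (1 : R) f l.

Lemma der_mul f g x l k : der f x l -> der g x k -> der (fun y => f y * g y) x (l * g x + f x * k).
Proof.
move=> df dg; rewrite /der (_ : l * g x + _ = f x *: k + g x *: l); first exact: is_deriveM df dg.
by rewrite /GRing.scale/= addrC [l * _]mulrC.
Qed.
Lemma der_add f g x l k : der f x l -> der g x k -> der (fun y => f y + g y) x (l + k).
Proof. by move=> df dg; exact: is_deriveD df dg. Qed.
Lemma der_opp f x l : der f x l -> der (fun y => - f y) x (- l).
Proof. by move=> df; exact: is_deriveN df. Qed.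
Lemma der_cst k x : der (fun=> k) x 0. Proof. exact: is_derive_cst. Qed.
Lemma der_id x : der (fun y => y) x 1. Proof. exact: is_derive_id. Qed.
Lemma der_inv f x l : f x != 0 -> der f x l -> der (fun y => (f y)^-1) x (- l / f x ^+ 2).
Proof.
move=> f0 df; rewrite /der (_ : - l / _ = - f x ^- 2 *: l); first exact: is_deriveV f0 df.
by rewrite /GRing.scale/=; ring.
Qed.
Lemma der_comp g f x l k : der g (f x) k -> der f x l -> der (fun y => g (f y)) x (k * l).
Proof. by move=> dg df; exact: is_derive1_comp dg df. Qed.
Lemma der_eq f x l k : der f x l -> l = k -> der f x k. Proof. by move=> h <-. Qed.

Section Profile.
Variable e : R.
Hypothesis e0 : 0 < e.

(** A smooth version, at scale [sqrt e], of the indicator of 0. Its negative derivative [gam] has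
    integral 1 over the positive half-line, so it approximates a Dirac mass at [0+]; evaluated at
    the stream function, it concentrates on the cell boundary. *)
Definition Xi x := e / (e + x ^+ 2).
Definition gam x := 2 * e * x / (e + x ^+ 2) ^+ 2.
Definition gam1 x := 2 * e / (e + x ^+ 2) ^+ 2 - 8 * e * x ^+ 2 / (e + x ^+ 2) ^+ 3.

Let D0 x : 0 < e + x ^+ 2. Proof. by rewrite ltr_pwDl// sqr_ge0. Qed.
Let Dn x : e + x ^+ 2 != 0. Proof. by rewrite gt_eqF. Qed.

Let der_D x : der (fun y => e + y ^+ 2) x (2 * x).
Proof.
have := der_add (der_cst e x) (der_mul (der_id x) (der_id x)); rewrite add0r mul1r mulr1 => h.
have -> : (fun y => e + y ^+ 2) = (fun y => e + y * y) by apply/funext => y; rewrite expr2.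
by apply: der_eq h _; ring.
Qed.

Lemma der_Xi x : der Xi x (- gam x).
Proof.
apply: der_eq (der_mul (der_cst e x) (der_inv _ (der_D x))) _; first exact: Dn.
by rewrite /gam; field.
Qed.

Lemma der_gam x : der gam x (gam1 x).
Proof.
have h2 : der (fun y => (e + y ^+ 2) ^+ 2) x (2 * (e + x ^+ 2) * (2 * x)).
  have -> : (fun y => (e + y ^+ 2) ^+ 2) = (fun y => (e + y ^+ 2) * (e + y ^+ 2)).
    by apply/funext => y; rewrite [LHS]expr2.
  by apply: der_eq (der_mul (der_D x) (der_D x)) _; ring.
apply: der_eq (der_mul (der_mul (der_cst (2 * e) x) (der_id x)) (der_inv _ h2)) _.
  by rewrite expf_neq0.
by rewrite /gam1; field.
Qed.

Lemma Xi01 x : 0 <= Xi x <= 1.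
Proof.
rewrite divr_ge0 ?(ltW e0) ?(ltW (D0 x))//= ler_pdivrMr// mul1r lerDl; exact: sqr_ge0.
Qed.

Lemma gam_bound x : `|gam x| <= 2 * (1 + e^-1).
Proof.
have d0 := D0 x; have ei : 0 < e^-1 by rewrite invr_gt0.
rewrite /gam normrM normfV (ger0_norm (exprn_ge0 _ (ltW d0))) normrM (gtr0_norm (_ : 0 < 2 * e)) ?mulr_gt0//.
rewrite ler_pdivrMr ?exprn_gt0//.
have h1 : `|x| <= (1 + e^-1) * (e + x ^+ 2).
  have : `|x| <= 1 + x ^+ 2.
    have := sqr_ge0 (`|x| - 1); rewrite sqrrB1 real_normK ?num_real//; have := normr_ge0 x; lra.
  have : 0 <= e^-1 * x ^+ 2 by rewrite mulr_ge0 ?sqr_ge0// ltW.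
  have : e^-1 * e = 1 by rewrite mulVf// gt_eqF.
  have -> : (1 + e^-1) * (e + x ^+ 2) = e + x ^+ 2 + e^-1 * e + e^-1 * x ^+ 2 by ring.
  by move: (e^-1 * e) (e^-1 * x ^+ 2) => w1 w2; have e0' := e0; lra.
have h2 : e <= e + x ^+ 2 by rewrite lerDl sqr_ge0.
have -> : 2 * (1 + e^-1) * (e + x ^+ 2) ^+ 2 = 2 * ((e + x ^+ 2) * ((1 + e^-1) * (e + x ^+ 2))) by ring.
by rewrite -mulrA ler_pM2l//; apply: ler_pM => //; exact: ltW.
Qed.

Lemma gam1_bound x : `|gam1 x| <= 10 / e.
Proof.
have d0 := D0 x; set d := e + x ^+ 2 in d0.
have ed : e <= d by rewrite lerDl sqr_ge0.
have xd : x ^+ 2 <= d by rewrite lerDr ltW.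
have ee : 0 < e ^+ 2 by rewrite exprn_gt0.
have h1 : 0 <= 2 * e / d ^+ 2 <= 2 / e.
  rewrite divr_ge0 ?mulr_ge0 ?exprn_ge0 ?(ltW e0) ?(ltW d0)//= ler_pdivrMr ?exprn_gt0//.
  rewrite -mulrA ler_pM2l// ler_pdivlMl// -expr2 lerXn2r ?nnegrE ?(ltW e0) ?(ltW d0)//.
have h2 : 0 <= 8 * e * x ^+ 2 / d ^+ 3 <= 8 / e.
  apply/andP; split; first by rewrite divr_ge0 ?(exprn_ge0 _ (ltW d0))// mulr_ge0 ?sqr_ge0// mulr_ge0// ltW.
  rewrite ler_pdivrMr ?exprn_gt0//.
  rewrite -!mulrA ler_pM2l// ler_pdivlMl// mulrA -expr2 [leRHS]exprSr.
  by apply: ler_pM; rewrite ?sqr_ge0// lerXn2r ?nnegrE ?(ltW e0) ?(ltW d0)//.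
move: h1 h2 => /andP[p1 p2] /andP[p3 p4]; rewrite /gam1 -/d ler_norml.
have : 10 / e = 2 / e + 8 / e by field; rewrite gt_eqF.
by move=> ->; apply/andP; split; lra.
Qed.

Lemma gam_lip x y : `|gam x - gam y| <= 10 / e * `|x - y|.
Proof. exact: (lip_deriv der_gam gam1_bound). Qed.
Lemma Xi_lip x y : `|Xi x - Xi y| <= 2 * (1 + e^-1) * `|x - y|.
Proof. by apply: (lip_deriv der_Xi) => u; rewrite normrN; exact: gam_bound. Qed.

Lemma gam0 : gam 0 = 0. Proof. by rewrite /gam mulr0 mul0r. Qed.
Lemma gamN x : gam (- x) = - gam x. Proof. by rewrite /gam sqrrN mulrN mulNr. Qed.
Lemma gam_ge0 x : 0 <= x -> 0 <= gam x.
Proof. by move=> x0; rewrite /gam divr_ge0 ?mulr_ge0 ?exprn_ge0 ?(ltW e0) ?(ltW (D0 x)). Qed.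

(* AM-GM: 2 sqrt(e) x <= e + x^2 *)
Lemma Xi_small x d : 0 <= x -> 0 <= d -> d ^+ 2 = e -> x * Xi x <= d.
Proof.
move=> x0 d0 de; rewrite /Xi mulrA ler_pdivrMr// -{1}de.
have := sqr_ge0 (d - x); rewrite sqrrB => h.
have -> : x * d ^+ 2 = d * (d * x) by ring.
apply: ler_wpM2l => //; rewrite -de; have := sqr_ge0 (d + x); rewrite sqrrD; lra.
Qed.

Lemma gam_small x d : 0 <= x -> 0 <= d -> d ^+ 2 = e -> x ^+ 2 * gam x <= 2 * d.
Proof.
move=> x0 d0 de; have h1 := Xi_small x0 d0 de; have Dx := D0 x.
have -> : x ^+ 2 * gam x = 2 * (x * Xi x) * (x ^+ 2 / (e + x ^+ 2)) by rewrite /gam /Xi; field.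
rewrite -[leRHS]mulr1; apply: ler_pM.
- by rewrite mulr_ge0// mulr_ge0//; case/andP: (Xi01 x).
- by rewrite divr_ge0 ?sqr_ge0// ltW.
- by rewrite ler_pM2l.
- by rewrite ler_pdivrMr// mul1r lerDr ltW.
Qed.

(** For [0 <= x <= 1] one has [x^2 Xi (x y) <= Xi y]. In the edge layer [x] is the bump in the
    coordinate along the edge, and the bound leaves a function of the transversal coordinate
    only. *)
Lemma Xi_norm x y : 0 <= x <= 1 -> (x * Xi (x * y)) ^+ 2 <= Xi y.
Proof.
move=> /andP[x0 x1]; have /andP[q0 q1] := Xi01 (x * y).
have xx : x ^+ 2 <= 1 by rewrite exprn_ile1.
have x2 := sqr_ge0 x.
apply: (@le_trans _ _ (x ^+ 2 * Xi (x * y))).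
  rewrite exprMn; apply: ler_wpM2l => //; rewrite expr2 -[leRHS]mulr1; exact: ler_wpM2l.
have d1 := D0 y; have d2 := D0 (x * y).
rewrite -subr_ge0 (_ : _ - _ = e ^+ 2 * (1 - x ^+ 2) / ((e + y ^+ 2) * (e + (x * y) ^+ 2))).
  by rewrite divr_ge0//; [rewrite mulr_ge0 ?sqr_ge0// subr_ge0|rewrite mulr_ge0// ltW].
rewrite exprMn in d2; rewrite /Xi exprMn; field; rewrite !gt_eqF//.
Qed.

End Profile.

Lemma Xi_mono (e e' x : R) : 0 < e -> e <= e' -> Xi e x <= Xi e' x.
Proof.
move=> e0 ee; have x2 := sqr_ge0 x.
rewrite /Xi ler_pdivrMr; last by lra.
rewrite mulrAC ler_pdivlMr; last by lra.
by have := ler_wpM2r x2 ee; lra.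
Qed.

End Calculus.

(** * The square norm of an edge layer *)

Section EdgeNorm.
Variable R : realType.
Implicit Types (e x : R).

Definition edge (m : nat) e : R := J 0 1 (fun x : R => Xi e (sn m x)).

Lemma cont_sn (m : nat) : (0 < m)%N -> continuous (sn m : R -> R).
Proof. by move=> m0; exact: lip_cont (@sn_lip R m m0). Qed.

Lemma edge_cont (m : nat) e : (0 < m)%N -> 0 < e -> continuous (fun x : R => Xi e (sn m x)).
Proof.
by move=> m0 e0; apply: cont_comp (cont_sn m0) _; exact: lip_cont (Xi_lip e0).
Qed.

(** A shift by a quarter period replaces sine by cosine, and the two fractions add up to a multiple
    of the same profile for the doubled frequency, with parameter [4 e (e + 1)]. For [e <= 1] the
    factor after averaging is at most [3 / 4]. Iteration makes the norm small uniformly in [m], with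
    no integral to evaluate. *)
Lemma edge_double m e : (0 < m)%N -> 0 < e -> e <= 1 -> edge m e <= 3 / 4 * edge (2 * m) (4 * e * (e + 1)).
Proof.
move=> m0 e0 e1; set e' := 4 * e * (e + 1).
have e'0 : 0 < e' by rewrite !mulr_gt0//; lra.
have m20 : (0 < 2 * m)%N by rewrite muln_gt0.
have c1 := edge_cont m0 e0; have c2 := edge_cont m20 e'0.
pose d : R := len R m / 2.
have sd x : sn m (x + d) = cs m x.
  by rewrite /sn mulrDr /d mulrA om_len// sinDpihalf.
have s2 x : sn (2 * m) x = 2 * (sn m x * cs m x).
  have h : om R (2 * m) * x = (om R m * x) *+ 2 by rewrite /om natrM; ring.
  by rewrite /sn h sin_mulr2n -mulr_natl [cos _ * _]mulrC.
have E x : Xi e (sn m x) + Xi e (sn m (x + d)) = (2 * e + 1) / (e + 1) * Xi e' (sn (2 * m) x).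
  rewrite s2 sd /Xi !exprMn sn_cs; set q := sn m x ^+ 2.
  have q0 : 0 <= q by exact: sqr_ge0.
  have q1 : q <= 1 by have := sn_cs m x; have := sqr_ge0 (cs m x); rewrite -/q; lra.
  have qq : 0 <= q * (1 - q) by rewrite mulr_ge0// subr_ge0.
  have ee : 0 < e * e by rewrite mulr_gt0.
  rewrite /e'; field; rewrite !gt_eqF//; lra.
have h1 : edge m e = J 0 1 (fun x => Xi e (sn m (x + d))).
  by rewrite /edge (J_per (g := fun x => Xi e (sn m x)))// => x; rewrite sn_per.
have cd : continuous (fun x : R => Xi e (sn m (x + d))).
  by apply: (cont_comp (g := fun x : R => x + d) (h := fun x : R => Xi e (sn m x))); [ct|exact: c1].
have h2 : edge m e + edge m e = (2 * e + 1) / (e + 1) * edge (2 * m) e'.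
  by rewrite [X in _ + X]h1 /edge -JD// -JZ//; apply: eq_J => x _; exact: E.
have h3 : (2 * e + 1) / (e + 1) <= 3 / 2 by rewrite ler_pdivrMr; lra.
have p0 : 0 <= edge (2 * m) e' by apply: J_ge0 => x _; case/andP: (Xi01 e'0 (sn (2 * m) x)).
by have := ler_wpM2r p0 h3; lra.
Qed.

Lemma edge_pow (k : nat) : exists2 e, 0 < e & forall m, (0 < m)%N -> edge m e <= (3 / 4) ^+ k.
Proof.
elim: k => [|k [e' e'0 IH]].
  exists 1 => // m m0; rewrite expr0 -[leRHS](_ : J 0 1 (fun=> 1 : R) = 1); last by rewrite J_cst// subr0 mulr1.
  by apply: J_le => [||x _]; [exact: edge_cont|exact: cont_cst|case/andP: (Xi01 (@ltr01 R) (sn m x))].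
(* For such [e] one has [4 e (e + 1) <= 8 e <= e'], so the induction hypothesis applies at frequency
   [2 * m]. *)
exists (Num.min 1 (e' / 8)); first by rewrite lt_min ltr01 divr_gt0.
set e := Num.min _ _ => m m0.
have e0 : 0 < e by rewrite lt_min ltr01 divr_gt0.
have e1 : e <= 1 by rewrite ge_min lexx.
have e2 : e <= e' / 8 by rewrite ge_min lexx orbT.
apply: le_trans (edge_double m0 e0 e1) _; rewrite exprS ler_pM2l; last by lra.
have m20 : (0 < 2 * m)%N by rewrite muln_gt0.
apply: le_trans (IH _ m20).
have p0 : 0 < 4 * e * (e + 1) by rewrite !mulr_gt0//; lra.
apply: J_le => [||x _]; [exact: edge_cont..|].
apply: Xi_mono => //; apply: (@le_trans _ _ (4 * (e' / 8) * (1 + 1))); last by lra.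
by apply: ler_pM; lra.
Qed.

Lemma edge_small (d : R) : 0 < d -> exists2 e0, 0 < e0 & forall m e, (0 < m)%N -> 0 < e -> e <= e0 -> edge m e <= d.
Proof.
move=> d0; have : (fun k : nat => (3 / 4 : R) ^+ k) @ \oo --> (0 : R).
  by apply: cvg_expr; rewrite ger0_norm; lra.
move=> /cvgrPdist_le/(_ _ d0)[k _ /(_ k (leqnn k))]; rewrite /= sub0r normrN ger0_norm => [kd|]; last by apply: exprn_ge0; lra.
 have [e0 e00 H] := edge_pow k; exists e0 => // m e m0 ep ee.
apply: le_trans kd; apply: le_trans (H m m0).
by apply: J_le => [||x _]; [exact: edge_cont..|exact: Xi_mono].
Qed.

End EdgeNorm.

(** * Functions of the stream function times cosines *)

Section CellTests.
Variable R : realType.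
Variable m : nat.
Hypothesis m0 : (0 < m)%N.
Implicit Types (z : R * R) (i : bool) (b : bool -> bool) (r x y A : R).

Definition cc (b : bool) x : R := if b then cs m x else 1.
Definition dcc (b : bool) x : R := if b then - (om R m * sn m x) else 0.
Definition wt b z := cc (b true) z.1 * cc (b false) z.2.
(** [v . grad (wt b)] divided by [A * (2 * pi) * om]. *)
Definition LW b z : R := (if b true then sn m z.1 ^+ 2 * cs m z.2 * cc (b false) z.2 else 0)
  - (if b false then sn m z.2 ^+ 2 * cs m z.1 * cc (b true) z.1 else 0).

Lemma der_cc c x : der (cc c) x (dcc c x).
Proof. by case: c; [exact: der_cs|exact: der_cst]. Qed.

Lemma wtE b i z : wt b z = cc (b i) (co i z) * cc (b (~~ i)) (co (~~ i) z).
Proof. by case: i => //=; rewrite mulrC. Qed.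

Lemma bl_wt b : bl (wt b).
Proof.
by apply: bl_mul; [case: (b true)|case: (b false)];
  [exact: (bl_cs R m0 true)|exact: bl_cst|exact: (bl_cs R m0 false)|exact: bl_cst].
Qed.

Lemma per_wt b : per (wt b).
Proof.
have p c (x : R) : cc c (x + 1) = cc c x by case: c => //; exact: cs_per.
exact: (perM (per_co true (p _)) (per_co false (p _))).
Qed.

Lemma bl_LW b : bl (LW b).
Proof.
have s1 := bl_sn R m0 true; have s2 := bl_sn R m0 false.
have c1 := bl_cs R m0 true; have c2 := bl_cs R m0 false.
have bc c i : bl (fun z => cc c (co i z)) by case: c; [exact: bl_cs|exact: bl_cst].
apply: bl_add; last apply: bl_opp.
- case: (b true); last exact: bl_cst.
  exact: (bl_mul (bl_mul (bl_exp 2 s1) c2) (bc (b false) false)).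
- case: (b false); last exact: bl_cst.
  exact: (bl_mul (bl_mul (bl_exp 2 s2) c1) (bc (b true) true)).
Qed.

Lemma coS i r z : co i (sh i r z) = co i z + r. Proof. by rewrite co_sh eqxx. Qed.
Lemma coSN i r z : co (~~ i) (sh i r z) = co (~~ i) z. Proof. by rewrite co_sh; case: i. Qed.

Lemma test_dlim (ph ph1 : R -> R) b i z : (forall y, der ph y (ph1 y)) ->
  dlim i (fun z => ph (psi m z) * wt b z) z
   (ph1 (psi m z) * (sig (len R m) (co i z) * (om R m * cs m (co i z)) * bump m (co (~~ i) z)) * wt b z
    + ph (psi m z) * (dcc (b i) (co i z) * cc (b (~~ i)) (co (~~ i) z))).
Proof.
move=> dph; have [r0 r00 Hr] := sig_left (co i z) (len_gt0 R m0).
set S := sig _ (co i z); set y0 := bump m _; set c0 := cc _ (co (~~ i) z).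
apply: (@dlim_local R i _ z (fun x => ph (S * sn m x * y0) * (cc (b i) x * c0))).
  exists r0 => // r rp rr; rewrite (psiE _ i) (wtE _ i) coS coSN -/y0 -/c0 /bump.
  by rewrite Hr.
have e : psi m z = S * sn m (co i z) * y0 by rewrite (psiE _ i).
rewrite e (wtE _ i) -/c0.
apply: der_eq (der_mul (der_comp (dph _) (der_mul (der_mul (der_cst S _) (der_sn m _)) (der_cst y0 _)))
   (der_mul (der_cc _ _) (der_cst c0 _))) _.
by ring.
Qed.

(** The flow is tangent to the level sets of [psi], so the factor [ph (psi)] passes through the
    transport and only [wt b] is differentiated. *)
Lemma test_fun_psi (ph ph1 : R -> R) b : (forall y, der ph y (ph1 y)) -> bl (fun z => ph (psi m z)) ->
  exists F L, [/\ 0 <= F, 0 <= L & forall A, test_fun (vel m A) F L (fun z => ph (psi m z) * wt b z)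
    (fun z => A * (2 * pi * om R m * (ph (psi m z) * LW b z)))].
Proof.
move=> dph bp; have [F [L [F0 L0 fF fL]]] := bl_mul bp (bl_wt b).
exists F, L; split=> // A.
apply: (test_fun_dlim (drift_vel m0 A) F0 L0 fF fL _ _ _ (fun i z => test_dlim b i z dph)).
- exact: bl_cont (bl_mul bp (bl_wt b)).
- by have c1 := bl_cont bp; have c2 := bl_cont (bl_LW b); ct.
- by apply: perM; [exact: per_comp (@per_psi R m)|exact: per_wt].
move=> z; rewrite !velE /= /bump /LW /wt.
by case: (b true); case: (b false); rewrite /cc /dcc /=; ring.
Qed.

End CellTests.

(** * The weak formulation over a time window *)

Section Window.
Variable R : realType.
Variables (a0 a1 La B : R) (a : R -> R) (P : R * R -> R -> R).
Hypothesis (Ha : diffusion a0 a1 La a).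
Variables (n : nat) (T1 : R).
Hypothesis T10 : 0 < T1.
Hypothesis HN : (2 * B + 1) * (2 + 2 * (La + 2 * Cgrad a0 La B)) <= a0 / 2 * n.+2%:R.

Lemma weak_abs (V Lv Kv : R) v F Lf fi W (s t : R) : drift V Lv Kv v -> solution B a v P ->
  0 <= Lf -> test_fun v F Lf fi W -> (exists Wb, forall z, `|W z| <= Wb) -> T1 <= s -> s <= t ->
  `|I (fun z => fi z * P z (Num.max T1 t)) - I (fun z => fi z * P z (Num.max T1 s))
   - J s t (fun u => I (fun z => P z (Num.max T1 u) * W z))|
  <= 2 * Lf * a1 ^+ 2 * (t - s) + (Lf + 2 * F + 1) * (entropy2 B P n T1 s - entropy2 B P n T1 t).
Proof.
move=> Hv HP Lf0 tf WB T1s st; have [[cfi cW] _ fib _ _] := tf.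
have U1 := weak_upper Ha Hv HP T10 HN Lf0 tf T1s st.
have U2 := weak_upper (diffusion_opp Ha) Hv (solution_opp HP) T10 HN Lf0 tf T1s st.
have eN u : entropy2 B (fun z t => - P z t) n T1 u = entropy2 B P n T1 u.
  rewrite /entropy2 addrC; congr (_ + _); congr (entropy _ _ _ _ _).
  by apply/funext => z; apply/funext => w; rewrite opprK.
have Tm u : 0 < Num.max T1 u by rewrite lt_max T10.
have cP u : continuous (fun z => P z (Num.max T1 u)) by case: HP => h _ _ _; exact: h.
have oI (f : R * R -> R) : continuous f -> I (fun z => - f z) = - I f.
  by move=> cf; rewrite -mulN1r -IZ//; apply: eq_I => z; rewrite mulN1r.
have e1 u : I (fun z => fi z * - P z (Num.max T1 u)) = - I (fun z => fi z * P z (Num.max T1 u)).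
  by have c := @cP u; rewrite -oI; [apply: eq_I => z; rewrite mulrN|ct].
have e2 : J s t (fun u => I (fun z => - P z (Num.max T1 u) * W z)) = - J s t (fun u => I (fun z => P z (Num.max T1 u) * W z)).
  have cJ : continuous (fun u => I (fun z => P z (Num.max T1 u) * W z)) by exact: (cont_I_mul HP T10 cW WB).
  rewrite -mulN1r -JZ//; apply: eq_J => u _; rewrite mulN1r -oI; last by have c := @cP u; ct.
  by apply: eq_I => z; rewrite mulNr.
rewrite !eN !e1 e2 in U2; rewrite ler_norml; apply/andP; split; last exact: U1.
by move: U2; lra.
Qed.

Lemma entropy2_sh v j (r t : R) : solution B a v P ->
  entropy2 B (fun z t => P (sh j r z) t) n T1 t = entropy2 B P n T1 t.
Proof.
move=> [cP pP _ _]; rewrite /entropy2 /entropy.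
have Tm : 0 < Num.max T1 t by rewrite lt_max T10.
have c := cP _ Tm; have p := pP _ Tm.
have cpw (k : R) (f : R * R -> R) : continuous f -> continuous (fun z => 1 / n.+3%:R * pw n.+3 (f z - k)).
  move=> cf; apply: cont_mul; first exact: cont_cst.
  by apply: (cont_comp (g := f) (h := fun x => pw n.+3 (x - k))) => //; apply: (@cont_pw R R n.+3 (fun x => x - k)); ct.
congr (_ + _).
  rewrite -(@I_sh R (fun z => 1 / n.+3%:R * pw n.+3 (P z (Num.max T1 t) - - (B + 1))) j r)//; first exact: cpw.
  by move=> i z; rewrite p.
rewrite -(@I_sh R (fun z => 1 / n.+3%:R * pw n.+3 (- P z (Num.max T1 t) - - (B + 1))) j r)//.
  by apply: (cpw _ (fun z => - P z (Num.max T1 t))); ct.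
by move=> i z; rewrite p.
Qed.

End Window.

(** * Mixing across the cells *)

Section Sums.
Variables (R : realType) (T : Type).
Implicit Types (F : T -> R * R -> R) (w : seq T).

Lemma bl_sum w F : (forall c, bl (F c)) -> bl (fun z => \sum_(c <- w) F c z).
Proof.
move=> bF; elim: w => [|c w IH]; first by under eq_fun do rewrite big_nil; exact: bl_cst.
by under eq_fun do rewrite big_cons; exact: bl_add.
Qed.

Lemma per_sum w F : (forall c, per (F c)) -> per (fun z => \sum_(c <- w) F c z).
Proof. by move=> pF i z; apply: eq_bigr => c _; exact: pF. Qed.

Lemma I_sum w F : (forall c, continuous (F c)) -> I (fun z => \sum_(c <- w) F c z) = \sum_(c <- w) I (F c).
Proof.
move=> cF.
have cS w' : continuous (fun z => \sum_(c <- w') F c z).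
  elim: w' => [|c w' IH]; first by under eq_fun do rewrite big_nil; exact: cont_cst.
  by under eq_fun do rewrite big_cons; apply: cont_add.
elim: w => [|c w IH]; first by rewrite big_nil (@eq_I _ _ (fun=> 0)) ?I_cst// => z; rewrite big_nil.
rewrite big_cons -IH -ID//.
by apply: eq_I => z; rewrite big_cons.
Qed.

Lemma J_sum (s t : R) w (G : T -> R -> R) : (forall c, continuous (G c)) ->
  J s t (fun u => \sum_(c <- w) G c u) = \sum_(c <- w) J s t (G c).
Proof.
move=> cG.
have cS w' : continuous (fun u => \sum_(c <- w') G c u).
  elim: w' => [|c w' IH]; first by under eq_fun do rewrite big_nil; exact: cont_cst.
  by under eq_fun do rewrite big_cons; apply: cont_add.
elim: w => [|c w IH].
  rewrite big_nil (@eq_J _ s t _ (fun u => 0 * 1)); first by rewrite JZ ?mul0r//; exact: cont_cst.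
  by move=> u _; rewrite big_nil mul0r.
rewrite big_cons -IH -JD//.
by apply: eq_J => u _; rewrite big_cons.
Qed.

Lemma dlim_add i (f g : R * R -> R) z l k : dlim i f z l -> dlim i g z k -> dlim i (fun z => f z + g z) z (l + k).
Proof.
move=> df dg e e0; have e2 : 0 < e / 2 by rewrite divr_gt0.
have [r1 r10 H1] := df _ e2; have [r2 r20 H2] := dg _ e2.
exists (Num.min r1 r2); first by rewrite lt_min r10.
move=> r r0; rewrite lt_min => /andP[h1 h2].
have -> : Dm i r (fun z => f z + g z) z - (l + k) = (Dm i r f z - l) + (Dm i r g z - k) by rewrite /Dm; ring.
by rewrite [e]splitr; apply: le_trans (ler_normD _ _) _; apply: lerD; [exact: H1|exact: H2].
Qed.

Lemma dlim_scale i (f : R * R -> R) z l k : dlim i f z l -> dlim i (fun z => k * f z) z (k * l).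
Proof.
move=> df e e0; have k1 : 0 < `|k| + 1 by rewrite ltr_wpDl.
have ek : 0 < e / (`|k| + 1) by rewrite divr_gt0.
have [r0 r00 H] := df _ ek; exists r0 => // r rp rr.
have -> : Dm i r (fun z => k * f z) z - k * l = k * (Dm i r f z - l) by rewrite /Dm; ring.
rewrite normrM; apply: le_trans (ler_wpM2l (normr_ge0 k) (H r rp rr)) _.
by rewrite mulrA ler_pdivrMr// mulrC ler_pM2l//; lra.
Qed.

Lemma dlim_sum i w F (h : T -> R * R -> R) z : (forall c, dlim i (F c) z (h c z)) ->
  dlim i (fun z => \sum_(c <- w) F c z) z (\sum_(c <- w) h c z).
Proof.
move=> dF; elim: w => [|c w IH].
  move=> k k0; exists 1 => // r _ _; rewrite /Dm !big_nil subrr mul0r subrr normr0; exact: ltW.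
rewrite big_cons; have := dlim_add (dF c) IH; congr (dlim _ _ _ _).
by apply/funext => y; rewrite big_cons.
Qed.

End Sums.

Section CellWindow.
Variable R : realType.
Variable m : nat.
Hypothesis m0 : (0 < m)%N.
Variables (a0 a1 La B A : R) (a : R -> R) (P : R * R -> R -> R).
Hypotheses (Ha : diffusion a0 a1 La a) (HP : solution B a (vel m A) P).
Variables (n : nat) (T1 s t : R).
Hypothesis T10 : 0 < T1.
Hypothesis HN : (2 * B + 1) * (2 + 2 * (La + 2 * Cgrad a0 La B)) <= a0 / 2 * n.+2%:R.
Hypotheses (T1s : T1 <= s) (st : s < t).
Implicit Types (c : nat * nat) (h k : R * R -> R).

Definition obs c (u : R) (z : R * R) := P (cell m c z) (Num.max T1 u).

Let Tm u : 0 < Num.max T1 u. Proof. by rewrite lt_max T10. Qed.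

Lemma cont_cell c : continuous (cell m c : R * R -> R * R).
Proof. by apply: cont_comp; [exact: cont_sh|exact: cont_sh]. Qed.

Lemma obs_cont c u : continuous (obs c u).
Proof. by case: HP => h _ _ _; exact: (cont_comp (g := cell m c) (h := fun z => P z (Num.max T1 u)) (@cont_cell c) (h _ (Tm u))). Qed.

Lemma obs_per c u : per (obs c u).
Proof. by move=> i z; rewrite /obs /cell !(shC _ i); case: HP => _ h _ _; rewrite h. Qed.

Lemma obs_bound c u z : `|obs c u z| <= B.
Proof. by case: HP => _ _ h _; exact: h. Qed.

Lemma obs_time c z : continuous (obs c ^~ z).
Proof. exact: (solution_clamp_cont HP T10). Qed.

Let B0 : 0 <= B. Proof. exact: le_trans (normr_ge0 _) (obs_bound (0, 0)%N 0 (0, 0)). Qed.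

Definition ob c h (u : R) := I (fun z => obs c u z * h z).
Definition avg c h := J s t (ob c h).
Definition drop := entropy2 B P n T1 s - entropy2 B P n T1 t.

Lemma ob_cont c h : bl h -> continuous (ob c h).
Proof.
move=> bh; have [F [L [F0 L0 hF hL]]] := bh; have ch := bl_cont bh.
apply: (@cont_I_time R (B * F) (fun z u => obs c u z * h z)).
- by move=> u; have co := @obs_cont c u; ct.
- by move=> z u; apply: prod_le_norm => //; exact: obs_bound.
- by move=> z; have co := @obs_time c z; ct.
Qed.

Lemma obD c h k u : bl h -> bl k -> ob c (fun z => h z + k z) u = ob c h u + ob c k u.
Proof.
move=> bh bk; have ch := bl_cont bh; have ck := bl_cont bk; have co := @obs_cont c u.
by rewrite /ob -ID; [apply: eq_I => z; rewrite mulrDr|ct..].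
Qed.

Lemma obZ c h (r : R) u : bl h -> ob c (fun z => r * h z) u = r * ob c h u.
Proof.
move=> bh; have ch := bl_cont bh; have co := @obs_cont c u.
by rewrite /ob -IZ; [apply: eq_I => z; rewrite mulrCA|ct].
Qed.

Lemma avgD c h k : bl h -> bl k -> avg c (fun z => h z + k z) = avg c h + avg c k.
Proof.
move=> bh bk; rewrite /avg -JD; [|exact: ob_cont..].
by apply: eq_J => u _; exact: obD.
Qed.

Lemma avgZ c h (r : R) : bl h -> avg c (fun z => r * h z) = r * avg c h.
Proof.
move=> bh; rewrite /avg -JZ; last exact: ob_cont.
by apply: eq_J => u _; exact: obZ.
Qed.

Lemma eq_avg c h k : h =1 k -> avg c h = avg c k.
Proof. by move=> hk; apply: eq_J => u _; apply: eq_I => z; rewrite hk. Qed.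

Lemma avg_bound c h (K : R) : bl h -> (forall z, `|h z| <= K) -> `|avg c h| <= B * K * (t - s).
Proof.
move=> bh hK; have ch := bl_cont bh; have co := ob_cont (c := c) bh.
apply: le_trans (J_abs _ _ co) _; rewrite -J_cst; last exact: ltW.
apply: J_le => [||u _]; [by ct|exact: cont_cst|].
have cu := @obs_cont c u.
by apply: I_norm_le => [|z]; [ct|apply: prod_le_norm => //; exact: obs_bound].
Qed.

Lemma cell_solution c : exists A', `|A'| = `|A| /\ solution B a (vel m A') (fun z u => P (cell m c z) u).
Proof.
have [A' [e h]] := vel_cell m0 A c; exists A'; split => //.
have := solution_sh false (c.2%:R * len R m) (solution_sh true (c.1%:R * len R m) HP).
congr (solution _ _ _ _); apply/funext => i; apply/funext => z; exact: h.
Qed.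

Lemma cell_entropy2 c u : entropy2 B (fun z u => P (cell m c z) u) n T1 u = entropy2 B P n T1 u.
Proof.
rewrite /cell -(entropy2_sh n T10 true (c.1%:R * len R m) u HP).
exact: (entropy2_sh n T10 false (c.2%:R * len R m) u (solution_sh true (c.1%:R * len R m) HP)).
Qed.

Lemma cell_weak c F L (ph : R * R -> R) (W : R * R -> R) (s' t' : R) : 0 <= L -> s <= s' -> s' <= t' ->
  (forall A, test_fun (vel m A) F L ph (fun z => A * W z)) -> bl W ->
  exists A', `|A'| = `|A| /\ `|ob c ph t' - ob c ph s' - A' * J s' t' (ob c W)|
    <= 2 * L * a1 ^+ 2 * (t' - s') + (L + 2 * F + 1) * (entropy2 B P n T1 s' - entropy2 B P n T1 t').
Proof.
move=> L0 ss st' tf bW; have [A' [e sol]] := cell_solution c; exists A'; split=> //.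
have [G [L' [G0 L0' gG gL]]] := bW.
have WB : exists Wb, forall z, `|A' * W z| <= Wb.
  by exists (`|A'| * G) => z; rewrite normrM ler_wpM2l.
have T1s' : T1 <= s' by exact: le_trans ss.
have := weak_abs Ha T10 HN (drift_vel m0 A') sol L0 (tf A') WB T1s' st'.
rewrite !cell_entropy2; congr (_ <= _); congr `|_|; congr (_ - _ - _).
- by apply: eq_I => z; rewrite mulrC.
- by apply: eq_I => z; rewrite mulrC.
rewrite -JZ; last exact: ob_cont.
apply: eq_J => u _; have cu := @obs_cont c u; have cW := bl_cont bW.
by rewrite /ob -IZ; [apply: eq_I => z; rewrite mulrCA|ct].
Qed.

Lemma entropy2_nonincr (s' t' : R) : T1 <= s' -> s' <= t' -> entropy2 B P n T1 t' <= entropy2 B P n T1 s'.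
Proof.
move=> h1 h2; have [e1 e2] := entropy_nonincr Ha (drift_vel m0 A) HP T10 HN h1 h2.
exact: lerD.
Qed.

(** For a test function invariant under the flow the weak formulation has no term in [A], so its
    integral against the solution moves by a small amount within the window, whatever the
    amplitude. *)
Lemma cell_conserved c F L (ph : R * R -> R) (u w : R) : 0 <= F -> 0 <= L ->
  (forall A, test_fun (vel m A) F L ph (fun z => A * 0)) -> s <= u <= t -> s <= w <= t ->
  `|ob c ph w - ob c ph u| <= 2 * L * a1 ^+ 2 * (t - s) + (L + 2 * F + 1) * drop.
Proof.
move=> F0 L0 tf.
have H u' w' : s <= u' -> u' <= w' -> w' <= t -> `|ob c ph w' - ob c ph u'| <= 2 * L * a1 ^+ 2 * (t - s) + (L + 2 * F + 1) * drop.
  move=> su uw wt'; have [A' [_]] := cell_weak c L0 su uw tf (bl_cst 0).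
  have -> : J u' w' (ob c (fun=> 0)) = 0.
    rewrite (@eq_J _ u' w' _ (fun=> 0)); first by rewrite J_cst ?mul0r.
    by move=> v _; rewrite /ob (@eq_I _ _ (fun=> 0)) ?I_cst// => z; rewrite mulr0.
  rewrite mulr0 subr0 => /le_trans; apply; apply: lerD.
    by apply: ler_wpM2l; [rewrite mulr_ge0 ?sqr_ge0// mulr_ge0|lra].
  apply: ler_wpM2l; first by rewrite !addr_ge0 ?mulr_ge0.
  rewrite /drop; have h1 := entropy2_nonincr T1s su.
  have h2 := entropy2_nonincr (le_trans (le_trans T1s su) uw) wt'; lra.
move=> /andP[su ut] /andP[sw wt']; have [uw|wu] := leP u w; first exact: H.
by rewrite distrC; apply: H => //; exact: ltW.
Qed.

(** Over the whole window the weak formulation reads [A' * avg c W] plus terms bounded independently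
    of [A]. *)
Lemma cell_mixed c F L (ph W : R * R -> R) (V0 : R) : 0 < A -> 0 <= F -> 0 <= L -> drop <= V0 -> bl ph ->
  (forall z, `|ph z| <= F) -> (forall A, test_fun (vel m A) F L ph (fun z => A * W z)) -> bl W ->
  `|avg c W| <= (2 * B * F + 2 * L * a1 ^+ 2 * (t - s) + (L + 2 * F + 1) * V0) / A.
Proof.
move=> A0 F0 L0 dV bp pF tf bW; have [A' [eA h]] := cell_weak c L0 (lexx s) (ltW st) tf bW.
have ob_le u : `|ob c ph u| <= B * F.
  have cu := @obs_cont c u; have cp := bl_cont bp.
  by apply: I_norm_le => [|z]; [ct|apply: prod_le_norm => //; exact: obs_bound].
rewrite ler_pdivlMr// mulrC -{1}(gtr0_norm A0) -eA -normrM; rewrite -/(avg c W) in h.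
have -> : A' * avg c W = (ob c ph t - ob c ph s) - (ob c ph t - ob c ph s - A' * avg c W) by ring.
apply: le_trans (ler_normB _ _) _.
have h1 : `|ob c ph t - ob c ph s| <= 2 * B * F.
  by apply: le_trans (ler_normB _ _) _; have := ob_le t; have := ob_le s; lra.
have h2 : (L + 2 * F + 1) * drop <= (L + 2 * F + 1) * V0 by apply: ler_wpM2l => //; rewrite !addr_ge0 ?mulr_ge0.
by rewrite -[leRHS]addrA; apply: lerD => //; apply: le_trans h _; rewrite -/drop lerD2l.
Qed.

Lemma window_energy i (r : R) : 0 < r -> r < 1 ->
  J s t (fun u => I (fun z => Dp i r (fun z => P z (Num.max T1 u)) z ^+ 2)) <= 2 / a0 * drop.
Proof.
move=> r0 r1; have a00 : 0 < a0 by case: Ha.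
have H := entropy_energy Ha (drift_vel m0 A) HP T10 HN r0 r1 T1s (ltW st).
have [_ e2] := entropy_nonincr Ha (drift_vel m0 A) HP T10 HN T1s (ltW st).
have rn0 : r != 0 by rewrite gt_eqF.
have c1 := cont_I_Dp HP T10 (i := true) rn0; have c2 := cont_I_Dp HP T10 (i := false) rn0.
rewrite JD// in H; set J1 := J _ _ _ in H; set J2 := J _ _ _ in H.
have j1 : 0 <= J1 by apply: J_ge0 => u _; apply: I_ge0 => z; exact: sqr_ge0.
have j2 : 0 <= J2 by apply: J_ge0 => u _; apply: I_ge0 => z; exact: sqr_ge0.
have H2 : J1 + J2 <= 2 / a0 * drop.
  rewrite mulrAC ler_pdivlMr//; apply: (@le_trans _ _ (2 * (a0 / 2 * (J1 + J2)))); first lra.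
  by rewrite ler_pM2l//; apply: le_trans H _; rewrite /drop /entropy2; move: e2; lra.
by apply: le_trans H2; case: i; rewrite -/J1 -/J2; lra.
Qed.

Lemma Dp_cell c i (r : R) u z : Dp i r (obs c u) z = Dp i r (fun z => P z (Num.max T1 u)) (cell m c z).
Proof. by rewrite /Dp /obs /cell !(shC _ i). Qed.

Lemma cell_I c (f : R * R -> R) : continuous f -> per f -> I (fun z => f (cell m c z)) = I f.
Proof.
move=> cf pf; rewrite /cell.
rewrite (@I_sh R (fun z => f (sh true (c.1%:R * len R m) z)) false)//; last exact: per_sh.
  exact: I_sh.
exact: cont_fsh.
Qed.

Lemma cell_dual c i (H h : R * R -> R) (lam : R) : 0 < lam -> bl H -> per H -> continuous h ->
  (forall z, dlim i H z (h z)) ->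
  avg c h <= lam / 2 * (2 / a0 * drop) + (t - s) / (2 * lam) * I (fun z => H z ^+ 2).
Proof.
move=> lam0 bH pH ch dl.
apply: (dual_est (B := B) (i := i)) => //; first exact: ltW.
- exact: obs_cont.
- exact: obs_per.
- exact: obs_bound.
- exact: obs_time.
move=> r r0 r1; apply: le_trans (window_energy i r0 r1).
rewrite le_eqVlt; apply/orP; left; apply/eqP; apply: eq_J => u _.
have cP : continuous (fun z => P z (Num.max T1 u)) by case: HP => h' _ _ _; exact: h'.
have pP : per (fun z => P z (Num.max T1 u)) by case: HP => _ h' _ _; exact: h'.
have cD := @cont_Dp R i r _ cP; have pD := @per_Dp R i r _ pP.
rewrite -(@cell_I c (fun z => Dp i r (fun z => P z (Num.max T1 u)) z ^+ 2)).
- by apply: eq_I => z; rewrite Dp_cell.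
- by ct.
- by move=> j z; rewrite pD.
Qed.

End CellWindow.

(** * Fields in the bulk of a cell and across an edge *)

Section Fields.
Variable R : realType.
Variable m : nat.
Hypothesis m0 : (0 < m)%N.
Variable e : R.
Hypothesis e0 : 0 < e.
Implicit Types (z : R * R) (i : bool) (r x y : R).

Let l : R := len R m.
Let w : R := om R m.

Lemma bl_gam_psi : bl (fun z => gam e (psi m z)).
Proof. exact: (bl_comp (bl_psi R m0) (gam_bound e0) (gam_lip e0)). Qed.

Lemma bl_Xi (f : R * R -> R) : bl f -> bl (fun z => Xi e (f z)).
Proof.
move=> bf; apply: (bl_comp bf (F := 1)) => [x|x y]; last exact: (Xi_lip e0).
by have /andP[h1 h2] := Xi01 e0 x; rewrite ger0_norm.
Qed.

Lemma Xi0 : Xi e 0 = 1. Proof. by rewrite /Xi expr0n addr0 divff// gt_eqF. Qed.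
Lemma XiN x : Xi e (- x) = Xi e x. Proof. by rewrite /Xi sqrrN. Qed.

(** The components of a field supported in one cell, whose divergence compares the boundary
    densities [dens] with [psi]: differentiating [1 - Xi] produces [gam], and differentiating the
    cosine produces [- psi]. *)
Definition bulk i z := (1 - Xi e (psi m z)) * (cs m (co i z) * bump m (co (~~ i) z)).
Definition bulk1 i z := w * (gam e (psi m z) * (bump m (co (~~ i) z) ^+ 2 - psi m z ^+ 2)
  - (1 - Xi e (psi m z)) * psi m z).

Lemma bl_bulk i : bl (bulk i).
Proof.
apply: bl_mul; last exact: bl_mul (bl_cs R m0 i) (bl_bump R m0 (~~ i)).
exact: bl_add (bl_cst 1) (bl_opp (bl_Xi (bl_psi R m0))).
Qed.

Lemma bl_bulk1 i : bl (bulk1 i).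
Proof.
have bp := bl_psi R m0; have bb := bl_bump R m0 (~~ i).
apply: bl_mul; first exact: bl_cst.
apply: bl_add; last apply: bl_opp.
  exact: bl_mul bl_gam_psi (bl_add (bl_exp 2 bb) (bl_opp (bl_exp 2 bp))).
exact: bl_mul (bl_add (bl_cst 1) (bl_opp (bl_Xi bp))) bp.
Qed.

Lemma per_bulk i : per (bulk i).
Proof.
have h1 := per_comp (fun x => 1 - Xi e x) (@per_psi R m).
exact: perM h1 (perM (per_co i (@cs_per R m)) (per_co (~~ i) (@bump_per R m))).
Qed.

Lemma bulk_le1 i z : `|bulk i z| <= 1.
Proof.
have /andP[h1 h2] := Xi01 e0 (psi m z); have /andP[b1 b2] := bump01 m0 (co (~~ i) z).
rewrite -[leRHS]mulr1; apply: prod_le_norm; first by rewrite ger0_norm; lra.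
rewrite -[leRHS]mulr1; apply: prod_le_norm; first exact: cs_le1.
by rewrite ger0_norm.
Qed.

Lemma bulk_supp i z : sig l z.1 * sig l z.2 = 0 -> bulk i z = 0.
Proof.
move=> h; have p0 : psi m z = 0.
  rewrite /psi /bump (_ : _ * _ = sig l z.1 * sig l z.2 * (sn m z.1 * sn m z.2)); last by rewrite /l; ring.
  by rewrite h mul0r.
by rewrite /bulk p0 Xi0 subrr mul0r.
Qed.

Lemma dlim_bulk i z : dlim i (bulk i) z (bulk1 i z).
Proof.
have [r0 r00 Hr] := sig_left (co i z) (len_gt0 R m0).
rewrite /bulk1 (psiE _ i) /bump.
set S := sig _ (co i z); set y0 := sig _ _ * sn m (co (~~ i) z).
apply: (@dlim_local R i _ z (fun x => (1 - Xi e (S * sn m x * y0)) * (cs m x * y0))).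
  exists r0 => // r rp rr; rewrite /bulk (psiE _ i) coS coSN /bump -/y0.
  by rewrite Hr.
apply: der_eq (der_mul (der_add (der_cst 1 _) (der_opp (der_comp (der_Xi e0 _) (der_mul (der_mul (der_cst S _) (der_sn m _)) (der_cst y0 _)))))
   (der_mul (der_cs m _) (der_cst y0 _))) _.
rewrite /S; case: (sig01 (len R m) (co i z)) => ->.
  by rewrite !mul0r gam0 Xi0; ring.
have := sn_cs m (co i z); rewrite mul1r /w; set X := gam _ _; set Y := Xi _ _ => h.
rewrite (_ : om R m * (X * (y0 ^+ 2 - (sn m (co i z) * y0) ^+ 2) - (1 - Y) * (sn m (co i z) * y0))
  = om R m * (X * y0 ^+ 2 * (1 - sn m (co i z) ^+ 2) - (1 - Y) * (sn m (co i z) * y0))); last by ring.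
by rewrite -h; ring.
Qed.

(** A layer field across the edge between two cells: [Xi] confines it to the neighbourhood of the
    lines where the sine vanishes, and [hat] selects one of these lines. *)
Definition edgef i z := bump m (co (~~ i) z) * Xi e (bump m (co (~~ i) z) * sn m (co i z)) * hat m (co i z).

Definition jump i (f : R -> R) z := f (psi m z) - f (psi m (sh i l z)).

Definition edge1 i z := - w / 2 * (jump i (gam e) z * bump m (co (~~ i) z) ^+ 2 * (cs m (co i z) * (1 + cs m (co i z)))
  + jump i (fun x => x * Xi e x) z).

Lemma bl_edgef i : bl (edgef i).
Proof.
apply: bl_mul; last exact: bl_hat.
have bb := bl_bump R m0 (~~ i); apply: bl_mul => //; apply: bl_Xi.
exact: bl_mul bb (bl_sn R m0 i).
Qed.

Lemma per_edgef i : per (edgef i).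
Proof.
move=> j z; rewrite /edgef; have b := per_co (~~ i) (@bump_per R m) j z.
have s := per_co i (@sn_per R m) j z; have h := per_co i (@hat_per R m) j z.
by rewrite b s h.
Qed.

Lemma bl_jump i (f : R -> R) : bl (fun z => f (psi m z)) -> bl (jump i f).
Proof. by move=> bf; exact: bl_add bf (bl_opp (bl_sh i l bf)). Qed.

Lemma bl_edge1 i : bl (edge1 i).
Proof.
have bp := bl_psi R m0; have bb := bl_bump R m0 (~~ i); have bc := bl_cs R m0 i.
apply: bl_mul; first exact: bl_cst.
apply: bl_add; last exact: bl_jump (bl_mul bp (bl_Xi bp)).
apply: bl_mul; last exact: bl_mul bc (bl_add (bl_cst 1) bc).
exact: bl_mul (bl_jump i bl_gam_psi) (bl_exp 2 bb).
Qed.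

Lemma dlim_edge i z : dlim i (edgef i) z (edge1 i z).
Proof.
have l0 := len_gt0 R m0; have l2 : 0 < 2 * len R m by lra.
have [r0 r00 Hr] := sig_left (co i z + len R m) l2.
rewrite /edge1 /jump !(psiE _ i) coS coSN /l bump_len// /bump; set y0 := sig _ (co (~~ i) z) * _.
set S2 := sig (2 * len R m) _ in Hr.
apply: (@dlim_local R i _ z (fun x => y0 * Xi e (y0 * sn m x) * (S2 * ((1 + cs m x) / 2)))).
  exists r0 => // r rp rr; rewrite /edgef coS coSN /hat /bump -/y0.
  by rewrite addrAC Hr.
apply: der_eq (der_mul (der_mul (der_cst y0 _) (der_comp (der_Xi e0 _) (der_mul (der_cst y0 _) (der_sn m _))))
  (der_mul (der_cst S2 _) (der_mul (der_add (der_cst 1 _) (der_cs m _)) (der_cst (2^-1) _)))) _.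
have e2 : S2 = sig (len R m) (co i z + len R m) + sig (len R m) (co i z) by exact: sig2_add.
have s2 : S2 = 0 \/ S2 = 1 by exact: sig01.
move: e2 s2; set C := cs m (co i z); set N := sn m (co i z).
case: (sig01 (len R m) (co i z)) => ->; case: (sig01 (len R m) (co i z + len R m)) => -> -> s2.
- by rewrite !mul0r oppr0 mul0r gam0; ring.
- have -> : - (1 * N) * y0 = - (y0 * N) by ring.
  have -> : 0 * N * y0 = 0 by ring.
  by rewrite gamN XiN gam0 /w; ring.
- have -> : - (0 * N) * y0 = 0 by ring.
  have -> : 1 * N * y0 = y0 * N by ring.
  by rewrite gam0 /w; ring.
- by exfalso; case: s2; lra.
Qed.

Lemma edgef_sq i z : edgef i z ^+ 2 <= Xi e (sn m (co i z)).
Proof.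
have /andP[h1 h2] := hat01 m (co i z); have hb := bump01 m0 (co (~~ i) z).
rewrite /edgef exprMn -[leRHS]mulr1; apply: ler_pM; rewrite ?sqr_ge0//; first exact: Xi_norm.
by rewrite exprn_ile1.
Qed.

Lemma I_co i (f : R -> R) : I (fun z => f (co i z)) = J 0 1 f.
Proof.
case: i; rewrite /I /JJ /=; last by rewrite J_cst ?subr0 ?mulr1.
by apply: eq_J => x _; rewrite J_cst ?subr0 ?mulr1.
Qed.

Lemma I_edgef i : I (fun z => edgef i z ^+ 2) <= edge m e.
Proof.
rewrite /edge -(I_co i); apply: I_le => [||z]; last exact: edgef_sq.
  by have c := bl_cont (bl_edgef i); ct.
exact: (cont_comp (@cont_co R i) (edge_cont m0 e0)).
Qed.

(** As [e] tends to 0 this concentrates on the two edges of the cell orthogonal to direction [i],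
    with a weight proportional to the sine of the coordinate along the edge. *)
Definition dens i z := gam e (psi m z) * bump m (co (~~ i) z) ^+ 2.

Lemma bl_dens i : bl (dens i).
Proof. exact: bl_mul bl_gam_psi (bl_exp 2 (bl_bump R m0 (~~ i))). Qed.

Lemma gam_sn j z : gam e (psi m z) * sn m (co j z) ^+ 2 = gam e (psi m z) * bump m (co j z) ^+ 2.
Proof.
rewrite (psiE _ j) /bump; case: (sig01 (len R m) (co j z)) => ->; last by rewrite !mul1r.
by rewrite !mul0r gam0 !mul0r.
Qed.

(** On the two sides of the common edge the derivative of [edgef] is the boundary density with
    opposite signs: [1 + cs] selects the near edge of one cell and [1 - cs] the far edge of its
    neighbour. The remainder consists of values of [x * Xi x] and [x^2 * gam x], which are
    [O(sqrt e)]; hence [d]. *)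
Lemma edge_split i z (d : R) : 0 <= d -> d ^+ 2 = e ->
  `|- (2 / w) * edge1 i z - (dens i z * (1 + cs m (co i z)) - dens i (sh i l z) * (1 - cs m (co i (sh i l z))))| <= 6 * d.
Proof.
move=> d0 de; have w0 := om_gt0 R m0.
have /andP[p0 _] := psi01 m0 z; have /andP[q0 _] := psi01 m0 (sh i l z).
have -> : - (2 / w) * edge1 i z - (dens i z * (1 + cs m (co i z)) - dens i (sh i l z) * (1 - cs m (co i (sh i l z))))
  = (psi m z * Xi e (psi m z) - psi m (sh i l z) * Xi e (psi m (sh i l z)))
   - (psi m z ^+ 2 * gam e (psi m z) - psi m (sh i l z) ^+ 2 * gam e (psi m (sh i l z))).
  have k1 : psi m z ^+ 2 * gam e (psi m z) = gam e (psi m z) * bump m (co (~~ i) z) ^+ 2 * sn m (co i z) ^+ 2.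
    rewrite [RHS]mulrAC gam_sn (_ : psi m z ^+ 2 = bump m (co i z) ^+ 2 * bump m (co (~~ i) z) ^+ 2); first by ring.
    by rewrite (psiE _ i) exprMn.
  have k2 : psi m (sh i l z) ^+ 2 * gam e (psi m (sh i l z)) =
     gam e (psi m (sh i l z)) * bump m (co (~~ i) z) ^+ 2 * sn m (co i z) ^+ 2.
    have := gam_sn i (sh i l z); rewrite coS sn_len// sqrrN => h.
    rewrite [RHS]mulrAC h (_ : psi m (sh i l z) ^+ 2 = bump m (co i z + len R m) ^+ 2 * bump m (co (~~ i) z) ^+ 2); first by ring.
    by rewrite (psiE _ i) coS coSN exprMn.
  rewrite k1 k2 /edge1 /jump /dens coS coSN cs_len// opprK.
  have := sn_cs m (co i z); set C := cs _ _; set N := sn _ _ ^+ 2 => h.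
  have -> : N = 1 - C ^+ 2 by rewrite h; ring.
  by field; rewrite gt_eqF.
have x1 := Xi_small e0 p0 d0 de; have x2 := Xi_small e0 q0 d0 de.
have y1 := gam_small e0 p0 d0 de; have y2 := gam_small e0 q0 d0 de.
have z1 : 0 <= psi m z * Xi e (psi m z) by rewrite mulr_ge0//; case/andP: (Xi01 e0 (psi m z)).
have z2 : 0 <= psi m (sh i l z) * Xi e (psi m (sh i l z)) by rewrite mulr_ge0//; case/andP: (Xi01 e0 (psi m (sh i l z))).
have z3 : 0 <= psi m z ^+ 2 * gam e (psi m z) by rewrite mulr_ge0 ?sqr_ge0 ?gam_ge0.
have z4 : 0 <= psi m (sh i l z) ^+ 2 * gam e (psi m (sh i l z)) by rewrite mulr_ge0 ?sqr_ge0 ?gam_ge0.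
by rewrite ler_norml; apply/andP; split; lra.
Qed.

Lemma bulk_split z (d : R) : 0 <= d -> d ^+ 2 = e ->
  `|w^-1 * (bulk1 true z + bulk1 false z) - (dens true z + dens false z - 2 * psi m z)| <= 6 * d.
Proof.
move=> d0 de; have w0 := om_gt0 R m0; have /andP[p0 _] := psi01 m0 z.
have -> : w^-1 * (bulk1 true z + bulk1 false z) - (dens true z + dens false z - 2 * psi m z)
  = 2 * (psi m z * Xi e (psi m z)) - 2 * (psi m z ^+ 2 * gam e (psi m z)).
  by rewrite /bulk1 /dens; field; rewrite gt_eqF.
have x1 := Xi_small e0 p0 d0 de; have y1 := gam_small e0 p0 d0 de.
have z1 : 0 <= psi m z * Xi e (psi m z) by rewrite mulr_ge0//; case/andP: (Xi01 e0 (psi m z)).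
have z3 : 0 <= psi m z ^+ 2 * gam e (psi m z) by rewrite mulr_ge0 ?sqr_ge0 ?gam_ge0.
by rewrite ler_norml; apply/andP; split; lra.
Qed.

End Fields.

(** * Sums over all cells *)

Section CellSums.
Variable R : realType.
Variable m : nat.
Hypothesis m0 : (0 < m)%N.
Implicit Types (z : R * R).

Definition cellm (c : nat * nat) z := sh true (- (c.1%:R * len R m)) (sh false (- (c.2%:R * len R m)) z).

Lemma cellmK c z : cellm c (cell m c z) = z.
Proof. by rewrite /cellm /cell (shC false true) !shKN. Qed.

Definition cells := ('I_(2 * m) * 'I_(2 * m))%type.
Definition cnat (c : cells) : nat * nat := (c.1 : nat, c.2 : nat).

Lemma cell_pick z : exists c0 : cells, forall c : cells,
  sig (len R m) (cellm (cnat c) z).1 * sig (len R m) (cellm (cnat c) z).2 = (c == c0)%:R.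
Proof.
have [i0 h1] := sig_pick z.1 (len_gt0 R m0) (cells_len R m0).
have [j0 h2] := sig_pick z.2 (len_gt0 R m0) (cells_len R m0).
exists (i0, j0) => -[i j]; rewrite /cellm /sh /=; rewrite h1 h2 xpair_eqE -natrM mulnb.
by [].
Qed.

Definition supp (H : R * R -> R) := forall z, sig (len R m) z.1 * sig (len R m) z.2 = 0 -> H z = 0.

Lemma sum_cells (H : R * R -> R) z (F : cells -> R -> R) : supp H -> (forall c, F c 0 = 0) ->
  exists c0 : cells, \sum_(c : cells) F c (H (cellm (cnat c) z)) = F c0 (H (cellm (cnat c0) z)).
Proof.
move=> sH F0; have [c0 h] := cell_pick z; exists c0; rewrite (bigD1 c0)//= big1 ?addr0// => c ne.
by rewrite sH ?F0// h (negbTE ne).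
Qed.

Lemma sum_cells_sq (H : R * R -> R) z (al : cells -> R) : supp H ->
  (\sum_(c : cells) al c * H (cellm (cnat c) z)) ^+ 2 = \sum_(c : cells) al c ^+ 2 * H (cellm (cnat c) z) ^+ 2.
Proof.
move=> sH; have [c0 h] := cell_pick z.
have k (c : cells) : c != c0 -> H (cellm (cnat c) z) = 0 by move=> ne; rewrite sH// h (negbTE ne).
rewrite (bigD1 c0)//= big1 => [|c ne]; last by rewrite k// mulr0.
rewrite [RHS](bigD1 c0)//= [X in _ = _ + X]big1 => [|c ne]; last by rewrite k// expr0n/= mulr0.
by rewrite !addr0 exprMn.
Qed.

Lemma cont_cellm c : continuous (cellm c).
Proof. by apply: cont_comp; exact: cont_sh. Qed.

Lemma bl_cellm c H : bl H -> bl (fun z => H (cellm c z)).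
Proof. by move=> bH; exact: (bl_sh false _ (bl_sh true _ bH)). Qed.

Lemma per_cellm c (H : R * R -> R) : per H -> per (fun z => H (cellm c z)).
Proof. by move=> pH i z; rewrite /cellm !(shC _ i) pH. Qed.

Lemma I_cellm c (f : R * R -> R) : continuous f -> per f -> I (fun z => f (cellm c z)) = I f.
Proof.
move=> cf pf; rewrite /cellm.
rewrite (@I_sh R (fun z => f (sh true (- (c.1%:R * len R m)) z)) false)//; last exact: per_sh.
  exact: I_sh.
exact: cont_fsh.
Qed.

Lemma dlim_cellm c i (H : R * R -> R) z l : dlim i H (cellm c z) l -> dlim i (fun z => H (cellm c z)) z l.
Proof.
move=> dH k k0; have [r0 r00 h] := dH k k0; exists r0 => // r rp rr.
by have := h r rp rr; rewrite /Dm /cellm !(shC i).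
Qed.

Lemma card_cells : \sum_(c : cells) (1 : R) = (2 * m)%:R ^+ 2.
Proof. by rewrite sumr_const card_prod !card_ord -natrX mulnn. Qed.

(** The translates of [H ^+ 2] over all cells have disjoint supports and add up to at most 1, and
    they all have the same integral. *)
Lemma I_supp_le (H : R * R -> R) : bl H -> per H -> supp H -> (forall z, `|H z| <= 1) ->
  I (fun z => H z ^+ 2) <= len R m ^+ 2.
Proof.
move=> bH pH sH H1; have cH := bl_cont bH; have cc c : continuous (fun z => H (cellm c z) ^+ 2).
  by have ch := bl_cont (bl_cellm c bH); ct.
have e1 c : I (fun z => H (cellm c z) ^+ 2) = I (fun z => H z ^+ 2).
  by apply: (@I_cellm c (fun z => H z ^+ 2)); [ct|move=> i z; rewrite pH].
have h : (2 * m)%:R ^+ 2 * I (fun z => H z ^+ 2) <= 1.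
  rewrite -card_cells mulr_suml -[leRHS](@I_cst R).
  rewrite (eq_bigr (fun c : cells => I (fun z => H (cellm (cnat c) z) ^+ 2))); last by move=> c _; rewrite e1 mul1r.
  have sq z : \sum_(c : cells) H (cellm (cnat c) z) ^+ 2 <= 1.
    have [c0 ->] := @sum_cells H z (fun _ x => x ^+ 2) sH (fun _ => expr0n _ 2).
    by rewrite -real_normK ?num_real// exprn_ile1.
  rewrite -(@I_sum R cells _ (fun c z => H (cellm (cnat c) z) ^+ 2))//.
  apply: I_le => //; last exact: cont_cst.
  by apply: bl_cont; apply: (@bl_sum R cells _ (fun c z => H (cellm (cnat c) z) ^+ 2)) => c; exact: bl_exp (bl_cellm _ bH).
have N0 : 0 < (2 * m)%:R :> R by rewrite ltr0n muln_gt0.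
have -> : len R m = (2 * m)%:R^-1 by rewrite /len natrM.
by rewrite exprVn -[leRHS]mul1r ler_pdivlMr ?exprn_gt0// mulrC.
Qed.

End CellSums.

Lemma bl_scale (R : realType) (c : R) (f : R * R -> R) : bl f -> bl (fun z => c * f z).
Proof. by move=> bf; exact: (bl_mul (bl_cst c) bf). Qed.

(** * From local relations to equal cell averages *)

Section Mixing.
Variable R : realType.
Variable m : nat.
Hypothesis m0 : (0 < m)%N.
Variables (a0 a1 La B : R).
Variable n : nat.
Hypothesis HN : (2 * B + 1) * (2 + 2 * (La + 2 * Cgrad a0 La B)) <= a0 / 2 * n.+2%:R.

Section OneSolution.
Variables (A : R) (a : R -> R) (P : R * R -> R -> R).
Hypotheses (Ha : diffusion a0 a1 La a) (HP : solution B a (vel m A) P).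
Variables (T1 s t : R).
Hypothesis T10 : 0 < T1.
Hypotheses (T1s : T1 <= s) (st : s < t).

Let E := 2 / a0 * drop B P n T1 s t.
Let av := avg m P T1 s t.

Definition nxt i (c : nat * nat) := if i then (c.1.+1, c.2) else (c.1, c.2.+1).

Lemma cell_nxt i c (z : R * R) : cell m (nxt i c) z = cell m c (sh i (len R m) z).
Proof.
by case: i; rewrite /cell /nxt /sh /= -natr1 mulrDl mul1r; congr (_, _); ring.
Qed.

Lemma avg_nxt i c (k : R * R -> R) : bl k -> per k ->
  av (nxt i c) (fun z => k (sh i (len R m) z)) = av c k.
Proof.
move=> bk pk; apply: eq_J => u _; have ck := bl_cont bk.
have co := obs_cont HP T10 (c := c) (u := u).
rewrite /ob -(@I_sh R (fun z => obs m P T1 c u z * k z) i (len R m)).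
- by apply: eq_I => z; rewrite /obs cell_nxt.
- by ct.
- exact: perM (obs_per HP T10 c u) pk.
Qed.

Let E0 : 0 <= E.
Proof.
have a00 : 0 < a0 by case: Ha.
rewrite mulr_ge0//; first by rewrite divr_ge0// ltW.
rewrite /drop subr_ge0; exact: (entropy2_nonincr m0 Ha HP T10 HN T1s (ltW st)).
Qed.

(** A Bessel type inequality: duality is used once for all cells together, with the averages [X c]
    themselves as coefficients. By disjointness of the supports the combined field has square norm
    at most [len^2] times the sum [S] of squares, and [lam = (t - s) * len^2] leads to
    [S <= lam / 2 * E + S / 2]. In this way the energy is counted once and not once per cell. *)
Lemma bulk_sum i (H h : R * R -> R) : bl H -> per H -> bl h -> per h -> supp m H -> (forall z, `|H z| <= 1) ->
  (forall z, dlim i H z (h z)) ->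
  \sum_(c : cells m) av (cnat c) h ^+ 2 <= (t - s) * len R m ^+ 2 * E.
Proof.
move=> bH pH bh ph sH H1 dl; have l0 := len_gt0 R m0; have d0 : 0 < t - s by rewrite subr_gt0.
pose X (c : cells m) := av (cnat c) h.
pose HX z := \sum_(c : cells m) X c * H (cellm m (cnat c) z).
pose hX z := \sum_(c : cells m) X c * h (cellm m (cnat c) z).
have bcH (c : cells m) : bl (fun z => X c * H (cellm m (cnat c) z)).
  exact: bl_scale _ (bl_cellm m _ bH).
have bch (c : cells m) : bl (fun z => X c * h (cellm m (cnat c) z)).
  exact: bl_scale _ (bl_cellm m _ bh).
have bHX : bl HX by exact: bl_sum.
have bhX : bl hX by exact: bl_sum.
have pHX : per HX.
  by apply: per_sum => c i' z; rewrite (per_cellm m (cnat c) pH).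
have dHX z : dlim i HX z (hX z).
  exact: (dlim_sum (F := fun (c : cells m) z => X c * H (cellm m (cnat c) z)) (h := fun c z => X c * h (cellm m (cnat c) z)) _
    (fun c => dlim_scale (X c) (dlim_cellm (dl _)))).
have lam0 : 0 < (t - s) * len R m ^+ 2 by rewrite mulr_gt0// exprn_gt0.
have D := cell_dual m0 Ha HP T10 HN T1s st (0, 0)%N lam0 bHX pHX (bl_cont bhX) dHX.
have avE (c : cells m) : av (0, 0)%N (fun z => h (cellm m (cnat c) z)) = X c.
  apply: eq_J => u _; have ch := bl_cont (bl_cellm m (cnat c) bh).
  have co := obs_cont HP T10 (c := (0, 0)%N) (u := u); have po := obs_per HP T10 (0, 0)%N u.
  rewrite /ob -(@cell_I R m (cnat c) (fun z => obs m P T1 (0, 0)%N u z * h (cellm m (cnat c) z))).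
  - by apply: eq_I => z; rewrite cellmK /obs {1}/cell !mul0r !sh0.
  - by ct.
  - exact: perM po (per_cellm m (cnat c) ph).
have e1 : av (0, 0)%N hX = \sum_(c : cells m) X c ^+ 2.
  rewrite /hX /av /avg.
  have -> : J s t (ob m P T1 (0, 0)%N hX) = J s t (fun u => \sum_(c : cells m) ob m P T1 (0, 0)%N (fun z => X c * h (cellm m (cnat c) z)) u).
    apply: eq_J => u _; have co := obs_cont HP T10 (c := (0, 0)%N) (u := u).
    rewrite /ob -(@I_sum R (cells m) _ (fun c z => obs m P T1 (0, 0)%N u z * (X c * h (cellm m (cnat c) z)))).
      by apply: eq_I => z; rewrite mulr_sumr.
    by move=> c; exact: (cont_mul co (bl_cont (bch c))).
  rewrite (@J_sum R (cells m) s t _ (fun c => ob m P T1 (0, 0)%N (fun z => X c * h (cellm m (cnat c) z)))).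
    apply: eq_bigr => c _; rewrite expr2.
    transitivity (X c * av (0, 0)%N (fun z => h (cellm m (cnat c) z))); last by rewrite avE.
    exact: (avgZ HP s t T10 (0, 0)%N (X c) (bl_cellm m (cnat c) bh)).
  by move=> c; exact: (ob_cont HP T10).
have e2 : I (fun z => HX z ^+ 2) <= (\sum_(c : cells m) X c ^+ 2) * len R m ^+ 2.
  rewrite (@eq_I _ _ (fun z => \sum_(c : cells m) X c ^+ 2 * H (cellm m (cnat c) z) ^+ 2)); last by move=> z; exact: sum_cells_sq.
  have cc c : continuous (fun z => H (cellm m c z) ^+ 2).
    by have c1 := bl_cont (bl_cellm m c bH); ct.
  rewrite (@I_sum R (cells m) _ (fun c z => X c ^+ 2 * H (cellm m (cnat c) z) ^+ 2)); last by move=> c; exact: (cont_mul (@cont_cst _ _ (X c ^+ 2)) (cc (cnat c))).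
  rewrite mulr_suml; apply: ler_sum => c _; rewrite IZ; last exact: cc.
  apply: ler_wpM2l; first exact: sqr_ge0.
  have cH := bl_cont bH.
  rewrite (@I_cellm R m (cnat c) (fun z => H z ^+ 2)); [exact: I_supp_le|by ct|by move=> j z; rewrite pH].
rewrite -/av e1 -/E in D; move: D e2; set S := \sum_(c : cells m) _.
set Q := I _ => D e2; rewrite -/S.
have e3 : (t - s) / (2 * ((t - s) * len R m ^+ 2)) * Q <= S / 2.
  have -> : (t - s) / (2 * ((t - s) * len R m ^+ 2)) * Q = Q / len R m ^+ 2 / 2 by field; rewrite !gt_eqF//.
  by rewrite ler_pM2r// ler_pdivrMr ?exprn_gt0.
by move: D e3; set L := (t - s) * len R m ^+ 2; lra.
Qed.

Section Profile.
Variables (e d rho : R).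
Hypotheses (e0 : 0 < e) (d0 : 0 <= d) (de : d ^+ 2 = e) (rho0 : 0 <= rho).
Let dn := dens m e.
Hypothesis bd : B * (6 * d) * (t - s) <= rho.
Hypothesis wk1 : forall c i, `|av c (fun z => dn i z * cs m (co i z))| <= rho.
Hypothesis wk2 : forall c, `|av c (dn true) - av c (dn false)| <= rho.
Hypothesis eg : forall c i, `|av c (edge1 m e i)| <= om R m / 2 * rho.

Let bdn i : bl (dn i). Proof. exact: bl_dens. Qed.
Let pdn i : per (dn i).
Proof.
apply: perM; first exact: per_comp (@per_psi R m).
by move=> j z; rewrite (per_co (~~ i) (@bump_per R m)).
Qed.
Let bcs i : bl (fun z : R * R => cs m (co i z)). Proof. exact: bl_cs. Qed.
Let avD c h k : bl h -> bl k -> av c (fun z => h z + k z) = av c h + av c k.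
Proof. by move=> bh bk; exact: (avgD HP s t T10). Qed.
Let avZ c h r : bl h -> av c (fun z => r * h z) = r * av c h.
Proof. by move=> bh; exact: (avgZ HP s t T10). Qed.

(** [edge_split] links [dn * (1 + cs)] in one cell with [dn * (1 - cs)] in its neighbour, and [wk1]
    removes both cosines. The four errors are the remainder, the edge average and two uses of
    [wk1]. *)
Lemma avg_step i c : `|av (nxt i c) (dn i) - av c (dn i)| <= 4 * rho.
Proof.
have w0 := om_gt0 R m0.
pose k1 z := dn i z * (1 + cs m (co i z)).
pose k2 z := dn i z * (1 - cs m (co i z)).
have bk1 : bl k1 by exact: bl_mul (bdn i) (bl_add (bl_cst 1) (bcs i)).
have bk2 : bl k2 by exact: bl_mul (bdn i) (bl_add (bl_cst 1) (bl_opp (bcs i))).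
have pk2 : per k2.
  by move=> j z; rewrite /k2 (pdn i j z) (per_co i (@cs_per R m)).
have bs := bl_sh i (len R m) bk2.
have be := bl_edge1 m0 e0 i.
pose r z := - (2 / om R m) * edge1 m e i z + (-1 * k1 z + k2 (sh i (len R m) z)).
have br : bl r.
  apply: bl_add; first exact: bl_scale _ be.
  exact: bl_add (bl_scale _ bk1) bs.
have rb z : `|r z| <= 6 * d.
  have := edge_split m0 e0 i z d0 de; rewrite /r /k1 /k2 /dn.
  by congr (_ <= _); congr `|_|; ring.
have h1 : `|av (nxt i c) r| <= rho by apply: le_trans bd; exact: (avg_bound HP T10 st).
have e1 : av (nxt i c) r = - (2 / om R m) * av (nxt i c) (edge1 m e i) + (- av (nxt i c) k1 + av c k2).
  rewrite avD; [|exact: bl_scale _ be|exact: bl_add (bl_scale _ bk1) bs].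
  rewrite avD; [|exact: bl_scale _ bk1|exact: bs].
  rewrite (avZ _ (- (2 / om R m)) be) (avZ _ (-1) bk1) mulN1r; congr (_ + (_ + _)); exact: avg_nxt.
have ek1 : av (nxt i c) k1 = av (nxt i c) (dn i) + av (nxt i c) (fun z => dn i z * cs m (co i z)).
  rewrite -avD; [|exact: bdn|exact: bl_mul (bdn i) (bcs i)].
  by apply: eq_avg => z; rewrite /k1 mulrDr mulr1.
have ek2 : av c k2 = av c (dn i) - av c (fun z => dn i z * cs m (co i z)).
  rewrite -mulN1r -avZ -?avD; [|exact: bdn|exact: bl_scale _ (bl_mul (bdn i) (bcs i))|exact: bl_mul (bdn i) (bcs i)].
  by apply: eq_avg => z; rewrite /k2; ring.
have h2 := wk1 (nxt i c) i; have h3 := wk1 c i.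
have h4 : `|2 / om R m * av (nxt i c) (edge1 m e i)| <= rho.
  rewrite normrM gtr0_norm ?divr_gt0// mulrAC ler_pdivrMr// [rho * _](_ : _ = 2 * (om R m / 2 * rho)); last by field.
  by rewrite ler_pM2l.
move: e1 h1 h2 h3 h4; rewrite ek1 ek2 mulNr => ->.
move: (av _ _) (av _ _) (av _ _) (av _ _) (_ * av _ _) => x1 x2 x3 x4 x5.
rewrite !ler_norml => /andP[? ?] /andP[? ?] /andP[? ?] /andP[? ?]; apply/andP; split; lra.
Qed.

Lemma avg_step2 i j c : `|av (nxt i c) (dn j) - av c (dn j)| <= 6 * rho.
Proof.
have H := avg_step i c; have h1 := wk2 c; have h2 := wk2 (nxt i c).
move: H h1 h2; case: i; case: j; rewrite !ler_norml => /andP[? ?] /andP[? ?] /andP[? ?]; apply/andP; split; have r0 := rho0; lra.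
Qed.

(** Steps in the two directions lead from the corner cell to [c]. The loss of a factor of the order
    of the number of steps is harmless, as [rho] is chosen after [m]. *)
Lemma avg_chain j (c : nat * nat) : `|av c (dn j) - av (0, 0)%N (dn j)| <= (c.1 + c.2)%:R * (6 * rho).
Proof.
case: c => c1 c2 /=; elim: c1 => [|c1 IH].
  elim: c2 => [|c2 IH]; first by rewrite subrr normr0 mul0r.
  have h := avg_step2 false j (0, c2)%N; rewrite /nxt /= in h.
  rewrite addnS -natr1 mulrDl mul1r [leRHS]addrC.
  have -> : av (0, c2.+1)%N (dn j) - av (0, 0)%N (dn j) = (av (0, c2.+1)%N (dn j) - av (0, c2)%N (dn j)) + (av (0, c2)%N (dn j) - av (0, 0)%N (dn j)) by ring.
  by apply: le_trans (ler_normD _ _) _; exact: lerD.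
have h := avg_step2 true j (c1, c2)%N; rewrite /nxt /= in h.
rewrite addSn -natr1 mulrDl mul1r [leRHS]addrC.
have -> : av (c1.+1, c2)%N (dn j) - av (0, 0)%N (dn j) = (av (c1.+1, c2)%N (dn j) - av (c1, c2)%N (dn j)) + (av (c1, c2)%N (dn j) - av (0, 0)%N (dn j)) by ring.
by apply: le_trans (ler_normD _ _) _; exact: lerD.
Qed.

Lemma per_bulk1 i : per (bulk1 m e i).
Proof.
move=> j z; rewrite /bulk1; have b := per_co (~~ i) (@bump_per R m) j z.
by rewrite b (@per_psi R m).
Qed.

(** By [bulk_split], twice the average of [psi] in a cell is the sum of the two boundary averages,
    each close to [kap] by the chain, minus the averages of [bulk1] divided by [om], whose squares
    are summed by [bulk_sum]. *)
Lemma avg_spread : exists kap, \sum_(c : cells m) (av (cnat c) (psi m) - kap) ^+ 2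
  <= 2 / om R m ^+ 2 * ((t - s) * len R m ^+ 2 * E) + 2 * (2 * m)%:R ^+ 2 * (14 * (2 * m)%:R * rho) ^+ 2.
Proof.
have w0 := om_gt0 R m0; exists (av (0, 0)%N (dn true)); set kap := av _ _.
pose N : R := (2 * m)%:R.
have N1 : 1 <= N by rewrite ler1n muln_gt0.
pose X i c := av c (bulk1 m e i).
have bX i : bl (bulk1 m e i) by exact: bl_bulk1.
have one (c : cells m) : `|2 * (av (cnat c) (psi m) - kap) + (om R m)^-1 * (X true (cnat c) + X false (cnat c))| <= 28 * N * rho.
  set c' := cnat c.
  pose r z := (om R m)^-1 * (bulk1 m e true z + bulk1 m e false z) + (-1 * dn true z + (-1 * dn false z + 2 * psi m z)).
  have bp := bl_psi R m0.
  have b1 : bl (fun z => (om R m)^-1 * (bulk1 m e true z + bulk1 m e false z)) by exact: bl_scale _ (bl_add (bX _) (bX _)).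
  have b4 : bl (fun z : R * R => 2 * psi m z) by exact: bl_scale _ bp.
  have b5 i : bl (fun z => -1 * dn i z) by exact: bl_scale _ (bdn i).
  have b3 := bl_add (b5 false) b4; have b2 := bl_add (b5 true) b3.
  have rb z : `|r z| <= 6 * d.
    have := bulk_split m0 e0 z d0 de; rewrite /r /dn.
    by congr (_ <= _); congr `|_|; ring.
  have h1 : `|av c' r| <= rho by apply: le_trans bd; exact: (avg_bound HP T10 st _ (bl_add b1 b2)).
  have e1 : av c' r = (om R m)^-1 * (X true c' + X false c') + (- av c' (dn true) + (- av c' (dn false) + 2 * av c' (psi m))).
    rewrite (avD _ b1 b2) (avZ _ _ (bl_add (bX _) (bX _))) (avD _ (bX _) (bX _)).
    by rewrite (avD _ (b5 _) b3) (avD _ (b5 _) b4) (avZ _ 2 bp) !(avZ _ (-1) (bdn _)) !mulN1r.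
  have h2 := avg_chain true c'; have h3 := wk2 c'.
  have h4 : (c'.1 + c'.2)%:R <= 2 * N.
    have k1 : c'.1%:R <= N by rewrite ler_nat ltnW// ltn_ord.
    have k2 : c'.2%:R <= N by rewrite ler_nat ltnW// ltn_ord.
    by rewrite natrD; lra.
  have h5 : (c'.1 + c'.2)%:R * (6 * rho) <= 2 * N * (6 * rho) by apply: ler_wpM2r => //; rewrite mulr_ge0.
  have h6 : rho <= N * rho by rewrite ler_peMl.
  move: h1 h2 h3 h5; rewrite e1 -/kap.
  move: (X _ _ + X _ _) (av _ _) (av _ _) (av _ _) => x1 x2 x3 x4.
  rewrite !ler_norml => /andP[? ?] /andP[? ?] /andP[? ?] h5; apply/andP; split; lra.
have S i : \sum_(c : cells m) X i (cnat c) ^+ 2 <= (t - s) * len R m ^+ 2 * E.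
  apply: (@bulk_sum i (bulk m e i)).
  - exact: bl_bulk.
  - exact: per_bulk.
  - exact: bX.
  - exact: per_bulk1.
  - exact: (bulk_supp (m := m) e0).
  - exact: bulk_le1.
  - exact: dlim_bulk.
have each (c : cells m) : (av (cnat c) (psi m) - kap) ^+ 2 <= (om R m ^+ 2)^-1 * (X true (cnat c) ^+ 2 + X false (cnat c) ^+ 2) + 2 * (14 * N * rho) ^+ 2.
  have := one c; set y := av _ _ - kap; set x := X true _; set x' := X false _; set D := 14 * N * rho => h.
  have {}h : (y + (om R m)^-1 * (x + x') / 2) ^+ 2 <= D ^+ 2.
    rewrite -real_normK ?num_real// lerXn2r ?nnegrE//; first by rewrite /D; move: N1 rho0 => ? ?; rewrite mulr_ge0//; lra.
    have -> : y + (om R m)^-1 * (x + x') / 2 = (2 * y + (om R m)^-1 * (x + x')) / 2 by field; rewrite gt_eqF.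
    by rewrite normrM [X in _ * X]ger0_norm// /D; move: h; lra.
  have -> : (om R m ^+ 2)^-1 = (om R m)^-1 ^+ 2 by rewrite exprVn.
  move: h; set v := (om R m)^-1 => h.
  have q1 := sqr_ge0 (v * x - v * x').
  have q2 := sqr_ge0 ((y + v * (x + x') / 2) + v * (x + x') / 2).
  lra.
apply: (@le_trans _ _ (\sum_(c : cells m) ((om R m ^+ 2)^-1 * (X true (cnat c) ^+ 2 + X false (cnat c) ^+ 2) + 2 * (14 * N * rho) ^+ 2))).
  by apply: ler_sum => c _.
rewrite big_split/= -mulr_sumr big_split/=.
have -> : \sum_(c : cells m) 2 * (14 * N * rho) ^+ 2 = 2 * N ^+ 2 * (14 * N * rho) ^+ 2.
  rewrite -[in RHS]card_cells big_distrr/= mulr_suml; by apply: eq_bigr => c _; rewrite mulr1.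
apply: lerD => //; rewrite -mulrA mulrCA; apply: ler_wpM2l; first by rewrite invr_ge0 exprn_ge0// ltW.
by have := S true; have := S false; lra.
Qed.

End Profile.
End OneSolution.
End Mixing.

(** * Choice of the layer and of the amplitude *)

Section MixingTime.
Variable R : realType.
Variable m : nat.
Hypothesis m0 : (0 < m)%N.
Variables (a0 a1 La B : R).
Hypotheses (a00 : 0 < a0) (B0 : 0 <= B).
Variable n : nat.
Hypothesis HN : (2 * B + 1) * (2 + 2 * (La + 2 * Cgrad a0 La B)) <= a0 / 2 * n.+2%:R.

Lemma mixed_flow (e dd V0 rho : R) (b : bool -> bool) : 0 < e -> 0 < dd -> 0 <= V0 -> 0 < rho ->
  exists A0, 0 <= A0 /\ forall A (a : R -> R) P T1 s t c, A0 <= A -> 0 < A -> diffusion a0 a1 La a -> solution B a (vel m A) P ->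
    0 < T1 -> T1 <= s -> s < t -> t - s = dd -> drop B P n T1 s t <= V0 ->
    `|avg m P T1 s t c (fun z => gam e (psi m z) * LW m b z)| <= rho.
Proof.
move=> e0 dd0 V00 rho0; have w0 := om_gt0 R m0; have p0 : 0 < pi :> R := pi_gt0 R.
have bg := bl_gam_psi m0 e0.
have [F [L [F0 L0 tf]]] := test_fun_psi m0 b (der_gam e0) bg.
set K := 2 * B * F + 2 * L * a1 ^+ 2 * dd + (L + 2 * F + 1) * V0.
have K0 : 0 <= K.
  apply: addr_ge0; last by rewrite mulr_ge0// !addr_ge0// mulr_ge0.
  apply: addr_ge0; first by rewrite !mulr_ge0.
  by apply: mulr_ge0 (ltW dd0); apply: mulr_ge0 (sqr_ge0 a1); rewrite mulr_ge0.
pose k := 2 * pi * om R m; have k0 : 0 < k by apply: mulr_gt0 w0; exact: mulr_gt0.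
exists (K / (k * rho)); split; first by rewrite divr_ge0// ltW// mulr_gt0.
move=> A a P T1 s t c AA A0 Ha HP T10 T1s st dE dV.
have bgl : bl (fun z => gam e (psi m z) * LW m b z) by exact: bl_mul bg (bl_LW R m0 b).
have bW : bl (fun z => k * (gam e (psi m z) * LW m b z)) by exact: bl_scale.
have [[cfi _] _ fF _ _] := tf 0.
have := cell_mixed m0 Ha HP T10 HN T1s st c A0 F0 L0 dV (bl_mul bg (bl_wt R m0 b)) fF tf bW.
rewrite (avgZ HP s t T10 c k bgl) normrM (gtr0_norm k0) dE -/K => h.
rewrite -(ler_pM2l k0); apply: le_trans h _.
by rewrite ler_pdivrMr// mulrC -ler_pdivrMr// mulr_gt0.
Qed.

Lemma edge_flow (e dd V0 rho lam eta A : R) (a : R -> R) P T1 s t c i : 0 < e -> 0 < lam -> edge m e <= eta ->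
  lam / 2 * (2 / a0 * V0) + dd / (2 * lam) * eta <= rho ->
  diffusion a0 a1 La a -> solution B a (vel m A) P ->
  0 < T1 -> T1 <= s -> s < t -> t - s = dd -> drop B P n T1 s t <= V0 ->
  `|avg m P T1 s t c (edge1 m e i)| <= rho.
Proof.
move=> e0 lam0 ed le_rho Ha HP T10 T1s st dE dV.
have dd0 : 0 < dd by rewrite -dE subr_gt0.
have bH := bl_edgef m0 e0 i; have bh := bl_edge1 m0 e0 i; have pH := @per_edgef R m e i.
have bound (X : R) : X <= lam / 2 * (2 / a0 * drop B P n T1 s t) + dd / (2 * lam) * I (fun z => edgef m e i z ^+ 2) -> X <= rho.
  move=> hX; apply: le_trans hX _; apply: le_trans le_rho; apply: lerD.
    by apply: ler_wpM2l; [rewrite divr_ge0// ltW|apply: ler_wpM2l; rewrite ?divr_ge0 ?(ltW a00)].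
  apply: ler_wpM2l; first by rewrite divr_ge0 ?mulr_ge0 ?(ltW lam0)// ltW.
  exact: le_trans (I_edgef m0 e0 i) ed.
rewrite -dE in bound.
have h1 := bound _ (cell_dual m0 Ha HP T10 HN T1s st c lam0 bH pH (bl_cont bh) (dlim_edge m0 e0 i)).
have bH' := bl_scale (-1) bH.
have pH' : per (fun z => -1 * edgef m e i z) by move=> j z; rewrite pH.
have dl' z := dlim_scale (-1) (dlim_edge m0 e0 i z).
have D2 := cell_dual m0 Ha HP T10 HN T1s st c lam0 bH' pH' (bl_cont (bl_scale (-1) bh)) dl'.
rewrite (@eq_I _ (fun z => (-1 * edgef m e i z) ^+ 2) (fun z => edgef m e i z ^+ 2)) in D2; last by move=> z; rewrite mulN1r sqrrN.
have h2 := bound _ D2; rewrite (avgZ HP s t T10 c (-1) bh) mulN1r in h2.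
by rewrite ler_norml; apply/andP; split; [move: h2; rewrite lerNl|exact: h1].
Qed.

(** First [rho] is fixed from [del] and the number of cells, then the layer parameter [e = d^2] from
    [rho], and last the amplitude, because the relations at fixed [e] hold up to [O(1/A)]. *)
Lemma mixing (dd V0 del : R) : 0 < dd -> 0 <= V0 -> 0 < del ->
  exists A, 0 < A /\ forall (a : R -> R) P T1 s t, diffusion a0 a1 La a -> solution B a (vel m A) P ->
    0 < T1 -> T1 <= s -> s < t -> t - s = dd -> drop B P n T1 s t <= V0 ->
    exists kap, \sum_(c : cells m) (avg m P T1 s t (cnat c) (psi m) - kap) ^+ 2
      <= 2 / om R m ^+ 2 * (dd * len R m ^+ 2 * (2 / a0 * drop B P n T1 s t)) + del.
Proof.
move=> dd0 V00 del0; have w0 := om_gt0 R m0.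
pose N : R := (2 * m)%:R; have N0 : 0 < N by rewrite ltr0n muln_gt0.
pose Cn : R := 2 * N ^+ 2 * (14 * N) ^+ 2; have Cn0 : 0 < Cn by rewrite mulr_gt0 ?mulr_gt0 ?exprn_gt0 ?mulr_gt0.
pose rho := Num.min 1 (del / Cn); have rho0 : 0 < rho by rewrite lt_min ltr01 divr_gt0.
have rho1 : rho <= 1 by rewrite ge_min lexx.
have rhoC : Cn * rho <= del by rewrite mulrC -ler_pdivlMr// ge_min lexx orbT.
pose E0 := 2 / a0 * V0; have E00 : 0 <= E0 by rewrite mulr_ge0 ?divr_ge0 ?(ltW a00).
(* [lam], and [eta] below, each contribute at most [om * rho / 4] to the duality estimate, whose
   target is [om * rho / 2]. *)
pose lam := om R m * rho / (2 * (E0 + 1)).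
have E1 : 0 < E0 + 1 by lra.
have lam0 : 0 < lam by apply: divr_gt0; exact: mulr_gt0.
pose eta := rho * om R m * lam / (2 * dd).
have eta0 : 0 < eta by apply: divr_gt0; last exact: mulr_gt0; apply: mulr_gt0 => //; exact: mulr_gt0.
have [ee ee0 He] := edge_small eta0.
pose d := Num.min (rho / (6 * (B + 1) * dd)) (Num.min 1 ee).
have B1 : 0 < B + 1 by rewrite ltr_wpDl.
have d0 : 0 < d by rewrite !lt_min ltr01 ee0 divr_gt0 ?mulr_gt0.
have d1 : d <= 1 by rewrite !ge_min lexx orbT.
have dee : d <= ee by rewrite !ge_min lexx !orbT.
have drho : d * (6 * (B + 1) * dd) <= rho by rewrite -ler_pdivlMr ?mulr_gt0// ge_min lexx.
pose e := d ^+ 2; have e0 : 0 < e by rewrite exprn_gt0.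
have eee : e <= ee by apply: le_trans dee; rewrite /e expr2 ler_piMr// ltW.
have edg := He m e m0 e0 eee.
have [A1 [A10 M1]] := mixed_flow (fun=> true) e0 dd0 V00 rho0.
have [A2 [A20 M2]] := mixed_flow (fun j => j == false) e0 dd0 V00 rho0.
have [A3 [A30 M3]] := mixed_flow (fun j => j == true) e0 dd0 V00 rho0.
exists (A1 + A2 + A3 + 1); have Ap : 0 < A1 + A2 + A3 + 1 by lra.
split=> // a P T1 s t Ha HP T10 T1s st dE dV.
have bg := bl_gam_psi m0 e0.
have bgl b : bl (fun z : R * R => gam e (psi m z) * LW m b z) by exact: bl_mul bg (bl_LW R m0 b).
have AA1 : A1 <= A1 + A2 + A3 + 1 by lra.
have AA2 : A2 <= A1 + A2 + A3 + 1 by lra.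
have AA3 : A3 <= A1 + A2 + A3 + 1 by lra.
have gs j z := @gam_sn R m e j z.
have [||c i|c|c i|kap Hk] := avg_spread m0 HN Ha HP T10 T1s st e0 (ltW d0) (erefl : d ^+ 2 = e) (rho := rho).
- exact: ltW.
- by rewrite dE; move: drho (mulr_gt0 d0 dd0); lra.
(* A single cosine, in one coordinate or in the other, equalises the two opposite edges of the
   cell. *)
- case: i.
    have h := M2 _ a P T1 s t c AA2 Ap Ha HP T10 T1s st dE dV.
    rewrite (@eq_avg R m P T1 s t c _ (fun z => -1 * (gam e (psi m z) * LW m (fun j => j == false) z))).
      by rewrite (avgZ HP s t T10 c (-1) (bgl _)) mulN1r normrN.
    by move=> z; have := gs false z; rewrite /dens /LW /= /cc => k; rewrite -k; ring.
  have h := M3 _ a P T1 s t c AA3 Ap Ha HP T10 T1s st dE dV.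
  rewrite (@eq_avg R m P T1 s t c _ (fun z => gam e (psi m z) * LW m (fun j => j == true) z))//.
  by move=> z; have := gs true z; rewrite /dens /LW /= /cc => k; rewrite -k; ring.
(* The product of both cosines compares the two directions, since [sn^2 x cs^2 y - sn^2 y cs^2 x =
   sn^2 x - sn^2 y]. *)
- have h := M1 _ a P T1 s t c AA1 Ap Ha HP T10 T1s st dE dV.
  have bd i : bl (dens m e i) by exact: bl_dens.
  rewrite distrC -[avg _ _ _ _ _ _ (dens m e true)]mul1r -[X in X - _]mul1r.
  rewrite (_ : 1 * _ - 1 * _ = avg m P T1 s t c (fun z => gam e (psi m z) * LW m (fun=> true) z))//.
  have -> : 1 * avg m P T1 s t c (dens m e false) - 1 * avg m P T1 s t c (dens m e true)
    = avg m P T1 s t c (dens m e false) + avg m P T1 s t c (fun z => -1 * dens m e true z).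
    by rewrite (avgZ HP s t T10 c (-1) (bd true)); ring.
  rewrite -(avgD HP s t T10 c (bd false) (bl_scale (-1) (bd true))); apply: eq_avg => z.
  have k1 := gs false z; have k2 := gs true z; rewrite /dens /= -k1 -k2 /LW /cc /=.
  have := sn_cs m z.1; have := sn_cs m z.2; move: (gam _ _) (cs m z.1) (cs m z.2) (sn m z.1) (sn m z.2) => g x1 x2 y1 y2 e1 e2.
  rewrite (_ : g * (y1 ^+ 2 * x2 * x2 - y2 ^+ 2 * x1 * x1) = g * (y1 ^+ 2 * x2 ^+ 2 - y2 ^+ 2 * x1 ^+ 2)); last by ring.
  by rewrite e1 e2; ring.
- have bnd : lam / 2 * (2 / a0 * V0) + dd / (2 * lam) * eta <= om R m / 2 * rho.
    have -> : dd / (2 * lam) * eta = om R m * rho / 4 by rewrite /eta; field; rewrite !gt_eqF.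
    have : lam * E0 <= om R m * rho / 2.
      rewrite /lam mulrAC ler_pdivrMr; last by rewrite mulr_gt0.
      have : 0 < om R m * rho by rewrite mulr_gt0.
      lra.
    by rewrite /E0; lra.
  exact: (edge_flow c i e0 lam0 edg bnd Ha HP T10 T1s st dE dV).
exists kap; apply: le_trans Hk _; rewrite dE lerD2l.
apply: le_trans rhoC; rewrite /Cn -/N.
have -> : 2 * N ^+ 2 * (14 * N * rho) ^+ 2 = 2 * N ^+ 2 * (14 * N) ^+ 2 * (rho * rho) by ring.
by apply: ler_wpM2l; [exact: ltW|rewrite ler_piMr// ltW].
Qed.

End MixingTime.

(** * A Poincare inequality and the decay of the variance *)

Section Fubini.
Variable R : realType.

Lemma J_swap (g : R -> R -> R) : continuous (fun u : R * R => g u.1 u.2) ->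
  J 0 1 (fun x => J 0 1 (g x)) = J 0 1 (fun y => J 0 1 (fun x => g x y)).
Proof. by move=> cg; exact: (JJ_swap (f := fun u => g u.1 u.2) ler01 ler01 cg). Qed.

(** Continuity is stated along arbitrary continuous coordinates, because each exchange of two
    integrals nests the four real variables in a different order. *)
Lemma I_swap (F : R * R -> R * R -> R) :
  (forall (T : topologicalType) (a b c d : T -> R), continuous a -> continuous b -> continuous c -> continuous d ->
    continuous (fun u => F (a u, b u) (c u, d u))) ->
  I (fun w => I (F w)) = I (fun z => I (fun w => F w z)).
Proof.
move=> cF; rewrite /I /JJ.
have c1 (T : topologicalType) : continuous (fun u : T * R => u.1) by move=> u; exact: cvg_fst.
have c2 (T : topologicalType) : continuous (fun u : T * R => u.2) by move=> u; exact: cvg_snd.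
have cf := @cont_fst R; have cs := @cont_snd R.
have K (T U : topologicalType) (g : T -> U) (h : U -> R) : continuous g -> continuous h -> continuous (fun u => h (g u)).
  exact: cont_comp.
have cc (T : topologicalType) (k : R) : continuous (fun _ : T => k) by exact: cont_cst.
have p1 : continuous (fun u : R * R * R => u.1.1) := K _ _ _ _ (c1 _) cf.
have p2 : continuous (fun u : R * R * R => u.1.2) := K _ _ _ _ (c1 _) cs.
have p3 : continuous (fun u : R * R * R => u.2) := c2 _.
have q1 : continuous (fun u : R * R * R * R => u.1.1.1) := K _ _ _ _ (c1 _) p1.
have q2 : continuous (fun u : R * R * R * R => u.1.1.2) := K _ _ _ _ (c1 _) p2.
have q3 : continuous (fun u : R * R * R * R => u.1.2) := K _ _ _ _ (c1 _) p3.
have q4 : continuous (fun u : R * R * R * R => u.2) := c2 _.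
transitivity (J 0 1 (fun a => J 0 1 (fun c => J 0 1 (fun b => J 0 1 (fun d => F (a, b) (c, d)))))).
  apply: eq_J => a _; apply: (J_swap (g := fun b c => J 0 1 (fun d => F (a, b) (c, d)))).
  apply: (@cont_J R (R * R)%type (fun u => F (a, u.1.1) (u.1.2, u.2)) 0 1 ler01).
  exact: cF (cc _ a) p1 p2 p3.
transitivity (J 0 1 (fun a => J 0 1 (fun c => J 0 1 (fun d => J 0 1 (fun b => F (a, b) (c, d)))))).
  apply: eq_J => a _; apply: eq_J => c _; apply: (J_swap (g := fun b d => F (a, b) (c, d))).
  exact: cF (cc _ a) cf (cc _ c) cs.
transitivity (J 0 1 (fun c => J 0 1 (fun a => J 0 1 (fun d => J 0 1 (fun b => F (a, b) (c, d)))))).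
  apply: (J_swap (g := fun a c => J 0 1 (fun d => J 0 1 (fun b => F (a, b) (c, d))))).
  apply: (@cont_J R (R * R)%type (fun u => J 0 1 (fun b => F (u.1.1, b) (u.1.2, u.2))) 0 1 ler01).
  apply: (@cont_J R (R * R * R)%type (fun u => F (u.1.1.1, u.2) (u.1.1.2, u.1.2)) 0 1 ler01).
  exact: cF q1 q4 q2 q3.
apply: eq_J => c _; apply: (J_swap (g := fun a d => J 0 1 (fun b => F (a, b) (c, d)))).
apply: (@cont_J R (R * R)%type (fun u => F (u.1.1, u.2) (c, u.1.2)) 0 1 ler01).
exact: cF p1 p3 (cc _ c) p2.
Qed.

Definition shw (w z : R * R) := sh true w.1 (sh false w.2 z).

Lemma shwC w z : shw w z = shw z w.
Proof. by rewrite /shw /sh/= addrC [z.2 + _]addrC. Qed.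

Lemma I_shw (w : R * R) (f : R * R -> R) : continuous f -> per f -> I (fun z => f (shw w z)) = I f.
Proof.
move=> cf pf; rewrite /shw (@I_sh R (fun z => f (sh true w.1 z)) false)//; last exact: per_sh.
  exact: I_sh.
exact: cont_fsh.
Qed.

Lemma I_conv (p q : R * R -> R) : continuous p -> continuous q -> per q ->
  I (fun w => I (fun z => p z * q (shw w z))) = I p * I q.
Proof.
move=> cp cq pq; rewrite (@I_swap (fun w z => p z * q (shw w z))).
  transitivity (I (fun z => I q * p z)); last by rewrite IZ// mulrC.
  apply: eq_I => z; rewrite [RHS]mulrC -(I_shw z cq pq) -IZ; last first.
    by apply: cont_comp cq; rewrite /shw; apply: cont_comp; exact: cont_sh.
  by apply: eq_I => w; rewrite shwC.
move=> T a b c d ca cb cc cd; apply: cont_mul.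
  by apply: (cont_comp (g := fun u => (c u, d u))) cp; exact: cont_mk.
apply: (cont_comp (g := fun u => (c u + a u, d u + b u))) cq; apply: cont_mk; exact: cont_add.
Qed.

Lemma cont_conv (p q : R * R -> R) : continuous p -> continuous q ->
  continuous (fun w : R * R => I (fun z => p z * q (shw w z))).
Proof.
move=> cp cq; rewrite /I /JJ.
apply: (@cont_J R (R * R)%type (fun u => J 0 1 (fun d => p (u.2, d) * q (shw u.1 (u.2, d)))) 0 1 ler01).
apply: (@cont_J R (R * R * R)%type (fun u => p (u.1.2, u.2) * q (shw u.1.1 (u.1.2, u.2))) 0 1 ler01).
have c1 (T U : topologicalType) : continuous (fun u : T * U => u.1) by move=> u; exact: cvg_fst.
have c2 (T U : topologicalType) : continuous (fun u : T * U => u.2) by move=> u; exact: cvg_snd.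
have k2 : continuous (fun u : R * R * R * R => u.1.2) := cont_comp (c1 _ _) (c2 _ _).
have k1 : continuous (fun u : R * R * R * R => u.1.1) := cont_comp (c1 _ _) (c1 _ _).
have k11 := cont_comp k1 (@cont_fst R); have k12 := cont_comp k1 (@cont_snd R).
have k3 : continuous (fun u : R * R * R * R => u.2) := c2 _ _.
apply: cont_mul.
  by apply: (cont_comp (g := fun u : R * R * R * R => (u.1.2, u.2))) cp; exact: cont_mk.
apply: (cont_comp (g := fun u : R * R * R * R => (u.1.2 + u.1.1.1, u.2 + u.1.1.2))) cq; apply: cont_mk; exact: cont_add.
Qed.

End Fubini.

(** * A cellwise Poincare inequality *)

Section Poincare.
Variable R : realType.
Variable m : nat.
Hypothesis m0 : (0 < m)%N.
Let l : R := len R m.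
Implicit Types (x w y : R).

Lemma sig_on (w x : R) : sig w x = 1 -> x <= base x + w.
Proof. by rewrite /sig; case: (x <= _) => // /eqP; rewrite eq_sym oner_eq0. Qed.

(** If both bumps are nonzero, [y] is within [len] of an integer. With angles scaled by [om], [cos y
    = cos x cos (x + y) + sin x sin (x + y)], and [cos (2 x + y) >= -1] then gives
    [sin x sin (x + y) <= (1 + cos y) / 2]. *)
Lemma bump_hat x y : bump m x * bump m (x + y) <= hat m y.
Proof.
have l0 := len_gt0 R m0; have /andP[h0 h1] := hat01 m y.
have [s0|s1] := sig01 l x; first by rewrite /bump s0 !mul0r.
have [s0|s2] := sig01 l (x + y); first by rewrite [X in _ * X]/bump s0 mul0r mulr0.
rewrite /bump s1 s2 !mul1r /hat.
have [n hn] := base_int x; have [k hk] := base_int (x + y).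
have a1 := sig_on s1; have a2 := sig_on s2.
have := baseP x; have := baseP (x + y); rewrite hn in a1 *; rewrite hk in a2 *.
move=> /andP[b1 _] /andP[b2 _]; rewrite /l in a1 a2; rewrite /sig.
have l2 := @len_half R m m0.
rewrite (@base_uniq _ _ (k - n)); last by rewrite intrB; apply/andP; split; lra.
have hh : y + len R m <= (k - n)%:~R + 2 * len R m by rewrite intrB; lra.
rewrite hh mul1r.
have e1 : sn m (x + y) = sn m x * cs m y + cs m x * sn m y by rewrite /sn mulrDr sinD.
have e2 : cs m (x + y) = cs m x * cs m y - sn m x * sn m y by rewrite /cs mulrDr cosD.
have c1 := sn_cs m x.
have := cs_le1 m (x + (x + y)).
rewrite /cs mulrDr cosD -/(cs m x) -/(cs m (x + y)) -/(sn m x) -/(sn m (x + y)) ler_norml => /andP[k1 _].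
have e3 : cs m y = cs m x * cs m (x + y) + sn m x * sn m (x + y).
  rewrite e1 e2 (_ : _ + _ = (cs m x ^+ 2 + sn m x ^+ 2) * cs m y); last by ring.
  by rewrite c1; ring.
by rewrite -/(cs m y) e3; lra.
Qed.

(** The [m] translates of [hat] by multiples of two cell sides add up to [(1 + cs) / 2], which is at
    most 1. *)
Lemma J_hat : J 0 1 (hat m : R -> R) <= 2 * l.
Proof.
have l0 := len_gt0 R m0; have mR : 0 < m%:R :> R by rewrite ltr0n.
have ch : continuous (hat m : R -> R) by exact: lip_cont (hat_lip m0).
have l2 : 0 < 2 * len R m by rewrite mulr_gt0.
have ml : m%:R * (2 * len R m) = 1 by rewrite mulrCA mulrA -natrM cells_len.
have csN (i : nat) x : cs m (x - i%:R * (2 * len R m)) = cs m x.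
  elim: i => [|i IH]; first by rewrite mul0r subr0.
  rewrite -[RHS]IH -[in RHS](subrK (2 * len R m) (x - i%:R * _)) -natr1 mulrDl mul1r opprD addrA.
  set u := _ - _ - _; have -> : u + 2 * len R m = u + len R m + len R m by ring.
  by rewrite !cs_len// opprK.
have S x : \sum_(i < m) hat m (x - i%:R * (2 * len R m)) = (1 + cs m x) / 2.
  rewrite (eq_bigr (fun i : 'I_m => sig (2 * len R m) (x + len R m - i%:R * (2 * len R m)) * ((1 + cs m x) / 2))).
    by rewrite -mulr_suml sum_sig ?mul1r.
  by move=> i _; rewrite /hat csN addrAC.
have c (i : 'I_m) : continuous (fun x : R => hat m (x - i%:R * (2 * len R m))).
  by apply: (cont_comp (g := fun x : R => x - i%:R * (2 * len R m))) ch; ct.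
have e : m%:R * J 0 1 (hat m : R -> R) <= 1.
  have -> : m%:R * J 0 1 (hat m : R -> R) = \sum_(i < m) J 0 1 (fun x : R => hat m (x - i%:R * (2 * len R m))).
    rewrite (eq_bigr (fun=> J 0 1 (hat m : R -> R))); first by rewrite sumr_const card_ord mulr_natl.
    by move=> i _; rewrite (J_per (g := hat m))// => x; exact: hat_per.
  rewrite -(J_sum _ _ _ c) -[leRHS](_ : J 0 1 (fun=> 1 : R) = 1); last by rewrite J_cst ?subr0 ?mulr1.
  apply: J_le => [||x _]; [|exact: cont_cst|].
    have -> : (fun u : R => \sum_(i < m) hat m (u - i%:R * (2 * len R m))) = (fun u => (1 + cs m u) / 2) by apply/funext.
    by have cc : continuous (cs m : R -> R) := lip_cont (cs_lip m0); ct.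
  by rewrite S; have := cs_le1 m x; rewrite ler_norml => /andP[_]; lra.
by rewrite -(ler_pM2l mR); apply: le_trans e _; rewrite ml.
Qed.

Definition Psi (z : R * R) := \sum_(c : cells m) psi m (cellm m (cnat c) z).

Lemma psi_supp : supp m (psi m : R * R -> R).
Proof.
move=> z h; rewrite /psi /bump (_ : _ * _ = sig (len R m) z.1 * sig (len R m) z.2 * (sn m z.1 * sn m z.2)); last by ring.
by rewrite h mul0r.
Qed.

Lemma sn_abs_cell (i : nat) x : `|sn m (x - i%:R * l)| = `|sn m x|.
Proof.
elim: i => [|i IH]; first by rewrite mul0r subr0.
rewrite -IH -[in RHS](subrK l (x - i%:R * l)) -natr1 mulrDl mul1r opprD addrA.
by rewrite sn_len// normrN.
Qed.

Lemma PsiE z : Psi z = `|sn m z.1| * `|sn m z.2|.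
Proof.
have [c0 h] := cell_pick m0 z.
have hc : sig l (cellm m (cnat c0) z).1 * sig l (cellm m (cnat c0) z).2 = 1 by rewrite h eqxx.
rewrite /Psi (bigD1 c0)//= big1 ?addr0; last by move=> c ne; rewrite psi_supp// h (negbTE ne).
have /andP[p0 _] := psi01 m0 (cellm m (cnat c0) z); rewrite -(ger0_norm p0).
rewrite -(sn_abs_cell c0.1 z.1) -(sn_abs_cell c0.2 z.2) -normrM; congr `|_|.
rewrite /psi /bump mulrACA hc mul1r; congr (sn _ _ * sn _ _).
Qed.

(** A shift by half a cell exchanges sine and cosine, so the four terms factor into [|sin| + |cos|]
    in each coordinate, and each factor is at least 1. *)
Lemma Psi_cover z : 1 <= Psi z + Psi (sh true (l / 2) z) + (Psi (sh false (l / 2) z) + Psi (sh true (l / 2) (sh false (l / 2) z))).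
Proof.
have sc x : sn m (x + l / 2) = cs m x.
  by rewrite /sn mulrDr /l mulrA om_len// sinDpihalf.
rewrite !PsiE /sh /= !sc.
rewrite (_ : _ + _ + _ = (`|sn m z.1| + `|cs m z.1|) * (`|sn m z.2| + `|cs m z.2|)); last by ring.
have H x : 1 <= `|sn m x| + `|cs m x|.
  have e := sn_cs m x; have a1 := sn_le1 m x; have a2 := cs_le1 m x.
  have b1 : `|sn m x| ^+ 2 <= `|sn m x| by rewrite expr2 ler_piMl.
  have b2 : `|cs m x| ^+ 2 <= `|cs m x| by rewrite expr2 ler_piMl.
  by move: b1 b2; rewrite !real_normK ?num_real//; lra.
by rewrite -[leLHS]mulr1; apply: ler_pM.
Qed.

Lemma bl_Psi : bl Psi.
Proof. by apply: (@bl_sum R (cells m) _ (fun c z => psi m (cellm m (cnat c) z))) => c; apply: bl_cellm; exact: bl_psi. Qed.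

Lemma per_Psi : per Psi.
Proof. by move=> i z; apply: eq_bigr => c _; rewrite (per_cellm m (cnat c) (@per_psi R m)). Qed.

Lemma Psi01 z : 0 <= Psi z <= 1.
Proof. by rewrite PsiE mulr_ge0//= mulr_ile1// sn_le1. Qed.

Definition mass : R := I (psi m : R * R -> R).

Lemma I_Psi (f : R * R -> R) : continuous f -> per f ->
  I (fun z => Psi z * f z) = \sum_(c : cells m) I (fun z => psi m z * f (cell m (cnat c) z)).
Proof.
move=> cf pf; have cp c : continuous (fun z => psi m (cellm m c z) * f z).
  by have h := bl_cont (bl_cellm m c (bl_psi R m0)); ct.
rewrite (@eq_I _ _ (fun z => \sum_(c : cells m) psi m (cellm m (cnat c) z) * f z)); last by move=> z; rewrite mulr_suml.
rewrite (@I_sum R (cells m) _ (fun c z => psi m (cellm m (cnat c) z) * f z))//.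
apply: eq_bigr => c _; rewrite -(@cell_I R m (cnat c) (fun z => psi m (cellm m (cnat c) z) * f z))//.
  by apply: eq_I => z; rewrite cellmK.
exact: perM (per_cellm m (cnat c) (@per_psi R m)) pf.
Qed.

(** [I Psi] is the mass times the number of cells, and by [Psi_cover] it is at least [1 / 4]. *)
Lemma mass_lb : l ^+ 2 / 4 <= mass.
Proof.
have cP := bl_cont bl_Psi; have pP := per_Psi.
have N0 : 0 < (2 * m)%:R :> R by rewrite ltr0n muln_gt0.
have e1 : I Psi = (2 * m)%:R ^+ 2 * mass.
  rewrite (@eq_I _ _ (fun z => Psi z * 1)); last by move=> z; rewrite mulr1.
  rewrite I_Psi //; last exact: cont_cst.
  rewrite (eq_bigr (fun=> 1 * mass)); first by rewrite -mulr_suml card_cells.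
  by move=> c _; rewrite mul1r; apply: eq_I => z; rewrite mulr1.
have h : 1 <= 4 * I Psi.
  rewrite -[leLHS](@I_cst R).
  have -> : 4 * I Psi = I (fun z => Psi z + Psi (sh true (l / 2) z) + (Psi (sh false (l / 2) z) + Psi (sh true (l / 2) (sh false (l / 2) z)))).
    have s1 := cont_fsh (i := true) (r := l / 2) cP; have s2 := cont_fsh (i := false) (r := l / 2) cP.
    have s3 := cont_fsh (i := false) (r := l / 2) s1.
    rewrite !ID; [|by ct..]; rewrite !I_sh//.
      by rewrite (@I_sh R (fun z => Psi (sh true (l / 2) z)) false) ?I_sh//; [ring|exact: per_sh].
  apply: I_le => [||z]; [exact: cont_cst| |exact: Psi_cover].
  have s1 := cont_fsh (i := true) (r := l / 2) cP; have s2 := cont_fsh (i := false) (r := l / 2) cP.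
  by have s3 := cont_fsh (i := false) (r := l / 2) s1; ct.
rewrite e1 in h; have := ler_wpM2l (sqr_ge0 l) h.
rewrite (_ : l ^+ 2 * (4 * ((2 * m)%:R ^+ 2 * mass)) = 4 * ((2 * m)%:R * l) ^+ 2 * mass); last by ring.
by rewrite cells_len//; lra.
Qed.

Section Function.
Variables (f : R * R -> R) (Q : R).
Hypotheses (cf : continuous f) (pf : per f) (Q0 : 0 <= Q).
Hypothesis fQ : forall i r, I (fun z => (f (sh i r z) - f z) ^+ 2) <= r ^+ 2 * Q.

Lemma shw_osc w1 w2 : I (fun z => (f (shw (w1, w2) z) - f z) ^+ 2) <= 2 * w1 ^+ 2 * Q + 2 * w2 ^+ 2 * Q.
Proof.
have c1 := cont_fsh (i := true) (r := w1) cf; have c2 := cont_fsh (i := false) (r := w2) cf.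
have c3 := cont_fsh (i := false) (r := w2) c1.
apply: (@le_trans _ _ (I (fun z => 2 * (f (sh true w1 (sh false w2 z)) - f (sh false w2 z)) ^+ 2 + 2 * (f (sh false w2 z) - f z) ^+ 2))).
  apply: I_le => [||z]; [by rewrite /shw/=; ct|by ct|].
  have key (x y b : R) : (x - b) ^+ 2 <= 2 * (x - y) ^+ 2 + 2 * (y - b) ^+ 2.
    by have := sqr_ge0 (x - y - (y - b)); lra.
  exact: key.
rewrite ID; [|by ct..]; rewrite !IZ; [|by ct..].
rewrite (@I_sh R (fun z => (f (sh true w1 z) - f z) ^+ 2) false); [|by ct|by move=> i z; rewrite shC !pf].
have h1 := fQ true w1; have h2 := fQ false w2.
by move: h1 h2; lra.
Qed.

Definition cobs c := I (fun z => f (cell m c z) * psi m z).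
(** [mass^2] times the variance of [f] in cell [c] for the probability density [psi / mass]. *)
Definition cvar c := mass * I (fun z => psi m z * f (cell m c z) ^+ 2) - cobs c ^+ 2.

Let cpsi := bl_cont (bl_psi R m0).
Let cfc c : continuous (fun z => f (cell m c z)).
Proof. exact: (cont_comp (@cont_cell R m c) cf). Qed.
Let pfc c : per (fun z => f (cell m c z)).
Proof. by move=> i z; rewrite /cell !(shC _ i) pf. Qed.
Let cshw (w : R * R) : continuous (shw w).
Proof. by rewrite /shw; apply: cont_comp; exact: cont_sh. Qed.

Let shw_cell c (w z : R * R) : shw w (cell m c z) = cell m c (shw w z).
Proof. by rewrite /shw /cell /sh /=; congr (_, _); ring. Qed.

Definition corr c (w : R * R) := I (fun z => psi m z * psi m (shw w z) * (f (cell m c (shw w z)) - f (cell m c z)) ^+ 2).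

(** A variance is half the double integral of squared differences; with the second point written as
    a translate by [w] and [w] integrated last, the inner integral is [corr]. *)
Lemma corrP c : continuous (corr c) /\ cvar c = 1 / 2 * I (corr c).
Proof.
have cg := @cfc c; set g := fun z => f (cell m c z) in cg.
have pg : per g := pfc c.
pose p1 z := psi m z * g z; pose p2 z := psi m z * g z ^+ 2.
have cp1 : continuous p1 by rewrite /p1; ct.
have cp2 : continuous p2 by rewrite /p2; ct.
have pp : per (psi m : R * R -> R) := @per_psi R m.
have pp1 : per p1 by exact: perM pp pg.
have pp2 : per p2 by move=> i z; rewrite /p2 pp pg.
have e (w : R * R) : corr c w = I (fun z => psi m z * p2 (shw w z)) + I (fun z => p2 z * psi m (shw w z)) - 2 * I (fun z => p1 z * p1 (shw w z)).
  have k1 := cont_comp (@cshw w) cpsi; have k2 := cont_comp (@cshw w) cp1; have k3 := cont_comp (@cshw w) cp2.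
  rewrite -ID; [|by ct..]; rewrite -IZ; [|by ct]; rewrite -IB; [|by ct..].
  by apply: eq_I => z; rewrite /p1 /p2 /g; ring.
have m1 := cont_conv cpsi cp2; have m2 := cont_conv cp2 cpsi; have m3 := cont_conv cp1 cp1.
split.
  by rewrite (_ : corr c = fun w : R * R => I (fun z => psi m z * p2 (shw w z)) + I (fun z => p2 z * psi m (shw w z)) - 2 * I (fun z => p1 z * p1 (shw w z))); [ct|apply/funext].
rewrite (eq_I e) IB; [|by ct..]; rewrite ID//; rewrite IZ//; rewrite !I_conv// /cvar /mass.
have -> : cobs c = I p1 by apply: eq_I => z; rewrite mulrC.
rewrite -/p2; lra.
Qed.

(** On the support of the hats each coordinate of [w] is within [len] of an integer, and integer
    translations leave [f] unchanged. *)
Lemma hat_osc (w : R * R) : hat m w.1 * hat m w.2 * I (fun z => (f (shw w z) - f z) ^+ 2) <= hat m w.1 * hat m w.2 * (4 * l ^+ 2 * Q).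
Proof.
have /andP[a0 _] := hat01 m w.1; have /andP[b0 _] := hat01 m w.2.
have near x : hat m x != 0 -> exists n : int, (x - n%:~R) ^+ 2 <= l ^+ 2.
  rewrite /hat; case: (sig01 (2 * len R m) (x + len R m)) => [->|h _]; first by rewrite mul0r eqxx.
  have [n hn] := base_int (x + len R m); have := baseP (x + len R m); have h1 := sig_on h; rewrite hn in h1 *.
  move=> /andP[h2 _].
  exists n; rewrite -real_normK ?num_real// lerXn2r ?nnegrE//; first exact: ltW (len_gt0 R m0).
  by rewrite ler_norml /l; apply/andP; split; lra.
have [->|n1] := eqVneq (hat m w.1) 0; first by rewrite !mul0r.
have [->|n2] := eqVneq (hat m w.2) 0; first by rewrite mulr0 !mul0r.
have [k1 h1] := near _ n1; have [k2 h2] := near _ n2.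
apply: ler_wpM2l; first exact: mulr_ge0.
have e z : f (shw w z) = f (shw (w.1 - k1%:~R, w.2 - k2%:~R) z).
  transitivity (f (sh false k2%:~R (sh true k1%:~R (shw (w.1 - k1%:~R, w.2 - k2%:~R) z)))).
    by congr f; rewrite /shw /sh /=; congr (_, _); ring.
  by rewrite !per_int.
rewrite (@eq_I _ _ (fun z => (f (shw (w.1 - k1%:~R, w.2 - k2%:~R) z) - f z) ^+ 2)); last by move=> z; rewrite e.
apply: le_trans (shw_osc _ _) _.
by have := ler_wpM2r Q0 h1; have := ler_wpM2r Q0 h2; lra.
Qed.

Lemma sum_corr (w : R * R) : \sum_(c : cells m) corr (cnat c) w <= hat m w.1 * hat m w.2 * (4 * l ^+ 2 * Q).
Proof.
apply: le_trans (hat_osc w); have cw := cont_comp (@cshw w) cf.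
have cb c : continuous (fun z => psi m (cellm m c z) * psi m (shw w (cellm m c z)) * (f (shw w z) - f z) ^+ 2).
  have k1 := bl_cont (bl_cellm m c (bl_psi R m0)).
  have k2 : continuous (fun z => psi m (shw w (cellm m c z))).
    exact: cont_comp (@cont_cellm R m c) (cont_comp (@cshw w) cpsi).
  by ct.
have e (c : cells m) : corr (cnat c) w = I (fun z => psi m (cellm m (cnat c) z) * psi m (shw w (cellm m (cnat c) z)) * (f (shw w z) - f z) ^+ 2).
  rewrite -(@cell_I R m (cnat c) (fun z => psi m (cellm m (cnat c) z) * psi m (shw w (cellm m (cnat c) z)) * (f (shw w z) - f z) ^+ 2))//.
    by apply: eq_I => z; rewrite cellmK shw_cell.
  move=> i z; rewrite (per_cellm m (cnat c) (@per_psi R m) i z) /shw /cellm !(shC _ i) !pf.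
  by rewrite (@per_psi R m).
rewrite (eq_bigr _ (fun c _ => e c)).
rewrite -(@I_sum R (cells m) _ (fun c z => psi m (cellm m (cnat c) z) * psi m (shw w (cellm m (cnat c) z)) * (f (shw w z) - f z) ^+ 2))//.
rewrite -IZ; last by ct.
have cS (w' : seq (cells m)) : continuous (fun z => \sum_(c <- w') psi m (cellm m (cnat c) z) * psi m (shw w (cellm m (cnat c) z)) * (f (shw w z) - f z) ^+ 2).
  elim: w' => [|c w' IH]; first by under eq_fun do rewrite big_nil; exact: cont_cst.
  by under eq_fun do rewrite big_cons; apply: cont_add.
apply: I_le => [||z]; [exact: cS|by ct|].
rewrite -mulr_suml; apply: ler_wpM2r; first exact: sqr_ge0.
have [c0 ->] := @sum_cells R m m0 (psi m) z (fun c x => x * psi m (shw w (cellm m (cnat c) z))) psi_supp (fun c => mul0r _).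
rewrite /psi mulrACA; apply: ler_pM; last first.
- have := bump_hat (cellm m (cnat c0) z).2 w.2; by rewrite /shw /sh /=.
- have := bump_hat (cellm m (cnat c0) z).1 w.1; by rewrite /shw /sh /=.
- by apply: mulr_ge0; [case/andP: (bump01 m0 (cellm m (cnat c0) z).2)|case/andP: (bump01 m0 (shw w (cellm m (cnat c0) z)).2)].
- by apply: mulr_ge0; [case/andP: (bump01 m0 (cellm m (cnat c0) z).1)|case/andP: (bump01 m0 (shw w (cellm m (cnat c0) z)).1)].
Qed.

(** The constant is [1/2 * (4 l^2 Q) * (2 l)^2]: the oscillation over one cell times the square of
    the integral of [hat]. *)
Lemma sum_cvar : \sum_(c : cells m) cvar (cnat c) <= 8 * l ^+ 4 * Q.
Proof.
have l0 : 0 <= l by exact: ltW (len_gt0 R m0).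
have ch : continuous (hat m : R -> R) by exact: lip_cont (hat_lip m0).
have ch1 := cont_comp (@cont_fst R) ch; have ch2 := cont_comp (@cont_snd R) ch.
rewrite (eq_bigr _ (fun c _ => (corrP (cnat c)).2)) -mulr_sumr.
rewrite -(@I_sum R (cells m) _ (fun c => corr (cnat c))); last by move=> c; exact: (corrP (cnat c)).1.
have cS (w' : seq (cells m)) : continuous (fun z => \sum_(c <- w') corr (cnat c) z).
  elim: w' => [|c w' IH]; first by under eq_fun do rewrite big_nil; exact: cont_cst.
  by under eq_fun do rewrite big_cons; apply: cont_add => //; exact: (corrP (cnat c)).1.
have h1 : I (fun z => \sum_(c : cells m) corr (cnat c) z) <= I (fun w : R * R => (4 * l ^+ 2 * Q) * (hat m w.1 * hat m w.2)).
  apply: I_le => [||w]; [exact: cS|by ct|by rewrite mulrC; exact: sum_corr].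
have h2 : I (fun w : R * R => hat m w.1 * hat m w.2) = J 0 1 (hat m : R -> R) * J 0 1 (hat m : R -> R).
  rewrite /I /JJ -[RHS]JZ//; apply: eq_J => x _; rewrite /= [RHS]mulrC.
  by rewrite JZ.
rewrite IZ in h1; last by ct.
rewrite h2 in h1; have j0 : 0 <= J 0 1 (hat m : R -> R) by apply: J_ge0 => x _; case/andP: (hat01 m x).
have j2 : J 0 1 (hat m : R -> R) * J 0 1 (hat m : R -> R) <= 2 * l * (2 * l) by apply: ler_pM => //; exact: J_hat.
have q0 : 0 <= 4 * l ^+ 2 * Q by rewrite mulr_ge0// mulr_ge0// sqr_ge0.
have := ler_wpM2l q0 j2; move: h1; lra.
Qed.

Lemma Psi_shift (k t1 t2 : R) : I (fun z => Psi (shw (t1, t2) z) * (f z - k) ^+ 2)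
  <= 4 * (t1 ^+ 2 + t2 ^+ 2) * Q + 2 * I (fun z => Psi z * (f z - k) ^+ 2).
Proof.
have cP := bl_cont bl_Psi; have cw := cont_comp (@cshw (- t1, - t2)) cf.
have sK z : shw (- t1, - t2) (shw (t1, t2) z) = z by case: z => x y; rewrite /shw /sh /=; congr (_, _); ring.
have c1 : continuous (fun z => Psi z * (f (shw (- t1, - t2) z) - k) ^+ 2) by ct.
have -> : I (fun z => Psi (shw (t1, t2) z) * (f z - k) ^+ 2) = I (fun z => Psi z * (f (shw (- t1, - t2) z) - k) ^+ 2).
  rewrite -(I_shw (t1, t2) c1); first by apply: eq_I => z; rewrite sK.
  by move=> i z; rewrite per_Psi /shw !(shC _ i) pf.
have c2 : continuous (fun z => (f (shw (- t1, - t2) z) - f z) ^+ 2) by ct.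
apply: (@le_trans _ _ (I (fun z => 2 * (f (shw (- t1, - t2) z) - f z) ^+ 2 + 2 * (Psi z * (f z - k) ^+ 2)))).
  apply: I_le => [||z]; [exact: c1|by ct|].
  have /andP[p0 p1] := Psi01 z; set x := f (shw _ _); set P := Psi z in p0 p1 *.
  have h1 := sqr_ge0 (x - f z - (f z - k)); have h2 := sqr_ge0 (x - f z).
  have h3 := ler_wpM2r h2 p1; have := mulr_ge0 p0 h1; move: h3; lra.
rewrite ID; [|by ct..]; rewrite !IZ; [|by ct..].
by have := shw_osc (- t1) (- t2); rewrite !sqrrN; lra.
Qed.

(** The weight [Psi] degenerates on the cell edges, so four of its half-cell translates are used to
    cover the torus. The constant is [260 = 8 * 32 + 4]: the weighted estimate enters eight times,
    and moving the weights costs [4 l^2 Q]. *)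
Lemma poincare (k : R) : I (fun z => (f z - k) ^+ 2)
  <= 260 * l ^+ 2 * Q + 8 / mass * \sum_(c : cells m) (cobs (cnat c) - mass * k) ^+ 2.
Proof.
have l0 := len_gt0 R m0; have ll : 0 < l ^+ 2 by rewrite exprn_gt0.
have mlb := mass_lb; have m_gt0 : 0 < mass by apply: lt_le_trans mlb; rewrite divr_gt0.
have cP := bl_cont bl_Psi.
set G := I (fun z => Psi z * (f z - k) ^+ 2).
have hG : G <= 32 * l ^+ 2 * Q + 1 / mass * \sum_(c : cells m) (cobs (cnat c) - mass * k) ^+ 2.
  have eG : G = 1 / mass * \sum_(c : cells m) (cvar (cnat c) + (cobs (cnat c) - mass * k) ^+ 2).
    rewrite /G (@I_Psi (fun z => (f z - k) ^+ 2)); [|by ct|by move=> i z; rewrite pf].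
    rewrite mulr_sumr; apply: eq_bigr => c _; have cc := @cfc (cnat c).
    have -> : I (fun z => psi m z * (f (cell m (cnat c) z) - k) ^+ 2) =
       I (fun z => psi m z * f (cell m (cnat c) z) ^+ 2) + (k ^+ 2 * mass - 2 * k * cobs (cnat c)).
      rewrite /mass /cobs -!IZ; [|by ct..]; rewrite -IB; [|by ct..]; rewrite -ID; [|by ct..].
      by apply: eq_I => z; ring.
    by rewrite /cvar; field; rewrite gt_eqF.
  rewrite eG big_split/= mulrDr lerD2r.
  rewrite mul1r ler_pdivrMl//; apply: le_trans sum_cvar _.
  have := ler_wpM2r (mulr_ge0 (ltW ll) Q0) mlb; rewrite -/l; lra.
have cs t1 t2 : continuous (fun z => Psi (shw (t1, t2) z) * (f z - k) ^+ 2).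
  by have c := cont_comp (@cshw (t1, t2)) cP; ct.
have h : I (fun z => (f z - k) ^+ 2) <= I (fun z => Psi (shw (0, 0) z) * (f z - k) ^+ 2 + Psi (shw (l / 2, 0) z) * (f z - k) ^+ 2
   + (Psi (shw (0, l / 2) z) * (f z - k) ^+ 2 + Psi (shw (l / 2, l / 2) z) * (f z - k) ^+ 2)).
  have c1 := cs 0 0; have c2 := cs (l / 2) 0; have c3 := cs 0 (l / 2); have c4 := cs (l / 2) (l / 2).
  apply: I_le => [||z]; [by ct| |].
    by apply: cont_add; apply: cont_add.
  rewrite -!mulrDl -[leLHS]mul1r; apply: ler_wpM2r; first exact: sqr_ge0.
  by case: z => x y; have := Psi_cover (x, y); rewrite /shw /sh /= !addr0.
apply: le_trans h _; rewrite !ID; [|by try apply: cont_add..].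
have s1 := Psi_shift k 0 0; have s2 := Psi_shift k (l / 2) 0; have s3 := Psi_shift k 0 (l / 2); have s4 := Psi_shift k (l / 2) (l / 2).
move: hG; rewrite -/G; set Sg := \sum_(c : cells m) _ => hG.
have -> : 8 / mass * Sg = 8 * (1 / mass * Sg) by rewrite !mulrA mulr1.
move: s1 s2 s3 s4 hG; rewrite -/G.
move: (1 / mass * Sg) (I _) (I _) (I _) (I _) => S x1 x2 x3 x4.
by rewrite expr0n /=; lra.
Qed.

End Function.
End Poincare.

(** * A time at which all difference quotients are controlled *)

Section GoodTime.
Variable R : realType.
Implicit Types (s t r u : R).

(** The sets where [g n] is at most [(E + d) / (t - s)] are closed, decreasing in [n], and nonempty
    by the mean value, so compactness gives a common point. *)
Lemma nested_good (g : nat -> R -> R) s t E d : s < t -> (forall n, continuous (g n)) ->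
  (forall n u, g n u <= g n.+1 u) -> (forall n, J s t (g n) <= E) -> 0 < d ->
  exists u, s <= u <= t /\ forall n, g n u <= (E + d) / (t - s).
Proof.
move=> st cg mg JE d0; have ts : 0 < t - s by rewrite subr_gt0.
set Q := (E + d) / (t - s).
have mono n k u : (n <= k)%N -> g n u <= g k u.
  by move=> /subnKC <-; elim: (k - n)%N => [|j IH]; rewrite ?addn0// addnS; exact: le_trans (mg _ _).
have H n : exists u, s <= u <= t /\ g n u <= Q.
  apply: contrapT => hn; have : Q * (t - s) <= J s t (g n).
    rewrite -J_cst ?(ltW st)//; apply: J_le => [|//|u ust]; first exact: cont_cst.
    by rewrite leNgt; apply/negP => lt; apply: hn; exists u; rewrite ust ltW.
  by rewrite /Q divfK ?gt_eqF//; have := JE n; lra.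
have [w Hw] := choice H.
have cK := @segment_compact R s t.
have [|u [ust clu]] := cK (w @ \oo) _.
  by exists 0%N => // n _ /=; rewrite in_itv/=; have [] := Hw n.
exists u; split; first by move: ust; rewrite /= in_itv.
move=> n; rewrite leNgt; apply/negP => lt.
have /cvgrPdist_lt/(_ (g n u - Q)) := cg n u; rewrite subr_gt0 => /(_ lt) nb.
have F : (w @ \oo) [set v | g n v <= Q].
  by exists n => // k /= nk; apply: le_trans (mono n k _ nk) _; have [] := Hw k.
have [v [/= h1 h2]] := clu _ _ F nb.
by move: h2; rewrite ltr_norml => /andP[_]; lra.
Qed.

(** Multiples of dyadic steps are handled by [I_sq_shift]; every real shift is a limit of such
    multiples. *)
Lemma osc_real (f : R * R -> R) (B Q : R) i : continuous f -> per f -> (forall z, `|f z| <= B) -> 0 <= Q ->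
  (forall n : nat, I (fun z => Dp i ((1 / 2) ^+ n.+1) f z ^+ 2) <= Q) ->
  forall r, I (fun z => (f (sh i r z) - f z) ^+ 2) <= r ^+ 2 * Q.
Proof.
move=> cf pf fB Q0 H.
pose hn (n : nat) : R := (1 / 2) ^+ n.+1.
have h0 n : 0 < hn n by rewrite exprn_gt0.
have cs r : continuous (fun z => (f (sh i r z) - f z) ^+ 2) by ct.
have step n (k : nat) : I (fun z => (f (sh i (k%:R * hn n) z) - f z) ^+ 2) <= (k%:R * hn n) ^+ 2 * Q.
  apply: le_trans (I_sq_shift i (hn n) k cf pf) _.
  rewrite [leRHS](_ : _ = k%:R ^+ 2 * (hn n ^+ 2 * Q)); last by rewrite exprMn mulrA.
  apply: ler_wpM2l; first exact: sqr_ge0.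
  apply: (le_trans _ (ler_wpM2l (ltW (exprn_gt0 2 (h0 n))) (H n))).
  rewrite -IZ; last by have c := @cont_Dp R i (hn n) f cf; ct.
  rewrite le_eqVlt; apply/orP; left; apply/eqP; apply: eq_I => z; rewrite /Dp exprMn exprVn mulrCA divff ?mulr1//.
  by rewrite expf_neq0// gt_eqF.
have pos r : 0 <= r -> I (fun z => (f (sh i r z) - f z) ^+ 2) <= r ^+ 2 * Q.
  move=> r0; pose rn n := (Num.truncn (r / hn n))%:R * hn n.
  have rnP n : rn n <= r /\ r - rn n <= hn n.
    have /andP[h1 h2] : (Num.truncn (r / hn n))%:R <= r / hn n < (Num.truncn (r / hn n)).+1%:R.
      by apply: truncn_itv; rewrite divr_ge0// ltW.
    rewrite ler_pdivlMr// in h1; rewrite ltr_pdivrMr// -natr1 mulrDl mul1r in h2.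
    by split => //; rewrite lerBlDl; exact: ltW.
  have hc : hn @ \oo --> (0 : R).
    have : (fun n : nat => (1 / 2 : R) ^+ n) @ \oo --> (0 : R) by apply: cvg_expr; rewrite ger0_norm; lra.
    by move=> c; rewrite -(cvg_shiftS (fun n : nat => (1 / 2 : R) ^+ n)) in c.
  have rc : rn @ \oo --> r.
    apply/cvgrPdist_le => k k0; have /cvgrPdist_le/(_ k k0)[N _ HN] := hc.
    exists N => // n Nn; have := HN n Nn; rewrite /= sub0r normrN (gtr0_norm (h0 n)); have [h1 h2] := rnP n.
    by rewrite ger0_norm ?subr_ge0//; exact: le_trans.
  have lim : (fun n => I (fun z => (f (sh i (rn n) z) - f z) ^+ 2)) @ \oo --> I (fun z => (f (sh i r z) - f z) ^+ 2).
    apply: (@I_dct R ((2 * B) ^+ 2)) => [n||n z|z]; [exact: cs|exact: cs| |].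
      rewrite normrX lerXn2r ?nnegrE ?mulr_ge0 ?(le_trans (normr_ge0 _) (fB (0, 0)))//.
      by apply: le_trans (ler_normB _ _) _; have := fB (sh i (rn n) z); have := fB z; lra.
    have c : continuous (fun r => (f (sh i r z) - f z) ^+ 2).
      have c1 : continuous (fun r => f (sh i r z)).
        apply: (cont_comp (g := fun r => sh i r z)) cf; case: (i); apply: cont_mk.
        - by apply: cont_add; [exact: cont_cst|exact: cont_idR].
        - exact: cont_cst.
        - exact: cont_cst.
        - by apply: cont_add; [exact: cont_cst|exact: cont_idR].
      by ct.
    exact: (cvg_comp _ _ rc (c r)).
  have c2 : (fun _ : nat => r ^+ 2 * Q) @ \oo --> r ^+ 2 * Q by exact: cvg_cst.
  apply: lim_le lim c2 _ => n; apply: le_trans (step n _) _; apply: ler_wpM2r => //.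
  have [h1 _] := rnP n; rewrite lerXn2r ?nnegrE//; by rewrite mulr_ge0// ltW.
move=> r; have [r0|r0] := leP 0 r; first exact: pos.
have := pos (- r); rewrite oppr_ge0 sqrrN => /(_ (ltW r0)); apply: le_trans.
rewrite -(@I_sh R (fun z => (f (sh i (- r) z) - f z) ^+ 2) i r)//.
  by rewrite le_eqVlt; apply/orP; left; apply/eqP; apply: eq_I => z; rewrite shKN -sqrrN opprB.
by move=> j z; rewrite shC !pf.
Qed.

End GoodTime.

(** * Smallness of the variance at some time *)

Section Decay.
Variable R : realType.
Variables (a0 a1 La B : R).
Hypotheses (a00 : 0 < a0) (B0 : 0 <= B).
Variable n : nat.
Hypothesis HN : (2 * B + 1) * (2 + 2 * (La + 2 * Cgrad a0 La B)) <= a0 / 2 * n.+2%:R.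

Section Window.
Variable m : nat.
Hypothesis m0 : (0 < m)%N.
Variables (A : R) (a : R -> R) (P : R * R -> R -> R).
Hypotheses (Ha : diffusion a0 a1 La a) (HP : solution B a (vel m A) P).
Variables (T1 s t : R).
Hypothesis T10 : 0 < T1.
Hypotheses (T1s : T1 <= s) (st : s < t).

Let E := 2 / a0 * drop B P n T1 s t.
Let f u z := P z (Num.max T1 u).

Lemma window_good_time d : 0 < d -> 0 <= E -> exists u, s <= u <= t /\
  forall i r, I (fun z => (f u (sh i r z) - f u z) ^+ 2) <= r ^+ 2 * ((2 * E + d) / (t - s)).
Proof.
move=> d0 E0; have ts : 0 < t - s by rewrite subr_gt0.
(* Dyadic steps: halving the step increases the discrete energy, by [I_sq_shift] with [N = 2], as
   [nested_good] requires. *)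
pose hn (k : nat) : R := (1 / 2) ^+ k.+1.
have h0 k : 0 < hn k by rewrite exprn_gt0.
have h1 k : hn k < 1 by rewrite /hn exprn_ilt1//; lra.
have hS k : hn k = 2%:R * hn k.+1 by rewrite /hn [in RHS]exprS; field.
have cf u : continuous (f u) by case: HP => h _ _ _; apply: h; rewrite lt_max T10.
have pf u : per (f u) by case: HP => _ h _ _; apply: h; rewrite lt_max T10.
have fB u z : `|f u z| <= B by case: HP => _ _ h _; apply: h; rewrite lt_max T10.
pose g (k : nat) u := I (fun z => Dp true (hn k) (f u) z ^+ 2) + I (fun z => Dp false (hn k) (f u) z ^+ 2).
have cg i k : continuous (fun u => I (fun z => Dp i (hn k) (f u) z ^+ 2)).
  by apply: (cont_I_Dp HP T10 (i := i)); rewrite gt_eqF.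
have mg i k u : I (fun z => Dp i (hn k) (f u) z ^+ 2) <= I (fun z => Dp i (hn k.+1) (f u) z ^+ 2).
  have cc r : continuous (fun z => (f u (sh i r z) - f u z) ^+ 2) by have c := @cf u; ct.
  have e r : I (fun z => Dp i r (f u) z ^+ 2) = r ^- 2 * I (fun z => (f u (sh i r z) - f u z) ^+ 2).
    by rewrite -IZ//; apply: eq_I => z; rewrite /Dp exprMn exprVn mulrC.
  have eS : hn k ^- 2 = hn k.+1 ^- 2 * (2%:R ^+ 2)^-1 by rewrite hS exprMn invfM mulrC.
  rewrite !e eS -mulrA; apply: ler_wpM2l; first by rewrite invr_ge0 sqr_ge0.
  by rewrite ler_pdivrMl ?exprn_gt0// hS; exact: I_sq_shift.
have [|||u [ust Hu]] := @nested_good R g s t (2 * E) d st _ _ _ d0.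
- by move=> k; have c1 := @cg true k; have c2 := @cg false k; rewrite /g; ct.
- by move=> k u; apply: lerD; exact: mg.
- move=> k; rewrite JD; [|exact: cg..].
  have w1 := window_energy m0 Ha HP T10 HN T1s st true (h0 k) (h1 k).
  have w2 := window_energy m0 Ha HP T10 HN T1s st false (h0 k) (h1 k).
  by rewrite -/f -/E in w1 w2; move: w1 w2; rewrite /f; lra.
exists u; split=> // i; apply: (osc_real (B := B)) => // [|k].
  by rewrite divr_ge0 ?(ltW ts)// addr_ge0 ?(ltW d0)// mulr_ge0.
apply: le_trans (Hu k); rewrite /g; case: (i); rewrite ?lerDl ?lerDr; apply: I_ge0 => z; exact: sqr_ge0.
Qed.

(** The averages against [psi] change by at most [be] within the window, so time averages may be
    replaced by values at the single time [u]. *)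
Lemma window_variance kap be u : s <= u <= t ->
  (forall c : nat * nat, forall w, s <= w <= t -> `|ob m P T1 c (psi m) w - ob m P T1 c (psi m) u| <= be) ->
  \sum_(c : cells m) (cobs m (f u) (cnat c) - kap / (t - s)) ^+ 2
  <= 2 * ((2 * m)%:R ^+ 2 * be ^+ 2) + 2 / (t - s) ^+ 2 * \sum_(c : cells m) (avg m P T1 s t (cnat c) (psi m) - kap) ^+ 2.
Proof.
move=> ust Hb; have ts : 0 < t - s by rewrite subr_gt0.
have be0 : 0 <= be by apply: le_trans (Hb (0, 0)%N u ust).
have bp := bl_psi R m0.
have each c : (cobs m (f u) c - kap / (t - s)) ^+ 2 <= 2 * be ^+ 2 + 2 / (t - s) ^+ 2 * (avg m P T1 s t c (psi m) - kap) ^+ 2.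
  have co := ob_cont HP T10 (c := c) bp.
  have e : `|cobs m (f u) c - avg m P T1 s t c (psi m) / (t - s)| <= be.
    rewrite -(ler_pM2r ts) -[X in _ * X <= _](gtr0_norm ts) -normrM mulrBl divfK ?gt_eqF//.
    have -> : cobs m (f u) c * (t - s) - avg m P T1 s t c (psi m) = J s t (fun w => ob m P T1 c (psi m) u - ob m P T1 c (psi m) w).
      by rewrite JB//; [rewrite J_cst ?(ltW st)|exact: cont_cst].
    have cd : continuous (fun w => ob m P T1 c (psi m) u - ob m P T1 c (psi m) w) by apply: cont_sub => //; exact: cont_cst.
    apply: le_trans (J_abs _ _ cd) _; rewrite -J_cst ?(ltW st)//.
    apply: J_le => [||w wst]; [exact: cont_norm|exact: cont_cst|rewrite distrC; exact: Hb].
  set x := cobs _ _ _ in e *; set y := avg _ _ _ _ _ _ _ in e *.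
  have -> : 2 / (t - s) ^+ 2 * (y - kap) ^+ 2 = 2 * (y / (t - s) - kap / (t - s)) ^+ 2 by field; rewrite gt_eqF.
  have h : (x - y / (t - s)) ^+ 2 <= be ^+ 2 by rewrite -real_normK ?num_real// lerXn2r ?nnegrE.
  have := sqr_ge0 ((x - y / (t - s)) - (y / (t - s) - kap / (t - s))); lra.
apply: (@le_trans _ _ (\sum_(c : cells m) (2 * be ^+ 2 + 2 / (t - s) ^+ 2 * (avg m P T1 s t (cnat c) (psi m) - kap) ^+ 2))).
  by apply: ler_sum => c _.
rewrite big_split/=; apply: lerD; last by rewrite mulr_sumr.
by rewrite -card_cells mulr_suml mulr_sumr; apply: ler_sum => c _; rewrite mul1r.
Qed.

End Window.

Lemma entropy2_bound m A (a : R -> R) P T1 t : solution B a (vel m A) P -> 0 < T1 ->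
  0 <= entropy2 B P n T1 t <= 2 * (2 * B + 1) ^+ n.+3.
Proof.
move=> HP T10; have /andP[h1 h2] := entropy_bound HP n T10 t.
have /andP[h3 h4] := entropy_bound (solution_opp HP) n T10 t.
by rewrite /entropy2; apply/andP; split; lra.
Qed.

Lemma pigeon (g : nat -> R) (V : R) (N : nat) : (0 < N)%N -> g 0%N - g N <= V ->
  exists2 j, (j < N)%N & g j - g j.+1 <= V / N%:R.
Proof.
move=> N0 gV; apply: contrapT => hn.
have NR : 0 < N%:R :> R by rewrite ltr0n.
have H k : (k <= N)%N -> k%:R * (V / N%:R) <= g 0%N - g k /\ ((0 < k)%N -> k%:R * (V / N%:R) < g 0%N - g k).
  elim: k => [|k IH] kN; first by rewrite subrr mul0r.
  have [h1 _] := IH (ltnW kN).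
  have h2 : V / N%:R < g k - g k.+1 by rewrite ltNge; apply/negP => le; apply: hn; exists k.
  by rewrite -natr1 mulrDl mul1r; split => [|_]; move: h1 h2; lra.
have [_ /(_ N0)] := H N (leqnn N); rewrite mulrC divfK ?gt_eqF//; lra.
Qed.

Lemma small_div (x k : R) : 0 <= x -> 0 < k -> exists2 N : nat, (0 < N)%N & x / N%:R <= k.
Proof.
move=> x0 k0; exists (Num.bound (x / k)).+1 => //.
rewrite ler_pdivrMr ?ltr0n// mulrC -ler_pdivrMr//.
by apply: ltW; apply: lt_le_trans (archi_boundP _) _; [rewrite divr_ge0// ltW|rewrite ler_nat].
Qed.

Lemma len_sqr m : (0 < m)%N -> len R m ^+ 2 <= m%:R^-1.
Proof.
move=> m0; have l0 := len_gt0 R m0; have l2 := len_half R m0.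
have mR : 0 < m%:R :> R by rewrite ltr0n.
apply: (@le_trans _ _ (len R m)); first by rewrite expr2 ler_piMl; lra.
by rewrite /len lef_pV2 ?posrE ?mulr_gt0//; lra.
Qed.

Lemma om_len_sqr m : (0 < m)%N -> om R m ^- 2 <= len R m ^+ 2.
Proof.
move=> m0; have w0 := om_gt0 R m0.
have h1 : 1 <= om R m * len R m by rewrite om_len//; have := pi_ge2 R; lra.
rewrite -[leLHS]mul1r ler_pdivrMr; last by rewrite exprn_gt0.
by rewrite mulrC -exprMn; exact: exprn_ege1.
Qed.

(** Three shares of [kappa]: the gradient terms, with [388 = 260 + 128], the motion of the cell
    averages within the window, with factor 64, and the error left by mixing, with
    [192 = 3 * 64]. *)
Lemma budget (N l w mu S W E dd q0 Q be kappa : R) : 0 < N -> 0 < l -> 0 < w -> 0 < dd -> 0 <= E -> 0 <= S ->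
  N * l = 1 -> mu^-1 <= 4 * N ^+ 2 -> w ^- 2 <= l ^+ 2 -> E <= q0 * dd -> 0 <= Q -> Q = 2 * q0 + 1 ->
  S <= 2 * (N ^+ 2 * be ^+ 2) + 2 / dd ^+ 2 * W ->
  W <= 2 / w ^+ 2 * (dd * l ^+ 2 * E) + kappa * dd ^+ 2 / (192 * N ^+ 2) ->
  388 * Q * l ^+ 2 <= kappa / 3 -> 64 * N ^+ 4 * be ^+ 2 <= kappa / 3 ->
  260 * l ^+ 2 * Q + 8 / mu * S <= kappa.
Proof.
move=> N0 l0 w0 dd0 E0 S0 NL im iom Eq Q0 QE WV Hk t6 t7.
have idd : 0 <= 2 / dd ^+ 2 by rewrite divr_ge0// exprn_ge0// ltW.
have N2 : 0 <= 32 * N ^+ 2 by rewrite mulr_ge0 ?sqr_ge0.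
have t1 : 8 / mu * S <= 32 * N ^+ 2 * S by apply: ler_wpM2r => //; move: im; lra.
have t2 := ler_wpM2l idd Hk.
have t3 : 32 * N ^+ 2 * S <= 32 * N ^+ 2 * (2 * (N ^+ 2 * be ^+ 2) + 2 / dd ^+ 2 * (2 / w ^+ 2 * (dd * l ^+ 2 * E) + kappa * dd ^+ 2 / (192 * N ^+ 2))).
  by apply: ler_wpM2l => //; apply: le_trans WV _; rewrite lerD2l.
have t4 : 32 * N ^+ 2 * (2 * (N ^+ 2 * be ^+ 2) + 2 / dd ^+ 2 * (2 / w ^+ 2 * (dd * l ^+ 2 * E) + kappa * dd ^+ 2 / (192 * N ^+ 2)))
  = 64 * N ^+ 4 * be ^+ 2 + 128 * w ^- 2 * (E / dd) * (N * l) ^+ 2 + kappa / 3.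
  by field; rewrite !gt_eqF.
rewrite NL expr1n mulr1 in t4.
have t5 : 128 * w ^- 2 * (E / dd) <= 128 * l ^+ 2 * Q.
  apply: ler_pM.
  - by rewrite mulr_ge0 ?ler0n// invr_ge0 sqr_ge0.
  - by rewrite divr_ge0// ltW.
  - by rewrite ler_pM2l.
  - rewrite ler_pdivrMr//; apply: le_trans Eq _; rewrite QE; apply: ler_wpM2r; first exact: ltW.
    by move: Q0; rewrite QE; lra.
rewrite t4 in t3; apply: le_trans (lerD (lexx _) (le_trans t1 t3)) _.
by move: t5 t6 t7; lra.
Qed.

(** The energy density [Q] depends only on the entropy bound, [a0] and [tau], so [m] can be fixed
    first. The number [Nw] of windows then makes the cell averages nearly constant in time, and the
    amplitude comes last. *)
Lemma decay (tau kappa : R) : 0 < tau -> 0 < kappa -> exists m A, [/\ (0 < m)%N, 0 < A &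
  forall (a : R -> R) P, diffusion a0 a1 La a -> solution B a (vel m A) P ->
    exists u k, tau / 2 <= u <= tau /\ I (fun z => (P z u - k) ^+ 2) <= kappa].
Proof.
move=> tau0 kap0; pose V0 := 2 * (2 * B + 1) ^+ n.+3.
have V00 : 0 <= V0 by rewrite mulr_ge0// exprn_ge0// addr_ge0// mulr_ge0.
(* Among [Nw] windows of length [tau / (2 Nw)] one loses at most [V0 / Nw] of entropy, hence has
   energy at most [q0 * dd], with [q0] independent of [Nw]. *)
pose q0 := 4 * V0 / (a0 * tau); have q00 : 0 <= q0 by apply: divr_ge0; apply: mulr_ge0 => //; exact: ltW.
pose Q := 2 * q0 + 1; have Q0 : 0 < Q by rewrite /Q; lra.
have k30 : 0 < kappa / 3 by rewrite divr_gt0.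
have Qb : 0 <= 388 * Q := mulr_ge0 (ler0n R 388) (ltW Q0).
have [m m0 mQ] := small_div Qb k30.
have mR : 0 < m%:R :> R by rewrite ltr0n.
pose N : R := (2 * m)%:R; have N0 : 0 < N by rewrite ltr0n muln_gt0.
have [F [Lp [F0 L0 fF fL]]] := bl_psi R m0.
(* [C1 / Nw] will bound the change of the averages against [psi] over the selected window. *)
pose C1 := Lp * a1 ^+ 2 * tau + (Lp + 2 * F + 1) * V0.
have C10 : 0 <= C1.
  by apply: addr_ge0; [rewrite mulr_ge0 ?(ltW tau0)// mulr_ge0 ?sqr_ge0|rewrite mulr_ge0// !addr_ge0// mulr_ge0].
have NC0 : 0 <= 64 * N ^+ 4 * C1 ^+ 2.
  exact: mulr_ge0 (mulr_ge0 (ler0n R 64) (exprn_ge0 4 (ltW N0))) (sqr_ge0 C1).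
have [Nw Nw0 NwC] := small_div NC0 k30.
have NwR : 0 < Nw%:R :> R by rewrite ltr0n.
pose dd := tau / 2 / Nw%:R; have dd0 : 0 < dd by rewrite !divr_gt0.
pose del := kappa * dd ^+ 2 / (192 * N ^+ 2).
have del0 : 0 < del.
  exact: divr_gt0 (mulr_gt0 kap0 (exprn_gt0 2 dd0)) (mulr_gt0 (ltr0Sn R 191) (exprn_gt0 2 N0)).
have [A [A0 HA]] := mixing m0 a1 a00 B0 HN dd0 V00 del0.
exists m, A; split=> // a P Ha HP.
pose T1 := tau / 2; have T10 : 0 < T1 by rewrite divr_gt0.
pose sj (j : nat) := T1 + j%:R * dd.
have hp : entropy2 B P n T1 (sj 0%N) - entropy2 B P n T1 (sj Nw) <= V0.
  have /andP[x1 x2] := entropy2_bound (sj 0%N) HP T10.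
  by have /andP[x3 x4] := entropy2_bound (sj Nw) HP T10; rewrite /V0; lra.
have [j jN hj] := @pigeon (fun j => entropy2 B P n T1 (sj j)) V0 Nw Nw0 hp.
set s := sj j in hj; set t := sj j.+1 in hj.
have st : s < t by rewrite /s /t /sj ltrD2l ltr_pM2r// ltr_nat.
have dE : t - s = dd by rewrite /s /t /sj -natr1; ring.
have T1s : T1 <= s by rewrite /s /sj lerDl mulr_ge0// ltW.
have tT : t <= tau.
  have : j.+1%:R * dd <= Nw%:R * dd by rewrite ler_pM2r// ler_nat.
  have -> : Nw%:R * dd = tau / 2 by rewrite /dd mulrC divfK// gt_eqF.
  by rewrite /t /sj /T1; lra.
have d_ge0 : 0 <= drop B P n T1 s t.
  by rewrite /drop subr_ge0; exact: (entropy2_nonincr m0 Ha HP T10 HN T1s (ltW st)).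
have dV : drop B P n T1 s t <= V0.
  apply: le_trans hj _; rewrite ler_pdivrMr// ler_peMr// ler1n.
  by [].
pose E := 2 / a0 * drop B P n T1 s t.
have E0 : 0 <= E by rewrite /E mulr_ge0// divr_ge0// ltW.
have Eq : E <= q0 * dd.
  have -> : q0 * dd = 2 / a0 * (V0 / Nw%:R).
    rewrite /q0 /dd; move: (Nw%:R) NwR => W W0; field.
    by rewrite !gt_eqF.
  by apply: ler_wpM2l => //; rewrite divr_ge0// ltW.
have [kap Hk] := HA a P T1 s t Ha HP T10 T1s st dE dV.
have [u [ust Hu]] := window_good_time m0 Ha HP T10 T1s st dd0 E0.
exists u, (kap / dd / mass R m); split.
  by move: ust => /andP[u1 u2]; rewrite (le_trans T1s u1) (le_trans u2 tT).
have Tu : Num.max T1 u = u by apply/max_idPr; case/andP: ust => u1 _; exact: le_trans T1s u1.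
have cf : continuous (fun z => P z (Num.max T1 u)) by case: HP => h _ _ _; apply: h; rewrite lt_max T10.
have pf : per (fun z => P z (Num.max T1 u)) by case: HP => _ h _ _; apply: h; rewrite lt_max T10.
have QE : (2 * E + dd) / (t - s) <= Q.
  by rewrite dE ler_pdivrMr// /Q; move: Eq; lra.
have fQ i r : I (fun z => (P (sh i r z) (Num.max T1 u) - P z (Num.max T1 u)) ^+ 2) <= r ^+ 2 * Q.
  by apply: le_trans (Hu i r) _; apply: ler_wpM2l => //; exact: sqr_ge0.
have PO := poincare m0 cf pf (ltW Q0) fQ (kap / dd / mass R m).
pose be := C1 / Nw%:R; have be0 : 0 <= be by rewrite divr_ge0// ltW.
have Hb (c : nat * nat) w : s <= w <= t -> `|ob m P T1 c (psi m) w - ob m P T1 c (psi m) u| <= be.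
  move=> wst.
  have tf A' : test_fun (vel m A') F Lp (psi m) (fun z => A' * 0).
    have dl i z := @test_dlim R m m0 (fun x => x) (fun=> 1) (fun=> false) i z (fun y => der_id y).
    apply: (test_fun_dlim (drift_vel m0 A') F0 L0 fF fL (bl_cont (bl_psi R m0)) _ (@per_psi R m) (d := fun i z =>
       1 * (sig (len R m) (co i z) * (om R m * cs m (co i z)) * bump m (co (~~ i) z)) * 1 + psi m z * (0 * 1))).
    - by move=> z; rewrite mulr0; exact: cvg_cst.
    - move=> i z; have := dl i z; rewrite /wt /cc /dcc /= mul1r.
      by congr (dlim _ _ _ _); apply/funext => y; rewrite !mulr1.
    by move=> z; rewrite !velE /= /bump; ring.
  have h := cell_conserved m0 Ha HP T10 HN T1s c F0 L0 tf ust wst.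
  apply: le_trans h _; rewrite dE /be /C1 [leRHS]mulrDl; apply: lerD.
    rewrite /dd le_eqVlt; apply/orP; left; apply/eqP; move: (Nw%:R) NwR => W W0; field.
    by rewrite gt_eqF.
  rewrite -[leRHS]mulrA; apply: ler_wpM2l => //; by rewrite !addr_ge0// mulr_ge0.
have WV := window_variance m0 HP T10 st kap ust Hb.
rewrite dE in WV; rewrite Tu in PO; apply: le_trans PO _.
have mlb := mass_lb R m0; have l0 := len_gt0 R m0; have w0 := om_gt0 R m0.
have NL : N * len R m = 1 by exact: cells_len.
have le : len R m = N^-1 by rewrite -[LHS]mul1r -(mulVf (lt0r_neq0 N0)) -mulrA NL mulr1.
have ll : 0 < len R m ^+ 2 / 4 by rewrite divr_gt0 ?exprn_gt0.
have M0 : 0 < mass R m by exact: lt_le_trans ll mlb.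
have im : (mass R m)^-1 <= 4 * N ^+ 2.
  rewrite -[leRHS]invrK lef_pV2 ?posrE ?invr_gt0 ?mulr_gt0 ?exprn_gt0//.
  by apply: le_trans mlb; rewrite le invfM exprVn mulrC.
rewrite Tu in WV; have ek : mass R m * (kap / dd / mass R m) = kap / dd by field; rewrite !gt_eqF.
rewrite ek; move: WV; set S := \sum_(c : cells m) _; set W := \sum_(c : cells m) _ in Hk * => WV.
have S0 : 0 <= S by apply: sumr_ge0 => c _; exact: sqr_ge0.
have t6 : 388 * Q * len R m ^+ 2 <= kappa / 3.
  apply: le_trans mQ; apply: ler_wpM2l Qb _ _ _; exact: len_sqr.
have t7 : 64 * N ^+ 4 * be ^+ 2 <= kappa / 3.
  apply: le_trans NwC; have -> : 64 * N ^+ 4 * be ^+ 2 = 64 * N ^+ 4 * C1 ^+ 2 / Nw%:R * Nw%:R^-1.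
    by rewrite /be; move: (Nw%:R) NwR => V W0; field; rewrite gt_eqF.
  apply: ler_piMr; first by rewrite divr_ge0 ?(ltW NwR).
  by rewrite invf_le1// ler1n.
exact: (budget N0 l0 w0 dd0 E0 S0 NL im (om_len_sqr m0) Eq (ltW Q0) (erefl Q) WV Hk t6 t7).
Qed.

End Decay.

(** * From some time to the given time *)

Section Terminal.
Variable R : realType.
Variables (a0 a1 La B : R).
Hypotheses (a00 : 0 < a0) (B0 : 0 <= B).

Lemma var_mean (f : R * R -> R) (k : R) : continuous f -> I (fun z => (f z - I f) ^+ 2) <= I (fun z => (f z - k) ^+ 2).
Proof.
move=> cf; have E (c : R) : I (fun z => (f z - c) ^+ 2) = I (fun z => f z ^+ 2) - 2 * c * I f + c ^+ 2.
  rewrite -(@I_cst R (c ^+ 2)) -IZ// -IB; [|by ct..]; rewrite -ID; [|by ct|exact: cont_cst].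
  by apply: eq_I => z; ring.
by rewrite !E; have := sqr_ge0 (I f - k); lra.
Qed.

(** Either [|x| <= k], or [x^2 <= |x|^(n+3) / k^(n+1)]. *)
Lemma sqr_le_pw (n : nat) (x k : R) : 0 < k -> x ^+ 2 <= k ^+ 2 + (pw n.+3 x + pw n.+3 (- x)) / k ^+ n.+1.
Proof.
move=> k0; have kn : 0 < k ^+ n.+1 by rewrite exprn_gt0.
have p0 := pw_ge0 n.+3 x; have q0 := pw_ge0 n.+3 (- x).
have [xk|kx] := lerP `|x| k.
  apply: (@le_trans _ _ (k ^+ 2)); first by rewrite -real_normK ?num_real// lerXn2r ?nnegrE// ltW.
  by rewrite lerDl divr_ge0 ?addr_ge0// ltW.
have h : `|x| ^+ n.+3 <= pw n.+3 x + pw n.+3 (- x).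
  have [x0|x0] := leP 0 x.
    have -> : pw n.+3 x = x ^+ n.+3 by rewrite /pw posE x0.
    by rewrite ger0_norm// lerDl.
  have -> : pw n.+3 (- x) = (- x) ^+ n.+3 by rewrite /pw posE oppr_ge0 (ltW x0).
  by rewrite ltr0_norm// lerDr.
have -> : x ^+ 2 = `|x| ^+ 2 by rewrite real_normK ?num_real.
apply: (@le_trans _ _ ((pw n.+3 x + pw n.+3 (- x)) / k ^+ n.+1)); last by rewrite lerDr sqr_ge0.
rewrite ler_pdivlMr//; apply: le_trans h; rewrite (_ : n.+3 = (2 + n.+1)%N)// exprD; apply: ler_wpM2l; first exact: sqr_ge0.
by rewrite lerXn2r ?nnegrE ?(ltW k0)// ltW.
Qed.

Lemma pw_le_sqr (n : nat) (x M : R) : `|x| <= M -> pw n.+3 x <= M ^+ n.+1 * x ^+ 2.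
Proof.
move=> xM; have M0 : 0 <= M by apply: le_trans xM.
rewrite /pw posE; case: ifP => x0; last by rewrite expr0n/=; exact: mulr_ge0 (exprn_ge0 _ M0) (sqr_ge0 x).
rewrite ger0_norm// in xM; rewrite -addn2 exprD; apply: ler_wpM2r; first exact: sqr_ge0.
by rewrite lerXn2r ?nnegrE.
Qed.

(** Monotonicity in time is available for the one-sided moments of order [n + 3]; the variance is
    recovered from them by cutting at height [k], and bounds them at time [u] because [P] is
    bounded. *)
Lemma level_var (n : nat) (V Lv Kv : R) v (a : R -> R) P (T1 u t c k k0 : R) :
  (2 * B + 1) * (2 + 2 * (La + 2 * Cgrad a0 La B)) <= a0 / 2 * n.+2%:R ->
  drift V Lv Kv v -> diffusion a0 a1 La a -> solution B a v P -> 0 < T1 -> T1 <= u -> u <= t ->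
  `|c| <= B -> 0 < k -> I (fun z => (P z u - c) ^+ 2) <= k0 ->
  I (fun z => (P z t - c) ^+ 2) <= k ^+ 2 + 2 * (2 * B) ^+ n.+1 * k0 / k ^+ n.+1.
Proof.
move=> HN Hv Ha HP T10 T1u ut cB kp kk.
have kn : 0 < k ^+ n.+1 by rewrite exprn_gt0.
have mu : Num.max T1 u = u by apply/max_idPr.
have mt : Num.max T1 t = t by apply/max_idPr; exact: le_trans ut.
have cP s : T1 <= s -> continuous (fun z => P z s).
  by move=> h; case: HP => h' _ _ _; apply: h'; exact: lt_le_trans h.
have PB s z : T1 <= s -> `|P z s| <= B.
  by move=> h; case: HP => _ _ h' _; apply: h'; exact: lt_le_trans h.
have cu := cP u T1u; have ct' := cP t (le_trans T1u ut).
have cpw (g : R * R -> R) : continuous g -> continuous (fun z => pw n.+3 (g z)).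
  by move=> cg; apply: (cont_comp cg); exact: (@cont_pw R R n.+3 (fun x => x) (@cont_idR R)).
have HN' : (2 * B + 1) * (2 + 2 * (La + 2 * Cgrad a0 La B)) <= a0 / 2 * n.+2%:R := HN.
have cBN : `|- c| <= B by rewrite normrN.
have l1 := level_nonincr Ha Hv HP T10 HN cB T1u ut.
have l2 := level_nonincr (diffusion_opp Ha) Hv (solution_opp HP) T10 HN cBN T1u ut.
rewrite mu mt in l1 l2.
have up (g : R * R -> R) : continuous g -> (forall z, `|g z| <= 2 * B) -> (forall z, g z ^+ 2 = (P z u - c) ^+ 2) ->
  I (fun z => pw n.+3 (g z)) <= (2 * B) ^+ n.+1 * k0.
  move=> cg gB gE; apply: (@le_trans _ _ (I (fun z => (2 * B) ^+ n.+1 * (P z u - c) ^+ 2))).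
    apply: I_le => [||z]; [exact: cpw|by ct|rewrite -gE; exact: pw_le_sqr].
  by rewrite IZ; [apply: ler_wpM2l => //; rewrite exprn_ge0// mulr_ge0|ct].
have b1 z : `|P z u - c| <= 2 * B.
  by apply: le_trans (ler_normB _ _) _; have := PB u z T1u; lra.
have u1 : I (fun z => pw n.+3 (P z u - c)) <= (2 * B) ^+ n.+1 * k0 by apply: up => //; ct.
have u2 : I (fun z => pw n.+3 (- P z u - - c)) <= (2 * B) ^+ n.+1 * k0.
  apply: up => [|z|z]; [by ct| |].
    by have := b1 z; rewrite -normrN; congr (`|_| <= _); ring.
  by ring.
have cc1 : continuous (fun z => P z t - c) by ct.
have cc2 : continuous (fun z => - P z t - - c) by ct.
have d1 := cpw _ cc1; have d2 := cpw _ cc2.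
apply: (@le_trans _ _ (I (fun z => k ^+ 2 + (k ^+ n.+1)^-1 * (pw n.+3 (P z t - c) + pw n.+3 (- P z t - - c))))).
  apply: I_le => [||z]; [by ct|by apply: cont_add; [exact: cont_cst|apply: cont_mul; [exact: cont_cst|exact: cont_add]]|].
  have := sqr_le_pw n (P z t - c) kp; rewrite mulrC (_ : - (P z t - c) = - P z t - - c)//; by ring.
rewrite ID; [|exact: cont_cst|by apply: cont_mul; [exact: cont_cst|exact: cont_add]].
rewrite I_cst IZ; last exact: cont_add.
rewrite ID// lerD2l mulrC ler_pM2r ?invr_gt0//; move: l1 l2 u1 u2; lra.
Qed.

(** The reference level is the mean at the time [u] at which the variance was found small, because
    the equation for [P], unlike that for [theta], does not conserve the mean. *)
Lemma decay_tau (tau eps : R) : 0 < tau -> 0 < eps -> exists m A, [/\ (0 < m)%N, 0 < A &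
  forall (a : R -> R) P, diffusion a0 a1 La a -> solution B a (vel m A) P ->
    exists u, 0 < u /\ I (fun z => (P z tau - I (P^~ u)) ^+ 2) <= eps].
Proof.
move=> tau0 eps0.
have [n HN] : exists n : nat, (2 * B + 1) * (2 + 2 * (La + 2 * Cgrad a0 La B)) <= a0 / 2 * n.+2%:R.
  set X := _ * _; exists (Num.bound `|X / (a0 / 2)|).
  have h := archi_boundP (normr_ge0 (X / (a0 / 2))); have a2 : 0 < a0 / 2 by rewrite divr_gt0.
  rewrite mulrC -ler_pdivrMr//; apply: le_trans (ler_norm _) _; apply: le_trans (ltW h) _.
  by rewrite ler_nat; exact: leq_trans (leqnSn _) (leqnSn _).
pose k := Num.min 1 (eps / 2); have k0 : 0 < k by rewrite lt_min ltr01 divr_gt0.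
have k1 : k ^+ 2 <= eps / 2.
  apply: (@le_trans _ _ k); last by rewrite ge_min lexx orbT.
  by rewrite expr2 ler_piMl ?(ltW k0)// ge_min lexx.
pose M := 2 * ((2 * B) ^+ n.+1 + 1).
have M0 : 0 < M by rewrite mulr_gt0// ltr_wpDl// exprn_ge0// mulr_ge0.
have kn : 0 < k ^+ n.+1 by rewrite exprn_gt0.
pose kap := eps / 2 * k ^+ n.+1 / M; have kap0 : 0 < kap by rewrite divr_gt0// mulr_gt0// divr_gt0.
have [m [A [m0 A0 H]]] := decay a1 a00 B0 HN tau0 kap0.
exists m, A; split=> // a P Ha HP; have [u [c [/andP[u1 u2] Hc]]] := H a P Ha HP.
have T0 : 0 < tau / 2 by rewrite divr_gt0.
have u0 : 0 < u by exact: lt_le_trans u1.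
exists u; split=> //.
have cu : continuous (P^~ u) by case: HP => h _ _ _; exact: h.
have cB : `|I (P^~ u)| <= B by apply: I_norm_le => // z; case: HP => _ _ h _; exact: h.
have Hm := le_trans (var_mean c cu) Hc.
apply: le_trans (level_var HN (drift_vel m0 A) Ha HP T0 u1 u2 cB k0 Hm) _.
have -> : 2 * (2 * B) ^+ n.+1 * kap / k ^+ n.+1 = eps / 2 * (2 * (2 * B) ^+ n.+1 / M).
  by rewrite /kap; field; rewrite !gt_eqF.
have h : 2 * (2 * B) ^+ n.+1 / M <= 1 by rewrite ler_pdivrMr// mul1r /M; lra.
have e2 : 0 <= eps / 2 by rewrite divr_ge0// ltW.
have := ler_wpM2l e2 h; move: k1; lra.
Qed.

End Terminal.

Section PowR.
Variable R : realType.
Implicit Types (x y al q lo hi : R).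

Lemma powR_mvt al x y : 0 < x -> x <= y -> exists2 c, x <= c <= y & y `^ al - x `^ al = al * c `^ (al - 1) * (y - x).
Proof.
move=> x0 xy.
have dg c : x <= c -> is_derive c (1 : R) (fun u : R => u `^ al) (al * c `^ (al - 1)).
  by move=> xc; apply: is_derive1_powR; exact: lt_le_trans xc.
have cg : {within `[x, y], continuous (fun u : R => u `^ al)}.
  apply: continuous_in_subspaceT => c; rewrite inE/= in_itv/= => /andP[xc _].
  exact: is_derive_continuous (dg c xc).
have dg' c : c \in `]x, y[ -> is_derive c (1 : R) (fun u : R => u `^ al) (al * c `^ (al - 1)).
  by rewrite in_itv/= => /andP[xc _]; exact: dg (ltW xc).
have [c] := MVT_segment xy dg' cg.
by rewrite in_itv/= => cxy E; exists c.
Qed.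

End PowR.

(** * The porous medium equation *)

Section Torus.
Variable R : realType.
Implicit Types f : R -> R -> R.

Lemma torus_intE f : continuous (fun z : R * R => f z.1 z.2) -> torus_int f = (I (fun z => f z.1 z.2))%:E.
Proof.
move=> cf; rewrite /torus_int /I /JJ -(JE 0 1 (cont_J ler01 cf)).
by apply: eq_integral => x _; rewrite -(JE 0 1 (@cont_pair2 _ R _ (x : R) cf)).
Qed.

Lemma L2sq_devE f : continuous (fun z : R * R => f z.1 z.2) ->
  L2sq_dev f = (I (fun z => (f z.1 z.2 - I (fun z => f z.1 z.2)) ^+ 2))%:E.
Proof.
move=> cf; rewrite /L2sq_dev /torus_mean (torus_intE cf)/= torus_intE//.
pose F (z : R * R) := f z.1 z.2; have cF : continuous F := cf.
have c2 : continuous (fun z => (F z - I F) ^+ 2) by ct.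
exact: c2.
Qed.

End Torus.

Section Powers.
Variable R : realType.
Implicit Types (x y al q lo hi : R).

Lemma powR_lip al lo x y : 0 <= al -> al <= 1 -> 0 < lo -> lo <= x -> lo <= y ->
  `|y `^ al - x `^ al| <= al * lo `^ (al - 1) * `|y - x|.
Proof.
move=> a0 a1 l0; wlog xy : x y / x <= y => [H|].
  have [xy|/ltW yx] := leP x y; first exact: H.
  by move=> lx ly; rewrite distrC [X in _ * X]distrC; exact: H.
move=> lx ly; have [c /andP[xc cy] ->] := powR_mvt al (lt_le_trans l0 lx) xy.
have lc := le_trans lx xc; have c0 := lt_le_trans l0 lc.
rewrite normrM; apply: ler_wpM2r => //; rewrite ger0_norm ?mulr_ge0 ?powR_ge0//.
apply: ler_wpM2l => //; rewrite -(opprB 1 al) !powRN lef_pV2 ?posrE ?powR_gt0//.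
by apply: ge0_ler_powR; rewrite ?subr_ge0// nnegrE ltW.
Qed.

(** On [[h, oo)] the derivative of [x ^ q] is at least [q h^(q-1)]; this carries smallness of [P]
    back to [theta]. *)
Lemma powR_expand q h x y : 1 <= q -> 0 < h -> h <= x -> h <= y ->
  q * h `^ (q - 1) * `|y - x| <= `|y `^ q - x `^ q|.
Proof.
move=> q1 h0; wlog xy : x y / x <= y => [H|].
  have [xy|/ltW yx] := leP x y; first exact: H.
  by move=> lx ly; rewrite distrC [leRHS]distrC; exact: H.
move=> lx ly; have [c /andP[xc cy] ->] := powR_mvt q (lt_le_trans h0 lx) xy.
have lc := le_trans lx xc; have c0 := lt_le_trans h0 lc; have q0 : 0 <= q := le_trans ler01 q1.
rewrite normrM; apply: ler_wpM2r => //; rewrite ger0_norm ?mulr_ge0 ?powR_ge0//.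
by apply: ler_wpM2l => //; apply: ge0_ler_powR; rewrite ?subr_ge0// nnegrE ltW.
Qed.

Definition clamp lo hi x := Num.max lo (Num.min hi x).

Lemma clamp_itv lo hi x : lo <= hi -> lo <= clamp lo hi x <= hi.
Proof. by move=> lh; rewrite /clamp le_max lexx/= ge_max lh ge_min lexx. Qed.

Lemma clamp_id lo hi x : lo <= x <= hi -> clamp lo hi x = x.
Proof. by case/andP=> lx xh; rewrite /clamp (min_r xh) max_r. Qed.

Lemma clamp_lip lo hi x y : `|clamp lo hi x - clamp lo hi y| <= `|x - y|.
Proof.
have min_lip (k a u w : R) : u - w <= k -> w - u <= k -> `|Num.min a u - Num.min a w| <= k.
  by case: (leP a u) => ?; case: (leP a w) => ? ? ?; rewrite ler_norml; apply/andP; split; lra.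
have max_lip (k a u w : R) : u - w <= k -> w - u <= k -> `|Num.max a u - Num.max a w| <= k.
  by case: (leP a u) => ?; case: (leP a w) => ? ? ?; rewrite ler_norml; apply/andP; split; lra.
have ab (k u w : R) : `|u - w| <= k -> u - w <= k /\ w - u <= k.
  by rewrite ler_norml => /andP[? ?]; split; lra.
have [g1 g2] := ab _ _ _ (lexx `|x - y|); have [g3 g4] := ab _ _ _ (min_lip _ hi _ _ g1 g2).
exact: max_lip.
Qed.

End Powers.

Section Link.
Variables (R : realType) (q nu h : R).
Hypotheses (q1 : 1 < q) (nu0 : 0 < nu) (h0 : 0 < h) (h1 : h < 1).

Let lo := h `^ q.
Let hi := h^-1 `^ q.
Let al := (q - 1) / q.

Let q0 : 0 < q. Proof. exact: lt_trans q1. Qed.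
Let lo0 : 0 < lo. Proof. exact: powR_gt0. Qed.
Let al0 : 0 <= al. Proof. by rewrite divr_ge0 ?ltW// subr_gt0. Qed.
Let al1 : al <= 1. Proof. by rewrite ler_pdivrMr// mul1r lerBlDr lerDl. Qed.
Let powq_itv x : h <= x <= h^-1 -> lo <= x `^ q <= hi.
Proof.
case/andP=> hx xh; have x0 := lt_le_trans h0 hx.
by rewrite /lo /hi !ge0_ler_powR// ?nnegrE ?(ltW q0)// ?(ltW h0)// ?(ltW x0)// invr_ge0 ltW.
Qed.
Let lohi : lo <= hi.
Proof.
have hh : h <= h <= h^-1 by rewrite lexx/= (le_trans (ltW h1))// invf_ge1// ltW.
by have /andP[_] := powq_itv hh.
Qed.

(* [d/dt (theta ^ q) = q theta ^ (q-1) d/dt theta] and [theta ^ (q-1) = (theta ^ q) ^ al]; the clamp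
   only serves to make the coefficient bounded and Lipschitz on the whole line. *)
Definition mobility p := nu * q * (clamp lo hi p) `^ al.

Lemma mobility_diffusion : diffusion (nu * q * lo `^ al) (nu * q * hi `^ al)
  (nu * q * (al * lo `^ (al - 1))) mobility.
Proof.
have nq : 0 < nu * q by rewrite mulr_gt0.
split.
- by rewrite mulr_gt0// powR_gt0.
- by rewrite mulr_ge0 ?(ltW nq)// mulr_ge0// powR_ge0.
- move=> p; have /andP[c1 c2] := clamp_itv p lohi.
  have c0 := lt_le_trans lo0 c1; have hi0 := lt_le_trans lo0 lohi.
  by rewrite /mobility !ler_pM2l// !ge0_ler_powR// nnegrE ltW.
- move=> p p'; rewrite /mobility -mulrBr normrM (gtr0_norm nq) -[leRHS]mulrA ler_pM2l//.
  have /andP[c1 _] := clamp_itv p lohi; have /andP[c2 _] := clamp_itv p' lohi.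
  apply: le_trans (powR_lip al0 al1 lo0 c2 c1) _.
  by apply: ler_wpM2l; [rewrite mulr_ge0// powR_ge0|exact: clamp_lip].
Qed.

Lemma is_derive_derive1 (g : R -> R) (x : R) : derivable g x 1 -> is_derive x (1 : R) g (derive1 g x).
Proof. by move=> dg; apply: (DeriveDef dg); rewrite derive1E. Qed.

Lemma is_derive_powq (g : R -> R) (x : R) : 0 < g x -> derivable g x 1 ->
  is_derive x (1 : R) (fun s => g s `^ q) (q * g x `^ (q - 1) * derive1 g x).
Proof.
move=> g0 dg.
by have := is_derive1_comp (f := fun u : R => u `^ q) (g := g) (is_derive1_powR q g0) (is_derive_derive1 dg).
Qed.

(** The equation multiplied by [q theta^(q-1)]: the time derivative and the drift become those of
    [P], and the Laplacian of [P] acquires the coefficient [nu q theta^(q-1)]. *)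
Lemma APME_solution A (m : nat) theta0 theta : is_APME_solution q nu h A m theta0 theta ->
  solution hi mobility (vel m A) (fun z t => theta z.1 z.2 t `^ q).
Proof.
case=> tper tbd tct teq _.
have th0 x1 x2 t : 0 < t -> 0 < theta x1 x2 t.
  by move=> t0; have /andP[hx _] := tbd x1 x2 t t0; exact: lt_le_trans hx.
split.
- move=> t t0 z; apply: (@continuous_comp _ _ _ (fun z : R * R => theta z.1 z.2 t) (fun u : R => u `^ q)); first exact: tct.
  exact: is_derive_continuous (is_derive1_powR q (th0 z.1 z.2 t t0)).
- by move=> t t0 i z; have [e1 e2] := tper z.1 z.2 t; case: i; rewrite /sh/= ?e1 ?e2.
- by move=> t t0 z; rewrite ger0_norm ?powR_ge0//; have /andP[] := powq_itv (tbd z.1 z.2 t t0).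
move=> [x1 x2] t t0; have g0 := th0 x1 x2 t t0.
have [dt [d1 [d2 [D1 [D2 [H1 [H2 E]]]]]]] := teq x1 x2 t t0.
have c1 := is_derive_powq (g := fun a => theta a x2 t) g0 d1.
have c2 := is_derive_powq (g := fun b => theta x1 b t) g0 d2.
pose P := fun a b => theta a b t `^ q.
exists (q * theta x1 x2 t `^ (q - 1) * derive1 (fun s => theta x1 x2 s) t),
  (fun i => if i then q * theta x1 x2 t `^ (q - 1) * derive1 (fun a => theta a x2 t) x1
            else q * theta x1 x2 t `^ (q - 1) * derive1 (fun b => theta x1 b t) x2),
  (fun i => if i then derive1 (derive1 (fun c => P c x2)) x1 else derive1 (derive1 (fun c => P x1 c)) x2).
split.
- exact: taylor1 (is_derive_powq (g := fun s => theta x1 x2 s) g0 dt).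
- by case; rewrite /sh/=; [exact: taylor1 c1|exact: taylor1 c2].
- case; rewrite /sh/=.
    exact: (taylor2 (g := fun c => P c x2) (fun y => is_derive_derive1 (D1 y)) (is_derive_derive1 H1)).
  exact: (taylor2 (g := fun c => P x1 c) (fun y => is_derive_derive1 (D2 y)) (is_derive_derive1 H2)).
have -> : mobility (theta x1 x2 t `^ q) = nu * q * theta x1 x2 t `^ (q - 1).
  rewrite /mobility clamp_id; last by exact: powq_itv (tbd x1 x2 t t0).
  by rewrite -powRrM /al mulrCA divff ?gt_eqF// mulr1.
rewrite /vel/=; move: E; rewrite -/P; move: (derive1 (derive1 _) x1) (derive1 (derive1 _) x2).
move: (derive1 _ t) (derive1 _ x1) (derive1 _ x2) (v1 _ _ _ _) (v2 _ _ _ _) (_ `^ (q - 1)) => e1 e2 e3 w1 w2 s F G E.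
have -> : e1 = nu * (F + G) - (w1 * e2 + w2 * e3) by move: E; lra.
by ring.
Qed.

End Link.

Theorem theorem4p5 (R : realType) (q nu h : R) :
  1 < q -> 0 < nu -> 0 < h < 1 ->
  forall tau : R, 0 < tau ->
  exists (m : nat) (A : R), (0 < m)%N /\ 0 < A /\
    forall (theta0 : R -> R -> R) (theta : R -> R -> R -> R),
      measurable_fun setT (fun p : R * R => theta0 p.1 p.2) ->
      (forall x1 x2, theta0 (x1 + 1) x2 = theta0 x1 x2
                     /\ theta0 x1 (x2 + 1) = theta0 x1 x2) ->
      (forall x1 x2, h <= theta0 x1 x2 <= h^-1) ->
      L2sq_dev theta0 = 1%E ->
      is_APME_solution q nu h A m theta0 theta ->
      (L2sq_dev (fun x1 x2 => theta x1 x2 tau) <= (1 / 4)%:E)%E.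
Proof.
move=> q1 nu0 /andP[h0 h1] tau tau0.
have q0 : 0 < q by exact: lt_trans q1.
have Ha := mobility_diffusion q1 nu0 h0 h1.
have a00 := let: And4 e _ _ _ := Ha in e.
have hi0 : 0 <= h^-1 `^ q by exact: powR_ge0.
(* [L] is the expansion factor of the power map, so a variance [L^2 / 4] of [P] gives [1 / 4], the
   square of one half, for [theta]. *)
pose L := q * h `^ (q - 1); have L0 : 0 < L by rewrite mulr_gt0// powR_gt0.
have eps0 : 0 < L ^+ 2 / 4 by rewrite divr_gt0// exprn_gt0.
have [m [A [m0 A0 H]]] := decay_tau (nu * q * (h^-1 `^ q) `^ ((q - 1) / q))
  (nu * q * ((q - 1) / q * (h `^ q) `^ ((q - 1) / q - 1))) a00 hi0 tau0 eps0.
exists m, A; split=> //; split=> // theta0 theta _ _ _ _ Hth.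
have HP := APME_solution q1 h0 Hth.
have [u [u0 Hc]] := H _ _ Ha HP; pose c := I (fun z : R * R => theta z.1 z.2 u `^ q).
rewrite /= -/c in Hc.
have [_ tbd tct _ _] := Hth; have ct0 := tct tau tau0.
have [cP _ _ _] := HP; have cu := cP u u0; have ctau := cP tau tau0.
have clo : h `^ q <= c.
  rewrite -(@I_cst R (h `^ q)); apply: I_le => [||z]; [exact: cont_cst|exact: cu|].
  have /andP[hx _] := tbd z.1 z.2 u u0.
  by apply: ge0_ler_powR; rewrite ?nnegrE ?(ltW q0) ?(ltW h0)// (le_trans (ltW h0)).
have c0 : 0 < c by apply: lt_le_trans clo; exact: powR_gt0.
(* The level of [theta] that corresponds to the level [c] of [P]. The mean minimises the square
   deviation, so [theta] may be compared with [k] in place of its mean. *)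
pose k := c `^ q^-1.
have kq : k `^ q = c by rewrite -powRrM mulVf ?gt_eqF// powRr1// ltW.
have hk : h <= k.
  have -> : h = (h `^ q) `^ q^-1 by rewrite -powRrM divff ?gt_eqF// powRr1// ltW.
  by apply: ge0_ler_powR; rewrite ?nnegrE ?powR_ge0 ?invr_ge0 ?(ltW q0) ?(ltW c0).
rewrite L2sq_devE// lee_fin.
pose T (z : R * R) := theta z.1 z.2 tau; have cT : continuous T := ct0.
apply: le_trans (var_mean k cT) _.
have pw z : L ^+ 2 * (T z - k) ^+ 2 <= (T z `^ q - c) ^+ 2.
  have /andP[hx _] := tbd z.1 z.2 tau tau0.
  have := powR_expand (ltW q1) h0 hk hx; rewrite kq -/L => e.
  have e' := lerXn2r 2 _ _ e; rewrite -(real_normK (num_real (T z - k))) -exprMn.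
  rewrite -(real_normK (num_real (T z `^ q - c))).
  by apply: e'; rewrite nnegrE// mulr_ge0// ltW.
have L2 : 0 < L ^+ 2 by rewrite exprn_gt0.
rewrite -(ler_pM2l L2) -IZ; last by ct.
apply: (@le_trans _ _ (L ^+ 2 / 4)); last by rewrite mul1r.
apply: le_trans Hc; apply: I_le => [||z]; [by ct| |exact: pw].
by have cc := ctau; ct.
Qed.
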